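(* Let $\theta\in(0,1)$ and let $f\in\mathcal F_\theta(\Sigma_A^+)$ be a real-valued function with $f>0$ on $\Sigma_A^+$. Assume that $f$ is non-lattice and that the Ruelle transfer operators related to $f$ are weakly contracting. Let $\rho$ be such that $0<\rho_1<\rho<1$ and the weak contraction estimate (W) of the context holds with $\rho$, where $\rho_1\in(0,1)$ is the constant described in the context. Let $\epsilon_n=e^{-\delta n}$ with $0<\delta<-\frac{\log\rho}{3}$. Then for any $0\le z\le\alpha$ and any $p<q$, $$\#\{\xi\in\Sigma_A^+:\ \sigma^n(\xi)=\xi,\ z+n\alpha+p\,\epsilon_n\le f^n(\xi)\le z+n\alpha+q\,\epsilon_n\}\ \sim\ e^{P_f(z+n\alpha)}\,\frac{(q-p)\,\epsilon_n}{\sqrt{2\pi}\,\sigma_0\sqrt n}$$ as $n\to\infty$, uniformly with respect to $z$.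
   Context: Symbol space. $\kappa_0\ge2$ is an integer and $A=(A(i,j))_{i,j=1}^{\kappa_0}$ is a matrix of $0$'s and $1$'s which is aperiodic ($A^M$ has strictly positive entries for some $M\ge1$). $\Sigma_A^+=\{(i_j)_{j=0}^\infty:1\le i_j\le\kappa_0,\ A(i_j,i_{j+1})=1\ \forall j\ge0\}$, with shift $\sigma((i_j)_j)=(i_{j+1})_j$. For $\theta\in(0,1)$, $d_\theta(\xi,\eta)=0$ if $\xi=\eta$, and $d_\theta(\xi,\eta)=\theta^m$ if $\xi_i=\eta_i$ for $0\le i<m$ and $m$ is maximal with this property. $\mathcal F_\theta(\Sigma_A^+)$ is the space of $d_\theta$-Lipschitz functions $g:\Sigma_A^+\to\mathbb C$; $|g|_\theta$ is the Lipschitz constant of $g$, $\|g\|_\theta=\|g\|_\infty+|g|_\theta$, and for $u\in\mathbb R\setminus\{0\}$, $\|g\|_{\theta,u}=\|g\|_\infty+|g|_\theta/|u|$. The same symbols denote the induced operator norms. $f^n(x)=f(x)+f(\sigma x)+\dots+f(\sigma^{n-1}x)$. Ruelle operator: $(\mathcal L_g v)(\xi)=\sum_{\sigma\eta=\xi}e^{g(\eta)}v(\eta)$. Pressure: for real-valued $F\in\mathcal F_\theta(\Sigma_A^+)$, $\mathrm{Pr}(F)=\sup_\mu\left[h(\mu)+\int F\,d\mu\right]$, the supremum over $\sigma$-invariant Borel probability measures, $h(\mu)$ being the measure-theoretic entropy of $\mu$; an equilibrium state of $F$ is a measure attaining the supremum. For real-valued $F,G\in\mathcal F_\theta(\Sigma_A^+)$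 and small $|u|$, $\mathrm{Pr}(F+\mathrm iuG)$ denotes the analytic continuation (the logarithm of the simple ''maximal'' eigenvalue of $\mathcal L_{F+\mathrm iuG}$). $P_f\in\mathbb R$ is the unique number with $\mathrm{Pr}(-P_f f)=0$; $m_0$ is the equilibrium state of $-P_f f$; $\alpha=\int f\,dm_0$; and $\sigma_0>0$ is defined by $\frac{d^2}{du^2}\mathrm{Pr}(-P_f f+\mathrm iuf)\big|_{u=0}=-\sigma_0^2$ (such $\sigma_0>0$ exists when $f$ is non-lattice). Non-lattice: there do not exist constants $\gamma_0,\gamma_1$, a bounded function $G$ on $\Sigma_A^+$ and a bounded integer-valued function $Z$ on $\Sigma_A^+$ such that $f=G\circ\sigma-G+\gamma_0+\gamma_1Z$ on $\Sigma_A^+$. Weakly contracting: for every $\epsilon>0$ there exist $a_0>0$, $\rho\in(0,1)$ and $A_\epsilon>0$ (possibly depending on $f$ and $\epsilon$) such that $$\text{(W)}\qquad \|\mathcal L^n_{(-P_f+\mathrm iu)f}\|_{\theta,u}\le A_\epsilon\,\rho^n|u|^\epsilon\qquad\text{for all }|u|\ge a_0\text{ and all integers }n\ge0.$$ ''(W) holds with $\rho$'' means that for every $\epsilon>0$ there are $a_0,A_\epsilon>0$ such that this estimate holds with this same $\rho$. The constant $\rho_1$: let $\chi_i$ be the characteristic function of the cylinder $\mathcal C_i=\{\eta\in\Sigma_A^+:\eta_0=i\}$ and fix arbitrary points $x_i\in\mathcal C_i$, $i=1,\dots,\kappa_0$. By a known version of Ruelle's Lemma there is a constant $\rho_1\in(0,1)$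 such that for $a_0,b_0>0$ and every $\epsilon>0$ there is $C_\epsilon>0$ with $$\Big|\sum_{\sigma^nx=x}e^{(t+\mathrm iu)f^n(x)}-\sum_{i=1}^{\kappa_0}\mathcal L^n_{(t+\mathrm iu)f}\chi_i(x_i)\Big|\le C_\epsilon|u|\sum_{m=2}^n\|\mathcal L^{n-m}_{(t+\mathrm iu)f}\|_\theta\,\rho_1^m e^{m(\epsilon+\mathrm{Pr}(tf))}$$ for all $n\in\mathbb N$, $|t|\le a_0$, $|u|\ge b_0$; $\rho_1$ is this constant. $A(n)\sim B(n)$ means $\lim_{n\to\infty}A(n)/B(n)=1$. *)

(* Defs.v *)
From HB Require Import structures.
From mathcomp Require Import all_boot all_order all_algebra.
From mathcomp Require Import finmap.
From mathcomp Require Import all_classical all_reals all_analysis.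
From mathcomp Require Import complex.

Set Implicit Arguments.
Unset Strict Implicit.
Unset Printing Implicit Defensive.

Import Order.TTheory GRing.Theory Num.Theory.
Import numFieldNormedType.Exports.

Local Open Scope classical_set_scope.
Local Open Scope complex_scope.
Local Open Scope ring_scope.

Record aperiodic_matrix := AperiodicMatrix {
  kappa : nat;
  transition :> 'M[nat]_kappa;
  kappa_ge2 : (2 <= kappa)%N;
  transition_01 : forall i j, transition i j = 0%N \/ transition i j = 1%N;
  transition_aperiodic : exists2 M : nat, (1 <= M)%N &
    forall i j, (0 < (transition ^+ M) i j)%N }.

Definition admissible (A : aperiodic_matrix) : set (nat -> 'I_(kappa A)) :=
  [set x | forall j, A (x j) (x j.+1) = 1%N].
Arguments admissible : clear implicits.

(* The parameter theta does not affect the underlying set; it selects the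
   metric dtheta below, and with it the Borel sets. *)
Definition shift_space (R : realType) (A : aperiodic_matrix) (theta : R) :
  Type := {x : nat -> 'I_(kappa A) | x \in admissible A}.

HB.instance Definition _ (R : realType) A (theta : R) :=
  Choice.on (shift_space A theta).

Lemma admissible_nonempty (A : aperiodic_matrix) : exists x, admissible A x.
Proof.
have succ (i : 'I_(kappa A)) : exists j, A i j = 1%N.
  have [M M0 AM] := transition_aperiodic A.
  apply: contrapT => /forallNP Ai; have := AM i i.
  case: M M0 {AM} => // M _; rewrite exprS mxE big1// => j _.
  by case: (@transition_01 A i j) => [->|/Ai//]; rewrite mul0r.
have [s sP] := choice succ.
exists (fun n => iter n s (Ordinal (ltnW (kappa_ge2 A)))) => j.
by rewrite /= sP.
Qed.

Lemma shift_space_nonempty (R : realType) A (theta : R) :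
  exists x : shift_space A theta, True.
Proof.
by have [x xA] := admissible_nonempty A; exists (exist _ x (mem_set xA)).
Qed.

HB.instance Definition _ (R : realType) A (theta : R) :=
  isPointed.Build (shift_space A theta)
    (projT1 (cid (shift_space_nonempty A theta))).

Lemma admissible_shift (R : realType) A (theta : R) (x : shift_space A theta) :
  (fun j => val x j.+1) \in admissible A.
Proof. by apply/mem_set => j; exact: (set_mem (valP x)). Qed.

Definition shift (R : realType) A (theta : R) (x : shift_space A theta) :
  shift_space A theta :=
  exist (fun y => y \in admissible A) (fun j => val x j.+1)
        (admissible_shift x).

Section metric.
Context {R : realType} {A : aperiodic_matrix} {theta : R}.
Implicit Types x y : shift_space A theta.

Definition agree x y (m : nat) := forall i, (i < m)%N -> val x i = val y i.

Definition dtheta x y : R :=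
  if x == y then 0 else
  theta ^+ xget 0%N [set m | agree x y m /\
                             forall m', agree x y m' -> (m' <= m)%N].

Definition dtheta_open (U : set (shift_space A theta)) :=
  forall x, U x -> exists2 r : R, 0 < r & forall y, dtheta x y < r -> U y.

End metric.

Definition borel_shift (R : realType) A (theta : R) :=
  g_sigma_algebraType (@dtheta_open R A theta).

Definition cexp (R : realType) (z : R[i]) : R[i] :=
  let: a +i* b := z in (expR a * cos b) +i* (expR a * sin b).

Section functions.
Context {R : realType} {A : aperiodic_matrix} {theta : R}.
Local Notation S := (shift_space A theta).
Local Notation abs := (@ComplexField.Normc.normc R).
Implicit Types (f F G : S -> R) (g v : S -> R[i]).

Definition birkhoff f (n : nat) (x : S) : R :=
  \sum_(0 <= i < n) f (iter i (@shift R A theta) x).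

Definition lipschitz_by g (C : R) :=
  0 <= C /\ forall x y, abs (g x - g y) <= C * dtheta x y.

Definition Ftheta : set (S -> R[i]) := [set g | exists C, lipschitz_by g C].

Definition cplx f : S -> R[i] := fun x => (f x)%:C.

Local Open Scope ereal_scope.

Definition sup_norm g : \bar R := ereal_sup (range (fun x => (abs (g x))%:E)).

Definition lip_const g : \bar R :=
  ereal_inf [set C%:E | C in lipschitz_by g].

Definition theta_norm g : \bar R := sup_norm g + lip_const g.

Definition theta_u_norm (u : R) g : \bar R :=
  sup_norm g + (`|u|^-1)%:E * lip_const g.

Definition op_norm (N : (S -> R[i]) -> \bar R)
    (T : (S -> R[i]) -> (S -> R[i])) : \bar R :=
  ereal_sup [set N (T g) | g in [set g | Ftheta g /\ N g <= 1]].

Local Close Scope ereal_scope.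

Definition ruelle_op g v : S -> R[i] := fun xi =>
  \sum_(eta \in [set eta | shift eta = xi]) cexp (g eta) * v eta.

Definition ruelle_pow f (s : R[i]) (n : nat) v : S -> R[i] :=
  iter n (ruelle_op (fun x => s * (f x)%:C)) v.

End functions.

Section thermodynamics.
Context {R : realType} {A : aperiodic_matrix} {theta : R}.
Local Notation S := (shift_space A theta).
Local Notation B := (borel_shift A theta).
Implicit Types (mu : probability B R) (F G : S -> R).

Definition invariant mu := forall E : set B, measurable E ->
  mu (@shift R A theta @^-1` E) = mu E.

(* A finite measurable partition is given by its labelling map c. The atoms of
   its join under 1, sigma, ..., sigma^(n-1) are indexed by words w. *)
Definition join_atom m (c : S -> 'I_m) n (w : {ffun 'I_n -> 'I_m}) : set B :=
  [set x | forall i : 'I_n, c (iter i (@shift R A theta) x) = w i].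

Definition join_entropy mu m (c : S -> 'I_m) n : R :=
  \sum_(w : {ffun 'I_n -> 'I_m})
    let a := fine (mu (join_atom c w)) in - (a * ln a).

Definition partition_entropy mu m (c : S -> 'I_m) : R :=
  limn (fun n => join_entropy mu c n / n%:R).

Local Open Scope ereal_scope.

Definition entropy mu : \bar R :=
  ereal_sup [set h | exists m (c : S -> 'I_m),
    (forall j, measurable (c @^-1` [set j] : set B)) /\
    h = (partition_entropy mu c)%:E].

Definition pressure F : \bar R :=
  ereal_sup [set entropy mu + \int[mu]_x (F x)%:E | mu in invariant].

Definition equilibrium_state F mu :=
  invariant mu /\ entropy mu + \int[mu]_x (F x)%:E = pressure F.

Local Close Scope ereal_scope.

Definition pressure_continuation F G (Q : R[i] -> R[i]) :=
  exists2 r : R, 0 < r &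
    (forall t : R, `|t| < r ->
       pressure (fun x => F x + t * G x) = (complex.Re (Q t%:C))%:E /\
       complex.Im (Q t%:C) = 0) /\
    (forall z : R[i], `|z| < r%:C -> derivable (Q : R[i]^o -> R[i]^o) z 1).

(* Pr(F + z G) for complex z close to 0; values away from 0 are irrelevant,
   since only the germ at 0 of the continuation is determined. *)
Definition pressureC F G : R[i] -> R[i] :=
  xget (fun=> 0) (pressure_continuation F G).

End thermodynamics.

Section hypotheses.
Context {R : realType} {A : aperiodic_matrix} {theta : R}.
Local Notation S := (shift_space A theta).
Implicit Types (f : S -> R).

Definition lattice f :=
  exists (gamma0 gamma1 : R) (G : S -> R) (Z : S -> int),
    [/\ exists M : R, forall x, `|G x| <= M,
        exists M : int, forall x, `|Z x| <= M &
        forall x, f x = G (shift x) - G x + gamma0 + gamma1 * (Z x)%:~R].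

Definition contraction_estimate f (P eps a0 rho Aeps : R) :=
  forall (u : R) (n : nat), a0 <= `|u| ->
    (op_norm (theta_u_norm u) (ruelle_pow f ((- P)%R +i* u) n)
      <= (Aeps * rho ^+ n * (`|u| `^ eps))%:E)%E.

Definition weakly_contracting f (P : R) :=
  forall eps : R, 0 < eps -> exists a0 rho Aeps : R,
    [/\ 0 < a0, 0 < rho < 1, 0 < Aeps &
        contraction_estimate f P eps a0 rho Aeps].

Definition weakly_contracting_with f (P rho : R) :=
  forall eps : R, 0 < eps -> exists a0 Aeps : R,
    [/\ 0 < a0, 0 < Aeps & contraction_estimate f P eps a0 rho Aeps].

Definition cyl_char (i : 'I_(kappa A)) : S -> R[i] :=
  fun x => (val x 0%N == i)%:R.

Definition periodic_points (n : nat) : set S :=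
  [set x | iter n (@shift R A theta) x = x].

(* The estimate is required for n >= 2 only: for n = 0 the sum over
   sigma^n x = x is infinite, and for n = 1 the right-hand side is an empty sum
   while the left-hand side is in general nonzero for arbitrary points x_i. *)
Definition ruelle_estimate f (x : 'I_(kappa A) -> S) (rho1 : R) :=
  forall a0 b0 eps : R, 0 < a0 -> 0 < b0 -> 0 < eps ->
  exists2 C : R, 0 < C &
  forall (n : nat) (t u : R), (2 <= n)%N -> `|t| <= a0 -> b0 <= `|u| ->
    ((ComplexField.Normc.normc
        (\sum_(y \in periodic_points n) cexp ((t +i* u) * (birkhoff f n y)%:C)
         - \sum_(i < kappa A) ruelle_pow f (t +i* u) n (cyl_char i) (x i)))%:E
     <= (C * `|u|)%:E *
        \sum_(2 <= m < n.+1)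
          op_norm theta_norm (ruelle_pow f (t +i* u) (n - m)) *
          (rho1 ^+ m *
           expR (m%:R * (eps + fine (pressure (fun y => t * f y)%R))))%:E)%E.

Definition count_periodic f (n : nat) (a b : R) : nat :=
  #|` fset_set [set x | periodic_points n x /\ a <= birkhoff f n x <= b] |.

End hypotheses.

(* Main.v *)
(* Normalizing -P f turns the weighted sums over periodic points into traces of
   powers of a transfer operator M fixing the constants. Near u = 0 the perturbed
   operator M_{iu} has a simple leading eigenvalue
   1 + iu alpha - u^2 (alpha^2 + sigma0^2) / 2 + O(u^3), the coefficients being read
   off from the pressure; on compact sets away from 0 the non-lattice condition, and
   for large u weak contraction with Ruelle's Lemma, make the sums exponentially
   small. Integrating against a Fejer kernel at scale eps_n gives a local limit
   theorem, and sandwiching an indicator between Fejer averages the count. *)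

Require Import Defs.
From HB Require Import structures.
From mathcomp Require Import all_boot all_order all_algebra.
From mathcomp Require Import finmap.
From mathcomp Require Import all_classical all_reals all_analysis.
From mathcomp Require Import complex measurable_realfun.
From mathcomp Require Import ring lra zify.

Set Implicit Arguments.
Unset Strict Implicit.
Unset Printing Implicit Defensive.

Import Order.TTheory GRing.Theory Num.Theory.
Import numFieldNormedType.Exports.

Local Open Scope classical_set_scope.
Local Open Scope complex_scope.
Local Open Scope ring_scope.


(** The Fejer kernel is chosen because its Fourier transform has compact support: at scale eps_n
    only frequencies up to T / eps_n occur. There the sums over periodic points are at most of order
    n rho^n |u|^(2+ep), and this must still beat a factor eps_n, which requires rho e^((3+ep) delta)
    < 1 and explains the condition delta < - log rho / 3. The normalization costs nothing on
    periodic points, since a coboundary cancels along a closed orbit; and as the window has width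
    O(eps_n), the weight e^(-P f^n) is almost constant on it, which turns the weighted average into
    a count. The obstacle is that P, m_0 and sigma_0 are given through a variational pressure and an
    unspecified analytic continuation of it, not through eigenvalues. Hence the variational
    principle, with a Gibbs measure built by hand, and enough Cauchy theory to carry the
    second-order expansion of the continuation from the real axis, where it is the logarithm of the
    eigenvalue, to the imaginary axis, where sigma_0 is defined. *)

Notation normc := ComplexField.Normc.normc.
Notation cRe := complex.Re.
Notation cIm := complex.Im.
Notation sg := (@Defs.shift _ _ _).

(** * Modulus and exponential of complex numbers, Taylor bounds *)

Section complex_norm.
Context {R : realType}.
Implicit Types (z w : R[i]) (a b : R).

Lemma le_of_eq a b : a = b -> a <= b.
Proof. by move=> ->. Qed.

Lemma normc_ge0 z : 0 <= normc z.
Proof. by case: z => a b; exact: sqrtr_ge0. Qed.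

Lemma normc0 : normc (0 : R[i]) = 0.
Proof. exact: ComplexField.Normc.normc0. Qed.

Lemma normc1 : normc (1 : R[i]) = 1.
Proof. exact: ComplexField.Normc.normc1. Qed.

Lemma normc_eq0 z : normc z = 0 -> z = 0.
Proof. exact: ComplexField.Normc.eq0_normc. Qed.

Lemma complex_ext z w : cRe z = cRe w -> cIm z = cIm w -> z = w.
Proof. by case: z w => a b [c d] /= -> ->. Qed.

Lemma normcM z w : normc (z * w) = normc z * normc w.
Proof. exact: ComplexField.Normc.normcM. Qed.

Lemma normcV z : normc z^-1 = (normc z)^-1.
Proof. exact: ComplexField.Normc.normcV. Qed.

Lemma normcN z : normc (- z) = normc z.
Proof. exact: normcN. Qed.

Lemma normcD z w : normc (z + w) <= normc z + normc w.
Proof. exact: le_normcD. Qed.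

Lemma normcB z w : normc (z - w) <= normc z + normc w.
Proof. by rewrite -(normcN w); exact: normcD. Qed.

Lemma normc_subC z w : normc (z - w) = normc (w - z).
Proof. by rewrite -normcN opprB. Qed.

Lemma normcX z n : normc (z ^+ n) = normc z ^+ n.
Proof.
by elim: n => [|n IH]; rewrite ?expr0 ?normc1// !exprS normcM IH.
Qed.

Lemma normc_dist z w v : normc (z - v) <= normc (z - w) + normc (w - v).
Proof. by rewrite (_ : z - v = (z - w) + (w - v)) ?normcD//; ring. Qed.

Lemma normc_ler_sub z w : normc z - normc w <= normc (z - w).
Proof. by rewrite lerBlDr -{1}(subrK w z) normcD. Qed.

Lemma normc_real a : normc a%:C = `|a|.
Proof. by rewrite /normc /= expr0n /= addr0 sqrtr_sqr. Qed.

Lemma normc_Re z : `|cRe z| <= normc z.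
Proof. by case: z => a b /=; rewrite -sqrtr_sqr ler_wsqrtr// lerDl sqr_ge0. Qed.

Lemma normc_Im z : `|cIm z| <= normc z.
Proof. by case: z => a b /=; rewrite -sqrtr_sqr ler_wsqrtr// lerDr sqr_ge0. Qed.

Lemma normc_leReIm z : normc z <= `|cRe z| + `|cIm z|.
Proof.
case: z => a b /=; rewrite -[leRHS]ger0_norm ?addr_ge0//.
rewrite -sqrtr_sqr ler_wsqrtr//.
rewrite sqrrD !real_normK ?num_real// -addrA [leRHS]addrA lerD//.
  by rewrite lerDl mulrn_wge0// mulr_ge0.
Qed.

Lemma normc_ge1 z : normc (Complex 0 1 * z) = normc z.
Proof. by rewrite normcM /normc /= expr0n /= expr1n add0r sqrtr1 mul1r. Qed.

Lemma normc_sum (I : Type) (r : seq I) (P : pred I) (F : I -> R[i]) :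
  normc (\sum_(i <- r | P i) F i) <= \sum_(i <- r | P i) normc (F i).
Proof.
elim/big_ind2: _ => //; first by rewrite normc0.
by move=> x a y b xa yb; rewrite (le_trans (normcD _ _))// lerD.
Qed.

(** Rotation of z onto the positive real axis. It reduces inequalities between complex quantities to
    real parts: in the mean value inequality, in the Doeblin estimate and in the extremal case of an
    average. *)
Lemma normc_dual z : exists2 w, normc w = 1 & cRe (w * z) = normc z.
Proof.
have [->|z0] := eqVneq z 0.
  by exists 1; rewrite ?normc1// mulr0 normc0.
have nz0 : normc z != 0 by apply: contra z0 => /eqP/normc_eq0 ->.
case: z z0 nz0 => a b z0 nz0.
set r := normc (a +i* b).
have r2 : r ^+ 2 = a ^+ 2 + b ^+ 2.
  by rewrite /r /normc sqr_sqrtr// addr_ge0// sqr_ge0.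
exists ((a / r) +i* (- (b / r))).
  rewrite /normc sqrrN !expr_div_n -mulrDl -r2 divff ?sqrtr1//.
  by rewrite expf_neq0.
rewrite /= mulNr opprK.
by rewrite mulrAC (mulrAC b) -mulrDl -!expr2 -r2 expr2 mulfK.
Qed.

Lemma ReM_real a z : cRe (a%:C * z) = a * cRe z.
Proof. by case: z => b c /=; rewrite mul0r subr0. Qed.

Lemma ImM_real a z : cIm (a%:C * z) = a * cIm z.
Proof. by case: z => b c /=; rewrite mul0r addr0. Qed.

Lemma ReB z w : cRe (z - w) = cRe z - cRe w.
Proof. by case: z; case: w. Qed.
Lemma ImB z w : cIm (z - w) = cIm z - cIm w.
Proof. by case: z; case: w. Qed.
Lemma ReD z w : cRe (z + w) = cRe z + cRe w.
Proof. by case: z; case: w. Qed.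
Lemma ImD z w : cIm (z + w) = cIm z + cIm w.
Proof. by case: z; case: w. Qed.

Lemma Re_sum (I : Type) (r : seq I) (P : pred I) (F : I -> R[i]) :
  cRe (\sum_(i <- r | P i) F i) = \sum_(i <- r | P i) cRe (F i).
Proof. by elim/big_ind2: _ => // x a y b <- <-; rewrite ReD. Qed.
Lemma Im_sum (I : Type) (r : seq I) (P : pred I) (F : I -> R[i]) :
  cIm (\sum_(i <- r | P i) F i) = \sum_(i <- r | P i) cIm (F i).
Proof. by elim/big_ind2: _ => // x a y b <- <-; rewrite ImD. Qed.

Lemma cexpD z w : cexp (z + w) = cexp z * cexp w.
Proof.
case: z => a b; case: w => c d /=.
by rewrite expRD cosD sinD; congr (_ +i* _); ring.
Qed.

Lemma cexp0 : cexp (0 : R[i]) = 1.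
Proof. by rewrite /cexp /= expR0 cos0 sin0 !mul1r. Qed.

Lemma normc_cexp z : normc (cexp z) = expR (cRe z).
Proof.
case: z => a b /=.
by rewrite !exprMn -mulrDr cos2Dsin2 mulr1 sqrtr_sqr ger0_norm// expR_ge0.
Qed.

Lemma cexp_real a : cexp a%:C = (expR a)%:C.
Proof. by rewrite /cexp /= cos0 sin0 mulr1 mulr0. Qed.

Lemma cexp_neq0 z : cexp z != 0.
Proof.
apply/eqP => /(congr1 (@normc R)); rewrite normc_cexp normc0.
by apply/eqP; rewrite gt_eqF// expR_gt0.
Qed.

Lemma cexpN z : cexp (- z) = (cexp z)^-1.
Proof.
apply: (mulfI (cexp_neq0 z)).
by rewrite -cexpD subrr cexp0 divff// cexp_neq0.
Qed.

Lemma cexpX z n : cexp (n%:R * z) = cexp z ^+ n.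
Proof.
elim: n => [|n IH]; first by rewrite mul0r expr0 cexp0.
by rewrite exprS -IH -cexpD -{2}(mul1r z) -mulrDl -natr1 addrC.
Qed.

(** The real mean value theorem applied to Re (w f), with w the rotation that makes w (f 1 - f 0)
    real and positive. The Taylor bounds for [cexp] follow along the ray t z, each remainder having
    z times the previous one as derivative. *)
Lemma complex_mvt (f df : R -> R[i]) (C : R) :
  (forall t : R, is_derive t 1 (fun t : R => cRe (f t)) (cRe (df t))) ->
  (forall t : R, is_derive t 1 (fun t : R => cIm (f t)) (cIm (df t))) ->
  (forall t, 0 <= t <= 1 -> normc (df t) <= C) ->
  normc (f 1 - f 0) <= C.
Proof.
move=> fre fim dfC.
have [[w1 w2] nw wf] := normc_dual (f 1 - f 0).
pose g : R -> R := w1 \*: (fun t : R => cRe (f t)) - w2 \*: (fun t : R => cIm (f t)).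
have gE t : g t = cRe ((w1 +i* w2) * f t).
  rewrite /g; change (w1 * cRe (f t) - w2 * cIm (f t) = cRe ((w1 +i* w2) * f t)).
  by case: (f t).
have dg (t : R) : is_derive t 1 g (cRe ((w1 +i* w2) * df t)).
  rewrite (_ : cRe _ = w1 *: cRe (df t) - w2 *: cIm (df t)).
    by apply: is_deriveB.
  by case: (df t).
have gc : {within `[0, 1], continuous g}.
  by apply: derivable_within_continuous => t _; have [] := dg t.
have [t t01 gt] := MVT ltr01 (fun t _ => dg t) gc.
rewrite -wf mulrBr ReB -!gE gt subr0 mulr1.
apply: (le_trans (ler_norm _)); apply: (le_trans (normc_Re _)).
rewrite normcM nw mul1r dfC//.
by move: t01; rewrite in_itv /= => /andP[/ltW -> /ltW ->].
Qed.

Lemma is_derive_cexp_ray (z : R[i]) (t : R) :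
  is_derive t 1 (fun t : R => cRe (cexp (t%:C * z)))
    (cRe (z * cexp (t%:C * z))) /\
  is_derive t 1 (fun t : R => cIm (cexp (t%:C * z)))
    (cIm (z * cexp (t%:C * z))).
Proof.
case: z => a b.
have da : is_derive t 1 (fun t : R => expR (t * a)) (a * expR (t * a)).
  by apply: is_derive_eq; rewrite /GRing.scale /=; ring.
have dc : is_derive t 1 (fun t : R => cos (t * b)) (- b * sin (t * b)).
  by apply: is_derive_eq; rewrite /GRing.scale /=; ring.
have ds : is_derive t 1 (fun t : R => sin (t * b)) (b * cos (t * b)).
  by apply: is_derive_eq; rewrite /GRing.scale /=; ring.
split.
- rewrite (_ : (fun _ => _) = (fun t => expR (t * a)) * (fun t => cos (t * b))).
    apply: is_derive_eq; rewrite /GRing.scale /= !mul0r !subr0 !addr0; ring.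
  by apply/funext => s /=; rewrite !mul0r subr0 addr0.
- rewrite (_ : (fun _ => _) = (fun t => expR (t * a)) * (fun t => sin (t * b))).
    apply: is_derive_eq; rewrite /GRing.scale /= !mul0r !subr0 !addr0; ring.
  by apply/funext => s /=; rewrite !mul0r subr0 addr0.
Qed.

Lemma is_derive_Re_ray (z : R[i]) (t : R) :
  is_derive t 1 (fun t : R => cRe (t%:C * z)) (cRe z) /\
  is_derive t 1 (fun t : R => cIm (t%:C * z)) (cIm z).
Proof.
have H (c : R) : is_derive t 1 (fun t : R => t * c) c.
  by apply: is_derive_eq; rewrite /GRing.scale /=; ring.
case: z => a b; split.
- rewrite (_ : (fun _ => _) = (fun t => t * a)); first exact: H.
  by apply/funext => s /=; rewrite mul0r subr0.
- rewrite (_ : (fun _ => _) = (fun t => t * b)); first exact: H.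
  by apply/funext => s /=; rewrite mul0r addr0.
Qed.

Lemma is_derive_Re_ray2 (z : R[i]) (t : R) :
  is_derive t 1 (fun t : R => cRe ((t ^+ 2 / 2)%:C * z)) (cRe (t%:C * z)) /\
  is_derive t 1 (fun t : R => cIm ((t ^+ 2 / 2)%:C * z)) (cIm (t%:C * z)).
Proof.
have H (c : R) : is_derive t 1 (fun t : R => (t ^+ 2) * (c / 2)) (t * c).
  by apply: is_derive_eq; rewrite /GRing.scale /=; field.
case: z => a b; split.
- rewrite (_ : (fun _ => _) = (fun t => (t ^+ 2) * (a / 2))).
    rewrite (_ : cRe _ = t * a); first exact: H.
    by rewrite /= mul0r subr0.
  by apply/funext => s /=; rewrite mul0r subr0 mulrAC mulrA.
- rewrite (_ : (fun _ => _) = (fun t => (t ^+ 2) * (b / 2))).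
    rewrite (_ : cIm _ = t * b); first exact: H.
    by rewrite /= mul0r addr0.
  by apply/funext => s /=; rewrite mul0r addr0 mulrAC mulrA.
Qed.

Lemma normc_ray (t : R) z : 0 <= t <= 1 -> normc (t%:C * z) <= normc z.
Proof.
move=> /andP[t0 t1]; rewrite normcM normc_real ger0_norm//.
by rewrite ler_piMl ?normc_ge0.
Qed.

Lemma normc_cexp_le z : normc (cexp z) <= expR (normc z).
Proof. by rewrite normc_cexp ler_expR (le_trans (ler_norm _))// normc_Re. Qed.

Lemma cexp_taylor1 z : normc (cexp z - 1) <= normc z * expR (normc z).
Proof.
have := @complex_mvt (fun t => cexp (t%:C * z)) (fun t => z * cexp (t%:C * z)).
rewrite mul1r mul0r cexp0; apply.
- by move=> t; exact: (is_derive_cexp_ray z t).1.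
- by move=> t; exact: (is_derive_cexp_ray z t).2.
- move=> t t01; rewrite normcM ler_wpM2l ?normc_ge0//.
  by rewrite (le_trans (normc_cexp_le _))// ler_expR normc_ray.
Qed.

Lemma cexp_taylor2 z : normc (cexp z - 1 - z) <= normc z ^+ 2 * expR (normc z).
Proof.
have := @complex_mvt (fun t => cexp (t%:C * z) - t%:C * z)
  (fun t => z * cexp (t%:C * z) - z).
rewrite !mul1r !mul0r cexp0 subr0 addrAC; apply.
- move=> t; rewrite ReB; under eq_fun do rewrite ReB.
  apply: is_deriveB; [exact: (is_derive_cexp_ray z t).1|exact: (is_derive_Re_ray z t).1].
- move=> t; rewrite ImB; under eq_fun do rewrite ImB.
  apply: is_deriveB; [exact: (is_derive_cexp_ray z t).2|exact: (is_derive_Re_ray z t).2].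
- move=> t t01; rewrite -[X in _ - X]mulr1 -mulrBr normcM expr2 -mulrA.
  rewrite ler_wpM2l ?normc_ge0// (le_trans (cexp_taylor1 _))//.
  by rewrite ler_pM ?normc_ge0 ?expR_ge0 ?ler_expR ?normc_ray.
Qed.

Lemma cexp_taylor3 z :
  normc (cexp z - 1 - z - z ^+ 2 / 2) <= normc z ^+ 3 * expR (normc z).
Proof.
have := @complex_mvt (fun t => cexp (t%:C * z) - t%:C * z - (t ^+ 2 / 2)%:C * z ^+ 2)
  (fun t => z * cexp (t%:C * z) - z - t%:C * z ^+ 2).
have E1 : (1 ^+ 2 / 2 : R)%:C = 2^-1 :> R[i].
  by rewrite expr1n mul1r fmorphV rmorph_nat.
have E0 : (0 ^+ 2 / 2 : R)%:C = 0 :> R[i] by rewrite expr0n /= mul0r.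
rewrite !mul1r !mul0r cexp0 subr0 E1 E0 !mul0r subr0.
rewrite (_ : cexp z - z - 2^-1 * z ^+ 2 - 1 = cexp z - 1 - z - z ^+ 2 / 2); last by ring.
apply.
- move=> t; rewrite !ReB; under eq_fun do rewrite !ReB.
  apply: is_deriveB; last exact: (is_derive_Re_ray2 _ t).1.
  apply: is_deriveB; [exact: (is_derive_cexp_ray z t).1|exact: (is_derive_Re_ray z t).1].
- move=> t; rewrite !ImB; under eq_fun do rewrite !ImB.
  apply: is_deriveB; last exact: (is_derive_Re_ray2 _ t).2.
  apply: is_deriveB; [exact: (is_derive_cexp_ray z t).2|exact: (is_derive_Re_ray z t).2].
- move=> t t01.
  rewrite (_ : _ - _ - _ = z * (cexp (t%:C * z) - 1 - t%:C * z)); last by ring.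
  rewrite normcM exprS -mulrA ler_wpM2l ?normc_ge0//.
  rewrite (le_trans (cexp_taylor2 _))//.
  rewrite ler_pM ?normc_ge0 ?expR_ge0 ?ler_expR ?normc_ray ?exprn_ge0 ?normc_ge0//.
  by rewrite lerXn2r ?nnegrE ?normc_ge0 ?normc_ray.
Qed.

End complex_norm.

(** * Sequences with geometric or bounded additive errors *)

Section sequences.
Context {R : realType}.

Lemma geom_le0 (a C r : R) : 0 <= r < 1 -> (forall n, a <= C * r ^+ n) -> a <= 0.
Proof.
move=> /andP[r0 r1] H; have cv : C * r ^+ n @[n --> \oo] --> (C * 0).
  by apply: cvgMr; apply: cvg_expr; rewrite ger0_norm.
rewrite -[leRHS](mulr0 C) -(cvg_lim (@Rhausdorff R) cv).
by apply: limr_ge; [apply/cvg_ex; eexists; exact: cv | exact: nearW].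
Qed.

(** With e n the geometric tail, the intervals [s n - e n, s n + e n] are nested; the limit is the
    supremum of their left ends, which gives the rate together with the existence. *)
Lemma geometric_cauchy_real (s : nat -> R) (C r : R) : 0 <= C -> 0 <= r < 1 ->
  (forall n, `|s n.+1 - s n| <= C * r ^+ n) ->
  exists l, forall n, `|s n - l| <= C / (1 - r) * r ^+ n.
Proof.
move=> C0 /andP[r0 r1] H; pose e n := C / (1 - r) * r ^+ n.
have r1' : 0 < 1 - r by rewrite subr_gt0.
have eE n : e n = e n.+1 + C * r ^+ n.
  by rewrite /e exprS; field; rewrite gt_eqF.
have e0 n : 0 <= e n by rewrite mulr_ge0 ?divr_ge0 ?exprn_ge0// ltW.
have lo n k : s n - e n <= s (n + k)%N - e (n + k)%N.
  elim: k => [|k IH]; first by rewrite addn0.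
  rewrite (le_trans IH)// addnS [e (n + k)%N]eE.
  by have := H (n + k)%N; rewrite ler_norml => /andP[]; lra.
have hi n k : s (n + k)%N + e (n + k)%N <= s n + e n.
  elim: k => [|k IH]; first by rewrite addn0.
  rewrite (le_trans _ IH)// addnS [e (n + k)%N]eE.
  by have := H (n + k)%N; rewrite ler_norml => /andP[]; lra.
have lh n m : s n - e n <= s m + e m.
  rewrite (le_trans (lo n m))// addnC (le_trans _ (hi m n))//.
  by have := e0 (m + n)%N; lra.
pose A := [set s n - e n | n in [set: nat]].
have A0 : A !=set0 by exists (s 0%N - e 0%N), 0%N.
have ubA m : ubound A (s m + e m) by move=> _ [n _ <-].
exists (sup A) => n; rewrite -/(e n) ler_norml; apply/andP; split.
  by have := ge_sup A0 (ubA n); lra.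
have : s n - e n <= sup A by apply: ub_le_sup; [exists (s 0%N + e 0%N) | exists n].
by lra.
Qed.

Lemma geometric_cauchy (s : nat -> R[i]) (C r : R) : 0 <= C -> 0 <= r < 1 ->
  (forall n, normc (s n.+1 - s n) <= C * r ^+ n) ->
  exists l, forall n, normc (s n - l) <= 2 * C / (1 - r) * r ^+ n.
Proof.
move=> C0 r01 H.
have [n|a aP] := geometric_cauchy_real (s := fun n => cRe (s n)) C0 r01.
  by rewrite -ReB (le_trans (normc_Re _)).
have [n|b bP] := geometric_cauchy_real (s := fun n => cIm (s n)) C0 r01.
  by rewrite -ImB (le_trans (normc_Im _)).
exists (a +i* b) => n; rewrite (le_trans (normc_leReIm _))// ReB ImB /=.
rewrite (_ : _ * _ = C / (1 - r) * r ^+ n + C / (1 - r) * r ^+ n); first by rewrite lerD.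
by rewrite -mulrDl -mulrDl -mulr2n mulr_natl.
Qed.

(** Two-sided form of Fekete's lemma: every (a n - c) / n lies below every (a m + c) / m, and L is
    the supremum of the former. The error stays bounded by c for all n, so exponentials of a n are
    comparable to e^(n L) up to a constant. *)
Lemma quasi_additive (a : nat -> R) (c : R) :
  (forall n m, `|a (n + m)%N - a n - a m| <= c) ->
  exists L, forall n, `|a n - n%:R * L| <= c.
Proof.
move=> H.
have up n m : a (m.+1 * n)%N + c <= m.+1%:R * (a n + c).
  elim: m => [|m IH]; first by rewrite mul1n mul1r.
  rewrite mulSn; have := H n (m.+1 * n)%N.
  rewrite -[m.+2]addn1 natrD mulrDl mul1r ler_norml => /andP[_]; lra.
have lo n m : m.+1%:R * (a n - c) <= a (m.+1 * n)%N - c.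
  elim: m => [|m IH]; first by rewrite mul1n mul1r.
  rewrite mulSn; have := H n (m.+1 * n)%N.
  rewrite -[m.+2]addn1 natrD mulrDl mul1r ler_norml => /andP[+ _]; lra.
have c0 : 0 <= c by exact: le_trans (normr_ge0 _) (H 0%N 0%N).
have lh n m : (a m.+1 - c) / m.+1%:R <= (a n.+1 + c) / n.+1%:R.
  rewrite ler_pdivrMr// mulrAC ler_pdivlMr//.
  rewrite mulrC (le_trans (lo _ _))// [leRHS]mulrC (le_trans _ (up _ _))//.
  by rewrite mulnC lerD2l; lra.
pose A := [set (a n.+1 - c) / n.+1%:R | n in [set: nat]].
have A0 : A !=set0 by exists ((a 1%N - c) / 1), 0%N.
have ubA m : ubound A ((a m.+1 + c) / m.+1%:R) by move=> _ [n _ <-].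
exists (sup A) => -[|n].
  by rewrite mul0r subr0; have := H 0%N 0%N; rewrite addn0 subrr sub0r normrN.
rewrite ler_norml; apply/andP; split.
  have := ge_sup A0 (ubA n); rewrite ler_pdivlMr// mulrC; lra.
have : (a n.+1 - c) / n.+1%:R <= sup A.
  by apply: ub_le_sup; [exists ((a 1%N + c) / 1); exact: (ubA 0%N) | exists n].
rewrite ler_pdivrMr// mulrC; lra.
Qed.

Lemma exists_ultra_oo : exists U : set_system nat, UltraFilter U /\ \oo `<=` U.
Proof. exact: ultraFilterLemma. Qed.

End sequences.

(** An ultrafilter finer than convergence to infinity. All bounded sequences converge along it, so a
    limit can be taken at every point of the shift space simultaneously, in place of a diagonal
    extraction or the Arzela-Ascoli theorem. *)
Definition uoo : set_system nat := projT1 (cid exists_ultra_oo).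

Instance uoo_ultra : UltraFilter uoo.
Proof. exact: (projT2 (cid exists_ultra_oo)).1. Qed.

Lemma uoo_near (P : nat -> Prop) : (\forall n \near \oo, P n) -> \forall n \near uoo, P n.
Proof. exact: (projT2 (cid exists_ultra_oo)).2. Qed.

(** * Limits of bounded sequences along the ultrafilter *)

Section ultralimits.
Context {R : realType}.

Lemma uoo_cvg_real (s : nat -> R) (C : R) : (forall n, `|s n| <= C) ->
  exists l : R, s n @[n --> uoo] --> l.
Proof.
move=> sC; have := @segment_compact R (- C) C.
rewrite compact_ultra => /(_ (s @ uoo)) H.
have UU : UltraFilter (s @ uoo).
  split; first exact: fmap_proper_filter.
  move=> G GP sG; apply/seteqP; split => [B GB|]; last exact: sG.
  have [//|UB] := in_ultra_setVsetC (s @^-1` B) uoo_ultra.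
  have GB' : G (~` B) by apply: sG.
  have GI : G (B `&` ~` B) by exact: filterI.
  by move: GI; rewrite setICr; case/(@filter_not_empty _ G).
have [] := H UU.
  by apply: nearW => n /=; rewrite in_itv /= -ler_norml sC.
by move=> l [_ sl]; exists l.
Qed.

Lemma uoo_lim (s : nat -> R[i]) (C : R) : (forall n, normc (s n) <= C) ->
  exists l, forall e, 0 < e -> \forall n \near uoo, normc (s n - l) < e.
Proof.
move=> sC.
have [n|a sa] := @uoo_cvg_real (fun n => cRe (s n)) C.
  exact: le_trans (normc_Re _) (sC n).
have [n|b sb] := @uoo_cvg_real (fun n => cIm (s n)) C.
  exact: le_trans (normc_Im _) (sC n).
exists (a +i* b) => e e0; near=> n.
rewrite (le_lt_trans (normc_leReIm _))// ReB ImB /= (splitr e) ltrD//.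
- near: n; have /cvgr_distC_lt := sa; apply; exact: divr_gt0.
- near: n; have /cvgr_distC_lt := sb; apply; exact: divr_gt0.
Unshelve. all: by end_near. Qed.

End ultralimits.

(** * Geometry of the shift space *)

Section shift_geometry.
Context {R : realType} {A : aperiodic_matrix} {theta : R}.
Local Notation S := (shift_space A theta).
Local Notation I := 'I_(kappa A).
Implicit Types (x y z : S) (i j : I).

Lemma shift_space_ext x y : (forall n, val x n = val y n) -> x = y.
Proof. by move=> xy; apply: val_inj; apply/funext. Qed.

Lemma admissibleP x n : A (val x n) (val x n.+1) = 1%N.
Proof. exact: (set_mem (valP x)). Qed.

Lemma val_iter_shift n x m : val (iter n sg x) m = val x (n + m)%N.
Proof.
elim: n m => [//|n IH] m; rewrite iterS.
by change (val (iter n sg x) m.+1 = val x (n.+1 + m)%N); rewrite IH addnS.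
Qed.

Definition adm i x : bool := A i (val x 0%N) == 1%N.

Lemma scons_admissible i x : adm i x ->
  (fun n => if n is m.+1 then val x m else i) \in admissible A.
Proof. by move=> /eqP ix; apply/mem_set => -[|n] //=; exact: admissibleP. Qed.

(* Prepends a symbol; junk value x when the result is not admissible. *)
Definition scons i x : S :=
  insubd (x : {x : nat -> I | x \in admissible A})
         (fun n => if n is m.+1 then val x m else i).

Lemma val_scons i x n : adm i x ->
  val (scons i x) n = if n is m.+1 then val x m else i.
Proof. by move=> /scons_admissible ix; rewrite /scons val_insubd ix. Qed.

Lemma shift_scons i x : adm i x -> sg (scons i x) = x.
Proof.
move=> ix; apply: shift_space_ext => n.
by change (val (scons i x) n.+1 = val x n); rewrite val_scons.
Qed.

Lemma adm_shift x : adm (val x 0%N) (sg x).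
Proof. by apply/eqP; exact: admissibleP. Qed.

Lemma scons_shift x : scons (val x 0%N) (sg x) = x.
Proof.
by apply: shift_space_ext => -[|n]; rewrite val_scons// adm_shift.
Qed.

(** Eliminates the choice operator in [dtheta]: for distinct points the maximal length of agreement
    exists and is the first index of disagreement. *)
Lemma dthetaP x y : (x = y /\ dtheta x y = 0) \/
  exists m, [/\ agree x y m, val x m != val y m & dtheta x y = theta ^+ m].
Proof.
have [xy|xy] := eqVneq x y; first by left; rewrite /dtheta xy eqxx.
right; have [n xyn] : exists n, val x n != val y n.
  apply/not_existsP => H; move/eqP: xy; apply; apply: shift_space_ext => n.
  by apply/eqP/negPn/negP; exact: H.
have H : exists n, val x n != val y n by exists n.
have [m xm mmin] := ex_minnP H; exists m.
have xym : agree x y m.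
  by move=> k km; apply/eqP; apply: contraTT km => /mmin; rewrite leqNgt.
split => //; rewrite /dtheta (negbTE xy); congr (theta ^+ _).
set P := [set _ | _].
have Pm : P m.
  split => // m' xym'; rewrite leqNgt; apply/negP => mm'.
  by move/eqP: xm; apply; exact: xym'.
case: (xgetP 0%N P) => [k _ [xyk kmax]|/(_ m)//].
by apply/eqP; rewrite eqn_leq (kmax _ xym) Pm.2.
Qed.

Hypothesis th01 : 0 < theta < 1.

Let th0 : 0 < theta. Proof. by case/andP: th01. Qed.
Let th1 : theta < 1. Proof. by case/andP: th01. Qed.

Lemma d_ge0 x y : 0 <= dtheta x y.
Proof. by case: (dthetaP x y) => [[_ ->]|[m [_ _ ->]]]//; rewrite exprn_ge0// ltW. Qed.

Lemma d_refl x : dtheta x x = 0.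
Proof. by rewrite /dtheta eqxx. Qed.

Lemma d_le_agree m x y : agree x y m -> dtheta x y <= theta ^+ m.
Proof.
move=> xym; case: (dthetaP x y) => [[_ ->]|[k [_ xk ->]]].
  by rewrite exprn_ge0// ltW.
rewrite ler_wiXn2l ?ltW// leqNgt; apply/negP => /xym xk'.
by move: xk; rewrite xk' eqxx.
Qed.

Lemma d_eq m x y : agree x y m -> val x m != val y m -> dtheta x y = theta ^+ m.
Proof.
move=> xym xm; case: (dthetaP x y) => [[xy _]|[k [xyk xk ->]]].
  by rewrite xy eqxx in xm.
suff -> : k = m by [].
case: (ltngtP k m) => // [/xym H|/xyk H]; first by rewrite H eqxx in xk.
by rewrite H eqxx in xm.
Qed.

Lemma d_lt_agree m x y : dtheta x y < theta ^+ m -> agree x y m.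
Proof.
case: (dthetaP x y) => [[-> _] _ k _//|[k [xyk xk ->]]] H j jm.
apply: xyk; rewrite (leq_trans jm)// leqNgt; apply/negP => km.
by move: H; rewrite ltNge ler_wiXn2l ?ltW// ltnW.
Qed.

Lemma d_sym x y : dtheta x y = dtheta y x.
Proof.
case: (dthetaP x y) => [[-> //]|[k [xyk xk ->]]].
by rewrite (@d_eq k)// 1?eq_sym// => j /xyk ->.
Qed.

Lemma d_le1 x y : dtheta x y <= 1.
Proof. by rewrite (le_trans (@d_le_agree 0 x y _)). Qed.

Lemma d_head x y : val x 0%N != val y 0%N -> dtheta x y = 1.
Proof. by move=> xy; rewrite (@d_eq 0%N). Qed.

Lemma d_scons i x y : adm i x -> adm i y ->
  dtheta (scons i x) (scons i y) = theta * dtheta x y.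
Proof.
move=> ix iy; case: (dthetaP x y) => [[-> ->]|[k [xyk xk ->]]].
  by rewrite d_refl mulr0.
rewrite -exprS; apply: d_eq; last by rewrite !val_scons.
by move=> [|j] jk; rewrite !val_scons// xyk.
Qed.

Lemma adm_head i x y : val x 0%N = val y 0%N -> adm i x = adm i y.
Proof. by rewrite /adm => ->. Qed.

Lemma exists_path n i j x : (0 < (transition A ^+ n) i j)%N -> val x 0%N = j ->
  exists2 z, iter n sg z = x & val z 0%N = i.
Proof.
elim: n i => [|n IH] i.
  by rewrite expr0 mxE; case: eqP => // -> _ <-; exists x.
rewrite exprS mxE => H xj.
have [k] : exists k, A i k * (transition A ^+ n) k j != 0.
  apply/not_existsP => H'; move: H; rewrite big1// => k _.
  by apply/eqP/negPn/negP; exact: H'.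
rewrite -lt0n muln_gt0 => /andP[ik kj].
have [z zx zk] := IH k kj xj.
have iz : adm i z.
  by apply/eqP; rewrite zk; case: (@transition_01 A i k) ik => ->.
exists (scons i z); last by rewrite val_scons.
by rewrite iterSr shift_scons.
Qed.

(** Aperiodicity in the form used throughout: the base case is positivity of the M-th power of the
    matrix, the step prepends the first symbol of y. That M does not depend on the points makes the
    later constants uniform. *)
Lemma exists_preimage : exists M : nat, forall k x y,
  exists2 z, iter (k + M) sg z = x & agree z y k.+1.
Proof.
have [M M1 AM] := transition_aperiodic A; exists M => k x.
elim: k => [|k IH] y.
  have [z zx zy] := exists_path (AM (val y 0%N) (val x 0%N)) erefl.
  by exists z => // -[].
have [z zx zy] := IH (sg y).
have yz : adm (val y 0%N) z.
  by rewrite (@adm_head _ z (sg y)) ?adm_shift// zy.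
exists (scons (val y 0%N) z); first by rewrite addSn iterSr shift_scons.
by move=> [|j] jk; rewrite val_scons//; exact: zy.
Qed.

End shift_geometry.

(** * Transfer operators and their iterates as sums over words *)

Section transfer.
Context {R : realType} {A : aperiodic_matrix} {theta : R} {K : comNzRingType}.
Local Notation S := (shift_space A theta).
Local Notation I := 'I_(kappa A).
Implicit Types (x y z : S) (i j : I) (w : seq I) (phi v : S -> K).

(** The Ruelle operator with multiplicative weight [phi], preimages being indexed by their first
    symbol so that the sum is finite by construction. The ring is abstract in order to serve real
    and complex weights alike. *)
Definition tr phi v : S -> K :=
  fun x => \sum_(i | adm i x) phi (scons i x) * v (scons i x).

Definition bprod phi n x := \prod_(0 <= j < n) phi (iter j sg x).

Lemma bprod0 phi x : bprod phi 0 x = 1.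
Proof. by rewrite /bprod big_geq. Qed.

Lemma bprodS phi n x : bprod phi n.+1 x = phi x * bprod phi n (sg x).
Proof.
rewrite /bprod big_nat_recl//; congr (_ * _).
by apply: eq_bigr => j _; rewrite -iterSr.
Qed.

Lemma bprodD phi m n x :
  bprod phi (m + n) x = bprod phi m x * bprod phi n (iter m sg x).
Proof.
elim: m x => [|m IH] x; first by rewrite bprod0 mul1r.
by rewrite addSn !bprodS IH iterSr mulrA.
Qed.

Lemma trD phi u v : tr phi (fun x => u x + v x) = fun x => tr phi u x + tr phi v x.
Proof.
apply/funext => x; rewrite /tr -big_split.
by apply: eq_bigr => i _; rewrite mulrDr.
Qed.

Lemma trZ phi (c : K) v : tr phi (fun x => c * v x) = fun x => c * tr phi v x.
Proof.
by apply/funext => x; rewrite /tr mulr_sumr; apply: eq_bigr => i _; rewrite mulrCA.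
Qed.

Lemma trB phi u v : tr phi (fun x => u x - v x) = fun x => tr phi u x - tr phi v x.
Proof.
apply/funext => x; rewrite /tr -sumrB.
by apply: eq_bigr => i _; rewrite mulrBr.
Qed.

Lemma iter_trD phi n u v : iter n (tr phi) (fun x => u x + v x) =
  fun x => iter n (tr phi) u x + iter n (tr phi) v x.
Proof. by elim: n => //= n ->; rewrite trD. Qed.

Lemma iter_trB phi n u v : iter n (tr phi) (fun x => u x - v x) =
  fun x => iter n (tr phi) u x - iter n (tr phi) v x.
Proof. by elim: n => //= n ->; rewrite trB. Qed.

Lemma iter_trZ phi n (c : K) v : iter n (tr phi) (fun x => c * v x) =
  fun x => c * iter n (tr phi) v x.
Proof. by elim: n => //= n ->; rewrite trZ. Qed.

Lemma tr_mul_shift phi u v :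
  tr phi (fun x => u (sg x) * v x) = fun x => u x * tr phi v x.
Proof.
apply/funext => x; rewrite /tr mulr_sumr.
by apply: eq_bigr => i ix; rewrite shift_scons// mulrCA.
Qed.

(** Meaningful only under [wok w x], since [scons] returns a junk value on an inadmissible
    symbol. *)
Definition wcat w x : S := foldr scons x w.

Fixpoint wok w x : bool := if w is i :: w' then adm i (wcat w' x) && wok w' x else true.

Fixpoint words n : seq (seq I) :=
  if n is n'.+1 then [seq i :: w | i <- enum I, w <- words n'] else [:: [::]].

Lemma big_words (V : nmodType) n (F : seq I -> V) :
  \sum_(w <- words n.+1) F w = \sum_i \sum_(w <- words n) F (i :: w).
Proof. rewrite /= big_flatten big_map big_enum.
by apply: eq_bigr => i _; rewrite big_map. Qed.

Lemma mem_words n w : (w \in words n) = (size w == n).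
Proof.
elim: n w => [|n IH] w; first by rewrite inE size_eq0.
apply/allpairsP/idP => [[[i w'] [_ /= w'n ->]] /=|].
  by rewrite eqSS -IH.
case: w => [//|i w]; rewrite /= eqSS -IH => wn.
by exists (i, w); rewrite mem_enum.
Qed.

Lemma words_uniq n : uniq (words n).
Proof.
elim: n => //= n IH; apply: allpairs_uniq => //; first exact: enum_uniq.
by move=> [i w] [j w'] _ _ /= [-> ->].
Qed.

Lemma iter_shift_wcat w x : wok w x -> iter (size w) sg (wcat w x) = x.
Proof. elim: w => // i w IH /= /andP[iw wx].
by rewrite -iterS iterSr shift_scons// IH. Qed.

Lemma iter_trE phi n v x : iter n (tr phi) v x =
  \sum_(w <- words n | wok w x) bprod phi n (wcat w x) * v (wcat w x).
Proof.
elim: n v x => [|n IH] v x; first by rewrite big_cons big_nil /= bprod0 mul1r addr0.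
rewrite iterSr IH big_mkcond [RHS]big_mkcond big_words exchange_big.
apply: eq_bigr => w _; rewrite -!big_mkcond /=.
case: (boolP (wok w x)) => wx; last by rewrite big_pred0// => i; rewrite andbF.
rewrite /tr mulr_sumr; apply: eq_big => [i|i iw]; first by rewrite andbT.
by rewrite bprodS shift_scons// mulrCA mulrA.
Qed.

End transfer.

(** * Positivity and monotonicity of real transfer operators *)

Section transfer_real.
Context {R : realType} {A : aperiodic_matrix} {theta : R}.
Local Notation S := (shift_space A theta).
Implicit Types (x y z : S) (phi g v : S -> R).

Lemma tr_ge phi g z : (forall x, 0 <= phi x) -> (forall x, 0 <= g x) ->
  phi z * g z <= tr phi g (sg z).
Proof.
move=> phi0 g0; rewrite /tr (bigD1 (val z 0%N)) ?adm_shift//= scons_shift.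
by rewrite lerDl sumr_ge0// => i _; rewrite mulr_ge0.
Qed.

Lemma tr_le phi u v : (forall x, 0 <= phi x) -> (forall x, u x <= v x) ->
  forall x, tr phi u x <= tr phi v x.
Proof. by move=> phi0 uv x; apply: ler_sum => i _; rewrite ler_wpM2l. Qed.

Lemma iter_tr_le phi n u v : (forall x, 0 <= phi x) -> (forall x, u x <= v x) ->
  forall x, iter n (tr phi) u x <= iter n (tr phi) v x.
Proof. by move=> phi0 uv; elim: n => //= n IH x; exact: tr_le. Qed.

Lemma iter_tr_ge0 phi n v : (forall x, 0 <= phi x) -> (forall x, 0 <= v x) ->
  forall x, 0 <= iter n (tr phi) v x.
Proof.
move=> phi0 v0; elim: n => //= n IH x.
by apply: sumr_ge0 => i _; rewrite mulr_ge0.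
Qed.

Lemma iter_tr_ge phi g n z : (forall x, 0 <= phi x) -> (forall x, 0 <= g x) ->
  bprod phi n z * g z <= iter n (tr phi) g (iter n sg z).
Proof.
move=> phi0; elim: n g z => [|n IH] g z g0; first by rewrite bprod0 mul1r.
have E : iter n.+1 (tr phi) g = iter n (tr phi) (tr phi g) by rewrite iterSr.
rewrite E [iter n.+1 sg z]iterSr bprodS mulrAC mulrC.
rewrite (le_trans _ (IH (tr phi g) (sg z) _))//; last first.
  exact: (@iter_tr_ge0 phi 1).
by rewrite ler_wpM2l ?tr_ge// /bprod prodr_ge0.
Qed.

End transfer_real.

(** * Exponential growth rate and positive eigenfunction *)

Section growth_rate.
Context {R : realType} {A : aperiodic_matrix} {theta : R}.
Local Notation S := (shift_space A theta).
Implicit Types (x y z : S) (g v : S -> R).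
Hypothesis th01 : 0 < theta < 1.
Variables (F : S -> R) (K : R).
Hypothesis K0 : 0 <= K.
Hypothesis FK : forall x y, `|F x - F y| <= K * dtheta x y.

Let th0 : 0 < theta. Proof. by case/andP: th01. Qed.
Let th1 : theta < 1. Proof. by case/andP: th01. Qed.

Local Notation phi := (fun x => expR (F x)).
Local Notation L := (tr phi).

Let phi0 x : 0 <= phi x. Proof. exact: expR_ge0. Qed.

(** Nonnegative functions whose logarithm is B-Lipschitz on each cylinder of length one, written
    multiplicatively so that zeros are allowed. *)
Definition cone (B : R) (g : S -> R) := (forall x, 0 <= g x) /\
  forall x y, val x 0%N = val y 0%N -> g x <= expR (B * dtheta x y) * g y.

(** The solution of B = theta (B + K): along a branch, the function contributes theta B and the
    weight theta K, so this is the value for which the cone is invariant. *)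
Definition cone_cst := theta * K / (1 - theta).

Lemma cone_cst_ge0 : 0 <= cone_cst.
Proof. by rewrite /cone_cst divr_ge0 ?mulr_ge0// ?subr_ge0 ltW. Qed.

Lemma tr_cone g : cone cone_cst g -> cone cone_cst (L g).
Proof.
move=> [g0 gB]; split; first by move=> x; apply: sumr_ge0 => i _; rewrite mulr_ge0.
move=> x y xy; rewrite /tr (eq_bigl (adm^~ y)); last by move=> i; exact: adm_head.
rewrite mulr_sumr; apply: ler_sum => i iy.
have ix : adm i x by rewrite (adm_head _ xy).
have dxy := d_scons ix iy.
have g1 : g (scons i x) <= expR (cone_cst * (theta * dtheta x y)) * g (scons i y).
  by rewrite -dxy; apply: gB; rewrite !val_scons.
have f1 : phi (scons i x) <= expR (K * (theta * dtheta x y)) * phi (scons i y).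
  rewrite -expRD ler_expR -lerBlDr -dxy.
  exact: le_trans (ler_norm _) (FK _ _).
rewrite (le_trans (ler_pM _ _ f1 g1))//.
rewrite mulrACA -expRD; apply: le_of_eq.
congr (expR _ * _); rewrite /cone_cst; field.
by rewrite gt_eqF// subr_gt0.
Qed.

Lemma cone_one : cone cone_cst (fun=> 1).
Proof.
split => // x y _; rewrite mulr1 -expR0 ler_expR.
by rewrite mulr_ge0 ?cone_cst_ge0 ?d_ge0.
Qed.

Lemma iter_cone n : cone cone_cst (iter n L (fun=> 1)).
Proof. by elim: n => [|n IH]; [exact: cone_one|exact: tr_cone]. Qed.

Lemma lip_bounded : exists b : R, forall x, `|F x| <= b.
Proof.
pose x0 : S := point; exists (`|F x0| + K) => x.
rewrite -[F x](subrK (F x0)) addrC (le_trans (ler_normD _ _))// lerD2l.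
by rewrite (le_trans (FK _ _))// ler_piMr// d_le1.
Qed.

Lemma bprod_exp n x : bprod phi n x = expR (birkhoff F n x).
Proof. by rewrite /birkhoff expR_sum. Qed.

Lemma birkhoff_bound b n x : (forall x, `|F x| <= b) -> `|birkhoff F n x| <= n%:R * b.
Proof.
move=> Fb; rewrite (le_trans (ler_norm_sum _ _ _))//.
rewrite (le_trans (ler_sum _ (fun i _ => Fb _)))//.
by rewrite sumr_const_nat subn0 mulr_natl.
Qed.

Lemma tr_cst_le b c : (forall x, `|F x| <= b) -> 0 <= c -> forall x,
  L (fun=> c) x <= (kappa A)%:R * expR b * c.
Proof.
move=> Fb c0 x; rewrite /tr big_mkcond.
rewrite (le_trans (ler_sum _ (fun i _ => _ : _ <= expR b * c)))//; last first.
  by rewrite sumr_const card_ord -mulrA mulr_natl.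
move=> i _; case: ifP => _; last by rewrite mulr_ge0 ?expR_ge0.
by rewrite ler_wpM2r// ler_expR (le_trans (ler_norm _)).
Qed.

Lemma iter_cst_le b n : (forall x, `|F x| <= b) -> forall x,
  iter n L (fun=> 1) x <= ((kappa A)%:R * expR b) ^+ n.
Proof.
move=> Fb; elim: n => [|n IH] x; first by rewrite expr0.
rewrite iterS (le_trans (tr_le _ IH x))//.
by rewrite exprS tr_cst_le// exprn_ge0// mulr_ge0 ?expR_ge0.
Qed.

Lemma iter_one_gt0 n x : 0 < iter n L (fun=> 1) x.
Proof.
have [M HM] := @exists_preimage R A theta.
have [z zx _] := HM n x x.
have nz : iter n sg (iter M sg z) = x by rewrite -iterD.
rewrite -nz (lt_le_trans _ (iter_tr_ge _ _ _ _))//.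
by rewrite mulr1 bprod_exp expR_gt0.
Qed.

(** Some preimage z of y of order M lies in the first cylinder of x. The cone condition compares x
    with z, and the M extra steps from z to y cost a factor that does not depend on n. *)
Lemma iter_one_comparable : exists2 C, 1 <= C & forall n x y,
  iter n L (fun=> 1) x <= C * iter n L (fun=> 1) y.
Proof.
have [b Fb] := lip_bounded.
have [M HM] := @exists_preimage R A theta.
have b0 : 0 <= b by exact: le_trans (normr_ge0 _) (Fb point).
set k := (kappa A)%:R * expR b.
have k1 : 1 <= k.
  rewrite -[1]mulr1 ler_pM// ?ler1n ?(ltnW (kappa_ge2 A))//.
  by rewrite -expR0 ler_expR.
exists (expR (cone_cst + M%:R * b) * k ^+ M).
  rewrite -[leLHS]mulr1 ler_pM ?exprn_ege1//.
  by rewrite -expR0 ler_expR addr_ge0 ?cone_cst_ge0// mulr_ge0.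
move=> n x y.
have [z zx zy] := HM 0%N y x.
rewrite add0n in zx.
set g := iter n L _.
have gx : g x <= expR cone_cst * g z.
  have [g0 gB] := iter_cone n.
  rewrite (le_trans (gB x z _)) ?zy// ler_wpM2r ?g0// ler_expR.
  by rewrite ler_piMr ?cone_cst_ge0 ?d_le1.
have gz : g z <= expR (M%:R * b) * iter M L g y.
  rewrite -ler_pdivrMl ?expR_gt0// -expRN -zx.
  rewrite (le_trans _ (iter_tr_ge _ _ _ _))//; last first.
    by move=> t; rewrite ltW// iter_one_gt0.
  rewrite ler_wpM2r ?(ltW (iter_one_gt0 _ _))// bprod_exp ler_expR.
  by have := birkhoff_bound M z Fb; rewrite ler_norml => /andP[].
have gy : iter M L g y <= k ^+ M * g y.
  rewrite /g -iterD addnC iterD.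
  rewrite (le_trans (iter_tr_le _ _ (iter_cst_le M Fb) _))//.
  have := @iter_trZ R A theta R phi n (k ^+ M) (fun=> 1).
  by rewrite mulr1 => ->.
rewrite (le_trans gx)// expRD -!mulrA ler_wpM2l ?expR_ge0//.
by rewrite (le_trans gz)// ler_wpM2l ?expR_ge0.
Qed.

(** Comparability makes the logarithm of the iterates at one fixed point additive up to a constant,
    so [quasi_additive] applies. *)
Theorem growth_exists : exists Lam C : R, 1 <= C /\ forall n x,
  C^-1 * expR (n%:R * Lam) <= iter n L (fun=> 1) x <= C * expR (n%:R * Lam).
Proof.
have [C C1 HC] := iter_one_comparable.
have C0 : 0 < C by exact: lt_le_trans C1.
pose x0 : S := point; pose l n := iter n L (fun=> 1) x0.
have l0 n : 0 < l n by exact: iter_one_gt0.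
have lD n m : l (n + m)%N <= C * (l n * l m) /\ l n * l m <= C * l (n + m)%N.
  rewrite /l iterD; split.
    rewrite (le_trans (iter_tr_le _ _ (fun x => HC m x x0) _))//.
    have := @iter_trZ R A theta R phi n (C * l m) (fun=> 1).
    by rewrite mulr1 => ->; rewrite -mulrA [l m * _]mulrC.
  have := @iter_trZ R A theta R phi n (l m) (fun=> 1).
  rewrite mulr1 mulrC => /(congr1 (fun g => g x0)) <-.
  rewrite (le_trans (iter_tr_le _ _ (fun x => HC m x0 x) _))//.
  by rewrite iter_trZ.
have [|Lam HL] := @quasi_additive R (fun n => ln (l n)) (ln C).
  move=> n m; have [u v] := lD n m.
  rewrite ler_norml -addrA -opprD -lnM ?posrE//.
  rewrite lerBrDr lerBlDr addrC lerBlDr -!lnM ?posrE ?mulr_gt0//.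
  by rewrite !ler_ln ?posrE ?mulr_gt0// [l (n+m)%N * C]mulrC v u.
have lb n : C^-1 * expR (n%:R * Lam) <= l n <= C * expR (n%:R * Lam).
  have := HL n; rewrite ler_norml lerBrDr lerBlDr => /andP[u v].
  rewrite ler_pdivrMl//; apply/andP; split.
    by rewrite -[l n]lnK ?posrE// -{1}[C]lnK ?posrE// -expRD ler_expR; lra.
  by rewrite -[l n]lnK ?posrE// -{1}[C]lnK ?posrE// -expRD ler_expR.
exists Lam, (C ^+ 2); split; first by rewrite exprn_ege1.
move=> n x; have /andP[u v] := lb n; apply/andP; split.
  rewrite -exprVn expr2 -mulrA ler_pdivrMl// (le_trans u)//.
  exact: HC.
by rewrite (le_trans (HC n x x0))// expr2 -mulrA ler_wpM2l// ltW.
Qed.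

(** The eigenfunction is a pointwise ultralimit of Cesaro means of e^(-k Lam) L^k 1. Averaging
    forces invariance in the limit; positivity, the bounds and the cone condition are closed
    conditions and pass to the limit. *)
Theorem eigenfunction : exists (Lam C : R) (h : S -> R), [/\ 1 <= C,
  (forall n x, C^-1 * expR (n%:R * Lam) <= iter n L (fun=> 1) x <= C * expR (n%:R * Lam)),
  (forall x, C^-1 <= h x <= C),
  cone cone_cst h &
  forall x, L h x = expR Lam * h x].
Proof.
have [Lam [C [C1 HC]]] := growth_exists.
have C0 : 0 < C by exact: lt_le_trans C1.
pose t k x := expR (- (k%:R * Lam)) * iter k L (fun=> 1) x.
have tC k x : C^-1 <= t k x <= C.
  have /andP[u v] := HC k x; rewrite /t expRN ler_pdivlMl ?expR_gt0//.
  by rewrite ler_pdivrMl ?expR_gt0// mulrC u mulrC v.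
pose s n x := n.+1%:R^-1 * \sum_(k < n.+1) t k x.
have sC n x : C^-1 <= s n x <= C.
  rewrite /s ler_pdivlMl// ler_pdivrMl// !mulr_natl.
  have cst c : c *+ n.+1 = \sum_(k < n.+1) c :> R by rewrite sumr_const card_ord.
  rewrite !cst; apply/andP; split; apply: ler_sum => k _; by have /andP[] := tC k x.
have /choice[h hP] : forall x, exists l : R, s n x @[n --> uoo] --> l.
  move=> x; apply: (@uoo_cvg_real R _ C) => n.
  have /andP[u v] := sC n x; rewrite ler_norml v andbT (le_trans _ u)//.
  by rewrite (@le_trans _ _ 0)// ?oppr_le0 ?invr_ge0 ltW.
exists Lam, C, h; split => //.
- move=> x; apply/andP; split.
    apply: (ler_cvg_to _ (hP x)); first exact: cvg_cst.
    by apply: nearW => n; have /andP[] := sC n x.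
  apply: (ler_cvg_to (hP x)); first exact: cvg_cst.
  by apply: nearW => n; have /andP[] := sC n x.
- split.
    move=> x; apply: (ler_cvg_to _ (hP x)); first exact: cvg_cst.
    by apply: nearW => n; have /andP[+ _] := sC n x; apply: le_trans; rewrite invr_ge0 ltW.
  move=> x y xy; apply: (ler_cvg_to (hP x)).
    by apply: cvgMl_tmp; exact: hP.
  apply: nearW => n; rewrite /s mulrCA ler_wpM2l// mulr_sumr.
  apply: ler_sum => k _; rewrite /t mulrCA ler_wpM2l ?expR_ge0//.
  by have [_] := iter_cone k; apply.
- move=> x.
  have Ls : L (s n) x @[n --> uoo] --> L h x.
    rewrite /tr; apply: cvg_big => [|i _]; [exact: add_continuous|apply: cvgMl_tmp; exact: hP].
  (* The two sides of the eigenvalue equation for the mean [s n] differ by a telescoped boundary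
     term, which is O(1 / n). *)
  have LsE n : L (s n) x = expR Lam * s n x + expR Lam * n.+1%:R^-1 * (t n.+1 x - 1).
    have Lt k : L (t k) x = expR Lam * t k.+1 x.
      rewrite /t trZ -iterS mulrA -expRD; congr (expR _ * _).
      by rewrite -natr1; ring.
    rewrite /s trZ.
    have -> : L (fun x => \sum_(k < n.+1) t k x) x = \sum_(k < n.+1) L (t k) x.
      by rewrite /tr exchange_big; apply: eq_bigr => i _; rewrite mulr_sumr.
    under eq_bigr do rewrite Lt.
    rewrite -mulr_sumr.
    have -> : \sum_(k < n.+1) t k.+1 x = \sum_(k < n.+1) t k x + (t n.+1 x - 1).
      have t0 : t 0%N x = 1 by rewrite /t mul0r oppr0 expR0 mul1r.
      have E1 : \sum_(k < n.+2) t k x = 1 + \sum_(k < n.+1) t k.+1 x.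
        by rewrite big_ord_recl t0.
      have E2 : \sum_(k < n.+2) t k x = \sum_(k < n.+1) t k x + t n.+1 x.
        by rewrite big_ord_recr.
      by apply: (addrI 1); rewrite -E1 E2; ring.
    by ring.
  have lim2 : expR Lam * s n x + expR Lam * n.+1%:R^-1 * (t n.+1 x - 1) @[n --> uoo]
      --> expR Lam * h x + 0.
    apply: cvgD; first by apply: cvgMl_tmp; exact: hP.
    apply/cvgr0Pnorm_lt => e e0.
    apply: uoo_near; near=> n.
    rewrite !normrM (ger0_norm (expR_ge0 _)) ger0_norm// -mulrA mulrCA.
    rewrite mulrC ltr_pdivrMr//.
    have tb : `|t n.+1 x - 1| <= C + 1.
      have /andP[u v] := tC n.+1 x; rewrite (le_trans (ler_normB _ _))// normr1 lerD2r.
      by rewrite ger0_norm// (le_trans _ u)// invr_ge0 ltW.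
    rewrite (@le_lt_trans _ _ (expR Lam * (C + 1)))//.
      by rewrite ler_wpM2l ?expR_ge0.
    rewrite -ltr_pdivrMl// (@lt_le_trans _ _ n%:R)// ?ler_nat//.
    by near: n; exact: nbhs_infty_gtr.
  rewrite addr0 in lim2.
  apply: (@cvg_unique R _ _ _ _ _ Ls); first exact: Rhausdorff.
  by rewrite (_ : (fun n => L (s n) x) = (fun n => expR Lam * s n x + expR Lam * n.+1%:R^-1 * (t n.+1 x - 1))) //; apply/funext.
Unshelve. all: by end_near. Qed.

End growth_rate.

(** * From contraction after m steps to an exponential rate *)

Section iterate_decay.
Context {R : realType} {V : Type}.

Lemma bernoulli (x : R) n : 0 <= x <= 1 -> 1 - n%:R * x <= (1 - x) ^+ n.
Proof.
move=> /andP[x0 x1]; elim: n => [|n IH]; first by rewrite mul0r subr0 expr0.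
rewrite exprS (le_trans _ (ler_wpM2l _ IH)) ?subr_ge0//.
rewrite -natr1; have : 0 <= n%:R * (x * x) by rewrite mulr_ge0// mulr_ge0.
lra.
Qed.

(** [N v s] reads: the size of v is at most s. The size is a relation because it will combine
    several seminorms, and because no best constant is needed. Serves both for the unperturbed gap
    and for intermediate frequencies. *)
Lemma iterate_decay (T : V -> V) (N : V -> R -> Prop) (m : nat) (B rho : R) :
  (forall v s t, s <= t -> N v s -> N v t) ->
  1 <= B -> (0 < m)%N -> 0 < rho < 1 ->
  (forall v s, 0 <= s -> N v s -> N (T v) (B * s)) ->
  (forall v s, 0 <= s -> N v s -> N (iter m T v) (rho * s)) ->
  exists C r : R, [/\ 0 < C, 0 < r < 1 & forall n v s, 0 <= s -> N v s ->
    N (iter n T v) (C * r ^+ n * s)].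
Proof.
move=> Nmon B1 m0 /andP[r0 r1] TB Tm.
have B0 : 0 < B by exact: lt_le_trans B1.
have m1 : 0 < m%:R :> R by rewrite ltr0n.
(* By Bernoulli's inequality the rate r = 1 - x satisfies rho <= r^m, so no m-th root is taken. *)
pose x := (1 - rho) / m%:R.
have x01 : 0 < x < 1.
  rewrite /x divr_gt0 ?subr_gt0//= ltr_pdivrMr// mul1r.
  by rewrite (@lt_le_trans _ _ 1) ?ler1n//; lra.
have /andP[x0 x1] := x01.
pose r := 1 - x.
have rm : rho <= r ^+ m.
  have xx : 0 <= x <= 1 by rewrite !ltW.
  rewrite (le_trans _ (bernoulli m xx))// /x mulrCA divff ?gt_eqF// mulr1; lra.
have rr : 0 < r < 1 by rewrite /r; lra.
have /andP[rr0 rr1] := rr.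
have Tn n v s : 0 <= s -> N v s -> N (iter n T v) (B ^+ n * s).
  move=> s0 Nv; elim: n => [|n IH]; first by rewrite mul1r.
  by rewrite iterS exprS -mulrA; apply: TB => //; rewrite mulr_ge0// exprn_ge0// ltW.
have Tq q v s : 0 <= s -> N v s -> N (iter (q * m) T v) (rho ^+ q * s).
  move=> s0 Nv; elim: q => [|q IH]; first by rewrite mul1r.
  rewrite mulSn iterD exprS -mulrA; apply: Tm => //.
  by rewrite mulr_ge0// exprn_ge0// ltW.
exists (B ^+ m * r ^- m), r; split => //.
  by rewrite mulr_gt0 ?exprn_gt0// invr_gt0 exprn_gt0.
move=> n v s s0 Nv; rewrite (divn_eq n m) addnC iterD.
have lt := ltn_pmod n m0.
apply: Nmon (Tn _ _ _ _ (Tq _ _ _ s0 Nv)); last by rewrite mulr_ge0// exprn_ge0// ltW.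
rewrite mulrA ler_wpM2r// -!mulrA.
apply: ler_pM; [by rewrite exprn_ge0// ltW|by rewrite exprn_ge0// ltW|
  by rewrite ler_weXn2l// ltnW|].
rewrite exprD mulrA mulnC exprM.
rewrite (@le_trans _ _ ((r ^+ m) ^+ (n %/ m)))//.
  by rewrite lerXn2r ?nnegrE ?exprn_ge0 ?(ltW rr0) ?(ltW r0).
apply: ler_peMl; first by rewrite !exprn_ge0// ltW.
rewrite mulrC ler_pdivlMr ?exprn_gt0// mul1r.
by rewrite ler_wiXn2l ?(ltW rr0) ?(ltW rr1)// ltnW.
Qed.

End iterate_decay.

(** * Lipschitz, sup and oscillation bounds *)

Section lipschitz_functions.
Context {R : realType} {A : aperiodic_matrix} {theta : R}.
Local Notation S := (shift_space A theta).
Implicit Types (x y z : S) (u v : S -> R[i]) (a b s : R) (c : R[i]).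

Definition lip v b := forall x y, normc (v x - v y) <= b * dtheta x y.
Definition bdd v a := forall x, normc (v x) <= a.
Definition osc v a := forall x y, normc (v x - v y) <= a.

Hypothesis th01 : 0 < theta < 1.

Lemma lip_le v a b : a <= b -> lip v a -> lip v b.
Proof. by move=> ab H x y; rewrite (le_trans (H x y))// ler_wpM2r ?d_ge0. Qed.

Lemma bdd_le v a b : a <= b -> bdd v a -> bdd v b.
Proof. by move=> ab H x; rewrite (le_trans (H x)). Qed.

Lemma lip_osc v b : 0 <= b -> lip v b -> osc v b.
Proof. by move=> b0 H x y; rewrite (le_trans (H x y))// ler_piMr ?d_le1. Qed.

Lemma lipD u v a b : lip u a -> lip v b -> lip (fun x => u x + v x) (a + b).
Proof.
move=> ua vb x y; rewrite opprD addrACA mulrDl.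
by rewrite (le_trans (normcD _ _))// lerD.
Qed.

Lemma lipB u v a b : lip u a -> lip v b -> lip (fun x => u x - v x) (a + b).
Proof.
move=> ua vb x y; rewrite (_ : _ - _ - _ = (u x - u y) - (v x - v y)); last by ring.
by rewrite mulrDl (le_trans (normcB _ _))// lerD.
Qed.

Lemma lipZ c v b : lip v b -> lip (fun x => c * v x) (normc c * b).
Proof. by move=> vb x y; rewrite -mulrBr normcM -mulrA ler_wpM2l ?normc_ge0. Qed.

Lemma lip_cst c : lip (fun=> c) 0.
Proof. by move=> x y; rewrite subrr normc0 mul0r. Qed.

Lemma lipM u v a a' b b' : bdd u a -> lip u a' -> bdd v b -> lip v b' ->
  lip (fun x => u x * v x) (a * b' + a' * b).
Proof.
move=> ua ul vb vl x y.
rewrite (_ : _ - _ = u x * (v x - v y) + (u x - u y) * v y); last by ring.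
rewrite (le_trans (normcD _ _))// !normcM mulrDl lerD//.
  rewrite -mulrA; apply: ler_pM; rewrite ?normc_ge0//.
rewrite mulrAC; apply: ler_pM; rewrite ?normc_ge0//.
Qed.

Lemma bddM u v a b : bdd u a -> bdd v b -> bdd (fun x => u x * v x) (a * b).
Proof. by move=> ua vb x; rewrite normcM ler_pM ?normc_ge0. Qed.

Lemma bddD u v a b : bdd u a -> bdd v b -> bdd (fun x => u x + v x) (a + b).
Proof. by move=> ua vb x; rewrite (le_trans (normcD _ _))// lerD. Qed.

Lemma bddZ c v b : bdd v b -> bdd (fun x => c * v x) (normc c * b).
Proof. by move=> vb x; rewrite normcM ler_wpM2l ?normc_ge0. Qed.

Lemma lip_bdd v b : 0 <= b -> lip v b -> exists2 a, 0 <= a & bdd v a.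
Proof.
move=> b0 vb; exists (normc (v point) + b); first by rewrite addr_ge0 ?normc_ge0.
move=> x; rewrite -lerBlDl (le_trans (normc_ler_sub _ _))//.
exact: lip_osc.
Qed.

End lipschitz_functions.

(* A g-function: the weight of a transfer operator fixing the constants, with
   a positive lower bound c and logarithmically Lipschitz along branches. *)
Record nweight (R : realType) (A : aperiodic_matrix) (theta : R) := NWeight {
  nw :> shift_space A theta -> R;
  nw_c : R;
  nw_D : R;
  nw_th : 0 < theta < 1;
  nw_c0 : 0 < nw_c;
  nw_D1 : 1 <= nw_D;
  nw_sum : forall x, \sum_(i | adm i x) nw (scons i x) = 1;
  nw_lb : forall x, nw_c <= nw x;
  nw_lip : forall i x y, adm i x -> val x 0%N = val y 0%N ->
    `|nw (scons i x) - nw (scons i y)| <= nw_D * nw (scons i y) * dtheta x y }.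

(** * Spectral gap and invariant functional of a g-function *)

Section normalized.
Context {R : realType} {A : aperiodic_matrix} {theta : R}.
Local Notation S := (shift_space A theta).
Implicit Types (x y z : S) (u v : S -> R[i]).
Variable p : @nweight R A theta.
Local Notation c := (nw_c p).
Local Notation D := (nw_D p).
Let th01 := nw_th p.
Let c0 := nw_c0 p.
Let D1 := nw_D1 p.
Let p_sum := nw_sum p.
Let p_lb := nw_lb p.
Let p_lip := nw_lip p.

Let th0 : 0 < theta. Proof. by case/andP: th01. Qed.
Let th1 : theta < 1. Proof. by case/andP: th01. Qed.
Let p0 x : 0 <= p x. Proof. exact: le_trans (ltW c0) (p_lb x). Qed.

Local Notation Mr := (tr p).
Local Notation M := (tr (fun z => (p z)%:C)).

Lemma Re_M v x : cRe (M v x) = Mr (fun y => cRe (v y)) x.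
Proof. by rewrite /tr Re_sum; apply: eq_bigr => i _; rewrite ReM_real. Qed.

Lemma Im_M v x : cIm (M v x) = Mr (fun y => cIm (v y)) x.
Proof. by rewrite /tr Im_sum; apply: eq_bigr => i _; rewrite ImM_real. Qed.

Lemma Re_iterM n v x : cRe (iter n M v x) = iter n Mr (fun y => cRe (v y)) x.
Proof.
elim: n x => //= n IH x; rewrite Re_M; congr (tr _ _ _); exact/funext.
Qed.

Lemma Mr_cst (a : R) : Mr (fun=> a) = fun=> a.
Proof. by apply/funext => x; rewrite /tr -mulr_suml p_sum mul1r. Qed.

Lemma M_cst (a : R[i]) : M (fun=> a) = fun=> a.
Proof.
by apply/funext => x; rewrite /tr -mulr_suml -(rmorph_sum (real_complex R)) p_sum mul1r.
Qed.

Lemma iter_M_cst n (a : R[i]) : iter n M (fun=> a) = fun=> a.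
Proof. by elim: n => //= n ->; rewrite M_cst. Qed.

Lemma iter_Mr_cst n (a : R) : iter n Mr (fun=> a) = fun=> a.
Proof. by elim: n => //= n ->; rewrite Mr_cst. Qed.

Lemma M_sub v (a : R[i]) x : M v x - a = M (fun y => v y - a) x.
Proof. by rewrite (@trB _ _ _ _ _ v (fun=> a)) M_cst. Qed.

Lemma normc_M v s x : (forall y, normc (v y) <= s) -> normc (M v x) <= s.
Proof.
move=> vs; rewrite /tr (le_trans (normc_sum _ _ _))//.
have -> : s = \sum_(i | adm i x) p (scons i x) * s by rewrite -mulr_suml p_sum mul1r.
apply: ler_sum => i _; rewrite normcM normc_real ger0_norm//.
by rewrite ler_wpM2l.
Qed.

Lemma osc_M v s : osc v s -> osc (M v) s.
Proof.
move=> vs x y; rewrite M_sub; apply: normc_M => z.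
by rewrite normc_subC M_sub; apply: normc_M => t.
Qed.

Lemma osc_iterM n v s : osc v s -> osc (iter n M v) s.
Proof. by move=> vs; elim: n => //= n; exact: osc_M. Qed.

(** Lasota-Yorke inequality with the oscillation as weak seminorm. Points in different first
    cylinders are at distance 1, where the oscillation bound suffices because D >= 1. *)
Lemma lip_M v l o : 0 <= l -> lip v l -> osc v o -> lip (M v) (theta * l + D * o).
Proof.
move=> l0 vl vo x y.
have o0 : 0 <= o by exact: le_trans (normc_ge0 _) (vo point point).
have [xy|xy] := eqVneq (val x 0%N) (val y 0%N); last first.
  rewrite (d_head xy) mulr1 (le_trans (osc_M vo x y))//.
  rewrite (@le_trans _ _ (D * o))// ?ler_peMl// lerDr mulr_ge0// ltW//.
(* Constants are fixed by M, so subtracting one is free; the variation of the weights is then paired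
   with differences of values of v only. *)
set a := v y.
rewrite (_ : _ - _ = (M v x - a) - (M v y - a)); last by ring.
rewrite (M_sub v a x) (M_sub v a y) /tr (eq_bigl (adm^~ y)); last by move=> i; exact: adm_head.
rewrite -sumrB (le_trans (normc_sum _ _ _))//.
have -> : (theta * l + D * o) * dtheta x y = \sum_(i | adm i y) p (scons i y) * ((theta * l + D * o) * dtheta x y).
  by rewrite -mulr_suml p_sum mul1r.
have -> : \sum_(i | adm i y) p (scons i y) * ((theta * l + D * o) * dtheta x y) =
  \sum_(i | adm i y) (p (scons i x) * (theta * l) + D * p (scons i y) * o) * dtheta x y.
  have -> : \sum_(i | adm i y) p (scons i y) * ((theta * l + D * o) * dtheta x y) =
    (\sum_(i | adm i y) p (scons i y)) * (theta * l * dtheta x y) + (\sum_(i | adm i y) p (scons i y)) * (D * o * dtheta x y).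
    by rewrite !mulr_suml -big_split; apply: eq_bigr => i _ /=; ring.
  have E : \sum_(i | adm i y) p (scons i y) = \sum_(i | adm i y) p (scons i x).
    rewrite p_sum (eq_bigl (adm^~ x)) ?p_sum// => i; exact/esym/adm_head.
  rewrite {1}E !mulr_suml -big_split; apply: eq_bigr => i _ /=; ring.
apply: ler_sum => i iy; have ix : adm i x by rewrite (adm_head _ xy).
rewrite (_ : _ - _ = (p (scons i x))%:C * (v (scons i x) - v (scons i y)) +
   (p (scons i x) - p (scons i y))%:C * (v (scons i y) - a)); last by rewrite rmorphB; ring.
rewrite (le_trans (normcD _ _))// !normcM !normc_real mulrDl lerD//.
  rewrite ger0_norm// -mulrA ler_wpM2l// (le_trans (vl _ _))//.
  by rewrite d_scons// mulrCA mulrA.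
rewrite [leRHS]mulrAC; apply: ler_pM; [by []|exact: normc_ge0|exact: p_lip|exact: vo].
Qed.

(** Sum of the series D theta^k of the errors made in iterating [lip_M]; it also serves as the
    distortion constant of products of weights. *)
Definition LY := D / (1 - theta).

Lemma LY_ge0 : 0 <= LY.
Proof. by rewrite /LY divr_ge0 ?subr_ge0 ?ltW// (lt_le_trans _ D1). Qed.

Lemma lip_iterM n v l o : 0 <= l -> lip v l -> osc v o ->
  lip (iter n M v) (theta ^+ n * l + LY * o).
Proof.
move=> l0 vl vo.
have o0 : 0 <= o by exact: le_trans (normc_ge0 _) (vo point point).
elim: n => [|n IH]; first by apply: lip_le vl => //; rewrite expr0 mul1r lerDl mulr_ge0 ?LY_ge0.
have H0 : 0 <= theta ^+ n * l + LY * o.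
  by rewrite addr_ge0// mulr_ge0 ?LY_ge0// exprn_ge0// ltW.
have := lip_M H0 IH (osc_iterM n vo).
apply: lip_le => //; rewrite mulrDr exprS -!mulrA -addrA lerD2l.
apply: le_of_eq.
by rewrite /LY; field; rewrite gt_eqF// subr_gt0.
Qed.

Lemma c_le1 : c <= 1.
Proof.
have x : S := point; have ix := adm_shift x.
rewrite -(p_sum (sg x)) (bigD1 (val x 0%N)) ?adm_shift//=.
by rewrite (le_trans (p_lb (scons (val x 0%N) (sg x))))// lerDl sumr_ge0.
Qed.

Lemma bprod_ge n z : c ^+ n <= bprod p n z.
Proof.
elim: n z => [|n IH] z; first by rewrite expr0 bprod0.
by rewrite exprS bprodS ler_pM// ?exprn_ge0// ltW.
Qed.

Lemma iter_Mr_ge n (g : S -> R) z : (forall x, 0 <= g x) ->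
  c ^+ n * g z <= iter n Mr g (iter n sg z).
Proof.
move=> g0; rewrite (le_trans _ (iter_tr_ge _ _ _ _))//.
by rewrite ler_wpM2r// bprod_ge.
Qed.

(* Doeblin: pairing the branches from x and y that end in a common long
   cylinder gains a fixed proportion of the oscillation. *)
Lemma doeblin : exists m : nat, forall k v l o, 0 <= l -> lip v l -> osc v o ->
  osc (iter (k + m) M v) ((1 - (c ^+ (k + m)) ^+ 2) * o + (c ^+ (k + m)) ^+ 2 * (theta ^+ k * l)).
Proof.
have [m mP] := @exists_preimage R A theta; exists m => k v l o l0 vl vo x y.
set n := (k + m)%N; set e := (c ^+ n) ^+ 2.
have e01 : 0 <= e <= 1.
  by rewrite /e -exprM exprn_ge0 ?(ltW c0)//= exprn_ile1 ?c_le1// ltW.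
have /andP[e0 e1] := e01.
have [w w1 <-] := normc_dual (iter n M v x - iter n M v y).
have [z zx za] := mP k x point; have [z' zy za'] := mP k y point.
rewrite -/n in zx zy.
pose g t := cRe (w * v t).
have gE t : iter n Mr g t = cRe (w * iter n M v t).
  rewrite -[RHS](congr1 (fun h => cRe (h t)) (iter_trZ _ n w v)).
  by rewrite Re_iterM.
rewrite mulrBr ReB -!gE.
have go t t' : g t - g t' <= o.
  rewrite /g -ReB -mulrBr (le_trans (ler_norm _))// (le_trans (normc_Re _))//.
  by rewrite normcM w1 mul1r.
have gl : g z - g z' <= theta ^+ k * l.
  rewrite /g -ReB -mulrBr (le_trans (ler_norm _))// (le_trans (normc_Re _))//.
  rewrite normcM w1 mul1r (le_trans (vl _ _))// mulrC ler_wpM2r//.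
  by apply: d_le_agree => // j jk; rewrite za ?za'// ltnW.
set a := iter n Mr g x; set b := iter n Mr g y.
have [big|small] := leP (theta ^+ k * l) o; last first.
  have : a - b <= o.
    have H t : a <= o + g t.
      have -> : o + g t = iter n Mr (fun=> o + g t) x by rewrite iter_Mr_cst.
      by apply: iter_tr_le => // s; have := go s t; lra.
    rewrite lerBlDr.
    have := @iter_trD R A theta R p n (fun=> o) g; rewrite iter_Mr_cst => /(congr1 (fun h => h y)) <-.
    have -> : a = iter n Mr (fun=> a) y by rewrite iter_Mr_cst.
    exact: iter_tr_le.
  have : e * o <= e * (theta ^+ k * l) by rewrite ler_wpM2l// ltW.
  lra.
(* The function o - g + g t is nonnegative, so its n-th image at x is at least the contribution of
   the single branch through z. Applying the operator at y, in the variable t, and then the branch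
   through z' gives the factor c^(2n). *)
have H1 t : c ^+ n * (o - g z + g t) <= o - a + g t.
  have := @iter_Mr_ge n (fun s => o - g s + g t) z.
  have -> : iter n Mr (fun s => o - g s + g t) (iter n sg z) = o - a + g t.
    have -> : (fun s => o - g s + g t) = (fun s => (o + g t) - g s).
      by apply/funext => s; ring.
    rewrite (@iter_trB R A theta R p n (fun=> o + g t) g) iter_Mr_cst zx -/a; ring.
  by apply => s; have := go s t; lra.
have H2 : c ^+ n * (o - g z + b) <= o - a + b.
  have E q : iter n Mr (fun s => q + g s) y = q + b.
    by rewrite (@iter_trD R A theta R p n (fun=> q) g) iter_Mr_cst.
  have E2 : iter n Mr (fun s => c ^+ n * (o - g z + g s)) y = c ^+ n * (o - g z + b).
    by rewrite iter_trZ E.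
  by rewrite -E2 -E; apply: iter_tr_le.
have H3 : c ^+ n * (o - g z + g z') <= o - g z + b.
  have := @iter_Mr_ge n (fun s => o - g z + g s) z'.
  have -> : iter n Mr (fun s => o - g z + g s) (iter n sg z') = o - g z + b.
    by rewrite (@iter_trD R A theta R p n (fun=> o - g z) g) iter_Mr_cst zy.
  by apply => s; have := go z s; lra.
have : c ^+ n * (c ^+ n * (o - theta ^+ k * l)) <= o - a + b.
  rewrite (le_trans _ H2)// ler_wpM2l ?exprn_ge0 ?(ltW c0)//.
  rewrite (le_trans _ H3)// ler_wpM2l ?exprn_ge0 ?(ltW c0)//; lra.
rewrite mulrA -expr2 -/e; lra.
Qed.

(** The oscillation and a multiple E of it as Lipschitz bound are controlled together: Doeblin
    lowers the oscillation once theta^k E is small, and Lasota-Yorke restores the Lipschitz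
    bound. *)
Theorem gap : exists C r : R, [/\ 0 < C, 0 < r < 1 & forall n v l, 0 <= l -> lip v l ->
  lip (iter n M v) (C * r ^+ n * l)].
Proof.
have [m mP] := doeblin.
(* Large compared with [LY], so that the term [LY] times the oscillation uses only a quarter of the
   admissible Lipschitz bound. *)
pose E := 4 * (1 + LY).
have E4 : 4 <= E by rewrite /E; have := LY_ge0; lra.
have LE : LY <= E / 4 by rewrite /E; lra.
have DLY : D <= LY.
  rewrite /LY ler_pdivlMr ?subr_gt0//.
  have : 0 <= D * theta by rewrite mulr_ge0 ?(ltW th0)// (le_trans _ D1).
  lra.
have [k kP] : exists k, theta ^+ k * E <= 1 / 2.
  have : (theta ^+ n * E) @[n --> \oo] --> 0 * E.
    by apply: cvgMr_tmp; apply: cvg_expr; rewrite ger0_norm ?ltW.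
  rewrite mul0r => /cvgr0_norm_le /(_ (1/2)) H.
  have [|k _ kP] := H; first by lra.
  by exists k; rewrite (le_trans (ler_norm _))//; apply: (kP k) => /=.
pose n := (k + m).+1; pose e := (c ^+ (k.+1 + m)) ^+ 2.
have e01 : 0 < e <= 1.
  by rewrite /e -exprM exprn_gt0//= exprn_ile1 ?c_le1// ltW.
have /andP[e0 e1] := e01.
pose N v s := osc v s /\ lip v (E * s).
have [||||v s s0 [vo vl]|v s s0 [vo vl]|C [r [C0 r01 H]]] :=
  @iterate_decay R _ M N n 2 (1 - e / 2).
- move=> v s t st [vo vl]; split; first by move=> x y; rewrite (le_trans (vo x y)).
  by apply: lip_le vl; rewrite // ler_wpM2l//; lra.
- by lra.
- by [].
- by lra.
- split; first by move=> x y; rewrite (le_trans (osc_M vo x y))//; lra.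
  have Es0 : 0 <= E * s by rewrite mulr_ge0//; lra.
  have := lip_M Es0 vl vo; apply: lip_le => //.
  rewrite (_ : E * (2 * s) = (2 * E) * s); last by ring.
  rewrite (_ : _ + _ = (theta * E + D) * s); last by ring.
  rewrite ler_wpM2r//.
  have : theta * E <= E by rewrite ler_piMl ?(ltW th1)//; lra.
  by lra.
- have Es0 : 0 <= E * s by rewrite mulr_ge0//; lra.
  have tk : theta ^+ k.+1 * (E * s) <= s / 2.
    rewrite (_ : s / 2 = s * (1 / 2)); last by field.
    rewrite mulrA mulrC ler_wpM2l// (le_trans _ kP)//= ler_wpM2r//; first lra.
    by rewrite ler_wiXn2l ?(ltW th0) ?(ltW th1).
  split.
    move=> x y; rewrite (le_trans (mP k.+1 v _ _ Es0 vl vo x y))// -/e.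
    have : e * (theta ^+ k.+1 * (E * s)) <= e * (s / 2) by rewrite ler_wpM2l// ltW.
    lra.
  have := lip_iterM n Es0 vl vo; apply: lip_le => //.
  have : theta ^+ n * (E * s) <= s / 2.
    by apply: le_trans tk; rewrite ler_wpM2r// ler_wiXn2l ?(ltW th0) ?(ltW th1)// /n ltnS leq_addr.
  have : LY * s <= E / 4 * s by rewrite ler_wpM2r.
  have : 4 * s <= E * s by rewrite ler_wpM2r.
  have : E * s * (e / 2) <= E * s * (1 / 2) by rewrite ler_wpM2l//; lra.
  lra.
exists (C * E), r; split => //; first by rewrite mulr_gt0//; lra.
move=> q v l l0 vl; have [|_] := H q v l l0.
  split; first exact: lip_osc.
  by apply: lip_le vl => //; rewrite ler_peMl//; lra.
by have -> : E * (C * r ^+ q * l) = C * E * r ^+ q * l by ring.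
Qed.

(** The integral of v against the invariant measure of the g-function, obtained as the constant to
    which the iterates of M converge geometrically; the default 0 is taken by functions without such
    convergence. *)
Definition mu v : R[i] := xget 0 [set l | exists C r : R, [/\ 0 <= C, 0 <= r < 1 &
  forall n x, normc (iter n M v x - l) <= C * r ^+ n]].

Lemma mu_unique v l (C r : R) : 0 <= C -> 0 <= r < 1 ->
  (forall n x, normc (iter n M v x - l) <= C * r ^+ n) -> mu v = l.
Proof.
move=> C0 r01 H; rewrite /mu; case: xgetP => [l' _|/(_ l)]; last first.
  by case; exists C, r.
move=> [C' [r' [C'0 r'01 H']]].
have : normc (l' - l) <= 0.
  have /andP[r0 r1] := r01; have /andP[r'0 r'1] := r'01.
  pose s := Num.max r r'.
  have s01 : 0 <= s < 1 by rewrite /s le_max r0 gt_max r1 r'1.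
  apply: (@geom_le0 R _ (C + C') s) => // n.
  rewrite (le_trans (normc_dist _ (iter n M v point) _))// mulrDl addrC lerD//.
    by rewrite (le_trans (H _ _))// ler_wpM2l// lerXn2r ?nnegrE// /s le_max ?lexx ?r0.
  rewrite normc_subC (le_trans (H' _ _))// ler_wpM2l// lerXn2r ?nnegrE// /s le_max ?lexx ?r0 ?orbT//.
move=> ll; apply/eqP; rewrite -subr_eq0; apply/eqP/normc_eq0/eqP.
by rewrite eq_le ll normc_ge0.
Qed.

Lemma mu_gap : exists C r : R, [/\ 0 < C, 0 < r < 1, (forall n v l, 0 <= l -> lip v l ->
  lip (iter n M v) (C * r ^+ n * l)) &
  forall n v l x, 0 <= l -> lip v l -> normc (iter n M v x - mu v) <= C * r ^+ n * l].
Proof.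
have [C [r [C0 r01 H]]] := gap.
have /andP[r0 r1] := r01.
have r01' : 0 <= r < 1 by rewrite r1 ltW.
have r1' : 0 < 1 - r by rewrite subr_gt0.
pose C' := C * (1 + 2 / (1 - r)).
have CC' : C <= C'.
  by rewrite /C' ler_peMr ?(ltW C0)// lerDl divr_ge0 ?(ltW r1').
exists C', r; split => //; first exact: lt_le_trans CC'.
  move=> n v l l0 vl; apply: lip_le (H n v l l0 vl) => //.
  by rewrite ler_wpM2r// ler_wpM2r// exprn_ge0// ltW.
move=> n v l x l0 vl.
have oscn k : osc (iter k M v) (C * l * r ^+ k).
  rewrite mulrAC; apply: lip_osc => //; last exact: H.
  by rewrite mulr_ge0// mulr_ge0 ?exprn_ge0 ?(ltW C0) ?(ltW r0).
pose x0 : S := point.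
have [||k|a aP] := @geometric_cauchy R (fun k => iter k M v x0) (C * l) r => //.
- by rewrite mulr_ge0// ltW.
- by rewrite iterS M_sub; apply: normc_M => t; exact: oscn.
have aP' k y : normc (iter k M v y - a) <= C' * l * r ^+ k.
  rewrite (le_trans (normc_dist _ (iter k M v x0) _))//.
  rewrite (le_trans (lerD (oscn k _ _) (aP k)))// /C' le_eqVlt; apply/orP; left.
  by apply/eqP; field; rewrite gt_eqF.
rewrite mulrAC (@mu_unique v a (C' * l) r)// mulr_ge0//.
by rewrite (le_trans (ltW C0)).
Qed.


Lemma mu_cst (a : R[i]) : mu (fun=> a) = a.
Proof.
apply: (@mu_unique _ _ 0 0) => //; first by rewrite lexx ltr01.
by move=> n x; rewrite iter_M_cst subrr normc0 mul0r.
Qed.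

Lemma mu_tends v l : 0 <= l -> lip v l -> exists C r : R, [/\ 0 <= C, 0 <= r < 1 &
  forall n x, normc (iter n M v x - mu v) <= C * r ^+ n].
Proof.
move=> l0 vl; have [C [r [C0 /andP[r0 r1] _ H]]] := mu_gap.
exists (C * l), r; split; first by rewrite mulr_ge0// ltW.
  by rewrite (ltW r0).
by move=> n x; rewrite mulrAC; exact: H.
Qed.

Lemma muD u v a b : 0 <= a -> lip u a -> 0 <= b -> lip v b ->
  mu (fun x => u x + v x) = mu u + mu v.
Proof.
move=> a0 ua b0 vb; have [C [r [C0 /andP[r0 r1] _ H]]] := mu_gap.
apply: (@mu_unique _ _ (C * a + C * b) r) => [||n x].
- by rewrite addr_ge0// mulr_ge0// ltW.
- by rewrite (ltW r0).
- rewrite iter_trD opprD addrACA (le_trans (normcD _ _))// mulrDl.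
  by rewrite lerD// mulrAC H.
Qed.

Lemma muZ (a : R[i]) v b : 0 <= b -> lip v b -> mu (fun x => a * v x) = a * mu v.
Proof.
move=> b0 vb; have [C [r [C0 /andP[r0 r1] _ H]]] := mu_gap.
apply: (@mu_unique _ _ (normc a * (C * b)) r) => [||n x].
- by rewrite !mulr_ge0 ?normc_ge0// ltW.
- by rewrite (ltW r0).
- by rewrite iter_trZ -mulrBr normcM -mulrA ler_wpM2l ?normc_ge0// mulrAC H.
Qed.

Lemma muB u v a b : 0 <= a -> lip u a -> 0 <= b -> lip v b ->
  mu (fun x => u x - v x) = mu u - mu v.
Proof.
move=> a0 ua b0 vb.
have vb' : lip (fun x => (-1) * v x) b.
  by have := lipZ (-1) vb; rewrite normcN normc1 mul1r.
transitivity (mu (fun x => u x + (-1) * v x)).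
  by congr mu; apply/funext => x; rewrite mulN1r.
by rewrite (muD a0 ua b0 vb') (muZ _ b0 vb) mulN1r.
Qed.

Lemma mu_M v l : 0 <= l -> lip v l -> mu (M v) = mu v.
Proof.
move=> l0 vl; have [C [r [C0 r01 H]]] := mu_tends l0 vl.
have /andP[r0 r1] := r01.
apply: (@mu_unique _ _ C r) => // n x.
rewrite -iterSr (le_trans (H _ _))// ler_wpM2l// ler_wiXn2l//; exact: ltW.
Qed.

Lemma lip_shift v l : 0 <= l -> lip v l -> lip (fun x => v (sg x)) (l / theta).
Proof.
move=> l0 vl x y; rewrite (le_trans (vl _ _))// -mulrA ler_wpM2l// ler_pdivlMl//.
have [xy|xy] := eqVneq (val x 0%N) (val y 0%N).
  rewrite -{2}(scons_shift x) -{2}(scons_shift y) -xy d_scons ?adm_shift//.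
  by rewrite xy adm_shift.
rewrite [leRHS]d_head// (le_trans (ler_piMr _ _))// ?d_le1//; exact: ltW.
Qed.

(** Shift invariance: M undoes the composition with the shift and [mu] does not see M. *)
Lemma mu_shift v l : 0 <= l -> lip v l -> mu (fun x => v (sg x)) = mu v.
Proof.
move=> l0 vl; have vl' := lip_shift l0 vl.
rewrite -(mu_M (divr_ge0 l0 (ltW th0)) vl'); congr mu.
have -> : (fun x => v (sg x)) = (fun x => v (sg x) * 1).
  by apply/funext => x; rewrite mulr1.
by rewrite tr_mul_shift M_cst; apply/funext => x; rewrite mulr1.
Qed.

Lemma mu_bound v a l : 0 <= l -> lip v l -> bdd v a -> normc (mu v) <= a.
Proof.
move=> l0 vl va; have [C [r [C0 r01 H]]] := mu_tends l0 vl.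
rewrite -subr_le0; apply: (@geom_le0 _ _ C r r01) => n.
rewrite lerBlDr -[mu v](subrK (iter n M v point)).
rewrite (le_trans (normcD _ _))// lerD// 1?normc_subC ?H//.
by elim: n point => //= n IH x; apply: normc_M.
Qed.

Lemma mu_osc v l x : 0 <= l -> lip v l -> normc (v x - mu v) <= l.
Proof.
move=> l0 vl; have := @mu_bound (fun y => v x - v y) l l l0.
have vl' : lip (fun y => v x - v y) l.
  by have := lipB (lip_cst (v x)) vl; rewrite add0r.
rewrite (muB (lexx 0) (lip_cst (v x)) l0 vl) mu_cst; apply => //.
by move=> y; apply: lip_osc.
Qed.

Lemma mu_real v l : 0 <= l -> lip v l -> (forall x, cIm (v x) = 0) ->
  cIm (mu v) = 0.
Proof.
move=> l0 vl vr; have [C [r [C0 r01 H]]] := mu_tends l0 vl.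
have vn n x : cIm (iter n M v x) = 0.
  elim: n x => //= n IH x; rewrite Im_M.
  by rewrite /tr big1// => i _; rewrite IH mulr0.
apply/eqP; rewrite -normr_le0; apply: (@geom_le0 _ _ C r r01) => n.
rewrite -normrN -[- _]add0r -(vn n point) -ImB.
exact: le_trans (normc_Im _) (H _ _).
Qed.

Lemma mu_ge0 v l : 0 <= l -> lip v l -> (forall x, 0 <= cRe (v x)) ->
  0 <= cRe (mu v).
Proof.
move=> l0 vl vr; have [C [r [C0 r01 H]]] := mu_tends l0 vl.
rewrite -oppr_le0; apply: (@geom_le0 _ _ C r r01) => n.
rewrite -[leLHS]addr0.
have h : 0 <= cRe (iter n M v point).
  by rewrite Re_iterM; apply: iter_tr_ge0.
rewrite (@le_trans _ _ (cRe (iter n M v point - mu v)))//.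
  by rewrite ReB; lra.
exact: le_trans (le_trans (ler_norm _) (normc_Re _)) (H _ _).
Qed.

End normalized.

(** * Perturbed operators near zero frequency *)

Section perturbation.
Context {R : realType} {A : aperiodic_matrix} {theta : R}.
Local Notation S := (shift_space A theta).
Implicit Types (x y : S) (u v : S -> R[i]) (a b : R) (z : R[i]).
Variables (p : @nweight R A theta) (f : S -> R) (B : R).
Hypothesis B1 : 1 <= B.
Hypothesis f_lip : lip (cplx f) B.
Hypothesis f_bdd : bdd (cplx f) B.
Let th01 := nw_th p.
Local Notation D := (nw_D p).
Local Notation M := (tr (fun x => (p x)%:C)).

Definition nb v a := bdd v a /\ lip v a.

Let B0 : 0 <= B. Proof. exact: le_trans B1. Qed.
Let D1 := nw_D1 p.
Let D0 : 0 <= D. Proof. exact: le_trans (nw_D1 p). Qed.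

Lemma nb_ge0 v a : nb v a -> 0 <= a.
Proof. by move=> [va _]; exact: le_trans (normc_ge0 _) (va point). Qed.

Lemma nbD u v a b : nb u a -> nb v b -> nb (fun x => u x + v x) (a + b).
Proof. by move=> [ua ul] [va vl]; split; [exact: bddD|exact: lipD]. Qed.

Lemma nbM u v a b : nb u a -> nb v b -> nb (fun x => u x * v x) (2 * (a * b)).
Proof.
move=> ua vb; have a0 := nb_ge0 ua; have b0 := nb_ge0 vb.
case: ua vb => [ua ul] [va vl]; split.
  by apply: bdd_le (bddM ua va); rewrite ler_peMl ?mulr_ge0//; lra.
by apply: lip_le (lipM ua ul va vl) => //; rewrite mulr_natl mulr2n.
Qed.

Lemma nbZ (c : R[i]) v a : nb v a -> nb (fun x => c * v x) (normc c * a).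
Proof. by move=> [va vl]; split; [exact: bddZ|exact: lipZ]. Qed.

Lemma nb_M v a : nb v a -> nb (M v) (3 * D * a).
Proof.
move=> va; have a0 := nb_ge0 va; case: va => va vl; split.
  move=> x; rewrite (le_trans (normc_M p x va))// ler_peMl//; have := D1; lra.
have ov : osc v (2 * a).
  by move=> x y; rewrite (le_trans (normcB _ _))// mulr_natl mulr2n lerD.
have := lip_M p a0 vl ov; apply: lip_le => //.
have /andP[t0 t1] := th01.
have : theta * a <= 1 * a by rewrite ler_wpM2r// ltW.
have : 1 * a <= D * a by rewrite ler_wpM2r.
lra.
Qed.

Lemma nb_mu v a : nb v a -> normc (mu p v) <= a.
Proof. by move=> va; exact: (mu_bound p (nb_ge0 va) va.2 va.1). Qed.

Definition pw z : S -> R[i] := fun x => (p x)%:C * cexp (z * (f x)%:C).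

Lemma tr_pw z v : tr (pw z) v = M (fun x => cexp (z * (f x)%:C) * v x).
Proof. by apply/funext => x; apply: eq_bigr => i _; rewrite /pw mulrA. Qed.

Lemma zf_bound z x : normc z <= 1 -> normc (z * (f x)%:C) <= B.
Proof.
move=> z1; rewrite normcM -[leRHS]mul1r ler_pM ?normc_ge0//; exact: f_bdd.
Qed.

Lemma zf_bound' z x : normc (z * (f x)%:C) <= normc z * B.
Proof. by rewrite normcM ler_wpM2l ?normc_ge0//; exact: f_bdd. Qed.

Lemma zf_dist z x y : normc z <= 1 ->
  normc (z * (f x)%:C - z * (f y)%:C) <= normc z * B * dtheta x y /\
  normc (z * (f x)%:C - z * (f y)%:C) <= B.
Proof.
move=> z1; have H : normc (z * (f x)%:C - z * (f y)%:C) <= normc z * B * dtheta x y.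
  by rewrite -mulrBr normcM -mulrA ler_wpM2l ?normc_ge0//; exact: f_lip.
split => //; rewrite (le_trans H)// (@le_trans _ _ (1 * B * 1)) ?mulr1 ?mul1r//.
by rewrite -[leRHS]mulr1 ler_pM ?mulr_ge0 ?normc_ge0 ?d_le1 ?d_ge0// -[leRHS]mul1r ler_wpM2r.
Qed.

Definition C1 := B * expR (2 * B).
Definition C2 := 2 * B ^+ 2 * expR (2 * B).

Lemma nb_e1 z : normc z <= 1 -> nb (fun x => cexp (z * (f x)%:C) - 1) (C1 * normc z).
Proof.
move=> z1; have E1 : expR B <= expR (2 * B) by rewrite ler_expR ler_peMl// ler1n.
split.
  move=> x; rewrite (le_trans (cexp_taylor1 _))// /C1.
  rewrite (_ : B * _ * _ = (normc z * B) * expR (2 * B)); last by ring.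
  rewrite ler_pM ?normc_ge0 ?expR_ge0 ?zf_bound'//.
  by rewrite (le_trans _ E1)// ler_expR zf_bound.
move=> x y; set a := z * (f x)%:C; set b := z * (f y)%:C.
have [ab ab'] := zf_dist x y z1.
rewrite (_ : _ - _ - _ = cexp b * (cexp (a - b) - 1)); last first.
  have -> : cexp a = cexp b * cexp (a - b) by rewrite -cexpD addrC subrK.
  by ring.
rewrite normcM (le_trans (ler_pM _ _ (normc_cexp_le _) (cexp_taylor1 _))) ?normc_ge0//.
rewrite (_ : C1 * _ * _ = expR B * ((normc z * B * dtheta x y) * expR B)); last first.
  by rewrite /C1 mulr_natl mulr2n expRD; ring.
rewrite ler_pM ?expR_ge0 ?mulr_ge0 ?normc_ge0 ?expR_ge0 ?ler_expR ?zf_bound//.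
by rewrite ler_pM ?expR_ge0 ?normc_ge0 ?ler_expR.
Qed.

Lemma nb_e2 z : normc z <= 1 ->
  nb (fun x => cexp (z * (f x)%:C) - 1 - z * (f x)%:C) (C2 * normc z ^+ 2).
Proof.
move=> z1; have E1 : expR B <= expR (2 * B) by rewrite ler_expR ler_peMl// ler1n.
split.
  move=> x; rewrite (le_trans (cexp_taylor2 _))// /C2.
  rewrite (@le_trans _ _ ((normc z * B) ^+ 2 * expR (2 * B)))//.
    rewrite ler_pM ?exprn_ge0 ?normc_ge0 ?expR_ge0//.
      by rewrite lerXn2r ?nnegrE ?mulr_ge0 ?normc_ge0 ?zf_bound'.
    by rewrite (le_trans _ E1)// ler_expR zf_bound.
  rewrite exprMn (_ : 2 * _ * _ * _ = 2 * (normc z ^+ 2 * B ^+ 2 * expR (2 * B))); last by ring.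
  apply: ler_peMl; last by rewrite ler1n.
  by rewrite !mulr_ge0 ?exprn_ge0 ?normc_ge0 ?expR_ge0.
move=> x y; set a := z * (f x)%:C; set b := z * (f y)%:C.
have [ab ab'] := zf_dist x y z1.
rewrite (_ : _ - (_ - b) = cexp b * (cexp (a - b) - 1 - (a - b)) + (a - b) * (cexp b - 1)); last first.
  have -> : cexp a = cexp b * cexp (a - b) by rewrite -cexpD addrC subrK.
  by ring.
have d0 := d_ge0 th01 x y; have d1 := d_le1 th01 x y.
rewrite (le_trans (normcD _ _))// !normcM.
have -> : C2 * normc z ^+ 2 * dtheta x y = B ^+ 2 * normc z ^+ 2 * dtheta x y * expR (2 * B)
  + B ^+ 2 * normc z ^+ 2 * dtheta x y * expR (2 * B) by rewrite /C2; ring.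
have z0 := normc_ge0 z.
apply: lerD.
  rewrite (_ : B ^+ 2 * _ * _ * _ = expR B * (B ^+ 2 * normc z ^+ 2 * dtheta x y * expR B)); last first.
    by rewrite mulr_natl mulr2n expRD; ring.
  rewrite ler_pM ?normc_ge0//.
    by rewrite (le_trans (normc_cexp_le _))// ler_expR zf_bound.
  rewrite (le_trans (cexp_taylor2 _))// ler_pM ?exprn_ge0 ?normc_ge0 ?expR_ge0 ?ler_expR//.
  rewrite (@le_trans _ _ ((normc z * B * dtheta x y) ^+ 2))//.
    by rewrite lerXn2r ?nnegrE ?mulr_ge0 ?normc_ge0.
  rewrite !exprMn [normc z ^+ 2 * _]mulrC ler_wpM2l ?mulr_ge0 ?exprn_ge0//.
  by rewrite expr2 ler_piMr.
rewrite (_ : B ^+ 2 * _ * _ * _ = (normc z * B * dtheta x y) * (normc z * B * expR (2 * B))); last by ring.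
rewrite ler_pM ?normc_ge0// (le_trans (cexp_taylor1 _))//.
rewrite ler_pM ?normc_ge0 ?expR_ge0 ?zf_bound'//.
by rewrite (le_trans _ E1)// ler_expR zf_bound.
Qed.

Variables (Cg r : R).
Hypothesis Cg0 : 0 < Cg.
Hypothesis r01 : 0 < r < 1.
Hypothesis Hgap : forall n v l, 0 <= l -> lip v l -> lip (iter n M v) (Cg * r ^+ n * l).

Let r0 : 0 < r. Proof. by case/andP: r01. Qed.
Let r1 : r < 1. Proof. by case/andP: r01. Qed.

(* A norm modulo constants, equivalent to the Lipschitz one, that M contracts
   by the factor r in a single step. *)
Definition gapn v b := forall n, lip (iter n M v) (r ^+ n * b).

Lemma gapn_lip v b : gapn v b -> lip v b.
Proof. by move=> /(_ 0%N); rewrite mul1r. Qed.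

Lemma lip_gapn v l : 0 <= l -> lip v l -> gapn v (Cg * l).
Proof. by move=> l0 vl n; have := Hgap n l0 vl; rewrite mulrAC mulrC. Qed.

Lemma gapn_le v a b : a <= b -> gapn v a -> gapn v b.
Proof.
move=> ab va n; apply: lip_le (va n) => //.
by rewrite ler_wpM2l// exprn_ge0// ltW.
Qed.

Lemma gapnM v b : gapn v b -> gapn (M v) (r * b).
Proof. by move=> vb n; rewrite -iterSr mulrA -exprSr; exact: vb. Qed.

Lemma gapnD u v a b : gapn u a -> gapn v b -> gapn (fun x => u x + v x) (a + b).
Proof. by move=> ua vb n; rewrite iter_trD mulrDr; exact: lipD. Qed.

Lemma gapnZ (c : R[i]) v b : gapn v b -> gapn (fun x => c * v x) (normc c * b).
Proof. by move=> vb n; rewrite iter_trZ mulrCA; exact: lipZ. Qed.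

Lemma gapn_cst (c : R[i]) : gapn (fun=> c) 0.
Proof. by move=> n; rewrite iter_M_cst mulr0; exact: lip_cst. Qed.

Lemma gapn_nb v b : 0 <= b -> gapn v b -> mu p v = 0 -> nb v b.
Proof.
move=> b0 vb v0; have vl := gapn_lip vb; split => // x.
by have := mu_osc p x b0 vl; rewrite v0 subr0.
Qed.

Lemma gapn_closed (v : nat -> S -> R[i]) h b (C s : R) : 0 <= s < 1 ->
  (forall n, gapn (v n) b) -> (forall n x, normc (v n x - h x) <= C * s ^+ n) ->
  gapn h b.
Proof.
move=> s01 vb vh m x y.
have H n t : normc (iter m M (v n) t - iter m M h t) <= C * s ^+ n.
  have -> : iter m M (v n) t - iter m M h t = iter m M (fun x => v n x - h x) t.
    by rewrite iter_trB.
  by elim: m t => //= k IH t; apply: (normc_M p).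
rewrite -subr_le0; apply: (@geom_le0 _ _ (C + C) s s01) => n.
rewrite lerBlDr.
rewrite (_ : iter m M h x - _ = (iter m M h x - iter m M (v n) x) +
  (iter m M (v n) x - iter m M (v n) y) + (iter m M (v n) y - iter m M h y)); last by ring.
rewrite (le_trans (normcD _ _))//.
have := normcD (iter m M h x - iter m M (v n) x) (iter m M (v n) x - iter m M (v n) y).
have := H n x; rewrite normc_subC; have := H n y; have := vb n m x y.
rewrite mulrDl; lra.
Qed.

Definition C4 := Cg * (3 * D * (2 * C1)).

Lemma C4_ge0 : 0 <= C4.
Proof.
rewrite /C4 mulr_ge0 ?(ltW Cg0)// mulr_ge0 ?(mulr_ge0 _ D0)// mulr_ge0// /C1.
by rewrite mulr_ge0 ?expR_ge0.
Qed.

(** The perturbation M_z - M of the operator (see [tr_pwE]); it is of order z in the Lipschitz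
    norm. *)
Definition Ez z v := M (fun x => (cexp (z * (f x)%:C) - 1) * v x).

Lemma tr_pwE z v x : tr (pw z) v x = M v x + Ez z v x.
Proof.
rewrite tr_pw /Ez -[RHS](congr1 (fun h => h x) (trD _ _ _)).
by congr (tr _ _ x); apply/funext => t; ring.
Qed.

Lemma nb_Ez z v a : normc z <= 1 -> nb v a ->
  nb (Ez z v) (3 * D * (2 * C1) * (normc z * a)).
Proof.
move=> z1 va; have := nb_M (nbM (nb_e1 z1) va); congr nb; ring.
Qed.

Lemma gapn_Ez z v a : normc z <= 1 -> nb v a -> gapn (Ez z v) (C4 * (normc z * a)).
Proof.
move=> z1 va; have e := nb_Ez z1 va.
have := lip_gapn (nb_ge0 e) e.2; congr gapn; rewrite /C4; ring.
Qed.

Lemma mu_Ez z v a : normc z <= 1 -> nb v a ->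
  normc (mu p (Ez z v)) <= 2 * C1 * (normc z * a).
Proof.
move=> z1 va; have n := nbM (nb_e1 z1) va.
rewrite (mu_M p (nb_ge0 n) n.2).
by rewrite (le_trans (nb_mu n))//; apply: le_of_eq; ring.
Qed.

Lemma tr_pw_bdd z v a : normc z <= 1 -> bdd v a -> bdd (tr (pw z) v) (expR B * a).
Proof.
move=> z1 va x; rewrite tr_pw; apply: (normc_M p) => y; rewrite normcM.
rewrite ler_pM ?normc_ge0// (le_trans (normc_cexp_le _))// ler_expR.
exact: zf_bound.
Qed.


Lemma C1_ge0 : 0 <= C1. Proof. by rewrite /C1 mulr_ge0 ?expR_ge0. Qed.

Definition K4 := C4 + 2 * C1.

Lemma K4_ge0 : 0 <= K4.
Proof. by rewrite /K4 addr_ge0 ?C4_ge0// mulr_ge0 ?C1_ge0. Qed.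

Local Notation fc := (cplx f).

Lemma nb_fc : nb fc B. Proof. by []. Qed.

Lemma gapnB u v a b : gapn u a -> gapn v b -> gapn (fun x => u x - v x) (a + b).
Proof.
move=> ua vb; have := gapnD ua (gapnZ (-1) vb).
rewrite normcN normc1 mul1r; congr gapn; apply/funext => x; by rewrite mulN1r.
Qed.

(** psi is the sum over j >= 1 of M^j f - mu f. It is the first derivative in z of the normalized
    eigenfunction at 0 and enters the second-order coefficient of the eigenvalue. *)
Lemma poisson : exists (psi : S -> R[i]) (K : R),
  [/\ nb psi K, gapn psi K, mu p psi = 0 & forall x, psi x - M psi x = M fc x - mu p fc].
Proof.
have r1' : 0 < 1 - r by rewrite subr_gt0.
pose b := Cg * B; have b0 : 0 <= b by rewrite /b mulr_ge0// ltW.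
have fb : gapn fc b by apply: lip_gapn.
have fn j : gapn (iter j M fc) (r ^+ j * b).
  elim: j => [|j IH]; first by rewrite mul1r.
  by rewrite iterS exprS -mulrA; exact: gapnM.
have mn j : mu p (iter j M fc) = mu p fc.
  elim: j => // j IH; rewrite iterS (mu_M p _ (gapn_lip (fn j)))//.
  by rewrite mulr_ge0// exprn_ge0// ltW.
pose t j x := iter j.+1 M fc x - mu p fc.
have tg j : gapn (t j) (r ^+ j.+1 * b).
  have := gapnB (fn j.+1) (gapn_cst (mu p fc)); by rewrite addr0.
have rb0 j : 0 <= r ^+ j * b by rewrite mulr_ge0// exprn_ge0// ltW.
have tm j : mu p (t j) = 0.
  rewrite /t (muB p (rb0 j.+1) (gapn_lip (fn j.+1)) (lexx 0) (lip_cst _)).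
  by rewrite mn mu_cst subrr.
have tb j x : normc (t j x) <= b * r ^+ j.
  rewrite (le_trans ((gapn_nb (rb0 _) (tg j) (tm j)).1 x))// mulrC ler_wpM2l//.
  by rewrite exprS ler_piMl ?exprn_ge0 ?(ltW r0) ?(ltW r1).
pose sm n x := \sum_(j < n) t j x.
have smS n : sm n.+1 = (fun x => sm n x + t n x).
  by apply/funext => x; rewrite /sm big_ord_recr.
pose K := b / (1 - r).
have K0 : 0 <= K by rewrite /K divr_ge0// ltW.
have sg n : gapn (sm n) (K * (1 - r ^+ n)).
  elim: n => [|n IH].
    rewrite expr0 subrr mulr0; have := gapn_cst 0; congr gapn.
    by apply/funext => x; rewrite /sm big_ord0.
  rewrite smS; apply: gapn_le (gapnD IH (tg n)).
  have -> : K * (1 - r ^+ n.+1) = K * (1 - r ^+ n) + r ^+ n * b.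
    by rewrite /K exprS; field; rewrite gt_eqF.
  by rewrite lerD2l exprS -mulrA ler_piMl// ltW.
have sgK n : gapn (sm n) K.
  apply: gapn_le (sg n); rewrite ler_piMr// lerBlDr lerDl exprn_ge0// ltW//.
have smu n : mu p (sm n) = 0.
  elim: n => [|n IH].
    rewrite -[RHS](mu_cst p 0); congr mu.
    by apply/funext => x; rewrite /sm big_ord0.
  by rewrite smS (muD p K0 (gapn_lip (sgK n)) (rb0 n.+1) (gapn_lip (tg n))) IH tm addr0.
have r01' : 0 <= r < 1 by rewrite r1 ltW.
have /choice[psi psiP] : forall x, exists l, forall n, normc (sm n x - l) <= 2 * b / (1 - r) * r ^+ n.
  move=> x; apply: geometric_cauchy => // n.
  by rewrite smS addrC addKr.
set C := 2 * b / (1 - r) in psiP.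
have C0 : 0 <= C by rewrite /C divr_ge0 ?(ltW r1')// mulr_ge0.
have pg : gapn psi K := gapn_closed r01' sgK (fun n x => psiP x n).
have pm : mu p psi = 0.
  apply/normc_eq0/eqP; rewrite eq_le normc_ge0 andbT.
  apply: (@geom_le0 _ _ C r) => // n.
  rewrite -[mu p psi]subr0 -(smu n) -(muB p K0 (gapn_lip pg) K0 (gapn_lip (sgK n))).
  apply: (mu_bound p _ (lipB (gapn_lip pg) (gapn_lip (sgK n)))); first by rewrite addr_ge0.
  by move=> x; rewrite normc_subC.
exists psi, K; split => //; first exact: gapn_nb.
move=> x; apply/eqP; rewrite -subr_eq0; apply/eqP/normc_eq0/eqP.
rewrite eq_le normc_ge0 andbT; apply: (@geom_le0 _ _ (C + C + b) r) => // n.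
have tM j y : M (t j) y = t j.+1 y.
  by rewrite /t -M_sub -iterS.
have sM : sm n x - M (sm n) x = t 0%N x - t n x.
  have : forall y, M (sm n) y = sm n y + t n y - t 0%N y.
    elim: n => [|n IH] y.
      rewrite /sm big_ord0 add0r subrr /tr big1// => i _; by rewrite big_ord0 mulr0.
    rewrite smS trD IH tM; ring.
  by move=> ->; ring.
rewrite (_ : _ - _ = - (sm n x - psi x) + (M (sm n) x - M psi x) - t n x); last first.
  have -> : M fc x - mu p fc = t 0%N x by [].
  by rewrite -(subrK (sm n x - M (sm n) x) (t 0%N x)) {1}sM; ring.
rewrite (le_trans (normcB _ _))// mulrDl lerD//.
rewrite (le_trans (normcD _ _))// mulrDl lerD//; first by rewrite normcN.
have -> : M (sm n) x - M psi x = M (fun y => sm n y - psi y) x by rewrite trB.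
by apply: (normc_M p) => y.
Qed.

(** For the perturbed eigenfunction h, [K5] bounds h - 1 to order z, [K6] the part of (e^(z f) - 1)
    h beyond z f to order z^2, [K7] the difference h - 1 - z psi to order z^2, and [K8] the
    remainder of the eigenvalue to order z^3. *)
Definition K5 := 8 / (1 - r) * K4.
Definition K6 := 4 * C2 + 2 * B * K5.
Definition K7 := (2 * K4 * K5 + Cg * K6) / (1 - r).
Definition K8 := B ^+ 3 * expR B + (2 * C2 * K5 + 2 * B * K7).

Variable z : R[i].
Hypothesis z1 : normc z <= 1.
Let e := K4 * normc z.
Hypothesis e_small : e <= (1 - r) / 8.
Let s := (1 + r) / 2.
Let Kb := 8 / (1 - r) * e.
Local Notation Mz := (tr (pw z)).

Let e0 : 0 <= e. Proof. by rewrite /e mulr_ge0 ?K4_ge0 ?normc_ge0. Qed.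
Let r1' : 0 < 1 - r. Proof. by rewrite subr_gt0. Qed.
Let s01 : 0 < s < 1.
Proof. by have r0' := r0; have r1'' := r1; rewrite /s; apply/andP; split; lra. Qed.
Let Kb0 : 0 <= Kb. Proof. by rewrite /Kb mulr_ge0 ?divr_ge0 ?(ltW r1'). Qed.
Let Kb1 : Kb <= 1.
Proof.
by rewrite /Kb -ler_pdivlMl ?divr_gt0// mulr1 invf_div.
Qed.
Let e2 : 1 - 2 * e > 0.
Proof. by have := r0; have := e_small; lra. Qed.
Let Kb_step : r * Kb + 2 * e <= Kb * (1 - 2 * e).
Proof.
rewrite /Kb; have : 8 / (1 - r) * e * (1 - r) = 8 * e by field; rewrite gt_eqF.
have : Kb * e <= 1 * e by rewrite ler_wpM2r.
rewrite /Kb => H1 H2.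
have := e0; lra.
Qed.
Let s_step : r + 2 * e <= s * (1 - 2 * e).
Proof.
have : s * e <= 1 * e by rewrite ler_wpM2r// /s; have := r1; lra.
have := e_small; rewrite /s => H1 H2; lra.
Qed.

Lemma gapn_E v a : nb v a -> gapn (Ez z v) (e * a).
Proof.
move=> va; apply: gapn_le (gapn_Ez z1 va).
rewrite mulrA ler_wpM2r ?(nb_ge0 va)// /e ler_wpM2r ?normc_ge0// /K4 lerDl.
by rewrite mulr_ge0 ?C1_ge0.
Qed.

Lemma mu_E v a : nb v a -> normc (mu p (Ez z v)) <= e * a.
Proof.
move=> va; rewrite (le_trans (mu_Ez z1 va))//.
rewrite mulrA ler_wpM2r ?(nb_ge0 va)// /e ler_wpM2r ?normc_ge0// /K4 lerDr.
exact: C4_ge0.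
Qed.

Lemma trpE v : Mz v = (fun x => M v x + Ez z v x).
Proof. by apply/funext => x; exact: tr_pwE. Qed.

Lemma mu_Mz v a : nb v a -> mu p (Mz v) = mu p v + mu p (Ez z v).
Proof.
move=> va; have n1 := nb_M va; have n2 := nb_Ez z1 va.
rewrite trpE (muD p (nb_ge0 n1) n1.2 (nb_ge0 n2) n2.2).
by rewrite (mu_M p (nb_ge0 va) va.2).
Qed.

Lemma gapn_Mz0 w b : 0 <= b -> gapn w b -> mu p w = 0 ->
  gapn (Mz w) ((r + e) * b).
Proof.
move=> b0 wb w0; rewrite trpE mulrDl; apply: gapnD; first exact: gapnM.
by apply: gapn_E; exact: gapn_nb.
Qed.

Lemma gapn_nb1 v : gapn v Kb -> mu p v = 1 -> nb v 2.
Proof.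
move=> vb v1; have vl := gapn_lip vb; split; last by apply: lip_le vl => //; have := Kb1; lra.
move=> x; have := mu_osc p x Kb0 vl; rewrite v1 => H.
rewrite -[v x](subrK 1) (le_trans (normcD _ _))// normc1; have := Kb1; lra.
Qed.

Lemma normc_near1 (l : R[i]) : normc (l - 1) <= 2 * e -> 1 - 2 * e <= normc l.
Proof.
move=> H; have := normcD l (1 - l); rewrite [l + _]addrC subrK normc1 (normc_subC 1); lra.
Qed.

(** The ball of radius [Kb] around 1 in the hyperplane mu v = 1 is invariant under the operator
    renormalized by mu: M contracts it by r, the perturbation moves it by 2 e, and the normalizing
    factor is at least 1 - 2 e. *)
Lemma eigen_step v : gapn v Kb -> mu p v = 1 ->
  [/\ normc (mu p (Mz v) - 1) <= 2 * e, mu p (Mz v) != 0,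
   gapn (fun x => (mu p (Mz v))^-1 * Mz v x) Kb &
   mu p (fun x => (mu p (Mz v))^-1 * Mz v x) = 1].
Proof.
move=> vb v1; have v2 := gapn_nb1 vb v1.
have lE := mu_Mz v2; set l := mu p (Mz v) in lE *.
have l1 : normc (l - 1) <= 2 * e.
  by rewrite lE v1 addrC addKr mulrC; exact: mu_E.
have l2 := normc_near1 l1.
have nl0 : 0 < normc l by exact: lt_le_trans e2 l2.
have l0 : l != 0 by apply/eqP => l0; rewrite l0 normc0 ltxx in nl0.
have g : gapn (Mz v) (r * Kb + 2 * e).
  by rewrite trpE; apply: gapnD; [exact: gapnM|rewrite mulrC; exact: gapn_E].
split => //.
  apply: gapn_le (gapnZ _ g); rewrite normcV ler_pdivrMl// (le_trans Kb_step)//.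
  by rewrite mulrC ler_wpM2r.
rewrite (muZ p _ _ (gapn_lip g)) ?mulVf//.
exact: addr_ge0 (mulr_ge0 (ltW r0) Kb0) (mulr_ge0 (ler0n _ 2) e0).
Qed.

(** Power iteration from the constant 1, renormalized at each step to keep mu equal to 1. *)
Definition vs := fix vs n : S -> R[i] := if n is n'.+1 then
  fun x => (mu p (Mz (vs n')))^-1 * Mz (vs n') x else fun=> 1.

Lemma vsS n x : vs n.+1 x = (mu p (Mz (vs n)))^-1 * Mz (vs n) x. Proof. by []. Qed.

Lemma vsP n : gapn (vs n) Kb /\ mu p (vs n) = 1.
Proof.
elim: n => [|n [IH1 IH2]]; last by have [_ _ ? ?] := eigen_step IH1 IH2.
split; last exact: mu_cst.
by apply: gapn_le (gapn_cst 1).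
Qed.

Lemma mu_sub0 u v a b : 0 <= a -> gapn u a -> 0 <= b -> gapn v b ->
  mu p u = mu p v -> mu p (fun x => u x - v x) = 0.
Proof.
by move=> a0 ua b0 vb uv; rewrite (muB p a0 (gapn_lip ua) b0 (gapn_lip vb)) uv subrr.
Qed.

(** Successive differences lie in the kernel of mu, where the operator contracts by r + e; the
    change of the normalizing factors adds at most e. The smallness of e leaves the rate s, halfway
    between r and 1. *)
Lemma vs_delta n : gapn (fun x => vs n.+1 x - vs n x) (2 * s ^+ n).
Proof.
elim: n => [|n IH].
  rewrite mulr1; apply: gapn_le (gapnB (vsP 1).1 (vsP 0).1); have := Kb1; lra.
set dl := (fun x => _) in IH; set b := 2 * s ^+ n in IH.
have b0 : 0 <= b by rewrite /b mulr_ge0 ?exprn_ge0// ltW//; case/andP: s01.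
have dl0 : mu p dl = 0.
  apply: (mu_sub0 Kb0 (vsP n.+1).1 Kb0 (vsP n).1).
  by rewrite (vsP n.+1).2 (vsP n).2.
have [l1 l0 _ _] := eigen_step (vsP n.+1).1 (vsP n.+1).2.
have [_ l'0 _ _] := eigen_step (vsP n).1 (vsP n).2.
set l := mu p _ in l1 l0; set l' := mu p _ in l'0.
have dln := gapn_nb b0 IH dl0.
have ll' : l - l' = mu p (Ez z dl).
  have <- : mu p (Mz dl) = mu p (Ez z dl) by rewrite (mu_Mz dln) dl0 add0r.
  rewrite /dl trB /l /l'.
  have m1 := tr_pwE z (vs n.+1).
  have n1 := nbD (nb_M (gapn_nb1 (vsP n.+1).1 (vsP n.+1).2)) (nb_Ez z1 (gapn_nb1 (vsP n.+1).1 (vsP n.+1).2)).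
  have n2 := nbD (nb_M (gapn_nb1 (vsP n).1 (vsP n).2)) (nb_Ez z1 (gapn_nb1 (vsP n).1 (vsP n).2)).
  rewrite -!trpE in n1 n2.
  by rewrite (muB p (nb_ge0 n1) n1.2 (nb_ge0 n2) n2.2).
have E : (fun x => vs n.+2 x - vs n.+1 x) =
  (fun x => l^-1 * (Mz dl x - (l - l') * vs n.+1 x)).
  apply/funext => x; rewrite [vs n.+2 x]vsS -/l.
  have M1 : Mz (vs n) x = l' * vs n.+1 x by rewrite vsS mulrA divff// mul1r.
  rewrite /dl trB M1; field; exact: l0.
rewrite E exprS mulrCA -/b.
have l2 := normc_near1 l1.
have nl0 : 0 < normc l by exact: lt_le_trans e2 l2.
have g1 := gapn_Mz0 b0 IH dl0.
have g2 := gapnZ (l - l') (vsP n.+1).1.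
apply: gapn_le (gapnZ l^-1 (gapnB g1 g2)).
rewrite normcV ler_pdivrMl//.
have : normc (l - l') * Kb <= e * b * 1.
  rewrite ler_pM ?normc_ge0// ll'; exact: mu_E.
have : (1 - 2 * e) * (s * b) <= normc l * (s * b).
  by rewrite ler_wpM2r// mulr_ge0// ltW//; case/andP: s01.
have : (r + 2 * e) * b <= s * (1 - 2 * e) * b by rewrite ler_wpM2r.
rewrite mulr1; lra.
Qed.

(** The power iteration converges geometrically and its limit is the eigenfunction. For real z all
    iterates are real, hence so is the eigenpair; this is what later identifies the eigenvalue with
    an exponential of the pressure. *)
Theorem perturbed_eigen : exists (h : S -> R[i]) (l : R[i]),
  [/\ mu p h = 1, gapn h Kb, (forall x, Mz h x = l * h x), normc (l - 1) <= 2 * e &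
   cIm z = 0 -> cIm l = 0 /\ forall x, cIm (h x) = 0].
Proof.
have /andP[s0 s1] := s01.
have s01' : 0 <= s < 1 by rewrite s1 ltW.
have s1' : 0 < 1 - s by rewrite subr_gt0.
have dlt n x : normc (vs n.+1 x - vs n x) <= 2 * s ^+ n.
  have b0 : 0 <= 2 * s ^+ n by rewrite mulr_ge0// exprn_ge0// ltW.
  have dl0 : mu p (fun x => vs n.+1 x - vs n x) = 0.
    apply: (mu_sub0 Kb0 (vsP n.+1).1 Kb0 (vsP n).1).
    by rewrite (vsP n.+1).2 (vsP n).2.
  exact: (gapn_nb b0 (vs_delta n) dl0).1.
have /choice[h hP] : forall x, exists l, forall n, normc (vs n x - l) <= 2 * 2 / (1 - s) * s ^+ n.
  by move=> x; apply: geometric_cauchy.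
set C := 2 * 2 / (1 - s) in hP.
have C0 : 0 <= C by rewrite /C divr_ge0// ltW.
have hb : gapn h Kb := gapn_closed s01' (fun n => (vsP n).1) (fun n x => hP x n).
have h1 : mu p h = 1.
  apply/eqP; rewrite -subr_eq0; apply/eqP/normc_eq0/eqP.
  rewrite eq_le normc_ge0 andbT; apply: (@geom_le0 _ _ C s) => // n.
  rewrite -(vsP n).2 -(muB p Kb0 (gapn_lip hb) Kb0 (gapn_lip (vsP n).1)).
  have lb := lipB (gapn_lip hb) (gapn_lip (vsP n).1).
  apply: (mu_bound p _ lb); first by rewrite addr_ge0.
  by move=> x; rewrite normc_subC.
have h2 := gapn_nb1 hb h1.
have [l1 l0 _ _] := eigen_step hb h1.
exists h, (mu p (Mz h)); split => //.
  move=> x; apply/eqP; rewrite -subr_eq0; apply/eqP/normc_eq0/eqP.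
  rewrite eq_le normc_ge0 andbT.
  have H n t : normc (Mz h t - Mz (vs n) t) <= expR B * (C * s ^+ n).
    rewrite -[X in normc X](congr1 (fun g => g t) (trB _ _ _)).
    by apply: tr_pw_bdd => // y; rewrite normc_subC.
  have Hl n : normc (mu p (Mz h) - mu p (Mz (vs n))) <= expR B * (C * s ^+ n).
    have n1 := nbD (nb_M h2) (nb_Ez z1 h2); rewrite -trpE in n1.
    have v2 := gapn_nb1 (vsP n).1 (vsP n).2.
    have n2 := nbD (nb_M v2) (nb_Ez z1 v2); rewrite -trpE in n2.
    rewrite -(muB p (nb_ge0 n1) n1.2 (nb_ge0 n2) n2.2).
    apply: (mu_bound p _ (lipB n1.2 n2.2)); first by rewrite addr_ge0 ?(nb_ge0 n1) ?(nb_ge0 n2).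
    exact: H.
  set l := mu p (Mz h) in l1 l0 Hl *.
  apply: (@geom_le0 _ _ (expR B * C + expR B * C * 2 + 2 * C) s) => // n.
  have [ln1 ln0 _ _] := eigen_step (vsP n).1 (vsP n).2.
  rewrite (_ : _ - _ = (Mz h x - Mz (vs n) x) - (l - mu p (Mz (vs n))) * h x
     + mu p (Mz (vs n)) * (vs n.+1 x - h x)); last first.
    by rewrite vsS; field.
  set ln := mu p _ in ln1 ln0 *.
  have nln : normc ln <= 2.
    rewrite -[ln](subrK 1) (le_trans (normcD _ _))// normc1.
    have := e_small; have := r0; lra.
  rewrite (le_trans (normcD _ _))// [leRHS]mulrDl lerD//.
    rewrite (le_trans (normcB _ _))// [leRHS]mulrDl lerD//; first by rewrite -mulrA.
    rewrite normcM (_ : _ * _ * _ * _ = (expR B * (C * s ^+ n)) * 2); last by ring.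
    by apply: ler_pM; [exact: normc_ge0|exact: normc_ge0|exact: Hl|exact: h2.1].
  rewrite normcM -mulrA ler_pM ?normc_ge0// (le_trans (hP x n.+1))//.
  by rewrite ler_wpM2l// exprS ler_piMl ?exprn_ge0 ?(ltW s0) ?(ltW s1).
move=> zr.
have zE : z = (cRe z)%:C by case: z zr => a b /= ->.
have Mr v : (forall x, cIm (v x) = 0) -> forall x, cIm (Mz v x) = 0.
  move=> vr x; rewrite /tr Im_sum big1// => i _.
  by rewrite /pw zE -rmorphM cexp_real -rmorphM ImM_real vr mulr0.
have mr v : nb v 2 -> (forall x, cIm (v x) = 0) -> cIm (mu p (Mz v)) = 0.
  move=> v2 vr; have n1 := nbD (nb_M v2) (nb_Ez z1 v2); rewrite -trpE in n1.
  by apply: (mu_real p (nb_ge0 n1) n1.2); exact: Mr.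
have vr n : forall x, cIm (vs n x) = 0.
  elim: n => [//|n IH] x; rewrite vsS.
  have := mr _ (gapn_nb1 (vsP n).1 (vsP n).2) IH.
  have := Mr _ IH x; case: (mu p _) => a b; case: (Mz _ x) => a' b' /= -> ->.
  by rewrite !mul0r oppr0 mulr0 mul0r addr0.
have hr x : cIm (h x) = 0.
  apply/eqP; rewrite -normr_le0; apply: (@geom_le0 _ _ C s) => // n.
  rewrite -normrN -[- _]add0r -(vr n x) -ImB.
  exact: le_trans (normc_Im _) (hP _ _).
by split => //; exact: mr.
Qed.

(** The remainder w is kept in the kernel of mu by moving mu (M_z w) h into the multiple of h at
    each step; on that kernel the operator contracts by s. *)
Theorem perturbed_gap (h : S -> R[i]) (l : R[i]) : mu p h = 1 -> gapn h Kb ->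
  (forall x, Mz h x = l * h x) -> forall v a n, nb v a ->
  exists c w, (forall x, iter n Mz v x = c * h x + w x) /\ nb w ((Cg * 2 + Cg) * s ^+ n * a).
Proof.
move=> h1 hb hE v a n va.
have h2 := gapn_nb1 hb h1.
have a0 := nb_ge0 va; have /andP[s0 s1] := s01.
suff [c [w [wE wb w0]]] : exists c w, [/\ (forall x, iter n Mz v x = c * h x + w x),
    gapn w ((Cg * 2 + Cg) * s ^+ n * a) & mu p w = 0].
  exists c, w; split => //; apply: gapn_nb => //.
  by rewrite !mulr_ge0 ?addr_ge0 ?mulr_ge0 ?exprn_ge0 ?(ltW Cg0) ?(ltW s0).
elim: n => [|n [c [w [wE wb w0]]]].
  have wl := lipB va.2 (lipZ (mu p v) h2.2).
  exists (mu p v), (fun x => v x - mu p v * h x); split.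
  - by move=> x /=; rewrite addrC subrK.
  - apply: gapn_le (lip_gapn _ wl); last first.
      by rewrite addr_ge0// mulr_ge0 ?normc_ge0.
    rewrite expr0 mulr1 (_ : (Cg * 2 + Cg) * a = Cg * (a + a * 2)); last by ring.
    rewrite ler_wpM2l ?(ltW Cg0)// lerD2l ler_wpM2r//.
    exact: nb_mu.
  - have hl := lipZ (mu p v) h2.2.
    rewrite (muB p a0 va.2 _ hl) ?mulr_ge0 ?normc_ge0//.
    by rewrite (muZ p _ (ler0n _ 2) h2.2) h1 mulr1 subrr.
set b := _ * a in wb; have b0 : 0 <= b.
  by rewrite /b !mulr_ge0 ?addr_ge0 ?mulr_ge0 ?exprn_ge0 ?(ltW Cg0) ?(ltW s0).
have wn := gapn_nb b0 wb w0.
have g := gapn_Mz0 b0 wb w0.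
have mE : mu p (Mz w) = mu p (Ez z w) by rewrite (mu_Mz wn) w0 add0r.
have g' := gapnZ (mu p (Mz w)) hb.
have reb : 0 <= (r + e) * b by rewrite mulr_ge0 ?addr_ge0 ?(ltW r0).
have nKb : 0 <= normc (mu p (Mz w)) * Kb by rewrite mulr_ge0 ?normc_ge0.
exists (c * l + mu p (Mz w)), (fun x => Mz w x - mu p (Mz w) * h x); split.
- move=> x; rewrite iterS.
  have -> : iter n Mz v = (fun x => c * h x + w x) by apply/funext.
  by rewrite trD trZ hE; ring.
- apply: gapn_le (gapnB g g'); rewrite exprS.
  rewrite (_ : (Cg * 2 + Cg) * _ * a = s * b); last by rewrite /b; ring.
  have : normc (mu p (Mz w)) * Kb <= e * b * 1.
    by rewrite ler_pM ?normc_ge0// mE; exact: mu_E.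
  have : (r + 2 * e) * b <= s * b.
    rewrite ler_wpM2r// (le_trans s_step)// ler_piMr ?(ltW s0)//; have := e0; lra.
  rewrite mulr1; lra.
- rewrite (muB p reb (gapn_lip g) nKb (gapn_lip g')).
  by rewrite (muZ p _ (ler0n _ 2) h2.2) h1 mulr1 subrr.
Qed.


Let KbE : Kb = K5 * normc z. Proof. by rewrite /Kb /e /K5 mulrA. Qed.

(** Lets a rough bound be improved to the fixed point b of a recursion that contracts the excess by
    r. *)
Lemma gapn_limit v (b b0 : R) : (forall n, gapn v (r ^+ n * b0 + b)) -> gapn v b.
Proof.
move=> H m x y; rewrite -subr_le0; apply: (@geom_le0 _ _ (r ^+ m * b0 * dtheta x y) r).
  by rewrite (ltW r0) r1.
by move=> n; rewrite lerBlDr (le_trans (H n m x y))//; apply: le_of_eq; ring.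
Qed.

(** Applying mu to the eigenvalue equation gives l - 1 = z mu f + mu g with g of second order. The
    quadratic coefficient needs h to first order, and h = 1 + z psi + O(z^2) by comparison with the
    Poisson equation. *)
Theorem eigenvalue_expansion (psi : S -> R[i]) (Kp : R) (h : S -> R[i]) (l : R[i]) :
  nb psi Kp -> gapn psi Kp -> mu p psi = 0 ->
  (forall x, psi x - M psi x = M fc x - mu p fc) ->
  mu p h = 1 -> gapn h Kb -> (forall x, Mz h x = l * h x) -> normc (l - 1) <= 2 * e ->
  normc (l - 1 - z * mu p fc -
    z ^+ 2 * (mu p (fun x => fc x * psi x) + mu p (fun x => fc x * fc x) / 2)) <=
    K8 * normc z ^+ 3.
Proof.
move=> psin psig psi0 psiE h1 hb hE l1.
set a := normc z; have a0 : 0 <= a := normc_ge0 z.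
have h2 := gapn_nb1 hb h1.
pose w x := h x - 1.
have wg : gapn w Kb by have := gapnB hb (gapn_cst 1); rewrite addr0.
have w0 : mu p w = 0 by rewrite /w (muB p Kb0 (gapn_lip hb) (lexx 0) (lip_cst 1)) h1 mu_cst subrr.
have wn := gapn_nb Kb0 wg w0.
pose zf x := z * fc x; have zfn : nb zf (a * B) := nbZ z nb_fc.
have e1n := nb_e1 z1; have e2n := nb_e2 z1.
set e2' := fun x => _ in e2n; rewrite -/a in e1n e2n.
pose g x := e2' x * h x + zf x * w x.
have gn : nb g (K6 * a ^+ 2).
  have := nbD (nbM e2n h2) (nbM zfn wn); congr nb; rewrite KbE /K6 -/a; ring.
have gE x : (cexp (z * (f x)%:C) - 1) * h x = zf x + g x.
  by rewrite /g /e2' /w /zf /cplx; ring.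
have EzE : Ez z h = (fun x => z * M fc x + M g x).
  rewrite /Ez; have -> : (fun x => (cexp (z * (f x)%:C) - 1) * h x) = (fun x => z * fc x + g x).
    by apply/funext => x; rewrite gE.
  by rewrite trD trZ.
have lE : l - 1 = z * mu p fc + mu p g.
  have -> : l = mu p (Mz h).
    have -> : Mz h = (fun x => l * h x) by apply/funext.
    by rewrite (muZ p _ (nb_ge0 h2) h2.2) h1 mulr1.
  rewrite (mu_Mz h2) h1 addrC addKr EzE.
  have n1 := nb_M nb_fc; have n2 := nb_M gn.
  rewrite (muD p _ (nbZ z n1).2 (nb_ge0 n2) n2.2) ?(nb_ge0 (nbZ z n1))//.
  rewrite (muZ p _ (nb_ge0 n1) n1.2) (mu_M p B0 nb_fc.2) (mu_M p (nb_ge0 gn) gn.2).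
  by [].
pose q x := w x - z * psi x.
have Kp0 := nb_ge0 psin.
have qg0 : gapn q (Kb + a * Kp) := gapnB wg (gapnZ z psig).
have aKp0 : 0 <= a * Kp by rewrite mulr_ge0.
have q0 : mu p q = 0.
  rewrite /q (muB p Kb0 (gapn_lip wg) aKp0 (gapn_lip (gapnZ z psig))).
  by rewrite (muZ p _ Kp0 (gapn_lip psig)) w0 psi0 mulr0 subr0.
pose d x := (1 - l) * w x + M g x.
have g6 : 0 <= K6 * a ^+ 2 := nb_ge0 gn.
have dg : gapn d ((1 - r) * (K7 * a ^+ 2)).
  have g1 := gapnM (lip_gapn g6 gn.2).
  apply: gapn_le (gapnD (gapnZ (1 - l) wg) g1).
  have -> : (1 - r) * (K7 * a ^+ 2) = 2 * K4 * K5 * a ^+ 2 + Cg * K6 * a ^+ 2.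
    by rewrite /K7; field; rewrite gt_eqF.
  rewrite lerD//.
    rewrite normc_subC (le_trans (ler_wpM2r Kb0 l1))// KbE /e -/a le_eqVlt.
    by apply/orP; left; apply/eqP; ring.
  rewrite -mulrA ler_piMl ?(ltW r1)// mulr_ge0// ltW//.
(* Subtracting z times the Poisson equation from the eigenvalue equation cancels the first-order
   terms, so q is a fixed point of M up to a source of order z^2; iterating this gives the bound
   with [K7]. *)
have qE : q = (fun x => M q x + (d x + (1 - l + z * mu p fc))).
  apply/funext => x.
  have E : (1 - l) * w x + (1 - l) + (z * M fc x + M g x) = w x - M w x.
    have := hE x; rewrite tr_pwE EzE => H.
    have -> : M w x = M h x - 1 by rewrite /w trB M_cst.
    have -> : z * M fc x + M g x = l * h x - M h x by rewrite -H; ring.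
    by rewrite /w; ring.
  have -> : M q x = M w x - z * M psi x by rewrite /q trB trZ.
  have -> : z * mu p fc = z * M fc x - z * (psi x - M psi x) by rewrite psiE; ring.
  have E' : M g x = w x - M w x - ((1 - l) * w x + (1 - l) + z * M fc x).
    by rewrite -E; ring.
  by rewrite /q /d E'; ring.
have k70 : 0 <= K7 * a ^+ 2.
  have k5 : 0 <= K5 by rewrite /K5 mulr_ge0 ?K4_ge0// divr_ge0 ?(ltW r1').
  rewrite mulr_ge0 ?exprn_ge0// divr_ge0 ?(ltW r1')//.
  rewrite addr_ge0 ?(mulr_ge0 (mulr_ge0 (ler0n _ 2) K4_ge0) k5)//.
  rewrite mulr_ge0 ?(ltW Cg0)// /K6 addr_ge0 ?(mulr_ge0 (mulr_ge0 (ler0n _ 2) B0) k5)//.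
  by rewrite mulr_ge0// /C2 !mulr_ge0 ?exprn_ge0 ?expR_ge0.
have qg : gapn q (K7 * a ^+ 2).
  apply: (@gapn_limit _ _ (Kb + a * Kp)); elim=> [|n IH].
    by rewrite mul1r; apply: gapn_le qg0; rewrite lerDl.
  rewrite qE; have := gapnD (gapnM IH) (gapnD dg (gapn_cst (1 - l + z * mu p fc))).
  by congr gapn; rewrite [r ^+ n.+1]exprS; ring.
have qn := gapn_nb k70 qg q0.
pose ff x := fc x * fc x; pose fp x := fc x * psi x.
have ffn : nb ff _ := nbM nb_fc nb_fc.
have fpn : nb fp _ := nbM nb_fc psin.
pose k x := e2' x * w x + zf x * q x.
have kn : nb k ((2 * C2 * K5 + 2 * B * K7) * a ^+ 3).
  have := nbD (nbM e2n wn) (nbM zfn qn); congr nb; rewrite KbE -/a; ring.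
pose e3 x := e2' x - z ^+ 2 / 2 * ff x.
have e3n : nb e3 (C2 * a ^+ 2 + normc (- (z ^+ 2 / 2)) * (2 * (B * B))).
  have := nbD e2n (nbZ (- (z ^+ 2 / 2)) ffn); congr nb; apply/funext => x.
  by rewrite /e3; ring.
have e3b : bdd e3 (B ^+ 3 * expR B * a ^+ 3).
  move=> x; rewrite /e3 /e2' /ff.
  rewrite (_ : _ - _ = cexp (zf x) - 1 - zf x - zf x ^+ 2 / 2); last by rewrite /zf /cplx; ring.
  rewrite (le_trans (cexp_taylor3 _))//.
  rewrite (_ : B ^+ 3 * _ * _ = (a * B) ^+ 3 * expR B); last by ring.
  rewrite ler_pM ?exprn_ge0 ?normc_ge0 ?expR_ge0 ?ler_expR ?zf_bound//.
  by rewrite lerXn2r ?nnegrE ?mulr_ge0 ?normc_ge0//; exact: zfn.1.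
have gE2 : g = (fun x => (e3 x + k x) + (z ^+ 2 * fp x + z ^+ 2 / 2 * ff x)).
  by apply/funext => x; rewrite /g /e3 /k /fp /ff /q /w /zf; ring.
have n1 := nbD e3n kn.
have n2 := nbZ (z ^+ 2) fpn; have n3 := nbZ (z ^+ 2 / 2) ffn.
have n4 := nbD n2 n3.
rewrite lE gE2 (muD p (nb_ge0 n1) n1.2 (nb_ge0 n4) n4.2).
rewrite (muD p (nb_ge0 n2) n2.2 (nb_ge0 n3) n3.2).
rewrite (muZ p _ (nb_ge0 fpn) fpn.2) (muZ p _ (nb_ge0 ffn) ffn.2).
rewrite (muD p (nb_ge0 e3n) e3n.2 (nb_ge0 kn) kn.2).
rewrite (_ : _ - _ = mu p e3 + mu p k); last by rewrite /fp /ff; ring.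
rewrite (le_trans (normcD _ _))// /K8 [leRHS]mulrDl lerD//; last exact: nb_mu.
exact: (mu_bound p (nb_ge0 e3n) e3n.2 e3b).
Qed.

End perturbation.

(** * Spectral data for small complex parameters *)

Section perturbation_summary.
Context {R : realType} {A : aperiodic_matrix} {theta : R}.
Local Notation S := (shift_space A theta).

(** The second clause is the spectral gap without a projection: the cross combination annihilates
    the multiple of h contained in the iterates and leaves only the decaying part. *)
Definition spectral_pair (p : @nweight R A theta) (f : S -> R) (K s : R) (be z : R[i]) (h : S -> R[i]) (l : R[i]) :=
  [/\ [/\ forall x, tr (pw p f z) h x = l * h x, nb h 2 & forall x, normc (h x - 1) <= 1 / 2],
    forall v a n x y, nb v a -> normc (h y * iter n (tr (pw p f z)) v x -
       h x * iter n (tr (pw p f z)) v y) <= K * s ^+ n * a,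
    normc (l - 1 - z * mu p (cplx f) - z ^+ 2 * be) <= K * normc z ^+ 3 &
    (cIm z = 0 -> cIm l = 0 /\ forall x, cIm (h x) = 0)].

Theorem perturbation (p : @nweight R A theta) (f : S -> R) (B : R) :
  1 <= B -> lip (cplx f) B -> bdd (cplx f) B ->
  exists z0 K s : R, exists be : R[i], [/\ 0 < z0 <= 1, 0 <= K, 0 < s < 1 &
  forall z : R[i], normc z <= z0 -> exists h l, spectral_pair p f K s be z h l].
Proof.
move=> B1 fl fb.
have [Cg [r [Cg0 r01 Hgap _]]] := mu_gap p.
have [psi [Kp [psin psig psi0 psiE]]] := poisson B1 fl Cg0 r01 Hgap.
have /andP[r0 r1] := r01.
set K4' := K4 p B Cg.
have K40 : 0 <= K4' := K4_ge0 p B1 Cg0.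
(* The eigenpair needs only 8 here; the factor 16 keeps h within 1/2 of 1, so that h does not
   vanish. *)
pose z0 := (1 - r) / (16 * (K4' + 1)).
have K41 : 0 < K4' + 1 by rewrite ltr_pwDr.
have z00 : 0 < z0 by rewrite /z0 divr_gt0 ?mulr_gt0 ?subr_gt0.
have z0K : K4' * z0 <= (1 - r) / 16.
  rewrite /z0 mulrA ler_pdivrMr ?mulr_gt0//.
  have : 0 <= (1 - r) by rewrite subr_ge0 ltW.
  have -> : (1 - r) / 16 * (16 * (K4' + 1)) = (1 - r) * (K4' + 1) by field.
  move=> h; rewrite mulrC ler_wpM2l//; lra.
have z01 : z0 <= 1.
  rewrite /z0 ler_pdivrMr ?mulr_gt0// mul1r; lra.
pose s := (1 + r) / 2.
exists z0, (Num.max (4 * 2 * 3 * Cg) (Num.max (K8 p B Cg r) (2 * K4'))), s,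
  (mu p (fun x => cplx f x * psi x) + mu p (fun x => cplx f x * cplx f x) / 2).
split.
- by rewrite z00.
- by rewrite le_max !mulr_ge0 ?(ltW Cg0).
- by rewrite /s; lra.
move=> z zz0.
have z1 : normc z <= 1 by exact: le_trans z01.
have es : K4' * normc z <= (1 - r) / 16.
  by apply: le_trans z0K; rewrite ler_wpM2l.
have es' : K4' * normc z <= (1 - r) / 8 by lra.
have [h [l [h1 hb hE l1 hr]]] := perturbed_eigen B1 fl fb Cg0 r01 Hgap z1 es'.
have h2 := gapn_nb1 B1 Cg0 r01 es' hb h1.
exists h, l; split => //.
- split => // x.
  have Kb0 : 0 <= 8 / (1 - r) * (K4' * normc z).
    by rewrite mulr_ge0 ?divr_ge0 ?subr_ge0 ?(ltW r1)// mulr_ge0 ?normc_ge0.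
  have := mu_osc p x Kb0 (gapn_lip hb); rewrite h1 => /le_trans; apply.
  rewrite mulrAC ler_pdivrMr ?subr_gt0//; lra.
- move=> v a n x y va.
  have [c [w [wE wb]]] := perturbed_gap B1 fl fb Cg0 r01 Hgap z1 es' h1 hb hE n va.
  rewrite !wE (_ : _ - _ = h y * w x - h x * w y); last by ring.
  rewrite (le_trans (normcB _ _))// !normcM.
  set b := (Cg * 2 + Cg) * s ^+ n * a in wb.
  have b0 := nb_ge0 wb.
  apply: (@le_trans _ _ (2 * b + 2 * b)).
    by apply: lerD; apply: ler_pM; rewrite ?normc_ge0//; [exact: h2.1|exact: wb.1|exact: h2.1|exact: wb.1].
  rewrite (_ : 2 * b + 2 * b = (4 * 3 * Cg) * (s ^+ n * a)); last by rewrite /b; ring.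
  rewrite -[leRHS]mulrA ler_wpM2r//.
    by rewrite mulr_ge0 ?(nb_ge0 va)// exprn_ge0// /s; lra.
  rewrite le_max; apply/orP; left.
  by rewrite !ler_wpM2r ?(ltW Cg0)//; lra.
- have := eigenvalue_expansion B1 fl fb Cg0 r01 Hgap z1 es' psin psig psi0 psiE h1 hb hE l1.
  move=> /le_trans; apply; rewrite ler_wpM2r ?exprn_ge0 ?normc_ge0//.
  by rewrite !le_max lexx orbT.
Qed.

End perturbation_summary.

(** * Passage from a potential to a g-function *)

Section normalization.
Context {R : realType} {A : aperiodic_matrix} {theta : R}.
Local Notation S := (shift_space A theta).
Implicit Types (x y z : S).

Lemma expR_sub1 (t T : R) : `|t| <= T -> `|expR t - 1| <= `|t| * expR T.
Proof.
move=> tT; have := cexp_taylor1 (t%:C); rewrite cexp_real -(rmorph1 (real_complex R)).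
rewrite -rmorphB !normc_real => /le_trans; apply.
by rewrite ler_wpM2l// ler_expR.
Qed.

(** The eigenvalue equation for h says exactly that e^(F - Lam) h / (h o shift) sums to 1 over the
    preimages of a point. The cone condition on h makes this weight logarithmically Lipschitz along
    branches. *)
Theorem normalization (th01 : 0 < theta < 1) (F : S -> R) (K : R) : 0 <= K ->
  (forall x y, `|F x - F y| <= K * dtheta x y) ->
  exists (Lam C : R) (h : S -> R) (p : @nweight R A theta), [/\ 1 <= C,
  (forall n x, C^-1 * expR (n%:R * Lam) <= iter n (tr (fun x => expR (F x))) (fun=> 1) x
     <= C * expR (n%:R * Lam)),
  (forall x, C^-1 <= h x <= C),
  (forall x y, `|h x - h y| <= C * dtheta x y) &
  forall x, p x = expR (F x - Lam) * h x / h (sg x)].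
Proof.
move=> K0 FK.
have [Lam [C [h [C1 HC hC [h0 hcone] hE]]]] := eigenfunction th01 K0 FK.
have [b Fb] := lip_bounded th01 K0 FK.
have C0 : 0 < C by exact: lt_le_trans C1.
have hp x : 0 < h x by have /andP[+ _] := hC x; apply: lt_le_trans; rewrite invr_gt0.
have := cone_cst_ge0 th01 K0; move: (@cone_cst R theta K) hcone => B hcone B0.
pose p x := expR (F x - Lam) * h x / h (sg x).
have pp x : 0 < p x by rewrite /p divr_gt0// mulr_gt0// expR_gt0.
have psum x : \sum_(i | adm i x) p (scons i x) = 1.
  have -> : \sum_(i | adm i x) p (scons i x) = expR (- Lam) / h x * tr (fun x => expR (F x)) h x.
    rewrite /tr mulr_sumr; apply: eq_bigr => i ix.
    by rewrite /p shift_scons// expRD; ring.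
  rewrite hE expRN; field.
  by rewrite !gt_eqF ?expR_gt0 ?hp.
(* One contribution from F and one from each of the two values of h in the weight. *)
pose D0 := K + B + B.
have D00 : 0 <= D0 by rewrite !addr_ge0.
have plip i x y : adm i x -> val x 0%N = val y 0%N ->
    p (scons i x) <= expR (D0 * dtheta x y) * p (scons i y).
  move=> ix xy; have iy : adm i y by rewrite -(adm_head _ xy).
  have d0 := d_ge0 th01 x y.
  have dxy := d_scons ix iy.
  have /andP[t0 t1] := th01.
  have dle : dtheta (scons i x) (scons i y) <= dtheta x y by rewrite dxy ler_piMl// ltW.
  have f1 : expR (F (scons i x) - Lam) <= expR (K * dtheta x y) * expR (F (scons i y) - Lam).
    rewrite -expRD ler_expR addrA lerD2r -lerBlDr.
    by rewrite (le_trans (ler_norm _))// (le_trans (FK _ _))// ler_wpM2l.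
  have h1 : h (scons i x) <= expR (B * dtheta x y) * h (scons i y).
    rewrite (le_trans (hcone (scons i x) (scons i y) _))// ?val_scons//.
    by rewrite ler_wpM2r ?h0// ler_expR ler_wpM2l.
  have h2 : h y <= expR (B * dtheta x y) * h x.
    by rewrite d_sym; apply: hcone.
  rewrite /p !shift_scons// ler_pdivrMr//.
  rewrite (_ : D0 * _ = K * dtheta x y + B * dtheta x y + B * dtheta x y); last by rewrite /D0; ring.
  rewrite [expR (_ + _ + B * _)]expRD [expR (K * _ + _)]expRD.
  set e1 := expR _ in f1 *; set ek := expR (K * _) in f1 *; set eB := expR (B * _) in h1 h2 *.
  set e2 := expR _ in f1 *.
  rewrite (_ : ek * eB * eB * (e2 * h (scons i y) / h y) * h x = (ek * e2) * (eB * h (scons i y)) * (eB * h x / h y)); last by ring.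
  rewrite (@le_trans _ _ ((ek * e2) * (eB * h (scons i y))))//.
    by rewrite ler_pM ?expR_ge0 ?h0.
  by rewrite ler_peMr ?mulr_ge0 ?expR_ge0 ?h0// ler_pdivlMr// mul1r.
pose D := D0 * expR D0 + 1.
have plip' i x y : adm i x -> val x 0%N = val y 0%N ->
   `|p (scons i x) - p (scons i y)| <= D * p (scons i y) * dtheta x y.
  move=> ix xy; have iy : adm i y by rewrite -(adm_head _ xy).
  have d0 := d_ge0 th01 x y; have d1 := d_le1 th01 x y.
  have Dd : `|D0 * dtheta x y| <= D0 by rewrite ger0_norm ?mulr_ge0// ler_piMr.
  have e1 := expR_sub1 Dd.
  have e2 : `|- (D0 * dtheta x y)| <= D0 by rewrite normrN.
  have {}e2 := expR_sub1 e2.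
  rewrite normrN in e2; rewrite (ger0_norm (mulr_ge0 D00 d0)) in e1 e2.
  have q1 := plip i x y ix xy; have q2 := plip i y x iy (esym xy).
  rewrite d_sym in q2.
  have q2' : expR (- (D0 * dtheta x y)) * p (scons i y) <= p (scons i x).
    by rewrite expRN ler_pdivrMl ?expR_gt0.
  rewrite (@le_trans _ _ (D0 * dtheta x y * expR D0 * p (scons i y)))//.
    rewrite ler_norml; apply/andP; split.
      rewrite -(lerD2r (p (scons i y))) subrK (le_trans _ q2')//.
      rewrite addrC -mulNr -[X in X + _]mul1r -mulrDl ler_wpM2r ?(ltW (pp _))//.
      by move: e2; rewrite ler_norml => /andP[+ _]; lra.
    rewrite lerBlDr (le_trans q1)// -[X in _ + X]mul1r -mulrDl ler_wpM2r ?(ltW (pp _))//.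
    by move: e1; rewrite ler_norml => /andP[_]; lra.
  rewrite (_ : D0 * _ * _ * _ = D0 * expR D0 * (p (scons i y) * dtheta x y)); last by ring.
  rewrite -[leRHS]mulrA; apply: ler_wpM2r; first by rewrite mulr_ge0 ?(ltW (pp _)).
  by rewrite /D lerDl.
have D1 : 1 <= D by rewrite /D lerDr mulr_ge0 ?expR_ge0.
have c0 : 0 < expR (- b - Lam) * C ^-2 by rewrite mulr_gt0 ?expR_gt0// invr_gt0 exprn_gt0.
have plb x : expR (- b - Lam) * C ^-2 <= p x.
  rewrite /p ler_pdivlMr// -mulrA ler_pM ?expR_ge0 ?mulr_ge0 ?invr_ge0 ?exprn_ge0 ?h0 ?(ltW C0)//.
    by rewrite ler_expR lerD2r; have := Fb x; rewrite ler_norml => /andP[].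
  rewrite (@le_trans _ _ (C ^- 2 * C))//.
    by rewrite ler_wpM2l ?invr_ge0 ?exprn_ge0 ?(ltW C0)//; have /andP[] := hC (sg x).
  rewrite expr2 invfM -mulrA mulVf ?gt_eqF// mulr1; by have /andP[] := hC x.
pose C' := C * (B * expR B + 2).
have BB : 0 <= B * expR B by rewrite mulr_ge0 ?expR_ge0.
have CC' : C <= C' by rewrite /C' ler_peMr ?(ltW C0)//; lra.
have C'0 : 0 < C' by exact: lt_le_trans CC'.
exists Lam, C', h, (NWeight th01 c0 D1 psum plb plip'); split => //.
- exact: le_trans CC'.
- move=> n x; have /andP[u v] := HC n x; apply/andP; split.
    by rewrite (le_trans _ u)// ler_wpM2r ?expR_ge0// lef_pV2 ?posrE.
  by rewrite (le_trans v)// ler_wpM2r ?expR_ge0.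
- move=> x; have /andP[u v] := hC x; apply/andP; split.
    by rewrite (le_trans _ u)// lef_pV2 ?posrE.
  exact: le_trans CC'.
- have dC x : h x <= C by have /andP[] := hC x.
  move=> x y; have [xy|xy] := eqVneq (val x 0%N) (val y 0%N); last first.
    rewrite d_head// mulr1 (le_trans (ler_normB _ _))// !ger0_norm ?h0//.
    rewrite (le_trans (lerD (dC x) (dC y)))// /C'.
    have := mulr_ge0 (ltW C0) BB.
    lra.
  have H (u v : S) : val u 0%N = val v 0%N -> h u - h v <= C * (B * expR B) * dtheta u v.
    move=> uv; have d0 := d_ge0 th01 u v; have d1 := d_le1 th01 u v.
    have Bd : `|B * dtheta u v| <= B by rewrite (ger0_norm (mulr_ge0 B0 d0)) ler_piMr.
    have := expR_sub1 Bd; rewrite ler_norml (ger0_norm (mulr_ge0 B0 d0)) => /andP[_ e1].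
    have q := hcone u v uv.
    rewrite (@le_trans _ _ ((expR (B * dtheta u v) - 1) * h v))//; first by rewrite mulrBl mul1r lerD2r.
    rewrite (_ : C * _ * _ = (B * dtheta u v * expR B) * C); last by ring.
    rewrite (@le_trans _ _ ((B * dtheta u v * expR B) * h v))//; first by rewrite ler_wpM2r.
    by rewrite ler_wpM2l ?mulr_ge0 ?expR_ge0.
  have CC2 : C * (B * expR B) * dtheta x y <= C' * dtheta x y.
    by rewrite ler_wpM2r ?d_ge0// /C' mulrDr lerDl mulr_ge0 ?(ltW C0).
  rewrite ler_norml; apply/andP; split; last exact: le_trans (H x y xy) _.
  by have := H y x (esym xy); rewrite d_sym; lra.
Qed.

Lemma bprod_normalized (F h p : S -> R) (Lam : R) : (forall x, 0 < h x) ->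
  (forall x, p x = expR (F x - Lam) * h x / h (sg x)) ->
  forall n x, bprod p n x = expR (birkhoff F n x - n%:R * Lam) * h x / h (iter n sg x).
Proof.
move=> h0 pE; elim=> [|n IH] x.
  by rewrite bprod0 /birkhoff big_geq// mul0r subr0 expR0 mul1r divff// gt_eqF.
have FE : birkhoff F n.+1 x = F x + birkhoff F n (sg x).
  rewrite /birkhoff big_nat_recl//; congr (_ + _).
  by apply: eq_bigr => j _; rewrite -iterSr.
rewrite bprodS IH pE FE -iterSr -natr1.
rewrite (_ : F x + _ - _ = (F x - Lam) + (birkhoff F n (sg x) - n%:R * Lam)); last by ring.
rewrite (expRD (F x - Lam) (_ - _)); field.
by rewrite !gt_eqF.
Qed.

Lemma Ftheta_bounds (th01 : 0 < theta < 1) (f : S -> R) : Ftheta (cplx f) ->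
  exists B, [/\ 1 <= B, lip (cplx f) B & bdd (cplx f) B].
Proof.
move=> [C [C0 fC]]; have [a a0 fa] := lip_bdd th01 C0 fC.
exists (1 + C + a); split; first lra.
  by apply: lip_le fC => //; lra.
by move=> x; rewrite (le_trans (fa x))//; lra.
Qed.

End normalization.

(** * Arguments of unimodular complex numbers *)

Section angles.
Context {R : realType}.

Lemma cexp_2pi : cexp (Complex 0 (pi *+ 2)) = 1 :> R[i].
Proof. by rewrite /cexp expR0 cos2pi sin2pi mul1r mulr0. Qed.

Lemma cexp_2pi_int (k : int) : cexp (Complex 0 (pi *+ 2 * k%:~R)) = 1 :> R[i].
Proof.
have H (n : nat) : cexp (Complex 0 (pi *+ 2 * n%:R)) = 1 :> R[i].
  have -> : Complex 0 (pi *+ 2 * n%:R) = n%:R * (Complex 0 (pi *+ 2)) :> R[i].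
    rewrite -(rmorph_nat (real_complex R)); apply/eqP; rewrite eq_complex /=.
    by rewrite !mul0r mulr0 subrr addr0 mulrC !eqxx.
  by rewrite cexpX cexp_2pi expr1n.
case: k => n; first exact: H.
rewrite NegzE mulrNz mulrN.
have -> : Complex 0 (- (pi *+ 2 * n.+1%:~R)) = - Complex 0 (pi *+ 2 * n.+1%:R) :> R[i].
  by apply/eqP; rewrite eq_complex /= oppr0 !eqxx.
by rewrite cexpN H invr1.
Qed.

(** Reduce t modulo 2 pi to s in [0, 2 pi); then cos s = 1 gives sin (s / 2) = 0, impossible for 0 <
    s < 2 pi. *)
Lemma cexp_imag_eq1 (t : R) : cexp (Complex 0 t) = 1 -> exists k : int, t = pi *+ 2 * k%:~R.
Proof.
move=> H; have p0 : 0 < pi *+ 2 :> R by rewrite pmulrn_lgt0// pi_gt0.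
pose k := Num.floor (t / (pi *+ 2)); pose s := t - pi *+ 2 * k%:~R.
exists k.
have s0 : 0 <= s.
  by rewrite /s subr_ge0 mulrC -ler_pdivlMr// ge_floor.
have s1 : s < pi *+ 2.
  rewrite /s ltrBlDr; have := lt_succ_floor (t / (pi *+ 2)).
  by rewrite intrD -/k ltr_pdivrMr// mulrDl mul1r addrC [k%:~R * _]mulrC.
have Hs : cexp (Complex 0 s) = 1 :> R[i].
  have E : Complex 0 t = Complex 0 s + Complex 0 (pi *+ 2 * k%:~R) :> R[i].
    by apply/eqP; rewrite eq_complex /= addr0 /s subrK !eqxx.
  by move: H; rewrite E cexpD cexp_2pi_int mulr1.
have c1 : cos s = 1.
  by move: Hs; rewrite /cexp expR0 !mul1r => -[].
have : sin (s / 2) = 0.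
  have := cosD (s / 2) (s / 2); rewrite -splitr c1 -!expr2.
  have := cos2Dsin2 (s / 2) => h1 h2.
  have : sin (s / 2) ^+ 2 = 0 by lra.
  by move/eqP; rewrite sqrf_eq0 => /eqP.
have [s00|sp] := eqVneq s 0; first by move=> _; apply/eqP; rewrite -subr_eq0 -/s s00.
have s2 : 0 < s by rewrite lt_def sp.
have : 0 < sin (s / 2).
  by apply: sin_gt0_pi; rewrite divr_gt0//= ltr_pdivrMr// mulr_natr.
by move=> + s00; rewrite s00 ltxx.
Qed.

Lemma unimodular_angle (w : R[i]) : normc w = 1 ->
  exists2 t : R, `|t| <= pi & w = cexp (Complex 0 t).
Proof.
case: w => a b; rewrite /normc => ab.
have ab1 : a ^+ 2 + b ^+ 2 = 1.
  by rewrite -[LHS]sqr_sqrtr ?addr_ge0 ?sqr_ge0// ab expr1n.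
have a1 : -1 <= a <= 1.
  rewrite -ler_norml -(@ler_pXn2r _ 2) ?nnegrE// expr1n real_normK ?num_real//.
  by rewrite -ab1 lerDl sqr_ge0.
have cE : cos (acos a) = a by apply: acosK; rewrite in_itv.
have sE : `|b| = sin (acos a).
  rewrite sin_acos// -sqrtr_sqr; congr Num.sqrt; lra.
have [b0|b0] := leP 0 b.
  exists (acos a); first by rewrite ger0_norm ?acos_ge0 ?acos_lepi.
  by rewrite /cexp expR0 !mul1r cE -sE ger0_norm.
exists (- acos a); first by rewrite normrN ger0_norm ?acos_ge0 ?acos_lepi.
by rewrite /cexp expR0 !mul1r cosN sinN cE -sE ltr0_norm// opprK.
Qed.

End angles.

(** * Complex limits along the ultrafilter *)

Section ulimits.
Context {R : realType}.
Implicit Types (s t : nat -> R[i]) (l : R[i]).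

Definition ulim s l := forall e : R, 0 < e -> \forall n \near uoo, normc (s n - l) < e.

Lemma ulim_unique s l l' : ulim s l -> ulim s l' -> l = l'.
Proof.
move=> sl sl'; apply/eqP; rewrite -subr_eq0; apply/eqP/normc_eq0/eqP.
rewrite eq_le normc_ge0 andbT; apply/ler_addgt0Pr => e e0; rewrite add0r.
near uoo => n; rewrite (le_trans (normc_dist _ (s n) _))// (splitr e) ltW// ltrD//.
  by rewrite normc_subC; near: n; apply: sl; rewrite divr_gt0.
by near: n; apply: sl'; rewrite divr_gt0.
Unshelve. all: by end_near. Qed.

Lemma ulimD s t l l' : ulim s l -> ulim t l' -> ulim (fun n => s n + t n) (l + l').
Proof.
move=> sl tl e e0; near=> n; rewrite opprD addrACA (le_lt_trans (normcD _ _))//.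
rewrite (splitr e) ltrD//; near: n; [apply: sl|apply: tl]; exact: divr_gt0.
Unshelve. all: by end_near. Qed.

Lemma ulim_cst l : ulim (fun=> l) l.
Proof. by move=> e e0; apply: nearW => n; rewrite subrr normc0. Qed.

Lemma ulim_sum (I : Type) (r : seq I) (P : pred I) (s : I -> nat -> R[i]) (l : I -> R[i]) :
  (forall i, P i -> ulim (s i) (l i)) ->
  ulim (fun n => \sum_(i <- r | P i) s i n) (\sum_(i <- r | P i) l i).
Proof.
move=> H; elim: r => [|i r IH].
  rewrite big_nil; under [fun n => _]eq_fun do rewrite big_nil; exact: ulim_cst.
rewrite big_cons; under [fun n => _]eq_fun do rewrite big_cons.
by case: ifP => // Pi; apply: ulimD => //; exact: H.
Qed.

Lemma ulimM s t l l' (C : R) : (forall n, normc (t n) <= C) ->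
  ulim s l -> ulim t l' -> ulim (fun n => s n * t n) (l * l').
Proof.
move=> tC sl tl e e0.
have C0 : 0 <= C by exact: le_trans (normc_ge0 _) (tC 0%N).
pose K := C + normc l + 1; have K0 : 0 < K by rewrite ltr_pwDr// addr_ge0 ?normc_ge0.
near=> n.
have h1 : normc (s n - l) < e / (2 * K) by near: n; apply: sl; rewrite divr_gt0// mulr_gt0.
have h2 : normc (t n - l') < e / (2 * K) by near: n; apply: tl; rewrite divr_gt0// mulr_gt0.
rewrite (_ : _ - _ = (s n - l) * t n + l * (t n - l')); last by ring.
rewrite (le_lt_trans (normcD _ _))// !normcM.
have : normc (s n - l) * normc (t n) <= e / (2 * K) * C.
  by rewrite ler_pM ?normc_ge0// ltW.
have : normc l * normc (t n - l') <= normc l * (e / (2 * K)).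
  by rewrite ler_wpM2l ?normc_ge0// ltW.
have : e / (2 * K) * K = e / 2 by field; rewrite gt_eqF.
have : 0 < e / (2 * K) by rewrite divr_gt0// mulr_gt0.
rewrite /K; lra.
Unshelve. all: by end_near. Qed.

Lemma ulim_cexp (u : nat -> R) (v a : R) : u n @[n --> uoo] --> v ->
  ulim (fun n => cexp (Complex 0 (u n) * a%:C)) (cexp (Complex 0 v * a%:C)).
Proof.
move=> uv e e0; near=> n.
have h : `|v - u n| < Num.min 1 (e / (`|a| * expR `|a| + 1)).
  near: n; have /cvgrPdist_lt := uv; apply.
  by rewrite lt_min ltr01 divr_gt0// ltr_pwDr// mulr_ge0 ?expR_ge0.
move: h; rewrite lt_min => /andP[h1 h2].
rewrite (_ : _ - _ = cexp (Complex 0 v * a%:C) * (cexp (Complex 0 (u n - v) * a%:C) - 1)); last first.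
  rewrite mulrBr mulr1 -cexpD -mulrDl; congr (cexp (_ * _) - _).
  by apply/eqP; rewrite eq_complex /= addr0 eqxx /= addrC subrK.
rewrite normcM normc_cexp.
have -> : cRe (Complex 0 v * a%:C) = 0 by rewrite /= !mul0r ?mulr0 subrr.
rewrite expR0 mul1r.
rewrite (le_lt_trans (cexp_taylor1 _))//.
have -> : normc (Complex 0 (u n - v) * a%:C) = `|v - u n| * `|a|.
  by rewrite normcM normc_real /normc /= expr0n add0r sqrtr_sqr distrC.
rewrite (@le_lt_trans _ _ (`|v - u n| * (`|a| * expR `|a| + 1)))//; last first.
  by rewrite -ltr_pdivlMr// ltr_pwDr// mulr_ge0 ?expR_ge0.
rewrite -mulrA ler_wpM2l// (@le_trans _ _ (`|a| * expR `|a|)) ?lerDl//.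
by rewrite ler_wpM2l// ler_expR ler_piMl// ltW.
Unshelve. all: by end_near. Qed.

Lemma ulim_norm_eq s l : ulim s l -> (forall n, normc (s n) <= 1) ->
  (forall e : R, 0 < e -> \forall n \near uoo, 1 - e <= normc (s n)) -> normc l = 1.
Proof.
move=> sl s1 s2; apply/eqP; rewrite eq_le; apply/andP; split; apply/ler_addgt0Pr => e e0.
  near uoo => n.
  have : normc (s n - l) < e by near: n; exact: sl.
  by have := normcD (s n) (l - s n); rewrite addrC subrK normc_subC; have := s1 n; lra.
near uoo => n.
have : normc (s n - l) < e / 2 by near: n; apply: sl; rewrite divr_gt0.
have : 1 - e / 2 <= normc (s n) by near: n; apply: s2; rewrite divr_gt0.
by have := normcD l (s n - l); rewrite addrC subrK; lra.
Unshelve. all: by end_near. Qed.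

End ulimits.

Section unimodular_average.
Context {R : realType} {I : finType}.

(** Strict convexity of the disc: after rotating the mean to 1, a sum of nonnegative terms p i (1 -
    Re) vanishes, so each term does, and a point of the disc with real part 1 is 1. *)
Lemma average_extreme (P : pred I) (p : I -> R) (t : I -> R[i]) :
  (forall i, P i -> 0 < p i) -> \sum_(i | P i) p i = 1 ->
  (forall i, P i -> normc (t i) <= 1) -> normc (\sum_(i | P i) (p i)%:C * t i) = 1 ->
  forall j, P j -> t j = \sum_(i | P i) (p i)%:C * t i.
Proof.
move=> p0 p1 t1 m1 j Pj; set m := \sum_(i | P i) _ in m1 *.
have [w w1 wm] := normc_dual m; rewrite m1 in wm.
have re1 (q : R[i]) : normc q <= 1 -> cRe (w * q) = 1 -> w * q = 1.
  move=> q1 re; have : normc (w * q) <= 1 by rewrite normcM w1 mul1r.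
  case: (w * q) re => a b /= -> H; apply/eqP; rewrite eq_complex /= eqxx /=.
  have : 1 ^+ 2 + b ^+ 2 <= 1.
    rewrite -[leLHS]sqr_sqrtr ?addr_ge0 ?sqr_ge0//.
    by rewrite exprn_ile1 ?sqrtr_ge0.
  rewrite expr1n gerDl => b0; have := sqr_ge0 b => b1.
  by rewrite -sqrf_eq0 eq_le b0 b1.
have S0 : \sum_(i | P i) p i * (1 - cRe (w * t i)) = 0.
  transitivity (\sum_(i | P i) p i - cRe (w * m)); last by rewrite p1 wm subrr.
  rewrite /m mulr_sumr Re_sum -sumrB; apply: eq_bigr => i _.
  by rewrite mulrCA ReM_real mulrBr mulr1.
have nn i : P i -> 0 <= p i * (1 - cRe (w * t i)).
  move=> Pi; rewrite mulr_ge0 ?(ltW (p0 i Pi))// subr_ge0.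
  rewrite (le_trans (ler_norm _))// (le_trans (normc_Re _))// normcM w1 mul1r; exact: t1.
have tj : cRe (w * t j) = 1.
  have /eqP := S0; rewrite psumr_eq0// => /allP/(_ j); rewrite mem_index_enum Pj => /(_ isT).
  by rewrite mulf_eq0 gt_eqF ?p0//= subr_eq0 => /eqP <-.
have E1 := re1 _ (t1 j Pj) tj.
have E2 : w * m = 1 by apply: re1 => //; rewrite m1.
have w0 : w != 0 by apply/eqP => w0; rewrite w0 normc0 in w1; move/eqP: w1; rewrite eq_sym oner_eq0.
by apply: (mulfI w0); rewrite E1 E2.
Qed.

End unimodular_average.

(** * Decay at intermediate frequencies from the non-lattice condition *)

Section nonlattice.
Context {R : realType} {A : aperiodic_matrix} {theta : R}.
Local Notation S := (shift_space A theta).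
Implicit Types (x y z : S) (u v : S -> R[i]).

(** Take arguments G of W and b of c in [-pi, pi]: the equation says that u f + G - b - G o shift is
    2 pi times an integer, and this integer is bounded because every other term is. Division by u
    gives the lattice form of f. *)
Lemma lattice_of_eigen (f : S -> R) (b0 : R) (u : R) (W : S -> R[i]) (c : R[i]) :
  (forall x, `|f x| <= b0) -> u != 0 ->
  (forall x, normc (W x) = 1) ->
  (forall x, cexp (Complex 0 u * (f x)%:C) * W x = c * W (sg x)) -> lattice f.
Proof.
move=> fb u0 W1 H.
have c1 : normc c = 1.
  have := congr1 (@normc R) (H point); rewrite !normcM !W1 !mulr1 => <-.
  by rewrite normc_cexp /= !mul0r ?mulr0 subrr expR0.
have /choice[G GP] : forall x, exists t : R, `|t| <= pi /\ W x = cexp (Complex 0 t).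
  by move=> x; have [t t1 tw] := unimodular_angle (W1 x); exists t.
have [b bp cb] := unimodular_angle c1.
have p0 : 0 < pi *+ 2 :> R by rewrite pmulrn_lgt0// pi_gt0.
have /choice[Z ZP] : forall x, exists k : int, u * f x + G x - b - G (sg x) = pi *+ 2 * k%:~R.
  move=> x; apply: cexp_imag_eq1.
  have -> : Complex 0 (u * f x + G x - b - G (sg x)) =
    (Complex 0 u * (f x)%:C + Complex 0 (G x)) - (Complex 0 b + Complex 0 (G (sg x))) :> R[i].
    apply/eqP; rewrite eq_complex /= !mul0r !mulr0 !addr0 !subrr ?oppr0 ?add0r eqxx /=.
    by apply/eqP; ring.
  rewrite cexpD cexpN !cexpD -cb -!(GP _).2 (H x) divff//.
  apply/eqP => /(congr1 (@normc R)); rewrite normcM c1 W1 mul1r normc0 => /eqP.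
  by rewrite oner_eq0.
have ZB x : `|(Z x)%:~R| <= (`|u| * b0 + pi *+ 3) / (pi *+ 2) :> R.
  rewrite ler_pdivlMr// -[X in _ * X]ger0_norm ?(ltW p0)// -normrM mulrC -ZP.
  have h1 := (GP x).1; have h2 := (GP (sg x)).1.
  rewrite (le_trans (ler_normB _ _))// (le_trans (lerD (ler_normB _ _) (lexx _)))//.
  rewrite (le_trans (lerD (lerD (ler_normD _ _) (lexx _)) (lexx _)))// normrM.
  have : `|u| * `|f x| <= `|u| * b0 by rewrite ler_wpM2l.
  rewrite !mulrS mulr0n addr0; lra.
exists (b / u), ((pi *+ 2) / u), (fun x => G x / u), Z; split.
- by exists (pi / `|u|) => x; rewrite normrM normfV ler_wpM2r ?invr_ge0//; exact: (GP x).1.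
- exists (Num.ceil ((`|u| * b0 + pi *+ 3) / (pi *+ 2))) => x.
  rewrite -(ler_int R) (le_trans _ (ceil_ge _))//.
  by rewrite intr_norm.
- move=> x; have := ZP x => E; apply: (mulfI u0).
  have -> : u * (G (sg x) / u - G x / u + b / u + (pi *+ 2) / u * (Z x)%:~R) =
    G (sg x) - G x + b + (pi *+ 2) * (Z x)%:~R by field.
  by rewrite -E; ring.
Qed.

Variables (p : @nweight R A theta) (f : S -> R) (B : R).
Hypothesis B1 : 1 <= B.
Hypothesis f_lip : lip (cplx f) B.
Hypothesis f_bdd : bdd (cplx f) B.
Let th01 := nw_th p.
Local Notation D := (nw_D p).
Local Notation c := (nw_c p).
Local Notation Mr := (tr p).
Local Notation M := (tr (fun x => (p x)%:C)).
Local Notation Mu u := (tr (pw p f (Complex 0 u))).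

Let B0 : 0 <= B. Proof. exact: le_trans B1. Qed.
Let p0 x : 0 <= p x. Proof. exact: le_trans (ltW (nw_c0 p)) (nw_lb p x). Qed.

Lemma normc_osc_factor (u a : R) : normc (cexp (Complex 0 u * a%:C)) = 1.
Proof. by rewrite normc_cexp /= !mul0r ?mulr0 subrr expR0. Qed.

Lemma Mu_le (u : R) v x : normc (Mu u v x) <= Mr (fun y => normc (v y)) x.
Proof.
rewrite /tr (le_trans (normc_sum _ _ _))//; apply: ler_sum => i _.
by rewrite !normcM normc_osc_factor mulr1 normc_real ger0_norm.
Qed.

Lemma iter_Mu_le (u : R) n v x : normc (iter n (Mu u) v x) <= iter n Mr (fun y => normc (v y)) x.
Proof.
elim: n x => //= n IH x; rewrite (le_trans (Mu_le _ _ _))//.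
exact: tr_le.
Qed.

Lemma Mu_bdd (u : R) v s : bdd v s -> bdd (Mu u v) s.
Proof.
move=> vs x; rewrite (le_trans (Mu_le _ _ _))//.
have -> : s = Mr (fun=> s) x by rewrite Mr_cst.
exact: tr_le.
Qed.

Lemma iter_Mu_bdd (u : R) n v s : bdd v s -> bdd (iter n (Mu u) v) s.
Proof. by move=> vs; elim: n => //= n; exact: Mu_bdd. Qed.

Definition Uc (a0 : R) := a0 * B * expR (a0 * B).

Lemma osc_factor_lip (u a0 : R) : `|u| <= a0 ->
  lip (fun x => cexp (Complex 0 u * (f x)%:C)) (Uc a0).
Proof.
move=> ua x y.
set a := Complex 0 u * (f x)%:C; set b := Complex 0 u * (f y)%:C.
have -> : cexp a - cexp b = cexp b * (cexp (a - b) - 1).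
  have -> : cexp a = cexp b * cexp (a - b) by rewrite -cexpD addrC subrK.
  by ring.
rewrite normcM normc_osc_factor mul1r (le_trans (cexp_taylor1 _))//.
have nab : normc (a - b) <= a0 * B * dtheta x y.
  rewrite /a /b -mulrBr normcM -mulrA.
  apply: ler_pM; [exact: normc_ge0|exact: normc_ge0| |exact: f_lip].
  by rewrite /normc /= expr0n add0r sqrtr_sqr.
have a00 : 0 <= a0 by exact: le_trans (normr_ge0 _) ua.
have d1 := d_le1 th01 x y; have d0 := d_ge0 th01 x y.
rewrite /Uc mulrAC ler_pM ?normc_ge0 ?expR_ge0// ler_expR.
by rewrite (le_trans nab)// ler_piMr// mulr_ge0.
Qed.

Lemma Mu_lip (u a0 : R) v s l : `|u| <= a0 -> bdd v s -> lip v l ->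
  lip (Mu u v) (theta * l + (Uc a0 + 2 * D) * s).
Proof.
move=> ua vs vl.
have s0 : 0 <= s by exact: le_trans (normc_ge0 _) (vs point).
have l0 : 0 <= l.
  have [x [y xy]] : exists x y : S, val x 0%N != val y 0%N.
    have k2 := kappa_ge2 A.
    have [m mP] := @exists_preimage R A theta; have [M' M1 AM] := transition_aperiodic A.
    pose i0 := Ordinal (ltnW k2); pose i1 := Ordinal k2.
    have [z zx zi] := exists_path (AM i0 (val (point : S) 0%N)) (erefl (val (point : S) 0%N)).
    have [z' zx' zi'] := exists_path (AM i1 (val (point : S) 0%N)) (erefl (val (point : S) 0%N)).
    by exists z, z'; rewrite zi zi'.
  by have := vl x y; rewrite d_head// mulr1; apply: le_trans; exact: normc_ge0.
rewrite tr_pw.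
have a00 : 0 <= a0 by exact: le_trans (normr_ge0 _) ua.
have fb1 : bdd (fun x => cexp (Complex 0 u * (f x)%:C)) 1 by move=> x; rewrite normc_osc_factor.
have b1 := bddM fb1 vs; rewrite mul1r in b1.
have U0 : 0 <= Uc a0 by rewrite /Uc !mulr_ge0 ?expR_ge0.
have l1 := lipM fb1 (osc_factor_lip ua) vs vl; rewrite mul1r in l1.
have l1' : 0 <= l + Uc a0 * s by rewrite addr_ge0// mulr_ge0.
have o1 : osc (fun x => cexp (Complex 0 u * (f x)%:C) * v x) (2 * s).
  by move=> x y; rewrite (le_trans (normcB _ _))// mulr_natl mulr2n lerD//; exact: b1.
apply: lip_le (lip_M p l1' l1 o1) => //.
have /andP[t0 t1] := th01.
have : theta * (Uc a0 * s) <= 1 * (Uc a0 * s) by rewrite ler_wpM2r ?mulr_ge0// ltW.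
lra.
Qed.

Definition Ec (a0 : R) := (Uc a0 + 2 * D) / (1 - theta).

Lemma iter_Mu_lip (u a0 : R) v s l n : `|u| <= a0 -> bdd v s -> lip v l ->
  lip (iter n (Mu u) v) (theta ^+ n * l + Ec a0 * s).
Proof.
move=> ua vs vl; have /andP[t0 t1] := th01.
have s0 : 0 <= s by exact: le_trans (normc_ge0 _) (vs point).
have a00 : 0 <= a0 by exact: le_trans (normr_ge0 _) ua.
have E0 : 0 <= Ec a0.
  rewrite /Ec divr_ge0 ?subr_ge0 ?(ltW t1)// addr_ge0//; first by rewrite /Uc !mulr_ge0 ?expR_ge0.
  by rewrite mulr_ge0// (le_trans _ (nw_D1 p)).
elim: n => [|n IH]; first by apply: lip_le vl => //; rewrite mul1r lerDl mulr_ge0.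
apply: lip_le (Mu_lip ua (iter_Mu_bdd u n vs) IH) => //.
apply: le_of_eq; rewrite exprS /Ec; field.
by rewrite gt_eqF// subr_gt0.
Qed.


Local Notation E0 a0 := (2 * (Ec a0 + 1)).

Lemma Ec_ge0 a0 : 0 <= a0 -> 0 <= Ec a0.
Proof.
move=> a00; have /andP[t0 t1] := th01.
rewrite /Ec divr_ge0 ?subr_ge0 ?(ltW t1)// addr_ge0//; first by rewrite /Uc !mulr_ge0 ?expR_ge0.
by rewrite mulr_ge0// (le_trans _ (nw_D1 p)).
Qed.

(** The constant 2 (Ec + 1) is large enough for the ball with sup norm s and Lipschitz constant
    [E0 a0] s to be invariant, uniformly in |u| <= a0. *)
Lemma Mu_ball (u a0 : R) n v s : 0 <= s -> `|u| <= a0 -> bdd v s -> lip v (E0 a0 * s) ->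
  bdd (iter n (Mu u) v) s /\ lip (iter n (Mu u) v) (E0 a0 * s).
Proof.
move=> s0 ua vs vl; have /andP[t0 t1] := th01.
have a00 : 0 <= a0 by exact: le_trans (normr_ge0 _) ua.
have e0 := Ec_ge0 a00.
split; first exact: iter_Mu_bdd.
elim: n => //= n IH.
apply: lip_le (Mu_lip ua (iter_Mu_bdd u n vs) IH) => //.
have -> : Uc a0 + 2 * D = Ec a0 * (1 - theta).
  by rewrite /Ec mulfVK// gt_eqF// subr_gt0.
rewrite mulrA -mulrDl ler_wpM2r//.
have : theta * 1 <= 1 * 1 by rewrite ler_wpM2r// ltW.
have : theta * Ec a0 <= 1 * Ec a0 by rewrite ler_wpM2r// ltW.
lra.
Qed.

(** Each branch of length n carries weight at least c^n, so a modulus close to 1 after n steps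
    forces a modulus close to 1 at every preimage of order n, the deficit being multiplied by at
    most c^(-n). *)
Lemma near_extreme (u : R) n v z (eta : R) : bdd v 1 ->
  1 - c ^+ n * eta < normc (iter n (Mu u) v (iter n sg z)) -> 1 - eta < normc (v z).
Proof.
move=> v1 H.
have := @iter_Mr_ge _ _ _ p n (fun y => 1 - normc (v y)) z.
have -> : iter n Mr (fun y => 1 - normc (v y)) (iter n sg z) =
    1 - iter n Mr (fun y => normc (v y)) (iter n sg z).
  by rewrite (@iter_trB R A theta R p n (fun=> 1) (fun y => normc (v y))) iter_Mr_cst.
move=> /(_ (fun x => _)) H1.
have {}H1 : c ^+ n * (1 - normc (v z)) <= 1 - iter n Mr (fun y => normc (v y)) (iter n sg z).
  by apply: H1 => x; rewrite subr_ge0; exact: v1.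
have := iter_Mu_le u n v (iter n sg z).
have cn : 0 < c ^+ n by rewrite exprn_gt0// nw_c0.
move=> H2; have : c ^+ n * (1 - normc (v z)) < c ^+ n * eta by lra.
by rewrite ltr_pM2l//; lra.
Qed.

Section limit_point.
Variables (a0 u0 : R).
Hypothesis u00 : 0 < u0.
Hypothesis a00 : u0 <= a0.
Variables (u : nat -> R) (v : nat -> S -> R[i]) (x : nat -> S) (N0 : nat).
Hypothesis ur : forall k, u0 <= `|u k| <= a0.
Hypothesis v1 : forall k, bdd (v k) 1.
Hypothesis vl : forall k, lip (v k) (E0 a0).
Hypothesis far : forall k, 1 - c ^+ (N0 + k) * k.+1%:R^-1 < normc (iter (N0 + k) (Mu (u k)) (v k) (x k)).

Let vj j k := iter j (Mu (u k)) (v k).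

Let vj1 j k : bdd (vj j k) 1.
Proof. exact: iter_Mu_bdd. Qed.

Let vjl j k : lip (vj j k) (E0 a0).
Proof.
have /andP[_ ua] := ur k.
by have := (@Mu_ball (u k) a0 j (v k) 1 ler01 ua (v1 k)); rewrite mulr1 => /(_ (vl k)) [].
Qed.

(** The hypotheses express the failure of uniform contraction. The ultralimits of the iterates are
    unimodular everywhere and are averages of one another; strict convexity turns the averaging
    relation into a multiplicative one, which is the lattice condition up to a constancy
    argument. *)
Lemma limit_lattice : lattice f.
Proof.
have /andP[t0 t1] := th01.
have [us usP] : exists l : R, u n @[n --> uoo] --> l.
  by apply: (@uoo_cvg_real R _ a0) => k; have /andP[] := ur k.
have us0 : us != 0.
  have usn : `|u n| @[n --> uoo] --> `|us| by apply: cvg_norm.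
  have : u0 <= `|us|.
    apply: (ler_cvg_to _ usn); first exact: cvg_cst.
    by apply: nearW => k; have /andP[] := ur k.
  by move=> h; rewrite -normr_gt0 (lt_le_trans u00).
have /choice[W WP] : forall jz : nat * S, exists l, ulim (fun k => vj jz.1 k jz.2) l.
  by move=> jz; apply: (@uoo_lim R _ 1) => k; exact: vj1.
pose Wj j z := W (j, z).
have WjP j z : ulim (fun k => vj j k z) (Wj j z) := WP (j, z).
have [m mP] := @exists_preimage R A theta.
(* Some preimage of x k, of the remaining order, lies close to any prescribed z; near-extremality
   there transfers to z by the uniform Lipschitz bound. *)
have near1 j z e : 0 < e -> \forall k \near uoo, 1 - e <= normc (vj j k z).
  move=> e0.
  have [K _ HK] : \forall n \near \oo, `|E0 a0 * theta ^+ n| <= e / 2.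
    have : (E0 a0 * theta ^+ n) @[n --> \oo] --> E0 a0 * 0.
      by apply: cvgMl_tmp; apply: cvg_expr; rewrite ger0_norm ?(ltW t0).
    by rewrite mulr0 => /cvgr0_norm_le /(_ (e/2) (divr_gt0 e0 (ltr0n _ 2))).
  apply: uoo_near; near=> k.
  have jk : (j + m <= N0 + k)%N.
    by rewrite (leq_trans _ (leq_addl _ _))//; near: k; exact: nbhs_infty_ge.
  set q := (N0 + k - (j + m))%N.
  have qE : (q + m + j = N0 + k)%N by rewrite /q; lia.
  have [y yx yz] := mP q (x k) z.
  have := far k; rewrite -qE iterD -/(vj j k) => F.
  have F' : 1 - c ^+ (q + m) * k.+1%:R^-1 < normc (iter (q + m) (Mu (u k)) (vj j k) (iter (q + m) sg y)).
    rewrite yx (le_lt_trans _ F)// lerD2l lerN2 ler_wpM2r//.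
    by rewrite exprD ler_piMr ?exprn_ge0 ?exprn_ile1 ?c_le1 ?(ltW (nw_c0 p)).
  have ny := near_extreme (vj1 j k) F'.
  have dzy : dtheta z y <= theta ^+ q.
    by rewrite d_sym; apply: d_le_agree => // i iq; rewrite yz// ltnW.
  have := vjl j k y z; rewrite d_sym => H.
  have E00 : 0 <= E0 a0 by rewrite mulr_ge0// addr_ge0// Ec_ge0// (le_trans (ltW u00)).
  have h1 : E0 a0 * dtheta z y <= E0 a0 * theta ^+ q by rewrite ler_wpM2l.
  have h2 : E0 a0 * theta ^+ q <= e / 2.
    rewrite (le_trans (ler_norm _))//; apply: HK => /=.
    have hk : (K + j + m <= k)%N by near: k; exact: nbhs_infty_ge.
    by rewrite /q leq_subRL// addnC addnA (leq_trans hk)// leq_addl.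
  have h3 : k.+1%:R^-1 <= e / 2.
    rewrite -[leRHS]invrK lef_pV2 ?posrE ?invr_gt0 ?divr_gt0//.
    rewrite (le_trans _ (_ : k%:R <= _)) ?ler_nat//.
    by near: k; exact: nbhs_infty_ger.
  have h4 := le_trans (normc_ler_sub _ _) (le_trans H (le_trans h1 h2)).
  have aux (a b1 b2 t : R) : 1 - a < b1 -> a <= t / 2 -> b1 - b2 <= t / 2 -> 1 - t <= b2 by lra.
  exact: aux ny h3 h4.
have W1 j z : normc (Wj j z) = 1.
  apply: (ulim_norm_eq (WjP j z)) => [k|e e0]; first exact: vj1.
  exact: near1.
have WS j z : Wj j.+1 z = Mu us (Wj j) z.
  apply: (ulim_unique (WjP j.+1 z)).
  rewrite /tr; apply: ulim_sum => i iz.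
  apply: (@ulimM _ _ _ _ _ 1) => [k||]; [exact: vj1| |exact: WjP].
  apply: (@ulimM _ _ _ _ _ 1) => [k||]; [by rewrite normc_osc_factor|exact: ulim_cst|].
  exact: ulim_cexp.
have WE j y : cexp (Complex 0 us * (f y)%:C) * Wj j y = Wj j.+1 (sg y).
  rewrite WS /tr.
  have E1 : \sum_(i | adm i (sg y)) pw p f (Complex 0 us) (scons i (sg y)) * Wj j (scons i (sg y)) =
    \sum_(i | adm i (sg y)) (p (scons i (sg y)))%:C * (cexp (Complex 0 us * (f (scons i (sg y)))%:C) * Wj j (scons i (sg y))).
    by apply: eq_bigr => i _; rewrite /pw mulrA.
  have N1 : normc (Wj j.+1 (sg y)) = 1 by [].
  rewrite WS /tr E1 in N1; rewrite E1.
  have := @average_extreme R _ (fun i => adm i (sg y)) (fun i => p (scons i (sg y)))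
    (fun i => cexp (Complex 0 us * (f (scons i (sg y)))%:C) * Wj j (scons i (sg y))).
  move=> /(_ _ (nw_sum p _) _ N1 (val y 0%N) (adm_shift y)); rewrite scons_shift; apply.
  - by move=> i _; exact: lt_le_trans (nw_c0 p) (nw_lb p _).
  - by move=> i _; rewrite normcM normc_osc_factor W1 mulr1.
have E00 : 0 <= E0 a0 by rewrite mulr_ge0// addr_ge0// Ec_ge0// (le_trans (ltW u00)).
have Wl j : lip (Wj j) (E0 a0).
  move=> y z; apply/ler_addgt0Pr => e e0.
  near uoo => k.
  have h1 : normc (vj j k y - Wj j y) < e / 2 by near: k; apply: WjP; rewrite divr_gt0.
  have h2 : normc (vj j k z - Wj j z) < e / 2 by near: k; apply: WjP; rewrite divr_gt0.
  have h3 := vjl j k y z.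
  rewrite (_ : Wj j y - _ = - (vj j k y - Wj j y) + (vj j k y - vj j k z) + (vj j k z - Wj j z)); last by ring.
  rewrite (le_trans (normcD _ _))//; have := normcD (- (vj j k y - Wj j y)) (vj j k y - vj j k z).
  rewrite normcN; lra.
have W0 j z : Wj j z != 0.
  by apply/eqP => w0; have := W1 j z; rewrite w0 normc0 => /eqP; rewrite eq_sym oner_eq0.
(* Consecutive limits may differ; it is their ratio that has to be a constant, the future
   eigenvalue. It satisfies g_(j+1) o shift = g_j, hence M^n g_j = g_(j+n). *)
pose g j z := Wj j.+1 z / Wj j z.
have gl j : lip (g j) (2 * E0 a0).
  move=> y z; rewrite /g.
  have -> : Wj j.+1 y / Wj j y - Wj j.+1 z / Wj j z =
    (Wj j.+1 y - Wj j.+1 z) / Wj j y - Wj j.+1 z * (Wj j y - Wj j z) / (Wj j y * Wj j z).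
    by field; rewrite !W0.
  rewrite (le_trans (normcB _ _))// !normcM !normcV !normcM !W1 !mulr1 !invr1 !mulr1 mul1r.
  by rewrite mulr_natl mulr2n mulrDl lerD//; exact: Wl.
have gS j y : g j.+1 (sg y) = g j y.
  rewrite /g -!WE; field; rewrite ?W0 ?cexp_neq0//.
have gn j n y : g (j + n)%N (iter n sg y) = g j y.
  elim: n y => [|n IH] y; first by rewrite addn0.
  by rewrite addnS iterS gS IH.
have [Cg [r [Cg0 r01 Hg]]] := gap p.
have gM j n : iter n M (g j) = g (j + n)%N.
  elim: n => [|n IH]; first by rewrite addn0.
  rewrite iterS IH addnS; apply/funext => z.
  have -> : g (j + n)%N = (fun y => g (j + n).+1 (sg y) * 1).
    by apply/funext => y; rewrite gS mulr1.
  by rewrite tr_mul_shift M_cst mulr1.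
(* g_j y is the value at the n-th shift of y of g_(j+n) = M^n g_j, whose Lipschitz constant tends to
   0 by the spectral gap. *)
have gc j y z : g j y = g j z.
  apply/eqP; rewrite -subr_eq0; apply/eqP/normc_eq0/eqP.
  have /andP[r0 r1] := r01.
  rewrite eq_le normc_ge0 andbT; apply: (@geom_le0 _ _ (Cg * (2 * E0 a0)) r) => [|n].
    by rewrite (ltW r0).
  rewrite -(gn j n y) -(gn j n z) -gM.
  have l0 : 0 <= 2 * E0 a0 by rewrite mulr_ge0.
  have H := Hg n _ _ l0 (gl j).
  rewrite mulrAC; apply: lip_osc => //.
  by rewrite !mulr_ge0 ?exprn_ge0 ?(ltW r0) ?(ltW Cg0)// addr_ge0// Ec_ge0// (le_trans (ltW u00)).
apply: (@lattice_of_eigen f B us (Wj 0%N) (g 0%N point)) => //.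
- by move=> y; have := f_bdd y; rewrite normc_real.
- move=> y; rewrite WE -(mulfVK (W0 0%N (sg y)) (Wj 1%N (sg y))).
  by congr (_ * _); exact: gc.
Unshelve. all: by end_near. Qed.

End limit_point.

(** Compactness in u: if no number of steps gave a uniform gain over the frequencies considered, the
    counterexamples would have a limit, and f would be a lattice function. *)
Theorem medium_decay (u0 a0 : R) : 0 < u0 -> u0 <= a0 -> ~ lattice f ->
  exists C r : R, [/\ 0 < C, 0 < r < 1 & forall u : R, u0 <= `|u| <= a0 -> forall n v a,
    nb v a -> bdd (iter n (Mu u) v) (C * r ^+ n * a)].
Proof.
move=> u00 ua0 nl; have /andP[t0 t1] := th01.
have a00 : 0 <= a0 by rewrite (le_trans (ltW u00)).
have Ec0 := Ec_ge0 a00.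
have [N0 N0P] : exists N0, theta ^+ N0 <= 1 / 4.
  have : (theta ^+ n) @[n --> \oo] --> (0 : R) by apply: cvg_expr; rewrite ger0_norm ?(ltW t0).
  move=> /cvgr0_norm_le /(_ (1 / 4)) []; first by [].
  by move=> K _ HK; exists K; rewrite (le_trans (ler_norm _))//; apply: HK => /=.
have [N [eta [NN0 eta0 H]]] : exists N (eta : R), [/\ (N0 <= N)%N, 0 < eta &
    forall (u : R) v, u0 <= `|u| <= a0 -> bdd v 1 -> lip v (E0 a0) -> bdd (iter N (Mu u) v) (1 - eta)].
  apply: contrapT => Hn; apply: nl.
  have /choice[uvx uvxP] : forall k : nat, exists q : R * (S -> R[i]) * S,
    [/\ u0 <= `|q.1.1| <= a0, bdd q.1.2 1, lip q.1.2 (E0 a0) &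
    1 - c ^+ (N0 + k) * k.+1%:R^-1 < normc (iter (N0 + k) (Mu q.1.1) q.1.2 q.2)].
    move=> k; apply: contrapT => Hk; apply: Hn.
    (* The factor c^(N0 + k) is what [near_extreme] divides by, so that a deficit of only 1 / (k +
       1) remains. *)
    exists (N0 + k)%N, (c ^+ (N0 + k) * k.+1%:R^-1); split; first exact: leq_addr.
      by rewrite mulr_gt0 ?exprn_gt0 ?nw_c0.
    move=> u v ur v1 vl x; rewrite leNgt; apply/negP => hx; apply: Hk.
    by exists (u, v, x).
  apply: (@limit_lattice a0 u0 u00 ua0 (fun k => (uvx k).1.1) (fun k => (uvx k).1.2) (fun k => (uvx k).2) N0) => k.
  - by have [] := uvxP k.
  - by have [] := uvxP k.
  - by have [] := uvxP k.
  - by have [] := uvxP k.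
(* The frequency is carried along as a component, so that [iterate_decay] yields constants common to
   all admissible u. *)
pose T (q : R * (S -> R[i])) := (q.1, Mu q.1 q.2).
have Tn n q : iter n T q = (q.1, iter n (Mu q.1) q.2).
  by elim: n => [|n IH]; [case: q|rewrite iterS IH /T].
pose Nn (q : R * (S -> R[i])) (s : R) := [/\ u0 <= `|q.1| <= a0, bdd q.2 s & lip q.2 (E0 a0 * s)].
have E00 : 0 <= E0 a0 by rewrite mulr_ge0// addr_ge0.
have bscale v s : bdd v s -> 0 < s -> bdd (fun x => (s^-1)%:C * v x) 1.
  move=> vs s0 x; rewrite normcM normc_real ger0_norm ?invr_ge0 ?(ltW s0)//.
  by rewrite ler_pdivrMl// mulr1.
have [||||[u v] s s0 [/= ur vs vl]|[u v] s s0 [/= ur vs vl]|C [r [C0 r01 HC]]] :=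
  @iterate_decay R _ T Nn N.+1 1 (Num.max (1 - eta) (3 / 4)).
- move=> [u v] s t st [/= ur vs vl]; split => //=; first exact: bdd_le vs.
  by apply: lip_le vl => //; rewrite ler_wpM2l.
- by [].
- by [].
- by rewrite lt_max gt_max; lra.
- rewrite mul1r; have /andP[_ ua] := ur.
  by have [] := Mu_ball 1 s0 ua vs vl; split.
- rewrite Tn; have /andP[_ ua] := ur; set rho := Num.max _ _.
  have rho34 : 3 / 4 <= rho by rewrite /rho le_max lexx orbT.
  split => //=.
    apply: Mu_bdd; apply: (@bdd_le _ _ _ _ ((1 - eta) * s)).
      by rewrite ler_wpM2r// /rho le_max lexx.
    have [sE|sn0] := eqVneq s 0.
      by move: vs vl; rewrite sE => vs vl; rewrite mulr0; have [] := Mu_ball N (lexx 0) ua vs vl.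
    have s0' : 0 < s by rewrite lt_def sn0.
    have vl1 : lip (fun x => (s^-1)%:C * v x) (E0 a0).
      have := lipZ (s^-1)%:C vl; apply: lip_le => //.
      by rewrite normc_real ger0_norm ?invr_ge0// mulrC mulfK.
    move=> x; have := H u _ ur (bscale v s vs s0') vl1 x.
    rewrite iter_trZ normcM normc_real ger0_norm ?invr_ge0//.
    by rewrite ler_pdivrMl// mulrC.
  apply: lip_le (iter_Mu_lip N.+1 ua vs vl) => //.
  have : theta ^+ N.+1 * (E0 a0 * s) <= 1 / 4 * (E0 a0 * s).
    apply: ler_wpM2r; first exact: mulr_ge0.
    rewrite (le_trans _ N0P)//.
    by rewrite ler_wiXn2l ?(ltW t0) ?(ltW t1)// ltnW// ltnS.
  have : 3 / 4 * (E0 a0 * s) <= rho * (E0 a0 * s).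
    by apply: ler_wpM2r => //; exact: mulr_ge0.
  have : 0 <= Ec a0 * s by rewrite mulr_ge0.
  lra.
exists C, r; split => // u ur n v a va.
have := HC n (u, v) a (nb_ge0 va); rewrite Tn.
case; first by split => //=; [exact: va.1|apply: lip_le va.2; rewrite // ler_peMl ?(nb_ge0 va)//; lra].
by [].
Qed.

End nonlattice.

(** * Periodic points and words *)

Section periodic_words.
Context {R : realType} {A : aperiodic_matrix} {theta : R}.
Local Notation S := (shift_space A theta).
Local Notation I := 'I_(kappa A).
Implicit Types (x y z : S) (w : seq I).

Definition word n x : seq I := [seq val x j | j <- iota 0 n].

Lemma wordS n x : word n.+1 x = val x 0%N :: word n (sg x).
Proof. by rewrite /word /= -[1%N]/(1 + 0)%N iotaDl -map_comp. Qed.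

Lemma size_word n x : size (word n x) = n.
Proof. by rewrite size_map size_iota. Qed.

Lemma take_word m n x : (m <= n)%N -> take m (word n x) = word m x.
Proof. by move=> mn; rewrite /word -map_take take_iota (minn_idPl mn). Qed.

Lemma word_agree n x y : word n x = word n y -> agree x y n.
Proof.
elim: n x y => [//|n IH] x y; rewrite !wordS => -[xy /IH H] [|j] jn //.
exact: (H j jn).
Qed.

Lemma agree_word n x y : agree x y n -> word n x = word n y.
Proof.
by move=> H; apply/eq_in_map => j; rewrite mem_iota add0n => /andP[_]; apply: H.
Qed.

Lemma wcat_word n x : wcat (word n x) (iter n sg x) = x.
Proof.
elim: n x => [//|n IH] x.
by rewrite iterSr wordS /= IH scons_shift.
Qed.

Lemma wok_word n x : wok (word n x) (iter n sg x).
Proof.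
elim: n x => [//|n IH] x; rewrite iterSr wordS /= IH wcat_word andbT.
exact: adm_shift.
Qed.

Lemma word_wcat w x : wok w x -> word (size w) (wcat w x) = w.
Proof.
elim: w => [//|i w IH] /= /andP[iw wx].
by rewrite wordS val_scons// shift_scons// IH.
Qed.

Lemma wcat_head w x y : wok w x -> wok w y -> val x 0%N = val y 0%N ->
  val (wcat w x) 0%N = val (wcat w y) 0%N.
Proof. by case: w => [//|i w] /= /andP[ix _] /andP[iy _] _; rewrite !val_scons. Qed.

Lemma wok_head w x y : val x 0%N = val y 0%N -> wok w x = wok w y.
Proof.
move=> xy; elim: w => [//|i w IH] /=; rewrite IH.
case: (boolP (wok w y)) => wy; last by rewrite !andbF.
by rewrite !andbT; apply: adm_head; apply: wcat_head; rewrite ?IH.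
Qed.

Lemma wok_cat w1 w2 x : wok (w1 ++ w2) x = wok w2 x && wok w1 (wcat w2 x).
Proof.
elim: w1 => [|i w1 IH] /=; first by rewrite andbT.
by rewrite IH /wcat foldr_cat; rewrite andbCA.
Qed.

Lemma wcat_cat w1 w2 x : wcat (w1 ++ w2) x = wcat w1 (wcat w2 x).
Proof. exact: foldr_cat. Qed.

Lemma d_wcat w x y : 0 < theta < 1 -> wok w x -> wok w y ->
  dtheta (wcat w x) (wcat w y) = theta ^+ size w * dtheta x y.
Proof.
move=> th01; elim: w => [|i w IH]; first by rewrite mul1r.
by move=> /= /andP[ix wx] /andP[iy wy]; rewrite d_scons// IH// mulrA -exprS.
Qed.

(** The repeated block is admissible because the symbol at n, which may follow the one at n - 1,
    equals the symbol at 0. *)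
Lemma periodize n z : (0 < n)%N -> val z n = val z 0%N ->
  exists2 y, iter n sg y = y & agree y z n.
Proof.
move=> n0 zn.
have adm : (fun j => val z (j %% n)%N) \in admissible A.
  apply/mem_set => j.
  have [/eqP H|H] := eqVneq (j.+1 %% n)%N 0%N.
    rewrite (eqP H) -zn.
    have nE : n = (j %% n).+1.
      apply/eqP; rewrite eqn_leq ltn_pmod// andbT.
      have := H; rewrite -addn1 -modnDml addn1 => /eqP H'.
      rewrite leqNgt; apply/negP => jn; move: H'; by rewrite modn_small.
    by have := admissibleP z (j %% n)%N; rewrite -nE.
  have -> : (j.+1 %% n = (j %% n).+1)%N.
    move: H; rewrite -[X in (X %% n)%N]addn1 -modnDml addn1 => H.
    rewrite modn_small// ltn_neqAle ltn_pmod// andbT.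
    by apply: contraNneq H => ->; rewrite modnn.
  exact: admissibleP.
exists (exist (fun a => a \in admissible A) _ adm : S).
  apply: shift_space_ext => j; rewrite val_iter_shift /=.
  by rewrite modnDl.
by move=> j jn /=; rewrite modn_small.
Qed.

Lemma periodic_val n x j : iter n sg x = x -> val x j = val x (j %% n)%N.
Proof.
move=> xn; rewrite {1}(divn_eq j n); elim: (j %/ n)%N => [//|k IH].
by rewrite mulSn -addnA -val_iter_shift xn.
Qed.

Lemma word_periodic_inj n x y : iter n sg x = x -> iter n sg y = y ->
  (0 < n)%N -> word n x = word n y -> x = y.
Proof.
move=> xn yn n0 /word_agree xy; apply: shift_space_ext => j.
by rewrite (periodic_val _ xn) (periodic_val _ yn) xy// ltn_pmod.
Qed.

Lemma finite_periodic n : (0 < n)%N -> finite_set (@periodic_points R A theta n).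
Proof.
move=> n0; pose g w : S := xget point [set y | iter n sg y = y /\ word n y = w].
apply: (@sub_finite_set _ _ (g @` [set` words n])); last first.
  by apply: finite_image; exact: finite_seq.
move=> y /= yn; exists (word n y) => /=; first by rewrite mem_words size_word.
rewrite /g; case: xgetP => [z _ [zn zy]|/(_ y)[]//].
exact: (word_periodic_inj zn yn n0).
Qed.

Lemma big_words_cat (V : nmodType) m k (F : seq I -> V) :
  \sum_(w <- words (m + k)) F w = \sum_(w1 <- words m) \sum_(w2 <- words k) F (w1 ++ w2).
Proof.
elim: m F => [|m IH] F; first by rewrite add0n [words 0]/= big_seq1.
by rewrite addSn !big_words; apply: eq_bigr => i _; rewrite IH.
Qed.

Lemma iter_tr_cylinder (K : comNzRingType) (phi : S -> K) w z :
  iter (size w) (tr phi) (fun z => (word (size w) z == w)%:R) z =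
  if wok w z then bprod phi (size w) (wcat w z) else 0.
Proof.
rewrite iter_trE big_mkcond (bigD1_seq w) ?words_uniq ?mem_words//= big1_seq ?addr0.
  by case: ifP => // wz; rewrite word_wcat// eqxx mulr1.
move=> w' /andP[w'w]; rewrite mem_words => /eqP w's; case: ifP => // w'z.
by rewrite -w's word_wcat// (negbTE w'w) mulr0.
Qed.

(** A periodic point is its word followed by itself. Replacing the tail by the point X of the
    cylinder of the first m symbols makes the sum over periodic points an exact sum of iterates of
    cylinder functions at the points X. *)
Lemma sum_periodic (K : comNzRingType) (X : seq I -> S) (m k : nat) (phi : S -> K) :
  (0 < m)%N ->
  (forall w x, word m x = w -> word m (X w) = w) ->
  \sum_(y \in @periodic_points R A theta (m + k)) bprod phi (m + k) (wcat (word (m + k) y) (X (word m y))) =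
  \sum_(w <- words m) iter k (tr phi) (iter m (tr phi) (fun z => (word m z == w)%:R)) (X w).
Proof.
move=> m0 Xw; have n0 : (0 < m + k)%N by rewrite addn_gt0 m0.
have fP := finite_periodic n0.
rewrite fsbig_finite//=.
(* As X (take m w) begins with the first symbol of w, this says that w is cyclically admissible,
   that is, the word of a periodic point. *)
pose Q (w : seq I) := wok w (X (take m w)).
have wdrop y w : word (m + k) y = w -> w = take m w ++ drop m w by rewrite cat_take_drop.
transitivity (\sum_(w <- words (m + k) | Q w) bprod phi (m + k) (wcat w (X (take m w)))).
  rewrite -[RHS]big_filter.
  transitivity (\sum_(w <- [seq word (m + k) y | y <- fset_set (@periodic_points R A theta (m + k))])
      bprod phi (m + k) (wcat w (X (take m w)))).
    by rewrite big_map; apply: eq_bigr => y _; rewrite take_word ?leq_addr.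
  apply: perm_big; apply: uniq_perm.
  - rewrite map_inj_in_uniq ?fset_uniq// => y y'; rewrite !in_fset_set// => /set_mem yP /set_mem y'P.
    exact: word_periodic_inj.
  - by rewrite filter_uniq// words_uniq.
  - move=> w; rewrite mem_filter mem_words; apply/mapP/idP.
      move=> [y]; rewrite in_fset_set// => /set_mem /= yn ->; rewrite size_word eqxx andbT.
      rewrite /Q take_word ?leq_addr// -(@wok_head _ y) ?{2}yn; last first.
        have := Xw (word m y) y erefl; case: (m) m0 => // m' _ /word_agree -> //.
      by rewrite -[X in wok _ X]yn wok_word.
    move=> /andP[Qw /eqP wn].
    set x := X (take m w) in Qw; set z := wcat w x.
    have wz : word (m + k) z = w by rewrite -wn word_wcat.
    have zn : iter (m + k) sg z = x by rewrite -wn iter_shift_wcat.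
    have xm : word m x = take m w.
      by apply: (Xw _ z); rewrite -wz take_word// leq_addr.
    have z0 : val z (m + k)%N = val z 0%N.
      rewrite -[(m + k)%N]addn0 -val_iter_shift zn.
      have : word m x = word m z by rewrite xm -wz take_word// leq_addr.
      by move=> /word_agree ->.
    have [y yn yz] := periodize n0 z0.
    exists y; first by rewrite in_fset_set//; apply/mem_set.
    by rewrite -wz; apply: agree_word => j jn; rewrite yz.
rewrite big_mkcond big_words_cat; apply: eq_big_seq => w1; rewrite mem_words => /eqP w1m.
rewrite iter_trE [RHS]big_mkcond; apply: eq_big_seq => w2; rewrite mem_words => /eqP w2k.
have tE : take m (w1 ++ w2) = w1 by rewrite -w1m take_size_cat.
have := iter_tr_cylinder phi w1 (wcat w2 (X w1)); rewrite w1m => cE.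
rewrite /Q tE wok_cat wcat_cat cE bprodD.
case: (boolP (wok w2 _)) => //= w2X; case: ifP => w1X; last by rewrite mulr0.
by rewrite -{2}w1m iter_shift_wcat// mulrC.
Qed.

End periodic_words.

(** * Sums over periodic points as traces of the perturbed operators *)

Section trace.
Context {R : realType} {A : aperiodic_matrix} {theta : R}.
Local Notation S := (shift_space A theta).
Local Notation I := 'I_(kappa A).
Implicit Types (x y : S) (w : seq I).

Variables (p : @nweight R A theta) (f : S -> R) (B : R).
Hypothesis B1 : 1 <= B.
Hypothesis f_lip : lip (cplx f) B.
Hypothesis f_bdd : bdd (cplx f) B.
Let th01 := nw_th p.
Local Notation D := (nw_D p).
Local Notation c := (nw_c p).
Local Notation Mr := (tr p).
Local Notation phi u := (pw p f (Complex 0 u)).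

Let B0 : 0 <= B. Proof. exact: le_trans B1. Qed.
Let p0 x : 0 <= p x. Proof. exact: le_trans (ltW (nw_c0 p)) (nw_lb p x). Qed.
Let D0 : 0 <= D. Proof. exact: le_trans (nw_D1 p). Qed.
Let th0 : 0 < theta. Proof. by case/andP: th01. Qed.
Let th1 : theta < 1. Proof. by case/andP: th01. Qed.
Let th1' : 0 < 1 - theta. Proof. by rewrite subr_gt0. Qed.

Lemma birkhoffS (F : S -> R) n x : birkhoff F n.+1 x = F x + birkhoff F n (sg x).
Proof.
rewrite /birkhoff big_nat_recl//; congr (_ + _).
by apply: eq_bigr => j _; rewrite -iterSr.
Qed.

Lemma bprod_ge0 n x : 0 <= bprod p n x.
Proof. by apply: le_trans (bprod_ge p n x); rewrite exprn_ge0// ltW// nw_c0. Qed.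

Lemma bprod_pw z n x : bprod (pw p f z) n x = (bprod p n x)%:C * cexp (z * (birkhoff f n x)%:C).
Proof.
elim: n x => [|n IH] x; first by rewrite !bprod0 /birkhoff big_geq// mulr0 cexp0 mulr1.
by rewrite !bprodS IH birkhoffS rmorphD mulrDr cexpD rmorphM /pw; ring.
Qed.

Lemma bprod_distortion w x y : wok w x -> val x 0%N = val y 0%N ->
  bprod p (size w) (wcat w x) <= expR (LY p * dtheta x y) * bprod p (size w) (wcat w y).
Proof.
move=> wx xy; have wy : wok w y by rewrite -(wok_head w xy).
have d0 := d_ge0 th01 x y.
(* The induction on w closes with the partial geometric sum as exponent; [LY] is its limit. *)
suff : bprod p (size w) (wcat w x) <=
    expR (D * (1 - theta ^+ size w) / (1 - theta) * dtheta x y) * bprod p (size w) (wcat w y).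
  move=> /le_trans; apply; apply: ler_wpM2r; first exact: bprod_ge0.
  rewrite ler_expR; apply: ler_wpM2r => //; rewrite /LY; apply: ler_wpM2r; first by rewrite invr_ge0 ltW.
  by rewrite ler_piMr// gerBl exprn_ge0// ltW.
elim: w wx wy => [|i w IH]; first by rewrite /= !bprod0 subrr mulr0 !mul0r expR0 mul1r.
move=> /= /andP[ix wx] /andP[iy wy].
rewrite !bprodS !shift_scons//; set a := wcat w x in ix *; set b := wcat w y in iy *.
have -> : D * (1 - theta ^+ (size w).+1) / (1 - theta) * dtheta x y =
    D * (theta ^+ size w * dtheta x y) + D * (1 - theta ^+ size w) / (1 - theta) * dtheta x y.
  by rewrite exprS; field; rewrite gt_eqF.
rewrite expRD mulrACA; apply: ler_pM => //; [exact: bprod_ge0| |exact: IH].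
rewrite -d_wcat// -/a -/b.
have ab : val a 0%N = val b 0%N by exact: wcat_head.
have := nw_lip p ix ab; rewrite ler_norml => /andP[_].
rewrite lerBlDr => /le_trans; apply.
rewrite mulrAC -[X in _ + X]mul1r -mulrDl; apply: ler_wpM2r; first exact: p0.
by rewrite addrC expR_ge1Dx.
Qed.

Lemma birkhoff_distortion w x y : wok w x -> val x 0%N = val y 0%N ->
  `|birkhoff f (size w) (wcat w x) - birkhoff f (size w) (wcat w y)| <= B / (1 - theta) * dtheta x y.
Proof.
move=> wx xy; have wy : wok w y by rewrite -(wok_head w xy).
have d0 := d_ge0 th01 x y.
suff : `|birkhoff f (size w) (wcat w x) - birkhoff f (size w) (wcat w y)| <=
    B * (1 - theta ^+ size w) / (1 - theta) * dtheta x y.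
  move=> /le_trans; apply; apply: ler_wpM2r => //; apply: ler_wpM2r; first by rewrite invr_ge0 ltW.
  by rewrite ler_piMr// gerBl exprn_ge0// ltW.
elim: w wx wy => [|i w IH]; first by rewrite /birkhoff !big_geq// subrr normr0 subrr mulr0 !mul0r.
move=> /= /andP[ix wx] /andP[iy wy].
rewrite !birkhoffS !shift_scons//; set a := wcat w x in ix *; set b := wcat w y in iy *.
have -> : B * (1 - theta ^+ (size w).+1) / (1 - theta) * dtheta x y =
    B * (theta ^+ size w * dtheta x y) + B * (1 - theta ^+ size w) / (1 - theta) * dtheta x y.
  by rewrite exprS; field; rewrite gt_eqF.
rewrite opprD addrACA (le_trans (ler_normD _ _))//; apply: lerD; last exact: IH.
have := f_lip (scons i a) (scons i b); rewrite /cplx -rmorphB normc_real => /le_trans; apply.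
apply: ler_wpM2l => //; rewrite d_scons// /a /b d_wcat//.
by rewrite ler_piMl ?(ltW th1)// mulr_ge0// exprn_ge0// ltW.
Qed.

Definition distc (a0 : R) := LY p * expR (LY p) + a0 * (B / (1 - theta)) * expR (a0 * (B / (1 - theta))).

Lemma distc_ge0 a0 : 0 <= a0 -> 0 <= distc a0.
Proof.
move=> a00; have Bt : 0 <= B / (1 - theta) by rewrite divr_ge0// ltW.
by rewrite addr_ge0// mulr_ge0 ?expR_ge0// ?LY_ge0// mulr_ge0.
Qed.

Lemma weight_distortion (u a0 : R) w x y : `|u| <= a0 -> wok w x -> val x 0%N = val y 0%N ->
  normc (bprod (phi u) (size w) (wcat w x) - bprod (phi u) (size w) (wcat w y))
    <= distc a0 * bprod p (size w) (wcat w y) * dtheta x y.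
Proof.
move=> ua wx xy; have wy : wok w y by rewrite -(wok_head w xy).
have a00 : 0 <= a0 by exact: le_trans (normr_ge0 _) ua.
have d0 := d_ge0 th01 x y; have d1 := d_le1 th01 x y.
have L0 := LY_ge0 p.
have h1 := bprod_distortion wx xy.
have h2 := bprod_distortion wy (esym xy).
have h3 := birkhoff_distortion wx xy.
have b0 := bprod_ge0 (size w) (wcat w y).
rewrite [dtheta y x]d_sym in h2.
rewrite !bprod_pw; move: h1 h2 h3 b0; move: (dtheta x y) d0 d1 => d d0 d1.
set a := bprod p _ (wcat w x); set b := bprod p _ (wcat w y).
set s := birkhoff f _ (wcat w x); set t := birkhoff f _ (wcat w y) => h1 h2 h3 b0.
have Ld0 : 0 <= LY p * d by exact: mulr_ge0.
have Ld : `|LY p * d| <= LY p by rewrite (ger0_norm Ld0) ler_piMr.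
have e1 := expR_sub1 Ld.
have Ld' : `|- (LY p * d)| <= LY p by rewrite normrN.
have e2 := expR_sub1 Ld'.
rewrite normrN in e2; rewrite (ger0_norm Ld0) in e1 e2.
have ab : `|a - b| <= LY p * expR (LY p) * d * b.
  have h2' : expR (- (LY p * d)) * b <= a by rewrite expRN ler_pdivrMl ?expR_gt0.
  rewrite (_ : LY p * _ * _ = LY p * d * expR (LY p)); last by ring.
  move: e1 e2; rewrite !ler_norml => /andP[_ e1] /andP[e2 _].
  apply/andP; split.
    rewrite lerNl opprB lerBlDr -lerBlDl (le_trans _ h2')//.
    rewrite -[X in X - _]mul1r -mulrBl ler_wpM2r//; lra.
  rewrite lerBlDr (le_trans h1)// -[X in _ + X]mul1r -mulrDl ler_wpM2r//; lra.
have -> : a%:C * cexp (Complex 0 u * s%:C) - b%:C * cexp (Complex 0 u * t%:C) =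
   (a - b)%:C * cexp (Complex 0 u * s%:C) + b%:C * (cexp (Complex 0 u * s%:C) - cexp (Complex 0 u * t%:C)).
  by rewrite rmorphB; ring.
rewrite (le_trans (normcD _ _))// !normcM !normc_real normc_osc_factor mulr1 (ger0_norm b0).
have -> : distc a0 * b * d = LY p * expR (LY p) * d * b +
  b * (a0 * (B / (1 - theta)) * expR (a0 * (B / (1 - theta))) * d).
  by rewrite /distc; ring.
rewrite lerD// ler_wpM2l//.
have -> : cexp (Complex 0 u * s%:C) - cexp (Complex 0 u * t%:C) =
   cexp (Complex 0 u * t%:C) * (cexp (Complex 0 u * (s - t)%:C) - 1).
  rewrite mulrBr mulr1 -cexpD; congr (cexp _ - _); rewrite rmorphB; ring.
rewrite normcM normc_osc_factor mul1r (le_trans (cexp_taylor1 _))//.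
have Bt : 0 <= B / (1 - theta) by rewrite divr_ge0// ltW.
have nu : normc (Complex 0 u * (s - t)%:C) <= a0 * (B / (1 - theta)) * d.
  rewrite normcM normc_real -mulrA; apply: ler_pM => //; first exact: normc_ge0.
  by rewrite /normc /= expr0n add0r sqrtr_sqr.
rewrite mulrAC ler_pM ?normc_ge0 ?expR_ge0// ler_expR (le_trans nu)//.
by rewrite ler_piMr// mulr_ge0.
Qed.

Definition Xh (i : I) : S := xget point [set x : S | val x 0%N = i].

Lemma Xh_head x : val (Xh (val x 0%N)) 0%N = val x 0%N.
Proof. by rewrite /Xh; case: xgetP => [y _ /= ->//|/(_ x) /=]. Qed.

(** A bound for the weight of the branch w that is uniform in its end point: one representative is
    taken in each first cylinder. Its sum over the words of a given length is [cylT], whatever the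
    length. *)
Definition cylw w : R := \sum_(j | wok w (Xh j)) expR (LY p) * bprod p (size w) (wcat w (Xh j)).

Lemma cylw_ge0 w : 0 <= cylw w.
Proof. by apply: sumr_ge0 => j _; rewrite mulr_ge0 ?expR_ge0 ?bprod_ge0. Qed.

Lemma bprod_cylw w x : wok w x -> bprod p (size w) (wcat w x) <= cylw w.
Proof.
move=> wx; have xh := Xh_head x.
have wh : wok w (Xh (val x 0%N)) by rewrite (wok_head w xh).
rewrite (le_trans (bprod_distortion wx (esym xh)))// /cylw (bigD1 (val x 0%N))//=.
rewrite -[leLHS]addr0; apply: lerD.
  rewrite ler_wpM2r ?bprod_ge0// ler_expR ler_piMr ?LY_ge0//; exact: d_le1.
by apply: sumr_ge0 => j _; rewrite mulr_ge0 ?expR_ge0 ?bprod_ge0.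
Qed.

Definition cylT := expR (LY p) * (kappa A)%:R.

Lemma sum_cylw n : \sum_(w <- words n) cylw w = cylT.
Proof.
rewrite /cylw; under eq_bigr do rewrite big_mkcond.
rewrite exchange_big /= /cylT.
rewrite (eq_bigr (fun=> expR (LY p))); first by rewrite sumr_const card_ord mulr_natr.
move=> j _; have := iter_Mr_cst p n 1 => /(congr1 (fun g => g (Xh j))).
rewrite iter_trE => H.
rewrite -[RHS]mulr1 -H mulr_sumr [RHS]big_mkcond; apply: eq_big_seq => w.
by rewrite mem_words => /eqP wn; case: ifP => _ //; rewrite mulr1 wn.
Qed.

Definition cyl w : S -> R[i] := fun z => (word (size w) z == w)%:R.

(** A cylinder function of length n may have Lipschitz constant theta^(-n), but n steps of the
    operator leave a single inverse branch, whose norm is comparable with the weight of the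
    cylinder. *)
Lemma iter_cyl_nb (u a0 : R) w : `|u| <= a0 ->
  nb (iter (size w) (tr (phi u)) (cyl w)) ((distc a0 + 2) * cylw w).
Proof.
move=> ua; have a00 : 0 <= a0 by exact: le_trans (normr_ge0 _) ua.
have dc := distc_ge0 a00; have cw := cylw_ge0 w.
have E z : iter (size w) (tr (phi u)) (cyl w) z = if wok w z then bprod (phi u) (size w) (wcat w z) else 0.
  exact: iter_tr_cylinder.
have bw : bdd (iter (size w) (tr (phi u)) (cyl w)) (cylw w).
  move=> z; rewrite E; case: ifP => wz; last by rewrite normc0.
  rewrite bprod_pw normcM normc_real normc_osc_factor mulr1 ger0_norm ?bprod_ge0//.
  exact: bprod_cylw.
split; first by apply: bdd_le bw; rewrite ler_peMl//; lra.
move=> x y; have [xy|xy] := eqVneq (val x 0%N) (val y 0%N); last first.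
  rewrite d_head// mulr1 (le_trans (normcB _ _))// (le_trans (lerD (bw x) (bw y)))//.
  by rewrite mulrDl [2 * _]mulr_natl mulr2n lerDr mulr_ge0.
have d0 := d_ge0 th01 x y.
rewrite !E -(wok_head w xy); case: ifP => wx; last first.
  by rewrite subrr normc0 !mulr_ge0// addr_ge0.
rewrite (le_trans (weight_distortion ua wx xy))//; apply: ler_wpM2r => //.
have wy : wok w y by rewrite -(wok_head w xy).
apply: ler_pM => //; first exact: bprod_ge0; last exact: bprod_cylw.
by rewrite lerDl.
Qed.

Definition Xc w : S := xget point [set x : S | word (size w) x = w].

Lemma XcP m w x : word m x = w -> word m (Xc w) = w.
Proof.
move=> wx; have sw : size w = m by rewrite -wx size_word.
by rewrite /Xc; case: xgetP => [y _|/(_ x)]; rewrite /= sw.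
Qed.

Definition Zsum (K : comNzRingType) (g : S -> K) n := \sum_(y \in @periodic_points R A theta n) bprod g n y.

(** A periodic point and the chosen point of its m-cylinder agree on m symbols, so moving the end
    point of the branch costs theta^m times its weight; the total weight is bounded by [cylT]. *)
Lemma trace_formula (u a0 : R) m k : (0 < m)%N -> `|u| <= a0 ->
  normc (Zsum (phi u) (m + k) - \sum_(w <- words m) iter k (tr (phi u)) (iter m (tr (phi u)) (cyl w)) (Xc w))
  <= distc a0 * cylT * theta ^+ m.
Proof.
move=> m0 ua; have a00 : 0 <= a0 by exact: le_trans (normr_ge0 _) ua.
have dc := distc_ge0 a00.
have n0 : (0 < m + k)%N by rewrite addn_gt0 m0.
have fP := @finite_periodic R A theta _ n0.
rewrite (eq_big_seq (fun w => iter k (tr (phi u)) (iter m (tr (phi u)) (fun z => (word m z == w)%:R)) (Xc w))); last first.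
  by move=> w; rewrite mem_words /cyl => /eqP ->.
rewrite -(sum_periodic k (phi u) m0 (@XcP m)) /Zsum !fsbig_finite// -sumrB.
rewrite (le_trans (normc_sum _ _ _))//.
have S1 := sum_periodic k p m0 (@XcP m); rewrite fsbig_finite// in S1.
have S2 : \sum_(w <- words m) iter k Mr (iter m Mr (fun z => (word m z == w)%:R)) (Xc w) <= cylT.
  rewrite -(sum_cylw m) big_seq [leRHS]big_seq; apply: ler_sum => w; rewrite mem_words => /eqP wm.
  rewrite -[leRHS](congr1 (fun g => g (Xc w)) (iter_Mr_cst p k (cylw w))).
  apply: iter_tr_le => // z; rewrite -wm iter_tr_cylinder; case: ifP => wz; last exact: cylw_ge0.
  exact: bprod_cylw.
rewrite mulrAC [leRHS]mulrC.
apply: le_trans (ler_wpM2r _ S2); last by rewrite mulr_ge0// exprn_ge0// ltW.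
rewrite -S1 mulr_suml big_seq [leRHS]big_seq; apply: ler_sum => y; rewrite in_fset_set// => /set_mem /= yn.
set X := Xc _.
have wX : word m X = word m y by apply: (@XcP m _ y).
have hX : val y 0%N = val X 0%N.
  by have := word_agree wX => /(_ 0%N m0) ->.
have wy : wok (word (m + k) y) y by rewrite -{2}yn wok_word.
have := weight_distortion ua wy hX; rewrite size_word -{2}yn wcat_word => /le_trans; apply.
rewrite [leRHS]mulrC [leRHS]mulrAC; apply: ler_wpM2l; first by rewrite mulr_ge0// bprod_ge0.
by rewrite d_sym; apply: d_le_agree => //; exact: word_agree.
Qed.

Lemma iter_tr_sum (K : comNzRingType) (T : Type) (r : seq T) (g : S -> K) n (a : T -> K) (v : T -> S -> K) :
  iter n (tr g) (fun x => \sum_(t <- r) a t * v t x) = fun x => \sum_(t <- r) a t * iter n (tr g) (v t) x.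
Proof.
elim: r => [|t r IH].
  have -> : (fun x => \sum_(t <- [::]) a t * v t x) = (fun=> 0).
    by apply/funext => x; rewrite big_nil.
  have -> : (fun=> 0) = (fun x => 0 * (0 : K)) :> (S -> K) by apply/funext => x; rewrite mul0r.
  by rewrite iter_trZ; apply/funext => x; rewrite big_nil mul0r.
have -> : (fun x => \sum_(t <- t :: r) a t * v t x) = (fun x => a t * v t x + \sum_(t <- r) a t * v t x).
  by apply/funext => x; rewrite big_cons.
by rewrite iter_trD iter_trZ IH; apply/funext => x; rewrite big_cons.
Qed.

Lemma trace_sum_bound (a0 : R) m (b : seq I -> R) : 0 <= a0 ->
  (forall w, w \in words m -> b w = (distc a0 + 2) * cylw w) ->
  \sum_(w <- words m) b w = (distc a0 + 2) * cylT.
Proof.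
move=> a00 bE; rewrite -(sum_cylw m) mulr_sumr; apply: eq_big_seq => w wm; exact: bE.
Qed.

Lemma half_bounds n : (n./2 <= n - n./2)%N /\ (n <= (2 * n./2).+1)%N.
Proof. by have := odd_double_half n; rewrite -muln2; case: odd => /=; lia. Qed.

Lemma sqrt_half_pow (a : R) n : 0 < a < 1 -> a ^+ n./2 <= Num.sqrt a ^+ n / Num.sqrt a.
Proof.
move=> /andP[a0 a1]; have s0 : 0 < Num.sqrt a by rewrite sqrtr_gt0.
have s1 : Num.sqrt a <= 1 by rewrite -sqrtr1 ler_sqrt// ltW.
rewrite ler_pdivlMr// -[X in X ^+ n./2]sqr_sqrtr ?(ltW a0)// -exprM -exprSr.
by rewrite ler_wiXn2l ?(ltW s0)//; exact: (half_bounds n).2.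
Qed.

(** The trace formula splits n into two halves, one for each error term; the price is the square
    root of the rate. *)
Lemma combine_rates (a r C1 C2 : R) : 0 < a < 1 -> 0 < r < 1 -> 0 <= C1 -> 0 <= C2 ->
  exists C s : R, [/\ 0 < C, 0 < s < 1 & forall n, C1 * a ^+ n./2 + C2 * r ^+ (n - n./2) <= C * s ^+ n].
Proof.
move=> a01 r01 C10 C20; have /andP[a0 a1] := a01; have /andP[r0 r1] := r01.
pose b := Num.max a r.
have b01 : 0 < b < 1 by rewrite /b lt_max a0 gt_max a1.
have /andP[b0 b1] := b01.
have s0 : 0 < Num.sqrt b by rewrite sqrtr_gt0.
have s1 : Num.sqrt b < 1 by rewrite -sqrtr1 ltr_sqrt.
exists ((C1 + C2 + 1) / Num.sqrt b), (Num.sqrt b); split.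
- by rewrite divr_gt0//; lra.
- by rewrite s0.
move=> n; have H := sqrt_half_pow n b01.
rewrite mulrAC -mulrA.
have h1 : a ^+ n./2 <= Num.sqrt b ^+ n / Num.sqrt b.
  by rewrite (le_trans _ H)// lerXn2r ?nnegrE ?(ltW a0) ?(ltW b0)// /b le_max lexx.
have h2 : r ^+ (n - n./2) <= Num.sqrt b ^+ n / Num.sqrt b.
  rewrite (le_trans _ H)// (@le_trans _ _ (r ^+ n./2))//.
    by rewrite ler_wiXn2l ?(ltW r0) ?(ltW r1)//; exact: (half_bounds n).1.
  by rewrite lerXn2r ?nnegrE ?(ltW r0) ?(ltW b0)// /b le_max lexx orbT.
rewrite !mulrDl mul1r -[leLHS]addr0; apply: lerD; last by rewrite divr_ge0 ?exprn_ge0 ?(ltW s0).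
by apply: lerD; apply: ler_wpM2l.
Qed.

Theorem trace_medium (u0 a0 : R) : 0 < u0 -> u0 <= a0 -> ~ lattice f ->
  exists C r : R, [/\ 0 < C, 0 < r < 1 & forall u : R, u0 <= `|u| <= a0 -> forall n, (2 <= n)%N ->
    normc (Zsum (phi u) n) <= C * r ^+ n].
Proof.
move=> u00 ua0 nl; have a00 : 0 <= a0 by rewrite (le_trans (ltW u00)).
have dc := distc_ge0 a00.
have cT : 0 <= cylT by rewrite mulr_ge0 ?expR_ge0.
have [C [r [C0 r01 H]]] := medium_decay p B1 f_lip f_bdd u00 ua0 nl.
have c1 : 0 <= distc a0 * cylT by exact: mulr_ge0.
have c2 : 0 <= C * ((distc a0 + 2) * cylT) by rewrite mulr_ge0 ?(ltW C0)// mulr_ge0// addr_ge0.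
have [C' [s [C'0 s01 H']]] := combine_rates th01 r01 c1 c2.
exists C', s; split => // u ur n n2; have /andP[_ ua] := ur.
have m0 : (0 < n./2)%N by rewrite half_gt0.
have nE : n = (n./2 + (n - n./2))%N by rewrite subnKC// (leq_trans (half_bounds n).1)// leq_subr.
apply: le_trans (H' n); have T := trace_formula (n - n./2) m0 ua.
rewrite -nE in T.
set t := \sum_(w <- _) _ in T.
have -> : Zsum (phi u) n = (Zsum (phi u) n - t) + t by rewrite subrK.
rewrite (le_trans (normcD _ _))// lerD//.
rewrite (le_trans (normc_sum _ _ _))// -mulrA [_ * r ^+ _]mulrC mulrA.
rewrite -(@trace_sum_bound a0 n./2 (fun w => (distc a0 + 2) * cylw w)) // mulr_sumr.
rewrite big_seq [leRHS]big_seq; apply: ler_sum => w; rewrite mem_words => /eqP wm.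
rewrite -wm; exact: (H u ur _ _ _ (iter_cyl_nb w ua)).
Qed.

(** The iterates in the trace formula are evaluated at points depending on the word. Multiplying by
    h at one base point and using the cross combination of [spectral_pair] moves all evaluations to
    that point, with coefficients h (Xc w). The resulting sum of branches approximates M_z^m h,
    hence l^m h. *)
Theorem trace_near (a0 : R) : 0 <= a0 -> exists2 C : R, 0 <= C &
  forall (u K s : R) (h : S -> R[i]) (l : R[i]), `|u| <= a0 -> 0 <= K -> 0 <= s ->
  (forall x, tr (phi u) h x = l * h x) -> nb h 2 -> (forall x, normc (h x - 1) <= 1 / 2) ->
  (forall v a n x y, nb v a -> normc (h y * iter n (tr (phi u)) v x -
       h x * iter n (tr (phi u)) v y) <= K * s ^+ n * a) ->
  forall m k, (0 < m)%N -> normc (Zsum (phi u) (m + k) - l ^+ (m + k)) <= C * theta ^+ m + C * K * s ^+ k.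
Proof.
move=> a00; have dc := distc_ge0 a00.
have cT : 0 <= cylT by rewrite mulr_ge0 ?expR_ge0.
have c1 : 0 <= distc a0 * cylT by exact: mulr_ge0.
have c2 : 0 <= (distc a0 + 2) * cylT by rewrite mulr_ge0// addr_ge0.
exists (4 + distc a0 * cylT + 2 * ((distc a0 + 2) * cylT)); first lra.
move=> u K s h l ua K0 s0 hE hb h1 G m k m0.
have T := trace_formula k m0 ua; set t := \sum_(w <- _) _ in T.
have lE j : iter j (tr (phi u)) h = fun x => l ^+ j * h x.
  elim: j => [|j IH]; first by apply/funext => x; rewrite mul1r.
  by rewrite iterS IH trZ; apply/funext => x; rewrite hE exprSr mulrA.
pose W w := iter m (tr (phi u)) (cyl w).
pose V z := \sum_(w <- words m) h (Xc w) * W w z.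
have tm0 : 0 <= theta ^+ m by rewrite exprn_ge0// ltW.
(* On the cylinder of w, h (Xc w) may replace h with an error 2 theta^m, weighted by a total mass
   1. *)
have Vh : bdd (fun z => V z - l ^+ m * h z) (2 * theta ^+ m).
  move=> z; have := congr1 (fun g => g z) (lE m); rewrite iter_trE => <-.
  rewrite [X in _ - X]big_mkcond /V -sumrB (le_trans (normc_sum _ _ _))//.
  have S1 := congr1 (fun g => g z) (iter_Mr_cst p m (2 * theta ^+ m)).
  rewrite iter_trE in S1; rewrite -[leRHS]S1 [leRHS]big_mkcond big_seq [leRHS]big_seq.
  apply: ler_sum => w; rewrite mem_words => /eqP wm.
  have -> : W w z = if wok w z then bprod (phi u) m (wcat w z) else 0.
    by rewrite /W -wm; exact: iter_tr_cylinder.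
  case: ifP => wz; last by rewrite mulr0 subrr normc0.
  rewrite mulrC -mulrBr normcM bprod_pw normcM normc_real normc_osc_factor mulr1.
  rewrite ger0_norm ?bprod_ge0// ler_wpM2l ?bprod_ge0//.
  have wz' : word m (wcat w z) = w by rewrite -wm word_wcat.
  rewrite (le_trans (hb.2 _ _))// ler_wpM2l//; apply: d_le_agree => //.
  by apply: word_agree; rewrite wz' (XcP wz').
have Vk : normc (iter k (tr (phi u)) V point - l ^+ (m + k) * h point) <= 2 * theta ^+ m.
  have := iter_Mu_bdd p f u k Vh point; rewrite iter_trB iter_trZ lE mulrA -exprD; exact.
have VE : iter k (tr (phi u)) V point = \sum_(w <- words m) h (Xc w) * iter k (tr (phi u)) (W w) point.
  by rewrite /V iter_tr_sum.
have tV : normc (h point * t - iter k (tr (phi u)) V point) <= K * s ^+ k * ((distc a0 + 2) * cylT).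
  rewrite VE /t mulr_sumr -sumrB (le_trans (normc_sum _ _ _))//.
  rewrite -(@trace_sum_bound a0 m (fun w => (distc a0 + 2) * cylw w)) // mulr_sumr.
  rewrite big_seq [leRHS]big_seq; apply: ler_sum => w; rewrite mem_words => /eqP wm.
  by apply: G; rewrite /W -wm; exact: iter_cyl_nb.
have hp : 1 / 2 <= normc (h point).
  have := normcD (1 - h point) (h point); rewrite subrK normc1 normc_subC => H.
  have := h1 point; lra.
have tl : normc (t - l ^+ (m + k)) <= 2 * (2 * theta ^+ m + K * s ^+ k * ((distc a0 + 2) * cylT)).
  have : normc (h point) * normc (t - l ^+ (m + k)) <= 2 * theta ^+ m + K * s ^+ k * ((distc a0 + 2) * cylT).
    rewrite -normcM mulrBr [h point * l ^+ _]mulrC.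
    by rewrite (le_trans (normc_dist _ (iter k (tr (phi u)) V point) _))// addrC lerD.
  have := ler_wpM2r (normc_ge0 (t - l ^+ (m + k))) hp; lra.
rewrite (le_trans (normc_dist _ t _))// (le_trans (lerD T tl))//.
have sk : 0 <= K * s ^+ k by rewrite mulr_ge0// exprn_ge0.
have := mulr_ge0 c2 tm0; have := mulr_ge0 c1 sk.
lra.
Qed.

End trace.

(** * Expectations of bounded measurable functions and the Gibbs inequality *)

Section expectation.
Context d (T : measurableType d) (R : realType) (mu : probability T R).
Implicit Types (phi psi : T -> R) (a : R).

Definition bm phi := measurable_fun setT phi /\ exists b, forall x, `|phi x| <= b.

Local Notation E phi := (\int[mu]_x phi x)%R.

Lemma bm_int phi : bm phi -> mu.-integrable setT (EFin \o phi).
Proof.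
move=> [mphi [b phib]]; apply: measurable_bounded_integrable => //.
  by apply: le_lt_trans (probability_le1 _ _) (ltry 1).
exists b; split; first exact: num_real.
by move=> t bt x _ /=; rewrite (le_trans (phib x))// ltW.
Qed.

Lemma bm_cst a : bm (fun=> a).
Proof. by split; [exact: measurable_cst|exists `|a|]. Qed.

Lemma bmD phi psi : bm phi -> bm psi -> bm (fun x => phi x + psi x).
Proof.
move=> [m1 [b1 H1]] [m2 [b2 H2]]; split; first exact: measurable_funD.
by exists (b1 + b2) => x; rewrite (le_trans (ler_normD _ _))// lerD.
Qed.

Lemma bmZ a phi : bm phi -> bm (fun x => a * phi x).
Proof.
move=> [m1 [b1 H1]]; split; first by apply: measurable_funM => //; exact: measurable_cst.
by exists (`|a| * b1) => x; rewrite normrM ler_wpM2l.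
Qed.

Lemma bm_indic (A : set T) : measurable A -> bm (\1_A).
Proof.
move=> mA; split; first exact: measurable_indic.
by exists 1 => x; rewrite indicE; case: (_ \in _); rewrite ?normr1 ?normr0.
Qed.

Lemma bm_sum (I : Type) (s : seq I) (h : I -> T -> R) : (forall i, bm (h i)) ->
  bm (fun x => \sum_(i <- s) h i x).
Proof.
move=> H; elim: s => [|i s IH].
  have -> : (fun x => \sum_(i <- [::]) h i x) = (fun=> 0) by apply/funext => x; rewrite big_nil.
  exact: bm_cst.
have -> : (fun x => \sum_(j <- i :: s) h j x) = (fun x => h i x + \sum_(j <- s) h j x).
  by apply/funext => x; rewrite big_cons.
exact: bmD.
Qed.

Lemma expect_EFin phi : bm phi -> (\int[mu]_x (phi x)%:E)%E = (E phi)%:E.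
Proof. by move=> /bm_int H; rewrite /Rintegral fineK//; exact: integrable_fin_num. Qed.

Lemma expectD phi psi : bm phi -> bm psi -> E (fun x => phi x + psi x) = E phi + E psi.
Proof. by move=> /bm_int H1 /bm_int H2; exact: RintegralD. Qed.

Lemma expectZ a phi : bm phi -> E (fun x => a * phi x) = a * E phi.
Proof. by move=> /bm_int H; exact: RintegralZl. Qed.

Lemma expect_cst a : E (fun=> a) = a.
Proof.
transitivity (a * fine (mu setT)); first exact: Rintegral_cst.
by rewrite (probability_setT mu) mulr1.
Qed.

Lemma expect_le phi psi : bm phi -> bm psi -> (forall x, phi x <= psi x) -> E phi <= E psi.
Proof. by move=> /bm_int H1 /bm_int H2 H; apply: le_Rintegral. Qed.

Lemma expect_indic (A : set T) : measurable A -> E (\1_A) = fine (mu A).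
Proof. by move=> mA; rewrite /Rintegral integral_indic// setIT. Qed.

Lemma expect_sum (I : Type) (s : seq I) (h : I -> T -> R) : (forall i, bm (h i)) ->
  E (fun x => \sum_(i <- s) h i x) = \sum_(i <- s) E (h i).
Proof.
move=> H; elim: s => [|i s IH].
  have -> : (fun x => \sum_(i <- [::]) h i x) = (fun=> 0) by apply/funext => x; rewrite big_nil.
  by rewrite expect_cst big_nil.
have -> : (fun x => \sum_(j <- i :: s) h j x) = (fun x => h i x + \sum_(j <- s) h j x).
  by apply/funext => x; rewrite big_cons.
by rewrite expectD// ?IH ?big_cons//; exact: bm_sum.
Qed.

Section finite_valued.
Context {W : finType} (t : T -> W).
Hypothesis mt : forall w, measurable (t @^-1` [set w]).

Let decomp (g : W -> R) : g \o t = fun x => \sum_w g w * \1_(t @^-1` [set w]) x.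
Proof.
apply/funext => x; rewrite (bigD1 (t x))//= big1 ?addr0.
  by rewrite indicE mem_set// mulr1.
by move=> w wx; rewrite indicE memNset ?mulr0// => /= H; rewrite H eqxx in wx.
Qed.

Lemma bm_fin (g : W -> R) : bm (g \o t).
Proof. by rewrite decomp; apply: bm_sum => w; apply: bmZ; apply: bm_indic. Qed.

Lemma expect_fin (g : W -> R) : E (g \o t) = \sum_w g w * fine (mu (t @^-1` [set w])).
Proof.
rewrite decomp expect_sum => [|w]; last by apply: bmZ; apply: bm_indic.
by apply: eq_bigr => w _; rewrite expectZ ?expect_indic//; apply: bm_indic.
Qed.

End finite_valued.

(** Nonnegativity of relative entropy, from ln x <= x - 1; the reference weights b may have total
    mass less than 1. *)
Lemma gibbs_inequality (W : finType) (a b : W -> R) : (forall w, 0 <= a w) -> (forall w, 0 < b w) ->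
  \sum_w a w = 1 -> \sum_w b w <= 1 -> \sum_w - (a w * ln (a w)) <= \sum_w - ln (b w) * a w.
Proof.
move=> a0 b0 a1 b1; rewrite -subr_ge0 -sumrB.
apply: (@le_trans _ _ (\sum_w (a w - b w))); first by rewrite sumrB a1 subr_ge0.
apply: ler_sum => w _.
have := a0 w; rewrite le_eqVlt => /predU1P[<-|aw].
  by rewrite mul0r oppr0 mulr0 subr0 sub0r oppr_le0 ltW.
have H : ln (b w / a w) <= b w / a w - 1.
  by have := expR_ge1Dx (ln (b w / a w)); rewrite lnK ?posrE ?divr_gt0//; lra.
rewrite ln_div ?posrE// in H.
have := ler_wpM2l (ltW aw) H.
have -> : a w * (b w / a w - 1) = b w - a w by field; rewrite gt_eqF.
lra.
Qed.

End expectation.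

(** * Approximation of Borel partitions by cylinders *)

Section borel.
Context {R : realType} {A : aperiodic_matrix} {theta : R}.
Local Notation S := (shift_space A theta).
Local Notation sg := (@Defs.shift R A theta).
Local Notation B := (borel_shift A theta).
Hypothesis th01 : 0 < theta < 1.
Implicit Types (x y z : S).
Let th0 : 0 < theta. Proof. by case/andP: th01. Qed.
Let th1 : theta < 1. Proof. by case/andP: th01. Qed.

Definition cylset n (E : set S) := forall x y, E x -> agree x y n -> E y.

Lemma cylset_le n m E : (n <= m)%N -> cylset n E -> cylset m E.
Proof. by move=> nm H x y Ex xy; apply: H Ex _ => i im; apply: xy; exact: leq_trans nm. Qed.

Lemma agree_sym n x y : agree x y n -> agree y x n.
Proof. by move=> xy i /xy ->. Qed.

Lemma cylsetC n E : cylset n E -> cylset n (~` E).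
Proof. by move=> H x y Ex xy Ey; apply: Ex; apply: H Ey (agree_sym xy). Qed.

Lemma cylset_open n E : cylset n E -> dtheta_open E.
Proof.
move=> H x Ex; exists (theta ^+ n); first by rewrite exprn_gt0.
by move=> y xy; apply: H Ex _; exact: d_lt_agree.
Qed.

Lemma measurable_open (U : set S) : dtheta_open U -> measurable (U : set B).
Proof. by move=> oU; exact: sub_sigma_algebra. Qed.

Lemma measurable_cylset n E : cylset n E -> measurable (E : set B).
Proof. by move=> /cylset_open; exact: measurable_open. Qed.

Lemma d_shift_le x y : dtheta (sg x) (sg y) <= dtheta x y / theta.
Proof.
rewrite ler_pdivlMr//; case: (dthetaP x y) => [[-> ->]|[[|m] [xy _ ->]]].
- by rewrite d_refl mul0r.
- by rewrite expr0 mulr_ile1 ?d_ge0 ?d_le1// ltW.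
rewrite exprSr ler_wpM2r ?(ltW th0)//; apply: d_le_agree => // j jm.
exact: (xy j.+1).
Qed.

Lemma measurable_shift : measurable_fun setT (sg : B -> B).
Proof.
apply: (@measurability _ _ B B setT sg (@dtheta_open R A theta)) => // _ [U oU <-].
rewrite setTI; apply: measurable_open => x Ux; have [r r0 H] := oU _ Ux.
exists (theta * r); first exact: mulr_gt0.
move=> y xy; apply: H; rewrite (le_lt_trans (d_shift_le _ _))// ltr_pdivrMr//.
by rewrite mulrC.
Qed.

Lemma measurable_lip (F : S -> R) K : (forall x y, `|F x - F y| <= K * dtheta x y) ->
  measurable_fun setT (F : B -> R).
Proof.
move=> FK; apply: (measurability _ (RGenOInfty.measurableE R)).
move=> _ [_ [a ->] <-]; rewrite setTI; apply: measurable_open => x.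
rewrite /= in_itv/= andbT => aF.
exists ((F x - a) / (`|K| + 1)); first by rewrite divr_gt0 ?subr_gt0 ?ltr_wpDl.
move=> y; rewrite ltr_pdivlMr ?(ltr_wpDl _ ltr01)// => H; rewrite /= in_itv/= andbT.
have : F x - F y < F x - a.
  rewrite (le_lt_trans (ler_norm _))// (le_lt_trans (FK x y))// (le_lt_trans _ H)//.
  rewrite mulrC ler_wpM2l ?d_ge0// (le_trans (ler_norm _))//; lra.
lra.
Qed.

Lemma bm_lip (F : S -> R) K : 0 <= K -> (forall x y, `|F x - F y| <= K * dtheta x y) -> bm (F : B -> R).
Proof. by move=> K0 FK; split; [exact: measurable_lip FK|exact: lip_bounded FK]. Qed.

Lemma bm_shift (phi : S -> R) n : bm (phi : B -> R) -> bm (phi \o iter n sg : B -> R).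
Proof.
move=> [mp [b H]]; split; last by exists b => x; exact: H.
have ms : measurable_fun setT (iter n sg : B -> B).
  elim: n => [|n IH]; first exact: measurable_id.
  exact: (measurableT_comp measurable_shift IH).
exact: (measurableT_comp mp ms).
Qed.

Variable mu : probability B R.

(** Sets approximable in measure by unions of cylinders of one length. The class is a sigma-algebra
    containing the open sets, so it contains all Borel sets. *)
Definition capprox (E : set S) := measurable (E : set B) /\ forall e : R, 0 < e ->
  exists n (E' : set S), cylset n E' /\ fine (mu ((E `\` E') `|` (E' `\` E))) <= e.

Lemma fine_le_mu (X Y : set B) : measurable X -> measurable Y -> X `<=` Y -> fine (mu X) <= fine (mu Y).
Proof.
move=> mX mY XY; rewrite fine_le ?fin_num_measure//.
by apply: le_measure => //; rewrite inE.
Qed.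

Lemma fine_muU (X Y : set B) : measurable X -> measurable Y -> fine (mu (X `|` Y)) <= fine (mu X) + fine (mu Y).
Proof.
move=> mX mY; rewrite -fineD ?fin_num_measure// fine_le ?fin_num_measure//.
- exact: measurableU.
- by rewrite fin_numD !fin_num_measure.
exact: measureU2.
Qed.

Let msd (X Y : set B) : measurable X -> measurable Y -> measurable ((X `\` Y) `|` (Y `\` X)).
Proof. by move=> mX mY; apply: measurableU; exact: measurableD. Qed.

Lemma capprox_cyl n E : cylset n E -> capprox E.
Proof.
move=> H; split; first exact: measurable_cylset H.
by move=> e e0; exists n, E; split => //; rewrite setDv setU0 measure0 ltW.
Qed.

Lemma capproxC E : capprox E -> capprox (~` E).
Proof.
move=> [mE H]; split; first exact: measurableC.
move=> e /H[n [E' [cE' HE]]]; exists n, (~` E'); split; first exact: cylsetC.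
suff -> : (~` E `\` ~` E') `|` (~` E' `\` ~` E) = (E `\` E') `|` (E' `\` E) by [].
by rewrite !setDE !setCK setUC setIC (setIC (~` E)).
Qed.

Lemma capproxU E F : capprox E -> capprox F -> capprox (E `|` F).
Proof.
move=> [mE HE] [mF HF]; split; first exact: measurableU.
move=> e e0; have e2 : 0 < e / 2 by lra.
have [n [E' [cE' hE]]] := HE _ e2; have [m [F' [cF' hF]]] := HF _ e2.
have mE' := measurable_cylset cE'; have mF' := measurable_cylset cF'.
exists (maxn n m), (E' `|` F'); split.
  move=> x y [Ex|Fx] xy; [left|right].
    exact: (cylset_le (leq_maxl n m) cE') Ex xy.
  exact: (cylset_le (leq_maxr n m) cF') Fx xy.
apply: (@le_trans _ _ (fine (mu (((E `\` E') `|` (E' `\` E)) `|` ((F `\` F') `|` (F' `\` F)))))).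
  apply: fine_le_mu; [apply: msd; exact: measurableU|apply: measurableU; exact: msd|].
  move=> x; rewrite /= !not_orP; tauto.
rewrite (le_trans (fine_muU (msd mE mE') (msd mF mF')))//; lra.
Qed.

Lemma capprox_incr (F : nat -> set S) : (forall n, capprox (F n)) -> nondecreasing_seq F ->
  capprox (\bigcup_n F n).
Proof.
move=> HF ndF; have mF n : measurable (F n : set B) by have [] := HF n.
have mU : measurable (\bigcup_n F n : set B) by exact: bigcup_measurable.
split => // e e0; have e2 : 0 < e / 2 by lra.
have [n hn] : exists n, fine (mu (\bigcup_n F n `\` F n)) <= e / 2.
  have : mu (F n) @[n --> \oo] --> mu (\bigcup_n F n : set B) by apply: nondecreasing_cvg_mu.
  rewrite -(@fineK _ (mu (\bigcup_n F n : set B))) ?fin_num_measure//.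
  move=> /fine_cvgP [_ /cvgrPdist_le /(_ _ e2)[n _ Hn]]; exists n.
  have := Hn n (leqnn n); rewrite /= => /(le_trans (ler_norm _)).
  have FU : F n `<=` \bigcup_n F n by move=> x Fx; exists n.
  rewrite measureD//; last by rewrite ltey_eq fin_num_measure.
  rewrite (_ : _ `&` F n = F n); last by apply/setIidPr.
  by rewrite fineB ?fin_num_measure.
have [k [E' [cE' h]]] := (HF n).2 _ e2; exists k, E'; split => //.
have mE' := measurable_cylset cE'.
apply: (@le_trans _ _ (fine (mu ((\bigcup_n F n `\` F n) `|` ((F n `\` E') `|` (E' `\` F n)))))).
  apply: fine_le_mu; [exact: msd|by apply: measurableU; [exact: measurableD|exact: msd]|].
  move=> x [[[m _ Fx] nE]|[Ex nF]]; last first.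
    by right; right; split => // Fx; apply: nF; exists n.
  by have [Fn|nFn] := pselect (F n x); [right; left|left; split => //; exists m].
rewrite (le_trans (fine_muU _ (msd (mF n) mE')))//; first exact: measurableD.
lra.
Qed.

Lemma capprox_measurable (E : set B) : measurable E -> capprox E.
Proof.
move=> mE; have {mE} : (<<s @dtheta_open R A theta >>) E by [].
apply: smallest_sub.
  split.
  - by apply: (@capprox_cyl 0%N) => x y [].
  - by move=> X /capproxC; rewrite setTD.
  (* A countable union is replaced by an increasing one, for which continuity of the measure leaves
     a small remainder after finitely many sets. *)
  - move=> F HF; have -> : \bigcup_n F n = \bigcup_n (\bigcup_(i in `I_n) F i).
      apply/seteqP; split => [x [n _ Fx]|x [n _ [i _ Fx]]]; last by exists i.
      by exists n.+1 => //; exists n => /=.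
    apply: capprox_incr => [n|n m nm]; last first.
      by apply/subsetPset => x [i /= ik Fx]; exists i => //=; exact: leq_trans nm.
    elim: n => [|n IH].
      by rewrite II0 bigcup_set0; apply: (@capprox_cyl 0%N) => x y [].
    have -> : \bigcup_(i in `I_n.+1) F i = (\bigcup_(i in `I_n) F i) `|` F n.
      by rewrite IIS bigcup_setU bigcup_set1.
    exact: capproxU.
move=> U oU; have -> : U = \bigcup_n [set x | forall y, agree x y n -> U y].
  apply/seteqP; split => [x Ux|x [n _ H]]; last exact: H.
  have [r r0 H] := oU _ Ux.
  have : (theta ^+ n) @[n --> \oo] --> (0 : R) by apply: cvg_expr; rewrite ger0_norm ?(ltW th0).
  move=> /cvgrPdist_lt /(_ r r0)[n _ Hn]; exists n => // y xy; apply: H.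
  rewrite (le_lt_trans (d_le_agree th01 xy))//.
  have := Hn n (leqnn n); rewrite /= sub0r normrN; exact/le_lt_trans/ler_norm.
apply: capprox_incr => [n|n m nm].
  apply: (@capprox_cyl n) => x y H xy z yz; apply: H => i jn; rewrite xy//; exact: yz.
by apply/subsetPset => x H y xy; apply: H => i jn; apply: xy; exact: leq_trans nm.
Qed.

(** A point is mislabelled only if it lies in one of the m symmetric differences, each of measure at
    most e / (m + 1). *)
Lemma partition_approx m (c : S -> 'I_m) (e : R) : 0 < e ->
  (forall j, measurable (c @^-1` [set j] : set B)) ->
  exists n (c' : S -> 'I_m), (forall x y, agree x y n -> c' x = c' y) /\
    measurable ([set x | c x != c' x] : set B) /\ fine (mu [set x | c x != c' x]) <= e.
Proof.
move=> e0 mc.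
have e1 : 0 < e / (m%:R + 1) by rewrite divr_gt0// ltr_wpDl.
have /choice[nE HnE] j : exists nE : nat * set S, cylset nE.1 nE.2 /\
    fine (mu ((c @^-1` [set j] `\` nE.2) `|` (nE.2 `\` c @^-1` [set j]))) <= e / (m%:R + 1).
  by have [n [E' H]] := (capprox_measurable (mc j)).2 _ e1; exists (n, E').
(* The default label does not depend on x, so c' depends only on the first n symbols of x. *)
pose c' x := odflt (c point) [pick j | x \in (nE j).2].
pose n := \max_j (nE j).1.
have c'E x y : agree x y n -> c' x = c' y.
  move=> xy; congr odflt; apply: eq_pick => j /=.
  have nj : ((nE j).1 <= n)%N by exact: (leq_bigmax j).
  have H := cylset_le nj (HnE j).1.
  by apply/idP/idP => /set_mem h; apply/mem_set; [apply: H h xy|apply: H h (agree_sym xy)].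
have c'c j : cylset n (c' @^-1` [set j]) by move=> x y /= <- /c'E ->.
pose D j := (c @^-1` [set j] `\` (nE j).2) `|` ((nE j).2 `\` c @^-1` [set j]).
have mD j : measurable (D j : set B) by apply: msd => //; exact: (measurable_cylset (HnE j).1).
have sub x : c x != c' x -> exists j, D j x.
  move=> cx; have [xE|xE] := pselect ((nE (c x)).2 x); last by exists (c x); left.
  exists (c' x); right; split; last by move=> /= H; rewrite H eqxx in cx.
  rewrite /c'; case: pickP => [j /set_mem //|/(_ (c x)) /negP[]]; exact/mem_set.
have mN : measurable ([set x | c x != c' x] : set B).
  have -> : [set x | c x != c' x] = ~` \bigcup_(j in [set: 'I_m]) (c @^-1` [set j] `&` c' @^-1` [set j]).
    apply/seteqP; split => [x /= cx [j _ [/= cj c'j]]|x H /=]; first by rewrite cj c'j eqxx in cx.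
    by apply/eqP => cx; apply: H; exists (c x).
  apply: measurableC; apply: fin_bigcup_measurable => [|j _]; first exact: finite_finset.
  by apply: measurableI => //; exact: measurable_cylset (c'c j).
exists n, c'; split => //; split => //.
rewrite -expect_indic// (@le_trans _ _ (\sum_j fine (mu (D j))))//; last first.
  rewrite (le_trans (ler_sum _ (fun j _ => (HnE j).2)))// sumr_const card_ord -[_ *+ m]mulr_natr.
  rewrite mulrAC ler_pdivrMr ?ltr_wpDl// ler_wpM2l ?(ltW e0)//; lra.
have -> : \sum_j fine (mu (D j)) = (\int[mu]_x (\sum_j \1_(D j) x))%R.
  rewrite expect_sum => [|j]; last exact: bm_indic.
  by apply: eq_bigr => j _; rewrite expect_indic.
apply: expect_le; [exact: bm_indic|by apply: bm_sum => j; exact: bm_indic|].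
move=> x; rewrite indicE; case: (boolP (x \in _)) => [/set_mem /= /sub[j Dj]|_].
  rewrite (bigD1 j)//= indicE mem_set// lerDl; apply: sumr_ge0 => i _; by rewrite indicE.
apply: sumr_ge0 => i _; by rewrite indicE.
Qed.

End borel.

(** * Entropy of an invariant measure is at most the growth rate minus the integral *)

Section entropy_upper_bound.
Context {R : realType} {A : aperiodic_matrix} {theta : R}.
Local Notation S := (shift_space A theta).
Local Notation sg := (@Defs.shift R A theta).
Local Notation B := (borel_shift A theta).
Hypothesis th01 : 0 < theta < 1.
Implicit Types (x y z : S).
Let th0 : 0 < theta. Proof. by case/andP: th01. Qed.
Let th1 : theta < 1. Proof. by case/andP: th01. Qed.

Variable mu : probability B R.
Hypothesis inv : Defs.invariant mu.

Lemma invariant_iter n (E : set B) : measurable E -> mu (iter n sg @^-1` E) = mu E.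
Proof.
have ms j : measurable_fun setT (iter j sg : B -> B).
  elim: j => [|j IH]; first exact: measurable_id.
  exact: (measurableT_comp (measurable_shift th01) IH).
move=> mE; elim: n => [//|n IH].
have mp : measurable (iter n sg @^-1` E : set B).
  by rewrite -[X in measurable X]setTI; apply: ms.
rewrite -IH -(inv mp); congr (mu _); apply/seteqP; split => x /=; by rewrite -iterSr.
Qed.

Lemma expect_shift n (phi : S -> R) : bm (phi : B -> R) ->
  (\int[mu]_x phi (iter n sg x))%R = (\int[mu]_x phi x)%R.
Proof.
move=> bphi; have ms : measurable_fun setT (iter n sg : B -> B).
  elim: n => [|n IH]; first exact: measurable_id.
  exact: (measurableT_comp (measurable_shift th01) IH).
have H := @integral_pushforward _ _ B B R (iter n sg) ms mu setT (EFin \o phi).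
rewrite /Rintegral; congr fine.
have -> : (\int[mu]_x (phi x)%:E)%E = (\int[pushforward mu (iter n sg : B -> B)]_x (phi x)%:E)%E.
  apply: eq_measure_integral => E mE _; rewrite /pushforward; exact/esym/invariant_iter.
rewrite H//.
- by apply/measurable_EFinP; exact: bphi.1.
- rewrite preimage_setT; exact: bm_int (bm_shift th01 n bphi).
Qed.

Variables (F : S -> R) (K : R).
Hypothesis K0 : 0 <= K.
Hypothesis FK : forall x y, `|F x - F y| <= K * dtheta x y.

Lemma birkhoff_agree n x y : agree x y n ->
  `|birkhoff F n x - birkhoff F n y| <= K / (1 - theta).
Proof.
move=> xy; have th1' : 0 < 1 - theta by rewrite subr_gt0.
suff : `|birkhoff F n x - birkhoff F n y| <= K * (1 - theta ^+ n) / (1 - theta).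
  move=> /le_trans; apply; rewrite ler_wpM2r ?invr_ge0 ?(ltW th1')//.
  by rewrite ler_piMr// gerBl exprn_ge0// ltW.
elim: n x y xy => [|n IH] x y xy.
  by rewrite /birkhoff !big_geq// subrr normr0 subrr mulr0 mul0r.
rewrite !birkhoffS (_ : K * (1 - theta ^+ n.+1) / (1 - theta) =
  K * theta ^+ n + K * (1 - theta ^+ n) / (1 - theta)); last first.
  by rewrite exprS; field; rewrite gt_eqF.
rewrite opprD addrACA (le_trans (ler_normD _ _))// lerD//.
  rewrite (le_trans (FK x y))// ler_wpM2l//; apply: d_le_agree => //.
  by move=> j jn; apply: xy; rewrite ltnS ltnW.
by apply: IH => j jn; apply: (xy j.+1).
Qed.

Lemma birkhoffD m n x : birkhoff F (m + n) x = birkhoff F m x + birkhoff F n (iter m sg x).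
Proof.
elim: m x => [|m IH] x; first by rewrite /birkhoff [X in _ = X + _]big_geq// add0r.
by rewrite addSn !birkhoffS IH iterSr addrA.
Qed.

Lemma bm_birkhoff n : bm (birkhoff F n : B -> R).
Proof.
have -> : birkhoff F n = fun x => \sum_(0 <= i < n) (F \o iter i sg) x by [].
by apply: bm_sum => i; apply: bm_shift => //; exact: bm_lip FK.
Qed.

Lemma expect_birkhoff n : (\int[mu]_x birkhoff F n x)%R = n%:R * (\int[mu]_x F x)%R.
Proof.
have bF : bm (F : B -> R) by exact: bm_lip FK.
rewrite /birkhoff expect_sum => [|i]; last exact: (bm_shift th01 i bF).
rewrite (eq_bigr (fun=> (\int[mu]_x F x)%R)) => [|i _]; last exact: expect_shift.
by rewrite sumr_const_nat subn0 mulr_natl.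
Qed.

Variables (Lam C : R).
Hypothesis C1 : 1 <= C.
Hypothesis LC : forall n x, iter n (tr (fun x => expR (F x))) (fun=> 1) x <= C * expR (n%:R * Lam).

Lemma itinerary_measurable m (c : S -> 'I_m) n : (forall j, measurable (c @^-1` [set j] : set B)) ->
  forall w : {ffun 'I_n -> 'I_m},
  measurable ((fun x : B => [ffun i : 'I_n => c (iter i sg x)]) @^-1` [set w]).
Proof.
move=> mc w.
have -> : (fun x : B => [ffun i : 'I_n => c (iter i sg x)]) @^-1` [set w] =
    \bigcap_(i in [set: 'I_n]) (iter i sg @^-1` (c @^-1` [set w i])).
  apply/seteqP; split => [x /= <- i _ /=|x H]; first by rewrite ffunE.
  by apply/ffunP => i; rewrite ffunE; apply: H.
apply: fin_bigcap_measurable => [|i _]; first exact: finite_finset.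
have ms j : measurable_fun setT (iter j sg : B -> B).
  elim: j => [|j IH]; first exact: measurable_id.
  exact: (measurableT_comp (measurable_shift th01) IH).
by rewrite -[X in measurable X]setTI; apply: ms.
Qed.

Lemma join_atomE m (c : S -> 'I_m) n (w : {ffun 'I_n -> 'I_m}) :
  join_atom c w = (fun x : B => [ffun i : 'I_n => c (iter i sg x)]) @^-1` [set w].
Proof.
apply/seteqP; split => [x H|x /= <- i]; last by rewrite ffunE.
by apply/ffunP => i; rewrite ffunE; exact: H.
Qed.

Section smoothing.
Variables (m : nat) (eta : R).
Hypothesis m0 : (0 < m)%N.
Hypothesis eta01 : 0 < eta < 1.
Implicit Types i j : 'I_m.

(** A channel keeping the label with probability 1 - eta and otherwise drawing it uniformly. Every
    itinerary thereby gets a positive reference weight, and a mismatch costs only the constant - ln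
    (eta / m). *)
Definition kap i j : R := (1 - eta) * (i == j)%:R + eta / m%:R.

Lemma kap_gt0 i j : 0 < kap i j.
Proof.
have /andP[e0 e1] := eta01.
by rewrite ltr_wpDl ?divr_gt0 ?ltr0n// mulr_ge0// subr_ge0 ltW.
Qed.

Lemma kap_sum j : \sum_i kap i j = 1.
Proof.
rewrite big_split/= -mulr_sumr (bigD1 j)//= eqxx big1 ?addr0 => [|i /negbTE->//].
rewrite sumr_const card_ord -[_ *+ m]mulr_natr divfK ?pnatr_eq0 -?lt0n// mulr1 subrK//.
Qed.

Lemma kap_lb i j : (1 - eta) * expR (- ((i != j)%:R * - ln (eta / m%:R))) <= kap i j.
Proof.
have /andP[e0 e1] := eta01.
have em0 : 0 < eta / m%:R by rewrite divr_gt0 ?ltr0n.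
rewrite /kap; case: eqVneq => _ /=.
  by rewrite mul0r oppr0 expR0 lerDl ltW.
rewrite mul1r opprK lnK ?posrE// mulr0 add0r ler_piMl ?(ltW em0)//; lra.
Qed.

End smoothing.

(** The Gibbs inequality against reference weights made from the transfer operator: L^(n+l) applied
    to the likelihood of an itinerary, evaluated at one point and normalized. Along the orbit of x
    the weight is at least e^(- Phi n x), and the integral of Phi is computed by invariance. *)
Theorem entropy_upper m (c : S -> 'I_m) (e : R) : 0 < e ->
  (forall j, measurable (c @^-1` [set j] : set B)) ->
  exists a : R, forall n, join_entropy mu c n <= a + n%:R * (Lam - (\int[mu]_x F x)%R + e).
Proof.
move=> e0 mc.
have m0 : (0 < m)%N by apply: leq_ltn_trans (ltn_ord (c point)).
(* Chosen so that keeping a label costs exactly e / 2 in logarithm. *)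
pose eta := 1 - expR (- (e / 2)).
have eta01 : 0 < eta < 1.
  by rewrite /eta subr_gt0 expR_lt1 gtrBl expR_gt0 andbT oppr_lt0 divr_gt0.
pose Lm := - ln (eta / m%:R).
have em0 : 0 < eta / m%:R by rewrite divr_gt0 ?ltr0n//; case/andP: eta01.
have Lm0 : 0 <= Lm.
  rewrite /Lm oppr_ge0 ln_le0// ler_pdivrMr ?ltr0n// mul1r.
  have /andP[_ e1] := eta01; by rewrite (le_trans (ltW e1))// ler1n.
(* A mismatch set of this measure contributes at most e / 2 per step, a mismatch costing [Lm]. *)
have eL : 0 < e / 2 / (Lm + 1) by rewrite divr_gt0 ?divr_gt0 ?(ltr_wpDl _ ltr01).
have [n' [c' [c'E [mN muN]]]] := partition_approx th01 mu eL mc.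
have [bF Fb] := lip_bounded th01 K0 FK.
have [M HM] := @exists_preimage R A theta.
have C0 : 0 < C by exact: lt_le_trans C1.
pose phi x := expR (F x).
have phi0 x : 0 <= phi x by exact: expR_ge0.
(* n' further symbols are needed for the approximate labels along n steps to be those of x, and M to
   reach the base point. *)
pose l := (n' + M)%N.
pose g n (w : {ffun 'I_n -> 'I_m}) y := \prod_i kap eta (w i) (c' (iter i sg y)).
have g0 n w y : 0 < g n w y by apply: prodr_gt0 => i _; exact: kap_gt0.
pose b n w := C^-1 * expR (- ((n + l)%:R * Lam)) * iter (n + l) (tr phi) (g n w) point.
pose N := [set x | c x != c' x].
pose psi x := e / 2 + \1_N x * Lm.
pose a := ln C + l%:R * (`|Lam| + bF) + K / (1 - theta).
pose Phi n x := a + n%:R * Lam - birkhoff F n x + \sum_(0 <= i < n) psi (iter i sg x).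
have bpsi : bm (psi : B -> R).
  apply: bmD; first exact: bm_cst.
  rewrite (_ : (fun x : B => _) = fun x : B => Lm * \1_N x); last by apply/funext => x; rewrite mulrC.
  by apply: bmZ; apply: bm_indic.
have Epsi : (\int[mu]_x psi x)%R <= e.
  rewrite (_ : psi = fun x : B => e / 2 + Lm * \1_N x); last by apply/funext => x; congr (_ + _); exact: mulrC.
  rewrite expectD ?expect_cst ?expectZ; [|exact: bm_indic|exact: bm_cst|by apply: bmZ; exact: bm_indic].
  rewrite expect_indic// (@le_trans _ _ (e / 2 + Lm * (e / 2 / (Lm + 1))))//.
    by rewrite lerD2l ler_wpM2l.
  rewrite [X in _ + X](_ : _ = (e / 2) * (Lm / (Lm + 1))); last by ring.
  have : Lm / (Lm + 1) <= 1 by rewrite ler_pdivrMr ?ltr_wpDl// mul1r lerDl.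
  move=> /(ler_wpM2l (ltW (divr_gt0 e0 (ltr0Sn R 1)))); lra.
have g1 n y : \sum_w g n w y = 1.
  rewrite -(bigA_distr_bigA (fun (i : 'I_n) (j : 'I_m) => kap eta j (c' (iter i sg y)))).
  by rewrite big1// => i _; exact: kap_sum.
have b1 n : \sum_w b n w <= 1.
  (* The likelihoods add up to 1, so the weights add up to a normalized value of L^(n+l) 1, at most
     1 by the growth bound. *)
  rewrite -mulr_sumr.
  have -> : \sum_w iter (n + l) (tr phi) (g n w) point = iter (n + l) (tr phi) (fun=> 1) point.
    have -> : (fun=> 1) = (fun y => \sum_w 1 * g n w y).
      by apply/funext => y; rewrite -[LHS](g1 n y); apply: eq_bigr => w _; rewrite mul1r.
    by rewrite iter_tr_sum; apply: eq_bigr => w _; rewrite mul1r.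
  rewrite (le_trans (ler_wpM2l _ (LC _ _)))//; first by rewrite mulr_ge0 ?expR_ge0// invr_ge0 ltW.
  by rewrite mulrACA mulVf ?gt_eqF// mul1r -expRD addNr expR0.
have blow n w z : iter (n + l) sg z = point ->
    C^-1 * expR (- ((n + l)%:R * Lam)) * (expR (birkhoff F (n + l) z) * g n w z) <= b n w.
  move=> zx; rewrite /b; apply: ler_wpM2l; first by rewrite mulr_ge0 ?expR_ge0// invr_ge0 ltW.
  rewrite -zx -bprod_exp; apply: iter_tr_ge => // y; exact/ltW/g0.
have lE n : (n + n' + M = n + l)%N by rewrite /l addnA.
have b0 n w : 0 < b n w.
  have [z zx _] := HM (n + n')%N point point; rewrite lE in zx.
  by apply: lt_le_trans (blow n w z zx); rewrite !mulr_gt0 ?expR_gt0// invr_gt0.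
have bPhi n x : expR (- Phi n x) <= b n [ffun i : 'I_n => c (iter i sg x)].
  have [z zx zy] := HM (n + n')%N point x; rewrite lE in zx.
  apply: le_trans (blow n _ z zx).
  have -> : - Phi n x = - ln C + (- (n%:R * Lam + l%:R * `|Lam|)) +
      ((birkhoff F n x - K / (1 - theta) - l%:R * bF) + - \sum_(0 <= i < n) psi (iter i sg x)).
    by rewrite /Phi /a; ring.
  rewrite expRD [expR (- ln C + _)]expRD [expR (- ln C)]expRN lnK ?posrE//.
  apply: ler_pM; rewrite ?mulr_ge0 ?expR_ge0 ?invr_ge0 ?(ltW C0)//.
    apply: ler_wpM2l; first by rewrite invr_ge0 ltW.
    by rewrite ler_expR lerN2 natrD mulrDl lerD2l ler_wpM2l// ler_norm.
  rewrite expRD; apply: ler_pM; rewrite ?expR_ge0//.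
    rewrite ler_expR birkhoffD lerD//.
      rewrite lerBlDr -lerBlDl (le_trans (ler_norm _))//.
      by apply: birkhoff_agree => i jn; rewrite zy// ltnS (leq_trans (ltnW jn))// leq_addr.
    have := birkhoff_bound (l) (iter n sg z) Fb.
    by rewrite ler_norml => /andP[].
  rewrite big_mkord -sumrN expR_sum; apply: ler_prod => i _; rewrite expR_ge0 /=.
  rewrite ffunE; apply: le_trans (kap_lb m0 eta01 _ _).
  have -> : c' (iter i sg z) = c' (iter i sg x).
    apply: c'E => j jn; rewrite !val_iter_shift zy// ltnS ltnW//.
    by rewrite -addSn leq_add// ?ltn_ord// ltnW.
  rewrite /psi opprD expRD /eta opprB addrCA subrr addr0 indicE.
  by rewrite (_ : (iter i sg x \in N) = (c (iter i sg x) != c' (iter i sg x)))//; apply/idP/idP => [/set_mem//|H]; exact/mem_set.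
exists a => n.
pose t (x : B) := [ffun i : 'I_n => c (iter i sg x)].
have mt : forall w, measurable (t @^-1` [set w]) by exact: itinerary_measurable.
have -> : join_entropy mu c n = \sum_w - (fine (mu (t @^-1` [set w])) * ln (fine (mu (t @^-1` [set w])))).
  by apply: eq_bigr => w _; rewrite /= join_atomE.
have asum : \sum_w fine (mu (t @^-1` [set w])) = 1.
  have := expect_fin mu mt (fun=> 1); rewrite (_ : _ \o t = fun=> 1)// expect_cst => ->.
  by apply: eq_bigr => w _; rewrite mul1r.
rewrite (le_trans (gibbs_inequality _ (b0 n) asum (b1 n)))//; first by move=> w; rewrite fine_ge0.
rewrite -(expect_fin mu mt (fun w => - ln (b n w))).
have bP : bm (Phi n : B -> R).
  apply: bmD; last by apply: bm_sum => i; apply: bm_shift.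
  apply: bmD; first exact: bm_cst.
  rewrite (_ : (fun x : B => - _) = fun x : B => -1 * birkhoff F n x).
    by apply: bmZ; exact: bm_birkhoff.
  by apply/funext => x; rewrite mulN1r.
rewrite (le_trans (expect_le mu (bm_fin mt _) bP _))//.
  move=> x; rewrite /= lerNl -ler_expR lnK ?posrE//; exact: bPhi.
have -> : Phi n = fun x : B => (a + n%:R * Lam) + ((-1) * birkhoff F n x + \sum_(0 <= i < n) psi (iter i sg x)).
  by apply/funext => x; rewrite /Phi mulN1r addrA.
have bs i : bm (fun x : B => psi (iter i sg x)) by exact: (bm_shift th01 i bpsi).
have bb : bm (fun x : B => -1 * birkhoff F n x) by apply: bmZ; exact: bm_birkhoff.
rewrite expectD ?expect_cst; [|exact: bm_cst|by apply: bmD => //; exact: bm_sum].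
rewrite expectD//; last exact: bm_sum.
rewrite expectZ ?expect_birkhoff; last exact: bm_birkhoff.
rewrite expect_sum// (eq_bigr (fun=> (\int[mu]_x psi x)%R)) => [|i _]; last exact: expect_shift.
rewrite sumr_const_nat subn0 -[_ *+ n]mulr_natl.
have := ler_wpM2l (ler0n R n) Epsi; lra.
Qed.

End entropy_upper_bound.

(** * Lebesgue measure on the unit interval *)

Section unit_interval.
Variable R : realType.

Lemma measurable_unit : measurable (`[0, 1[%classic : set R).
Proof. exact: measurable_itv. Qed.

Definition unit_measure := mrestr (@lebesgue_measure R) measurable_unit.

HB.instance Definition _ := Measure.on unit_measure.

Lemma unit_measureT : unit_measure setT = 1%:E.
Proof. by rewrite /unit_measure /mrestr setTI lebesgue_measure_itv/= lte_fin ltr01 oppr0 adde0. Qed.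

HB.instance Definition _ := Measure_isProbability.Build _ _ _ unit_measure unit_measureT.

End unit_interval.

Section open_sets.
Context {R : realType} {A : aperiodic_matrix} {theta : R}.
Local Notation S := (shift_space A theta).

Lemma open_cylinders (U : set S) : 0 < theta < 1 -> dtheta_open U ->
  U = \bigcup_n \bigcup_(w in [set w | w \in words n /\ forall x : S, word n x = w -> U x])
    [set x : S | word (size w) x = w].
Proof.
move=> th01 oU; apply/seteqP; split => [x Ux|x [n _ [w [wn H]] /= xw]]; last first.
  by apply: H; move: wn xw; rewrite mem_words => /eqP ->.
have [r r0 H] := oU _ Ux; have /andP[t0 t1] := th01.
have : (theta ^+ n) @[n --> \oo] --> (0 : R) by apply: cvg_expr; rewrite ger0_norm ?(ltW t0).
move=> /cvgrPdist_lt /(_ r r0)[n _ Hn]; exists n => //.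
exists (word n x); last by rewrite /= size_word.
split; first by rewrite mem_words size_word.
move=> y yx; apply: H; rewrite d_sym (le_lt_trans (d_le_agree th01 (word_agree yx)))//.
have := Hn n (leqnn n); rewrite /= sub0r normrN; exact/le_lt_trans/ler_norm.
Qed.

End open_sets.

(** * A measure with prescribed consistent cylinder masses *)

Section coding.
Context {R : realType} {A : aperiodic_matrix} {theta : R}.
Local Notation S := (shift_space A theta).
Local Notation I := 'I_(kappa A).
Local Notation B := (borel_shift A theta).
Hypothesis th01 : 0 < theta < 1.
Implicit Types (x y : S) (w : seq I) (t : R).

Variable m : seq I -> R.
Hypothesis m_ge0 : forall w, 0 <= m w.
Hypothesis m_nil : m [::] = 1.
Hypothesis m_sum : forall w, \sum_i m (rcons w i) = m w.
Hypothesis m_pos : forall w, 0 < m w -> exists x, word (size w) x = w.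

Lemma partial_sums n (a : 'I_n -> R) (s : R) : 0 <= s < \sum_j a j ->
  exists i : 'I_n, \sum_(j < n | (j < i)%N) a j <= s < \sum_(j < n | (j < i)%N) a j + a i.
Proof.
move=> /andP[s0 s1].
have E (k : nat) (kn : (k < n)%N) : \sum_(j < n | (j < k.+1)%N) a j =
    \sum_(j < n | (j < k)%N) a j + a (Ordinal kn).
  rewrite (bigD1 (Ordinal kn))//= addrC; congr (_ + _); apply: eq_bigl => j.
  by rewrite ltnS ltn_neqAle andbC; congr (_ && _).
have [k [kn ks kmin]] : exists k, [/\ (k <= n)%N, s < \sum_(j < n | (j < k)%N) a j &
    forall k', (k' < k)%N -> \sum_(j < n | (j < k')%N) a j <= s].
  have H : exists k, (k <= n)%N && (s < \sum_(j < n | (j < k)%N) a j).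
    exists n; rewrite leqnn; rewrite (eq_bigl xpredT)// => j; exact: ltn_ord.
  have [k /andP[kn ks] kmin] := ex_minnP H; exists k; split => // k' k'k.
  rewrite leNgt; apply/negP => s'; have := kmin k'.
  by rewrite s' (leq_trans (ltnW k'k) kn) leqNgt k'k => /(_ isT).
case: k kn ks kmin => [|k] kn ks kmin.
  by move: ks; rewrite big_pred0// ltNge s0.
by exists (Ordinal kn); rewrite kmin//= -(E k kn).
Qed.

Lemma partial_sums_unique n (a : 'I_n -> R) (s : R) (i i' : 'I_n) : (forall j, 0 <= a j) ->
  \sum_(j < n | (j < i)%N) a j <= s < \sum_(j < n | (j < i)%N) a j + a i ->
  \sum_(j < n | (j < i')%N) a j <= s < \sum_(j < n | (j < i')%N) a j + a i' -> i = i'.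
Proof.
move=> a0; wlog ii : i i' / (i <= i')%N => [H h h'|/andP[h1 h2] /andP[h3 h4]].
  by have [ii|/ltnW ii] := leqP i i'; [exact: H|apply/esym/H].
apply/val_inj/eqP; rewrite eqn_leq ii leqNgt; apply/negP => ii'.
have : \sum_(j < n | (j < i)%N) a j + a i <= \sum_(j < n | (j < i')%N) a j.
  have -> : \sum_(j < n | (j < i')%N) a j = \sum_(j < n | (j < i')%N && (j != i)) a j + a i.
    by rewrite (bigD1 i)// addrC.
  rewrite lerD2r big_mkcond [leRHS]big_mkcond /=.
  apply: ler_sum => j _; case: ifP => ji; last by case: ifP.
  by rewrite (ltn_trans ji ii') /= (_ : j != i)// -val_eqE neq_ltn ji.
lra.
Qed.

(** Left end of the interval of length m w attached to w: the total mass of the words of the same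
    length that precede w lexicographically. The intervals of the one-letter extensions of w tile
    the interval of w. *)
Definition lft w : R :=
  \sum_(0 <= k < size w) \sum_(j : I | (j < nth j w k)%N) m (rcons (take k w) j).

Lemma lft_rcons w (i : I) : lft (rcons w i) = lft w + \sum_(j : I | (j < i)%N) m (rcons w j).
Proof.
rewrite /lft size_rcons big_nat_recr//=; congr (_ + _).
  apply: eq_big_nat => k /andP[_ kw]; apply: eq_big => [j|j _].
    by rewrite nth_rcons kw.
  by rewrite -[rcons w i]cats1 takel_cat// ltnW.
apply: eq_big => [j|j _]; first by rewrite nth_rcons ltnn eqxx.
by rewrite -[rcons w i]cats1 takel_cat// take_size.
Qed.

Definition itv w t := lft w <= t < lft w + m w.

Lemma itv_sub w i t : itv (rcons w i) t -> itv w t.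
Proof.
rewrite /itv lft_rcons => /andP[h1 h2]; apply/andP; split.
  by apply: le_trans h1; rewrite lerDl sumr_ge0.
apply: (lt_le_trans h2); rewrite -addrA lerD2l -(m_sum w) [leRHS](bigD1 i)//= addrC lerD2l.
rewrite big_mkcond [leRHS]big_mkcond /=; apply: ler_sum => j _.
case: ifP => ji; last by case: ifP.
by rewrite (_ : j != i)// -val_eqE neq_ltn ji.
Qed.

Lemma itv_ex w t : itv w t -> exists i, itv (rcons w i) t.
Proof.
move=> /andP[h1 h2].
have [|i /andP[i1 i2]] := @partial_sums _ (fun j => m (rcons w j)) (t - lft w).
  by rewrite m_sum subr_ge0 h1 ltrBlDl.
exists i; rewrite /itv lft_rcons; lra.
Qed.

Lemma itv_unique w i i' t : itv (rcons w i) t -> itv (rcons w i') t -> i = i'.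
Proof.
rewrite /itv !lft_rcons => h h'.
apply: (@partial_sums_unique _ (fun j => m (rcons w j)) (t - lft w)) => //; lra.
Qed.

Lemma itv_nil t : itv [::] t = (0 <= t < 1).
Proof. by rewrite /itv /lft big_geq// add0r m_nil. Qed.

Lemma itv_unit w t : itv w t -> 0 <= t < 1.
Proof. by elim/last_ind: w => [|w i IH]; [rewrite itv_nil|move=> /itv_sub]. Qed.

Definition i0 : I := val (point : S) 0%N.
Definition nexti w t : I := xget i0 [set i | itv (rcons w i) t].
Fixpoint code t n : seq I := if n is n'.+1 then rcons (code t n') (nexti (code t n') t) else [::].

Lemma size_code t n : size (code t n) = n.
Proof. by elim: n => //= n IH; rewrite size_rcons IH. Qed.

Lemma code_itv t n : 0 <= t < 1 -> itv (code t n) t.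
Proof.
move=> t01; elim: n => [|n IH]; first by rewrite itv_nil.
rewrite /= /nexti; case: xgetP => [i _ //|] /=.
by have [i it] := itv_ex IH => /(_ i).
Qed.

Lemma code_unique t w : itv w t -> code t (size w) = w.
Proof.
elim/last_ind: w => [//|w i IH] it; rewrite size_rcons /= (IH (itv_sub it)); congr rcons.
have := code_itv (size w).+1 (itv_unit it); rewrite /= (IH (itv_sub it)) => H.
exact: itv_unique H it.
Qed.

Lemma take_code t n k : (k <= n)%N -> take k (code t n) = code t k.
Proof.
elim: n => [|n IH]; first by case: k.
rewrite leq_eqVlt => /predU1P[->|]; first by rewrite -{1}(size_code t n.+1) take_size.
rewrite ltnS => kn; rewrite /= -cats1 takel_cat ?size_code//; exact: IH.
Qed.

Definition coded t : nat -> I := fun j => nth i0 (code t j.+1) j.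

Lemma nth_code t n j : (j < n)%N -> nth i0 (code t n) j = coded t j.
Proof. by move=> jn; rewrite /coded -(take_code t jn) nth_take. Qed.

Lemma coded_admissible t : 0 <= t < 1 -> coded t \in admissible A.
Proof.
move=> t01; apply/mem_set => j.
have /andP[h1 h2] := code_itv j.+2 t01.
have [|x] := m_pos (w := code t j.+2); first by move: (le_lt_trans h1 h2); rewrite ltrDl.
rewrite size_code => xw.
have E k : (k < j.+2)%N -> coded t k = val x k.
  move=> kj; rewrite -(nth_code t kj) -xw (nth_map 0%N) ?size_iota//.
  by rewrite nth_iota.
by rewrite !E//; exact: admissibleP.
Qed.

Definition base_point : S := point.

(** Sends t to the sequence whose prefixes are the words with t in their interval. Such words have
    positive mass, so they are realized by points, whence admissibility; outside [0, 1) the value is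
    a fixed point. *)
Definition decode t : B :=
  if 0 <= t < 1 then insubd (base_point : {x : nat -> I | x \in admissible A}) (coded t) else base_point.

Lemma word_decode t n : 0 <= t < 1 -> word n (decode t : S) = code t n.
Proof.
move=> t01; apply: (@eq_from_nth _ i0); first by rewrite size_word size_code.
move=> j; rewrite size_word => jn; rewrite nth_code// (nth_map 0%N) ?size_iota// nth_iota//.
by rewrite /decode t01 val_insubd coded_admissible.
Qed.

Lemma word_decodeP t w : 0 <= t < 1 -> (word (size w) (decode t : S) == w) = itv w t.
Proof.
move=> t01; rewrite word_decode//; apply/eqP/idP => [<-|]; last exact: code_unique.
exact: code_itv.
Qed.

Lemma measurable_decode : measurable_fun setT (decode : R -> B).
Proof.
apply: (@measurability _ _ R B setT decode (@dtheta_open R A theta)) => // _ [U oU <-].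
rewrite setTI.
rewrite (open_cylinders th01 oU) preimage_bigcup; apply: bigcup_measurable => n _.
rewrite preimage_bigcup; apply: fin_bigcup_measurable.
  apply: (@sub_finite_set _ _ [set` words n]); first by move=> w [].
  exact: finite_seq.
move=> w _.
(* Inside [0, 1) the preimage of a cylinder is its interval; outside, it is everything or nothing
   according to the default point. *)
have -> : decode @^-1` [set x | word (size w) x = w] =
    (`[0, 1[%classic `&` `[lft w, lft w + m w[%classic) `|`
    (~` `[0, 1[%classic `&` (if word (size w) base_point == w then setT else set0)).
  apply/seteqP; split => t /=; rewrite !in_itv/=.
    have [t01|t01] := boolP (0 <= t < 1).
      by rewrite -[_ /\ _]/(true /\ itv w t) => /eqP; rewrite word_decodeP// => H; left.
    by rewrite /decode (negbTE t01) => /eqP ->; right.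
  move=> [[t01 tw]|[/negP t01]].
    by apply/eqP; rewrite word_decodeP.
  by rewrite /decode (negbTE t01); case: eqP.
apply: measurableU; apply: measurableI; try exact: measurable_itv.
  by apply: measurableC; exact: measurable_itv.
by case: ifP.
Qed.

(** The image of Lebesgue measure under the coding takes the place of an extension theorem. *)
Theorem cylinder_measure : exists nu : probability B R,
  forall w, nu [set x | word (size w) x = w] = (m w)%:E.
Proof.
have mX : @measurable_fun _ _ (g_sigma_algebraType R.-ocitv.-measurable) B setT decode.
  exact: measurable_decode.
pose X : {mfun (g_sigma_algebraType R.-ocitv.-measurable) >-> B} :=
  MeasurableFun.Pack (MeasurableFun.Class (isMeasurableFun.Build _ _ _ _ _ mX)).
exists (distribution (@unit_measure R) X) => w.
rewrite /distribution /pushforward /= /unit_measure /mrestr.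
have -> : decode @^-1` [set x | word (size w) x = w] `&` `[0, 1[%classic = `[lft w, lft w + m w[%classic.
  apply/seteqP; split => t /=; rewrite !in_itv/=.
    by move=> [/eqP + t01]; rewrite word_decodeP.
  move=> tw; have t01 : 0 <= t < 1 by exact: itv_unit tw.
  by split => //; apply/eqP; rewrite word_decodeP.
rewrite lebesgue_measure_itv/= lte_fin ltrDl; case: ifP => mw.
  by rewrite -EFinB addrAC subrr add0r.
by congr (_%:E); apply/eqP; rewrite eq_le m_ge0 /= leNgt mw.
Qed.

End coding.

(** * Rates of sequences with linear bounds *)

Section linear_rate.
Context {R : realType}.
Implicit Types (u : nat -> R) (L a e : R).

Lemma le_of_linear L L' a : (forall n : nat, n%:R * L <= a + n%:R * L') -> L <= L'.
Proof.
move=> H; rewrite leNgt; apply/negP => LL.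
have d0 : 0 < L - L' by rewrite subr_gt0.
pose n := Num.bound `|a / (L - L')|.
have := H n; have : a < n%:R * (L - L').
  by rewrite -ltr_pdivrMr// (le_lt_trans (ler_norm _))// archi_boundP ?normr_ge0.
lra.
Qed.

Lemma linear_rate_ge0 u L : (forall n, 0 <= u n) ->
  (forall e, 0 < e -> exists a, forall n, u n <= a + n%:R * (L + e)) -> 0 <= L.
Proof.
move=> u0 H; apply/ler_addgt0Pr => e /H[a Ha].
by apply: (@le_of_linear _ _ a) => n; rewrite mulr0 (le_trans (u0 n)).
Qed.

Lemma rate_le (u : nat -> R) L : (forall e, 0 < e -> exists a, forall n, u n <= a + n%:R * (L + e)) ->
  forall e, 0 < e -> \forall n \near \oo, u n / n%:R <= L + e.
Proof.
move=> H e e0; have e2 : 0 < e / 2 by lra.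
have [a Ha] := H _ e2; near=> n.
have n0 : (0 < n)%N by near: n; exact: nbhs_infty_gt.
have nR : 0 < n%:R :> R by rewrite ltr0n.
rewrite ler_pdivrMr// (le_trans (Ha n))//.
have : a <= n%:R * (e / 2).
  rewrite -ler_pdivrMr//; near: n; exact: nbhs_infty_ger.
lra.
Unshelve. all: end_near. Qed.

Lemma lim_rate_le u L : (forall n, 0 <= u n) ->
  (forall e, 0 < e -> exists a, forall n, u n <= a + n%:R * (L + e)) ->
  limn (fun n => u n / n%:R) <= L.
Proof.
move=> u0 H; have [cu|dvg] := pselect (cvgn (fun n => u n / n%:R)); last first.
  (* A divergent sequence has limit the default real 0, so the claim becomes 0 <= L. *)
  have -> : limn (fun n => u n / n%:R) = (point : R) by exact: dvgP.
  exact: linear_rate_ge0 H.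
apply/ler_addgt0Pr => e e0; apply: limr_le => //; exact: rate_le.
Qed.

Lemma lim_rate_eq u L a0 : (forall e, 0 < e -> exists a, forall n, u n <= a + n%:R * (L + e)) ->
  (forall n, n%:R * L <= a0 + u n) -> limn (fun n => u n / n%:R) = L.
Proof.
move=> H Hl; apply/cvg_lim => //; apply/cvgrPdist_le => e e0; near=> n.
have n0 : (0 < n)%N by near: n; exact: nbhs_infty_gt.
have nR : 0 < n%:R :> R by rewrite ltr0n.
rewrite ler_distlC; apply/andP; split; last first.
  by near: n; exact: rate_le.
rewrite ler_pdivlMr// mulrC.
have : a0 <= n%:R * e.
  rewrite -ler_pdivrMr//; near: n; exact: nbhs_infty_ger.
have := Hl n; lra.
Unshelve. all: end_near. Qed.

End linear_rate.

(** * The invariant Gibbs measure of a g-function *)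

Section gibbs_measure.
Context {R : realType} {A : aperiodic_matrix} {theta : R}.
Local Notation S := (shift_space A theta).
Local Notation I := 'I_(kappa A).
Local Notation sg := (@Defs.shift R A theta).
Local Notation B := (borel_shift A theta).
Implicit Types (x y z : S) (w : seq I).

Variable p : @nweight R A theta.
Let th01 := nw_th p.
Let th0 : 0 < theta. Proof. by case/andP: th01. Qed.
Let th1 : theta < 1. Proof. by case/andP: th01. Qed.
Local Notation cyl := (@cyl R A theta).

Lemma lip_cyl w : lip (cyl w) (theta ^- size w).
Proof.
move=> x y; have t0 : 0 < theta ^+ size w by rewrite exprn_gt0.
have [H|H] := ltP (dtheta x y) (theta ^+ size w).
  rewrite /cyl (agree_word (d_lt_agree th01 H)) subrr normc0 mulr_ge0 ?d_ge0// invr_ge0 ltW//.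
rewrite (@le_trans _ _ 1)//; last by rewrite ler_pdivlMl// mulr1.
rewrite /cyl; case: eqP => _; case: eqP => _; rewrite ?subrr ?subr0 ?sub0r ?normcN ?normc1 ?normc0//.
Qed.

Lemma cyl_rcons w x : cyl w x = \sum_i cyl (rcons w i) x.
Proof.
have E : word (size w).+1 x = rcons (word (size w) x) (val x (size w)).
  by rewrite /word -addn1 iotaD map_cat cats1.
rewrite /cyl (bigD1 (val x (size w)))//= size_rcons E big1 ?addr0 => [|i iw].
  by rewrite eqseq_rcons eqxx andbT.
by rewrite size_rcons E eqseq_rcons [val x _ == i]eq_sym (negbTE iw) andbF.
Qed.

Lemma cyl_cons w x : cyl w (sg x) = \sum_(i : I) cyl (i :: w) x.
Proof.
rewrite /cyl (bigD1 (val x 0%N))//= wordS eqseq_cons eqxx big1 ?addr0// => i iw.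
by have /negbTE := iw; rewrite eq_sym eqseq_cons => ->.
Qed.

Lemma mu_sum (r : seq I) (v : I -> S -> R[i]) (l : R) : 0 <= l -> (forall i, lip (v i) l) ->
  mu p (fun x => \sum_(i <- r) v i x) = \sum_(i <- r) mu p (v i) /\
  lip (fun x => \sum_(i <- r) v i x) ((size r)%:R * l).
Proof.
move=> l0 vl; elim: r => [|i r [IH1 IH2]].
  have -> : (fun x => \sum_(i <- [::]) v i x) = (fun=> 0) by apply/funext => x; rewrite big_nil.
  by rewrite mu_cst big_nil mul0r; split => //; exact: lip_cst.
have -> : (fun x => \sum_(j <- i :: r) v j x) = (fun x => v i x + \sum_(j <- r) v j x).
  by apply/funext => x; rewrite big_cons.
have rl : 0 <= (size r)%:R * l by rewrite mulr_ge0.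
split; first by rewrite (muD p l0 (vl i) rl IH2) IH1 big_cons.
rewrite /= -natr1 mulrDl mul1r addrC; exact: lipD.
Qed.

Definition cmass w := cRe (mu p (cyl w)).

Let tw0 w : 0 <= theta ^- size w.
Proof. by rewrite invr_ge0 exprn_ge0// ltW. Qed.

Lemma cmass_ge0 w : 0 <= cmass w.
Proof.
apply: (mu_ge0 p (tw0 w) (lip_cyl w)) => x.
by rewrite /cyl; case: eqP.
Qed.

Lemma cmass_nil : cmass [::] = 1.
Proof. by rewrite /cmass (_ : cyl [::] = fun=> 1)// mu_cst. Qed.

Lemma cmass_rcons w : \sum_i cmass (rcons w i) = cmass w.
Proof.
rewrite /cmass -Re_sum; congr cRe.
have [||E _] := @mu_sum (index_enum I) (fun i => cyl (rcons w i)) (theta ^- (size w).+1).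
- by have := tw0 (rcons w (val (point : S) 0%N)); rewrite size_rcons.
- by move=> i; have := lip_cyl (rcons w i); rewrite size_rcons.
by rewrite -E; congr mu; apply/funext => x; rewrite [RHS]cyl_rcons.
Qed.

Lemma cmass_cons w : \sum_(i : I) cmass (i :: w) = cmass w.
Proof.
rewrite /cmass -Re_sum; congr cRe.
have [||E _] := @mu_sum (index_enum I) (fun i => cyl (i :: w)) (theta ^- (size w).+1).
- exact: (tw0 (val (point : S) 0%N :: w)).
- move=> i; exact: (lip_cyl (i :: w)).
rewrite -E -(mu_shift p (tw0 w) (lip_cyl w)); congr mu; apply/funext => x.
by rewrite -cyl_cons.
Qed.

Lemma cmass_pos w : 0 < cmass w -> exists x, word (size w) x = w.
Proof.
move=> m0; apply: contrapT => H; move: m0.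
rewrite /cmass (_ : cyl w = fun=> 0) ?mu_cst ?ltxx//.
apply/funext => x; rewrite /cyl; case: eqP => // xw.
by case: H; exists x.
Qed.

(** After as many steps as the length of w, the cylinder function is a single branch weight, bounded
    by b; further steps average it, and the mass is the limit. *)
Lemma cmass_le w (b : R) : (forall x, wok w x -> bprod p (size w) (wcat w x) <= b) -> 0 <= b -> cmass w <= b.
Proof.
move=> H b0; have [Cm [r [C0 r01 G]]] := mu_tends p (tw0 w) (lip_cyl w).
have bn k x : normc (iter (k + size w) (tr (fun z => (p z)%:C)) (cyl w) x) <= b.
  elim: k x => [|k IH] x; last exact: normc_M.
  have -> : iter (0 + size w) (tr (fun z => (p z)%:C)) (cyl w) x =
     if wok w x then bprod (fun z => (p z)%:C) (size w) (wcat w x) else 0 by exact: iter_tr_cylinder.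
  case: ifP => wx; last by rewrite normc0.
  have -> : bprod (fun z => (p z)%:C) (size w) (wcat w x) = (bprod p (size w) (wcat w x))%:C.
    by rewrite /bprod rmorph_prod.
  by rewrite normc_real ger0_norm ?H// bprod_ge0.
have /andP[r0 r1] := r01.
rewrite /cmass -subr_le0; apply: (@geom_le0 _ _ Cm r r01) => k.
rewrite lerBlDr (le_trans (ler_norm _))// (le_trans (normc_Re _))//.
rewrite -[mu p (cyl w)](subrK (iter (k + size w) (tr (fun z => (p z)%:C)) (cyl w) point)).
rewrite (le_trans (normcD _ _))// lerD ?bn// normc_subC (le_trans (G _ _))//.
by rewrite ler_wpM2l// ler_wiXn2l ?(ltW r1)// leq_addr.
Qed.

(** The cylinder masses are those given by the functional [mu]; its shift invariance is the
    invariance of the measure on cylinders. Cylinders and the empty set are stable under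
    intersection and generate the Borel sets. *)
Theorem gibbs_measure : exists2 nu : probability B R, Defs.invariant nu &
  forall w, nu [set x | word (size w) x = w] = (cmass w)%:E.
Proof.
have [nu nuE] := cylinder_measure th01 cmass_ge0 cmass_nil cmass_rcons cmass_pos.
exists nu => // E mE.
pose cs w : set S := [set x | word (size w) x = w].
have mcs w : measurable (cs w : set B).
  apply: (measurable_cylset th01 (n := size w)) => x y /= <- xy.
  by rewrite size_word in xy; rewrite /cs /= size_word; apply/esym/agree_word.
have ms : measurable_fun setT (sg : B -> B) by exact: measurable_shift.
have mpre w : measurable (sg @^-1` cs w : set B).
  by rewrite -[X in measurable X]setTI; exact: ms.
have nuc v : nu (cs v) = (cmass v)%:E by exact: nuE.
have nus w : nu (sg @^-1` cs w) = (cmass w)%:E.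
  rewrite -[LHS]fineK ?fin_num_measure//; congr (_%:E).
  rewrite -expect_indic// -cmass_cons.
  have -> : \1_(sg @^-1` cs w) = (fun x : B => \sum_(i : I) \1_(cs (i :: w)) x) :> (B -> R).
    apply/funext => x; rewrite (bigD1 (val x 0%N))//= big1 ?addr0 => [|i ix].
      rewrite !indicE; congr (_%:R); congr nat_of_bool; apply/idP/idP => /set_mem h; apply/mem_set; move: h => /=.
        by move=> /= h; rewrite /cs /= wordS h.
      by rewrite /cs /= wordS => -[].
    rewrite indicE memNset// /cs /= wordS => -[h _]; by rewrite h eqxx in ix.
  rewrite expect_sum => [|i]; last exact: bm_indic.
  by apply: eq_bigr => i _; rewrite expect_indic// nuc.
pose G : set (set B) := [set X | X = set0 \/ exists w, X = cs w].
pose X : {mfun B >-> B} := MeasurableFun.Pack (MeasurableFun.Class (isMeasurableFun.Build _ _ _ _ _ ms)).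
apply: (@measure_unique _ R B G (fun=> setT) _ _ _ _ (distribution nu X) nu) => //.
- apply/seteqP; split; last first.
    apply: smallest_sub; first exact: sigma_algebra_measurable.
    by move=> Y [->|[w ->]]; [exact: measurable0|exact: mcs].
  apply: smallest_sub; first exact: smallest_sigma_algebra.
  move=> U oU; rewrite (open_cylinders th01 oU).
  apply: (@bigcup_measurable _ (g_sigma_algebraType G)) => n _.
  apply: (@fin_bigcup_measurable _ (g_sigma_algebraType G)).
    apply: (@sub_finite_set _ _ [set` words n]); first by move=> w [].
    exact: finite_seq.
  by move=> w _; apply: sub_sigma_algebra; right; exists w.
- move=> Y Z [->|[w ->]]; first by rewrite set0I; left.
  move=> [->|[w' ->]]; first by rewrite setI0; left.
  wlog ww : w w' / (size w <= size w')%N => [H|].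
    by have [h|/ltnW h] := leqP (size w) (size w'); [exact: H|rewrite setIC; exact: H].
  have [Ew|Ew] := eqVneq (take (size w) w') w; [right; exists w'|left].
    by apply/setIidPr => x /= xw'; rewrite /cs /= -(take_word x ww) xw'.
  by apply/seteqP; split => // x [/= xw xw']; move: Ew; rewrite -xw' take_word// xw eqxx.
- by move=> _; right; exists [::]; apply/seteqP; split.
- by apply/seteqP; split => // x _; exists 0%N.
- move=> Y [->|[w ->]]; first by rewrite !measure0.
  exact: (etrans (nus w) (esym (nuc w))).
- move=> _; apply: le_lt_trans (probability_le1 _ _) (ltry 1); exact: measurableT.
Qed.

End gibbs_measure.

(** * Pressure equals the exponential growth rate *)

Section variational_principle.
Context {R : realType} {A : aperiodic_matrix} {theta : R}.
Local Notation S := (shift_space A theta).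
Local Notation I := 'I_(kappa A).
Local Notation sg := (@Defs.shift R A theta).
Local Notation B := (borel_shift A theta).
Hypothesis th01 : 0 < theta < 1.
Implicit Types (x y z : S).

Variables (F : S -> R) (K : R).
Hypothesis K0 : 0 <= K.
Hypothesis FK : forall x y, `|F x - F y| <= K * dtheta x y.
Variables (Lam C : R) (h : S -> R) (p : @nweight R A theta).
Hypothesis C1 : 1 <= C.
Hypothesis LC : forall n x, iter n (tr (fun x => expR (F x))) (fun=> 1) x <= C * expR (n%:R * Lam).
Hypothesis hC : forall x, C^-1 <= h x <= C.
Hypothesis pE : forall x, p x = expR (F x - Lam) * h x / h (sg x).
Let C0 : 0 < C. Proof. exact: lt_le_trans C1. Qed.
Let h0 x : 0 < h x.
Proof. by have /andP[+ _] := hC x; apply: lt_le_trans; rewrite invr_gt0. Qed.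

Lemma join_entropy_ge0 (nu : probability B R) m (c : S -> 'I_m) n :
  (forall j, measurable (c @^-1` [set j] : set B)) -> 0 <= join_entropy nu c n.
Proof.
move=> mc; apply: sumr_ge0 => w _ /=; rewrite oppr_ge0.
have mj : measurable (join_atom c w) by rewrite join_atomE; exact: itinerary_measurable.
apply: mulr_ge0_le0; first by rewrite fine_ge0.
by apply: ln_le0; rewrite -lee_fin fineK ?fin_num_measure// probability_le1.
Qed.

Lemma partition_entropy_le (nu : probability B R) m (c : S -> 'I_m) : Defs.invariant nu ->
  (forall j, measurable (c @^-1` [set j] : set B)) ->
  partition_entropy nu c <= Lam - (\int[nu]_x F x)%R.
Proof.
move=> inv mc; apply: lim_rate_le => [n|e e0]; first exact: join_entropy_ge0.
by have [a Ha] := entropy_upper th01 inv K0 FK C1 LC e0 mc; exists a.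
Qed.

(** Upper half of the Gibbs property: the coboundary contributes at most C^2 and the variation of
    the Birkhoff sum on a cylinder at most K / (1 - theta). *)
Lemma cmass_gibbs x n : cmass p (word n x) <=
  C * C * expR (K / (1 - theta)) * expR (birkhoff F n x - n%:R * Lam).
Proof.
apply: cmass_le => [y|]; last by rewrite !mulr_ge0 ?expR_ge0 ?(ltW C0).
rewrite size_word => wy.
have zx : agree (wcat (word n x) y) x n.
  by apply: word_agree; have := word_wcat wy; rewrite size_word.
rewrite (bprod_normalized h0 pE) -mulrA -[leRHS]mulrA mulrC.
apply: ler_pM; rewrite ?expR_ge0// ?divr_ge0 ?(ltW (h0 _))//.
  apply: ler_pM; rewrite ?invr_ge0 ?(ltW (h0 _))//; first by have /andP[] := hC (wcat (word n x) y).
  have /andP[H _] := hC (iter n sg (wcat (word n x) y)).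
  by rewrite -[leRHS]invrK lef_pV2 ?posrE ?invr_gt0.
rewrite -expRD ler_expR addrA lerD2r -lerBlDr (le_trans (ler_norm _))//.
exact: (birkhoff_agree th01 K0 FK zx).
Qed.

(** The entropy of the n-th join is the integral of minus the logarithm of the mass of the
    n-cylinder of x, bounded below pointwise by [cmass_gibbs]. *)
Lemma gibbs_entropy_lower (nu : probability B R) n : Defs.invariant nu ->
  (forall w, nu [set x | word (size w) x = w] = (cmass p w)%:E) ->
  n%:R * (Lam - (\int[nu]_x F x)%R) <=
  ln (C * C * expR (K / (1 - theta))) + join_entropy nu (fun x : S => val x 0%N : I) n.
Proof.
move=> inv nuE; pose c x : I := val x 0%N; set C2 := C * C * _.
have C20 : 0 < C2 by rewrite !mulr_gt0 ?expR_gt0.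
have [b Fb] := lip_bounded th01 K0 FK.
have mc j : measurable (c @^-1` [set j] : set B).
  by apply: (measurable_cylset th01 (n := 1%N)) => x y /= <- xy; rewrite /c; apply/esym/xy.
pose t (x : B) := [ffun i : 'I_n => c (iter i sg x)].
have mt : forall w, measurable (t @^-1` [set w]) by exact: itinerary_measurable.
pose a w := fine (nu (t @^-1` [set w])).
have tword x y : (t x = t y) <-> (word n x = word n y).
  split => [H|H].
    apply: agree_word => j jn; have := congr1 (fun g : {ffun 'I_n -> I} => g (Ordinal jn)) H.
    by rewrite !ffunE /c !val_iter_shift !addn0.
  apply/ffunP => i; rewrite !ffunE /c !val_iter_shift !addn0.
  by apply: (word_agree H).
have aE x : a (t x) = cmass p (word n x).
  rewrite /a (_ : t @^-1` [set t x] = [set y | word (size (word n x)) y = word n x]) ?nuE//.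
  by apply/seteqP; split => y /=; rewrite size_word => /tword.
(* Substitute for minus the logarithm on null words, large enough for the pointwise comparison; such
   words contribute nothing to the entropy. *)
pose L := n%:R * Lam + n%:R * b - ln C2.
pose g w := if a w == 0 then L else - ln (a w).
have -> : join_entropy nu (fun x : S => val x 0%N : I) n = \sum_w g w * a w.
  apply: eq_bigr => w _; rewrite /= join_atomE -/c -/(a w) /g.
  by case: eqP => [->|_]; rewrite ?mul0r ?mulr0 ?oppr0// mulrC mulNr.
rewrite -(expect_fin nu mt g).
have bb : bm (birkhoff F n : B -> R) by exact: (bm_birkhoff th01 K0 FK).
have -> : n%:R * (Lam - (\int[nu]_x F x)%R) = ln C2 + (\int[nu]_x ((n%:R * Lam - ln C2) + -1 * birkhoff F n x))%R.
  rewrite expectD; [|exact: bm_cst|exact: bmZ].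
  rewrite expect_cst expectZ// (expect_birkhoff th01 inv K0 FK); ring.
rewrite lerD2l; apply: expect_le; [by apply: bmD; [exact: bm_cst|exact: bmZ]|exact: bm_fin|].
move=> x; rewrite /g /=; case: eqP => [_|/eqP a0].
  rewrite /L; have := birkhoff_bound n x Fb; rewrite ler_norml => /andP[+ _]; lra.
have ap : 0 < a (t x) by rewrite lt_neqAle eq_sym a0 /a fine_ge0.
have := cmass_gibbs x n; rewrite -aE -/C2 => H.
have : ln (a (t x)) <= ln C2 + (birkhoff F n x - n%:R * Lam).
  by rewrite -ler_expR lnK ?posrE// expRD lnK ?posrE.
lra.
Qed.

(** The upper bound holds for every invariant measure and partition; the Gibbs measure attains it
    with the partition by the first symbol. *)
Theorem variational_principle : pressure F = Lam%:E.
Proof.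
have bF : bm (F : B -> R) by exact: bm_lip FK.
apply/eqP; rewrite eq_le; apply/andP; split.
  apply: ge_ereal_sup => _ [nu inv <-].
  rewrite (expect_EFin nu bF) -leeBrDr// -EFinB.
  apply: ge_ereal_sup => _ [m [c [mc ->]]].
  by rewrite lee_fin; exact: partition_entropy_le.
have [nu inv nuE] := gibbs_measure p.
apply: le_ereal_sup_tmp; exists (entropy nu + \int[nu]_x (F x)%:E)%E; first by exists nu.
rewrite (expect_EFin nu bF) -leeBlDr// -EFinB.
pose c x : I := val x 0%N.
have mc j : measurable (c @^-1` [set j] : set B).
  apply: (measurable_cylset th01 (n := 1%N)) => x y /= <- xy; rewrite /c.
  by apply/esym/xy.
apply: le_ereal_sup_tmp; exists (partition_entropy nu c)%:E; first by exists (kappa A), c.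
rewrite lee_fin; apply/le_of_eq/esym.
apply: (@lim_rate_eq _ _ _ (ln (C * C * expR (K / (1 - theta))))) => [e e0|n].
  by have [a Ha] := entropy_upper th01 inv K0 FK C1 LC e0 mc; exists a.
exact: gibbs_entropy_lower.
Qed.

End variational_principle.

(** * Integrals of real and complex functions over a segment *)

Section line_integrals.
Context {R : realType}.
Implicit Types (u v : R -> R) (f g : R -> R[i]) (a b c M : R).
Local Notation leb := (@lebesgue_measure R).

(** Continuity at each point of the segment, with y ranging over the whole line: this restricts
    trivially to subsegments and avoids the relative topology. *)
Definition rcont u a b := forall x, a <= x <= b -> forall e : R, 0 < e ->
  exists2 d : R, 0 < d & forall y, `|y - x| < d -> `|u y - u x| <= e.

Definition ri u a b : R := \int[leb]_(x in `[a, b]) u x.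

Lemma rcont_sub u a b a' b' : a <= a' -> b' <= b -> rcont u a b -> rcont u a' b'.
Proof. by move=> aa bb H x /andP[h1 h2]; apply: H; rewrite (le_trans aa)//= (le_trans h2). Qed.

Lemma rcont_int u a b : rcont u a b -> leb.-integrable `[a, b] (EFin \o u).
Proof.
move=> H; apply: continuous_compact_integrable; first exact: segment_compact.
apply: continuous_in_subspaceT => x; rewrite inE/= in_itv/= => xab.
apply/cvgrPdist_le => e e0; have [d d0 hd] := H x xab e e0.
near=> y; rewrite distrC; apply: hd; rewrite distrC.
by near: y; apply/nbhs_ballP; exists d.
Unshelve. all: end_near. Qed.

Lemma riD u v a b : rcont u a b -> rcont v a b -> ri (fun x => u x + v x) a b = ri u a b + ri v a b.
Proof. by move=> /rcont_int H1 /rcont_int H2; exact: RintegralD. Qed.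

Lemma riZ k u a b : rcont u a b -> ri (fun x => k * u x) a b = k * ri u a b.
Proof. by move=> /rcont_int H; exact: RintegralZl. Qed.

Lemma ri_cst k a b : a <= b -> ri (fun=> k) a b = k * (b - a).
Proof.
move=> ab; rewrite /ri Rintegral_cst//= lebesgue_measure_itv/= lte_fin.
move: ab; rewrite le_eqVlt => /predU1P[->|->]; first by rewrite ltxx subrr.
by rewrite -EFinB.
Qed.

Lemma ri_split u a b c : a <= c -> c <= b -> rcont u a b -> ri u a b = ri u a c + ri u c b.
Proof.
move=> ac cb H.
have I1 := rcont_int H; have I3 := rcont_int (rcont_sub ac (lexx b) H).
have := Rintegral_itvB (x := c) I1; rewrite !bnd_simp => /(_ ac cb).
rewrite Rintegral_itv_obnd_cbnd; last first.
  apply: integrableS I3 => //.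
  by apply: subset_itvr; rewrite bnd_simp.
by rewrite /ri => <-; ring.
Qed.

Lemma ri_bound u a b M : a <= b -> rcont u a b -> (forall x, a <= x <= b -> `|u x| <= M) ->
  `|ri u a b| <= M * (b - a).
Proof.
move=> ab H uM; have Hi := rcont_int H; rewrite ler_norml; apply/andP; split.
  rewrite -mulNr -(ri_cst _ ab); apply: le_Rintegral => //.
    apply: rcont_int => x _ e e0; exists 1 => // y _; by rewrite subrr normr0 ltW.
  by move=> x /=; rewrite in_itv/= => /uM; rewrite ler_norml => /andP[].
rewrite -(ri_cst _ ab); apply: le_Rintegral => //.
  apply: rcont_int => x _ e e0; exists 1 => // y _; by rewrite subrr normr0 ltW.
by move=> x /=; rewrite in_itv/= => /uM; rewrite ler_norml => /andP[].
Qed.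

Lemma ri_ge u a b M : a <= b -> rcont u a b -> (forall x, a <= x <= b -> M <= u x) ->
  M * (b - a) <= ri u a b.
Proof.
move=> ab H uM; have Hi := rcont_int H; rewrite -(ri_cst _ ab); apply: le_Rintegral => //.
  by apply: rcont_int => x _ e e0; exists 1 => // y _; rewrite subrr normr0 ltW.
Qed.

Lemma eq_ri u v a b : (forall x, a <= x <= b -> u x = v x) -> ri u a b = ri v a b.
Proof. by move=> H; apply: eq_Rintegral => x; rewrite inE/= in_itv/= => /H. Qed.

Definition ccont f a b := forall x, a <= x <= b -> forall e : R, 0 < e ->
  exists2 d : R, 0 < d & forall y, `|y - x| < d -> normc (f y - f x) <= e.

Definition ci f a b : R[i] :=
  Complex (ri (fun x => cRe (f x)) a b) (ri (fun x => cIm (f x)) a b).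

Lemma ccont_Re f a b : ccont f a b -> rcont (fun x => cRe (f x)) a b.
Proof.
move=> H x xab e e0; have [d d0 hd] := H x xab e e0; exists d => // y yx.
by rewrite -ReB (le_trans (normc_Re _))// hd.
Qed.

Lemma ccont_Im f a b : ccont f a b -> rcont (fun x => cIm (f x)) a b.
Proof.
move=> H x xab e e0; have [d d0 hd] := H x xab e e0; exists d => // y yx.
by rewrite -ImB (le_trans (normc_Im _))// hd.
Qed.

Lemma rcontZ k u a b : rcont u a b -> rcont (fun x => k * u x) a b.
Proof.
move=> H x xab e e0; have k0 : 0 < `|k| + 1 by rewrite ltr_wpDl.
have [d d0 hd] := H x xab (e / (`|k| + 1)) (divr_gt0 e0 k0); exists d => // y yx.
rewrite -mulrBr normrM (le_trans (ler_wpM2l (normr_ge0 k) (hd y yx)))//.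
rewrite mulrCA ler_piMr ?(ltW e0)// ler_pdivrMr// mul1r; lra.
Qed.

Lemma ccont_cst (k : R[i]) a b : ccont (fun=> k) a b.
Proof. by move=> x _ e e0; exists 1 => // y _; rewrite subrr normc0 ltW. Qed.

Lemma ciD f g a b : ccont f a b -> ccont g a b -> ci (fun x => f x + g x) a b = ci f a b + ci g a b.
Proof.
move=> Hf Hg; rewrite /ci; apply/eqP; rewrite eq_complex/=; apply/andP; split; apply/eqP.
  rewrite -riD; [|exact: ccont_Re|exact: ccont_Re].
  by apply: eq_ri => x _; rewrite ReD.
rewrite -riD; [|exact: ccont_Im|exact: ccont_Im].
by apply: eq_ri => x _; rewrite ImD.
Qed.

Lemma ciZ (k : R[i]) f a b : ccont f a b -> ci (fun x => k * f x) a b = k * ci f a b.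
Proof.
move=> Hf; have H1 := ccont_Re Hf; have H2 := ccont_Im Hf.
case: k => k1 k2; rewrite /ci; apply/eqP; rewrite eq_complex/=; apply/andP; split; apply/eqP.
  rewrite -mulNr -!riZ// -riD; [|exact: rcontZ|exact: rcontZ].
  by apply: eq_ri => x _; case: (f x) => p q /=; rewrite mulNr.
rewrite -!riZ// -riD; [|exact: rcontZ|exact: rcontZ].
by apply: eq_ri => x _; case: (f x) => p q /=.
Qed.

Lemma ci_cst (k : R[i]) a b : a <= b -> ci (fun=> k) a b = k * (b - a)%:C.
Proof.
by move=> ab; rewrite /ci !ri_cst//; case: k => k1 k2; rewrite /=; apply/eqP; rewrite eq_complex /= !mulr0 subr0 add0r !eqxx.
Qed.

Lemma ci_split f a b c : a <= c -> c <= b -> ccont f a b -> ci f a b = ci f a c + ci f c b.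
Proof.
move=> ac cb H; rewrite /ci (ri_split ac cb (ccont_Re H)) (ri_split ac cb (ccont_Im H)).
by [].
Qed.

Lemma ci_bound f a b M : a <= b -> ccont f a b -> (forall x, a <= x <= b -> normc (f x) <= M) ->
  normc (ci f a b) <= 2 * M * (b - a).
Proof.
move=> ab H fM; rewrite (le_trans (normc_leReIm _))//= -mulrA mulr_natl mulr2n lerD//.
  apply: ri_bound => //; first exact: ccont_Re.
  by move=> x /fM; apply: le_trans; exact: normc_Re.
apply: ri_bound => //; first exact: ccont_Im.
by move=> x /fM; apply: le_trans; exact: normc_Im.
Qed.

Lemma eq_ci f g a b : (forall x, a <= x <= b -> f x = g x) -> ci f a b = ci g a b.
Proof. by move=> H; congr Complex; apply: eq_ri => x /H ->. Qed.

End line_integrals.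

(** * Contour integrals over rectangles and Goursat's theorem *)

Section rectangles.
Context {R : realType}.
Implicit Types (f g : R[i] -> R[i]) (x y : R) (z : R[i]).

Definition contz g z := forall e : R, 0 < e -> exists2 d : R, 0 < d &
  forall w, normc (w - z) < d -> normc (g w - g z) <= e.

Definition cdiff g z (l : R[i]) := forall e : R, 0 < e -> exists2 d : R, 0 < d &
  forall w, normc (w - z) < d -> normc (g w - g z - l * (w - z)) <= e * normc (w - z).

Definition inrect z x1 x2 y1 y2 := x1 <= cRe z <= x2 /\ y1 <= cIm z <= y2.

Lemma inrect_sub z x1 x2 y1 y2 u1 u2 v1 v2 : x1 <= u1 -> u2 <= x2 -> y1 <= v1 -> v2 <= y2 ->
  inrect z u1 u2 v1 v2 -> inrect z x1 x2 y1 y2.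
Proof.
move=> i1 i2 i3 i4 [/andP[a1 a2] /andP[a3 a4]].
by rewrite /inrect (le_trans i1)// (le_trans i3)// (le_trans a2)// (le_trans a4).
Qed.

Definition contr g x1 x2 y1 y2 := forall z, inrect z x1 x2 y1 y2 -> contz g z.

(** The integral of g dz over the boundary, counterclockwise: bottom minus top, plus i times right
    minus left. *)
Definition rect g x1 x2 y1 y2 : R[i] :=
  (ci (fun t => g (Complex t y1)) x1 x2 - ci (fun t => g (Complex t y2)) x1 x2) +
  Complex 0 1 * (ci (fun t => g (Complex x2 t)) y1 y2 - ci (fun t => g (Complex x1 t)) y1 y2).

Lemma contz_cdiff g z l : cdiff g z l -> contz g z.
Proof.
move=> H e e0; have [d d0 hd] := H 1 ltr01.
have l0 : 0 < normc l + 1 by rewrite ltr_wpDl// normc_ge0.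
exists (Num.min d (e / (normc l + 1))); first by rewrite lt_min d0 divr_gt0.
move=> w; rewrite lt_min => /andP[wd we].
have -> : g w - g z = (g w - g z - l * (w - z)) + l * (w - z) by rewrite subrK.
rewrite (le_trans (normcD _ _))// normcM.
move: we; rewrite ltr_pdivlMr// => we; have := hd w wd; lra.
Qed.

Lemma contzD f g z : contz f z -> contz g z -> contz (fun w => f w + g w) z.
Proof.
move=> H1 H2 e e0; have e2 : 0 < e / 2 by lra.
have [d1 d10 h1] := H1 _ e2; have [d2 d20 h2] := H2 _ e2.
exists (Num.min d1 d2); first by rewrite lt_min d10.
move=> y; rewrite lt_min => /andP[y1 y2].
rewrite opprD addrACA (le_trans (normcD _ _))//.
have := h1 y y1; have := h2 y y2; lra.
Qed.

Lemma contzZ (k : R[i]) g z : contz g z -> contz (fun w => k * g w) z.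
Proof.
move=> H e e0; have k0 : 0 < normc k + 1 by rewrite ltr_wpDl// normc_ge0.
have [d d0 hd] := H (e / (normc k + 1)) (divr_gt0 e0 k0); exists d => // y yx.
rewrite -mulrBr normcM (le_trans (ler_wpM2l (normc_ge0 k) (hd y yx)))//.
rewrite mulrCA ler_piMr ?(ltW e0)// ler_pdivrMr// mul1r; lra.
Qed.

Lemma contz_id z : contz id z.
Proof. by move=> e e0; exists e => // w /ltW. Qed.

Lemma contz_cst (k : R[i]) z : contz (fun=> k) z.
Proof. by move=> e e0; exists 1 => // w _; rewrite subrr normc0 ltW. Qed.

Lemma contzM f g z : contz f z -> contz g z -> contz (fun w => f w * g w) z.
Proof.
move=> H1 H2 e e0.
pose m := normc (f z) + normc (g z) + 1.
have m0 : 0 < m by rewrite ltr_wpDl// addr_ge0 ?normc_ge0.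
pose e' := Num.min 1 (e / (2 * m)).
have e'0 : 0 < e' by rewrite lt_min ltr01 divr_gt0// mulr_gt0.
have [d1 d10 h1] := H1 _ e'0; have [d2 d20 h2] := H2 _ e'0.
exists (Num.min d1 d2); first by rewrite lt_min d10.
move=> y; rewrite lt_min => /andP[y1 y2].
have -> : f y * g y - f z * g z = (f y - f z) * (g y - g z) + (f z * (g y - g z) + (f y - f z) * g z) by ring.
have e'1 : e' <= 1 by rewrite ge_min lexx.
have e'e : e' * (2 * m) <= e by rewrite -ler_pdivlMr ?mulr_gt0// ge_min lexx orbT.
have a1 := h1 y y1; have a2 := h2 y y2.
rewrite (le_trans (normcD _ _))// (@le_trans _ _ (e' * 1 + (normc (f z) * e' + e' * normc (g z))))//.
  rewrite normcM lerD//; first by rewrite ler_pM ?normc_ge0// (le_trans a2).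
  rewrite (le_trans (normcD _ _))// !normcM lerD//.
    by rewrite ler_wpM2l ?normc_ge0.
  by rewrite ler_wpM2r ?normc_ge0.
rewrite (le_trans _ e'e)// /m.
have := mulr_ge0 (ltW e'0) (normc_ge0 (f z)); have := mulr_ge0 (ltW e'0) (normc_ge0 (g z)); lra.
Qed.

Lemma contzV g z : contz g z -> g z != 0 -> contz (fun w => (g w)^-1) z.
Proof.
move=> H gz e e0; have n0 : 0 < normc (g z).
  by rewrite lt_neqAle normc_ge0 andbT eq_sym; apply: contraNneq gz => /normc_eq0 ->.
pose e' := Num.min (normc (g z) / 2) (e * normc (g z) ^+ 2 / 2).
have e'0 : 0 < e' by rewrite lt_min !divr_gt0// mulr_gt0// exprn_gt0.
have [d d0 hd] := H _ e'0; exists d => // w /hd wd.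
have w1 : normc (g z) / 2 <= normc (g w).
  have := normc_ler_sub (g z) (g w); rewrite normc_subC.
  have : normc (g w - g z) <= normc (g z) / 2 by rewrite (le_trans wd)// ge_min lexx.
  lra.
have gw0 : 0 < normc (g w) by apply: lt_le_trans w1; rewrite divr_gt0.
have gw : g w != 0 by apply: contraTneq gw0 => ->; rewrite normc0 ltxx.
have -> : (g w)^-1 - (g z)^-1 = (g z - g w) * (g w)^-1 * (g z)^-1 by field; rewrite gz gw.
rewrite !normcM !normcV -mulrA -invfM ler_pdivrMr ?mulr_gt0// normc_subC.
have : normc (g w - g z) <= e * normc (g z) ^+ 2 / 2 by rewrite (le_trans wd)// ge_min lexx orbT.
move=> /le_trans; apply; rewrite expr2.
have := ler_wpM2l (ltW (mulr_gt0 e0 n0)) w1; lra.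
Qed.

Lemma hline g x1 x2 y1 y2 y : contr g x1 x2 y1 y2 -> y1 <= y <= y2 -> ccont (fun t => g (Complex t y)) x1 x2.
Proof.
move=> H yy x xx e e0; have [d d0 hd] := H (Complex x y) (conj xx yy) e e0.
exists d => // t tx; apply: hd.
by rewrite /normc /= subrr expr0n addr0 sqrtr_sqr.
Qed.

Lemma vline g x1 x2 y1 y2 x : contr g x1 x2 y1 y2 -> x1 <= x <= x2 -> ccont (fun t => g (Complex x t)) y1 y2.
Proof.
move=> H xx y yy e e0; have [d d0 hd] := H (Complex x y) (conj xx yy) e e0.
exists d => // t tx; apply: hd.
by rewrite /normc /= subrr expr0n add0r sqrtr_sqr.
Qed.

Lemma rect_splitx g x1 x2 y1 y2 x : contr g x1 x2 y1 y2 -> x1 <= x <= x2 -> y1 <= y2 ->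
  rect g x1 x2 y1 y2 = rect g x1 x y1 y2 + rect g x x2 y1 y2.
Proof.
move=> H /andP[h1 h2] yy; rewrite /rect.
rewrite (@ci_split _ (fun t => g (Complex t y1)) x1 x2 x)//; last by apply: hline H _; rewrite lexx.
rewrite (@ci_split _ (fun t => g (Complex t y2)) x1 x2 x)//; last by apply: hline H _; rewrite lexx andbT.
ring.
Qed.

Lemma rect_splity g x1 x2 y1 y2 y : contr g x1 x2 y1 y2 -> y1 <= y <= y2 -> x1 <= x2 ->
  rect g x1 x2 y1 y2 = rect g x1 x2 y1 y + rect g x1 x2 y y2.
Proof.
move=> H /andP[h1 h2] xx; rewrite /rect.
rewrite (@ci_split _ (fun t => g (Complex x1 t)) y1 y2 y)//; last by apply: vline H _; rewrite lexx.
rewrite (@ci_split _ (fun t => g (Complex x2 t)) y1 y2 y)//; last by apply: vline H _; rewrite lexx andbT.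
ring.
Qed.

Definition bdry z x1 x2 y1 y2 := inrect z x1 x2 y1 y2 /\
  [\/ cRe z = x1, cRe z = x2, cIm z = y1 | cIm z = y2].

(** Continuity at boundary points only, which is all that the contour integral sees; the Cauchy
    kernel has its pole inside. *)
Definition contb g x1 x2 y1 y2 := forall z, bdry z x1 x2 y1 y2 -> contz g z.

Lemma contr_b g x1 x2 y1 y2 : contr g x1 x2 y1 y2 -> contb g x1 x2 y1 y2.
Proof. by move=> H z [/H]. Qed.

Section linearity.
Variables (x1 x2 y1 y2 : R).
Hypothesis xx : x1 <= x2.
Hypothesis yy : y1 <= y2.

Let X1 : x1 <= x1 <= x2. Proof. by rewrite lexx. Qed.
Let X2 : x1 <= x2 <= x2. Proof. by rewrite lexx andbT. Qed.
Let Y1 : y1 <= y1 <= y2. Proof. by rewrite lexx. Qed.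
Let Y2 : y1 <= y2 <= y2. Proof. by rewrite lexx andbT. Qed.

Lemma hline1 g : contb g x1 x2 y1 y2 -> ccont (fun t => g (Complex t y1)) x1 x2.
Proof.
move=> H x xx' e e0; have [|d d0 hd] := H (Complex x y1) _ e e0; first by split => //; constructor 3.
by exists d => // t tx; apply: hd; rewrite /normc /= subrr expr0n addr0 sqrtr_sqr.
Qed.

Lemma hline2 g : contb g x1 x2 y1 y2 -> ccont (fun t => g (Complex t y2)) x1 x2.
Proof.
move=> H x xx' e e0; have [|d d0 hd] := H (Complex x y2) _ e e0; first by split => //; constructor 4.
by exists d => // t tx; apply: hd; rewrite /normc /= subrr expr0n addr0 sqrtr_sqr.
Qed.

Lemma vline1 g : contb g x1 x2 y1 y2 -> ccont (fun t => g (Complex x1 t)) y1 y2.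
Proof.
move=> H y yy' e e0; have [|d d0 hd] := H (Complex x1 y) _ e e0; first by split => //; constructor 1.
by exists d => // t tx; apply: hd; rewrite /normc /= subrr expr0n add0r sqrtr_sqr.
Qed.

Lemma vline2 g : contb g x1 x2 y1 y2 -> ccont (fun t => g (Complex x2 t)) y1 y2.
Proof.
move=> H y yy' e e0; have [|d d0 hd] := H (Complex x2 y) _ e e0; first by split => //; constructor 2.
by exists d => // t tx; apply: hd; rewrite /normc /= subrr expr0n add0r sqrtr_sqr.
Qed.

Lemma eq_rect f g : (forall z, bdry z x1 x2 y1 y2 -> f z = g z) -> rect f x1 x2 y1 y2 = rect g x1 x2 y1 y2.
Proof.
move=> H; rewrite /rect; congr (_ - _ + _ * (_ - _)); apply: eq_ci => t tt; apply: H; split => //.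
- by constructor 3.
- by constructor 4.
- by constructor 2.
- by constructor 1.
Qed.

Lemma rectD f g : contb f x1 x2 y1 y2 -> contb g x1 x2 y1 y2 ->
  rect (fun z => f z + g z) x1 x2 y1 y2 = rect f x1 x2 y1 y2 + rect g x1 x2 y1 y2.
Proof.
move=> Hf Hg; rewrite /rect.
rewrite (ciD (hline1 Hf) (hline1 Hg)) (ciD (hline2 Hf) (hline2 Hg)).
rewrite (ciD (vline1 Hf) (vline1 Hg)) (ciD (vline2 Hf) (vline2 Hg)); ring.
Qed.

Lemma rectZ (k : R[i]) g : contb g x1 x2 y1 y2 -> rect (fun z => k * g z) x1 x2 y1 y2 = k * rect g x1 x2 y1 y2.
Proof.
move=> Hg; rewrite /rect.
rewrite (ciZ k (hline1 Hg)) (ciZ k (hline2 Hg)) (ciZ k (vline1 Hg)) (ciZ k (vline2 Hg)); ring.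
Qed.

Lemma rect_affine (c0 c1 : R[i]) : rect (fun z => c0 + c1 * z) x1 x2 y1 y2 = 0.
Proof.
have C0 : contr (fun=> c0) x1 x2 y1 y2 by move=> z _; exact: contz_cst.
have Cid : contr id x1 x2 y1 y2 by move=> z _; exact: contz_id.
have C1 : contr (fun z => c1 * z) x1 x2 y1 y2 by move=> z _; apply: contzZ; exact: contz_id.
rewrite rectD; [|exact: contr_b|exact: contr_b].
rewrite (rectZ _ (contr_b Cid)).
have -> : rect (fun=> c0) x1 x2 y1 y2 = 0 by rewrite /rect !subrr mulr0 addr0.
rewrite /rect.
have -> : ci (fun t => Complex t y1) x1 x2 = ci (fun t => Complex t y2) x1 x2 + (Complex 0 (y1 - y2)) * (x2 - x1)%:C.
  rewrite -(ci_cst _ xx) -ciD; [|exact: hline2 (contr_b Cid)|exact: ccont_cst].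
  apply: eq_ci => t _; apply/eqP; rewrite eq_complex /= addr0 eqxx /=; apply/eqP; ring.
have -> : ci (fun t => Complex x2 t) y1 y2 = ci (fun t => Complex x1 t) y1 y2 + (Complex (x2 - x1) 0) * (y2 - y1)%:C.
  rewrite -(ci_cst _ yy) -ciD; [|exact: vline1 (contr_b Cid)|exact: ccont_cst].
  apply: eq_ci => t _; apply/eqP; rewrite eq_complex /= addr0 eqxx andbT /=; apply/eqP; ring.
set a := ci _ x1 x2; set b := ci _ y1 y2; set u := Complex 0 (y1 - y2) * _; set v := Complex (x2 - x1) 0 * _.
rewrite (_ : 0 + _ = c1 * (u + Complex 0 1 * v)); last by ring.
rewrite (_ : u + _ = 0) ?mulr0// /u /v.
by apply: complex_ext => /=; ring.
Qed.

Lemma rect_bound g (M : R) : contb g x1 x2 y1 y2 -> (forall z, bdry z x1 x2 y1 y2 -> normc (g z) <= M) ->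
  normc (rect g x1 x2 y1 y2) <= 4 * M * ((x2 - x1) + (y2 - y1)).
Proof.
move=> Hg gM; rewrite /rect.
have b1 := ci_bound xx (hline1 Hg) (fun t tt => gM (Complex t y1) (conj (conj tt Y1) (Or43 _ _ _ erefl))).
have b2 := ci_bound xx (hline2 Hg) (fun t tt => gM (Complex t y2) (conj (conj tt Y2) (Or44 _ _ _ erefl))).
have b3 := ci_bound yy (vline1 Hg) (fun t tt => gM (Complex x1 t) (conj (conj X1 tt) (Or41 _ _ _ erefl))).
have b4 := ci_bound yy (vline2 Hg) (fun t tt => gM (Complex x2 t) (conj (conj X2 tt) (Or42 _ _ _ erefl))).
rewrite (le_trans (normcD _ _))// normc_ge1.
rewrite (le_trans (lerD (normcB _ _) (normcB _ _)))//; lra.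
Qed.

End linearity.

Lemma quadrisect g x1 x2 y1 y2 : contr g x1 x2 y1 y2 -> x1 <= x2 -> y1 <= y2 ->
  exists x y, [/\ (x = x1 \/ x = (x1 + x2) / 2), (y = y1 \/ y = (y1 + y2) / 2) &
    normc (rect g x1 x2 y1 y2) <= 4 * normc (rect g x (x + (x2 - x1) / 2) y (y + (y2 - y1) / 2))].
Proof.
move=> H xx yy.
have mx : x1 <= (x1 + x2) / 2 <= x2 by lra.
have my : y1 <= (y1 + y2) / 2 <= y2 by lra.
pose r x y := normc (rect g x (x + (x2 - x1) / 2) y (y + (y2 - y1) / 2)).
have ex1 : x1 + (x2 - x1) / 2 = (x1 + x2) / 2 by lra.
have ex2 : (x1 + x2) / 2 + (x2 - x1) / 2 = x2 by lra.
have ey1 : y1 + (y2 - y1) / 2 = (y1 + y2) / 2 by lra.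
have ey2 : (y1 + y2) / 2 + (y2 - y1) / 2 = y2 by lra.
have sub u1 u2 : x1 <= u1 -> u2 <= x2 -> contr g u1 u2 y1 y2.
  by move=> h1 h2 z [/andP[a b] c]; apply: H; split => //; rewrite (le_trans h1)//= (le_trans b).
have S : normc (rect g x1 x2 y1 y2) <=
    (r x1 y1 + r x1 ((y1 + y2) / 2)) + (r ((x1 + x2) / 2) y1 + r ((x1 + x2) / 2) ((y1 + y2) / 2)).
  rewrite (rect_splitx H mx yy).
  have /andP[m1 m2] := mx.
  rewrite (rect_splity (sub x1 _ (lexx _) m2) my m1) (rect_splity (sub _ x2 m1 (lexx _)) my m2).
  rewrite (le_trans (normcD _ _))// lerD// (le_trans (normcD _ _))// /r ?ex1 ?ex2 ?ey1 ?ey2//.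
apply: contrapT => /forallNP N.
have K x y : (x = x1 \/ x = (x1 + x2) / 2) -> (y = y1 \/ y = (y1 + y2) / 2) ->
    4 * r x y < normc (rect g x1 x2 y1 y2).
  move=> hx hy; rewrite ltNge; apply/negP => h.
  by have /forallNP := N x => /(_ y); apply; split.
have := K x1 y1 (or_introl erefl) (or_introl erefl).
have := K x1 _ (or_introl erefl) (or_intror erefl).
have := K _ y1 (or_intror erefl) (or_introl erefl).
have := K _ _ (or_intror erefl) (or_intror erefl).
lra.
Qed.

(** The pressure continuation is only known to be differentiable at each point, with no continuity
    of the derivative, hence the repeated quartering of the rectangle. *)
Theorem goursat g x1 x2 y1 y2 : x1 <= x2 -> y1 <= y2 ->
  (forall z, inrect z x1 x2 y1 y2 -> exists l, cdiff g z l) -> rect g x1 x2 y1 y2 = 0.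
Proof.
move=> xx yy D.
have H : contr g x1 x2 y1 y2 by move=> z /D[l]; exact: contz_cdiff.
pose W n := (x2 - x1) / 2 ^+ n; pose V n := (y2 - y1) / 2 ^+ n.
have t0 n : 0 < 2 ^+ n :> R by rewrite exprn_gt0.
have W0 n : 0 <= W n by rewrite divr_ge0 ?subr_ge0// ltW.
have V0 n : 0 <= V n by rewrite divr_ge0 ?subr_ge0// ltW.
have WS n : W n.+1 = W n / 2 by rewrite /W exprSr invfM mulrA.
have VS n : V n.+1 = V n / 2 by rewrite /V exprSr invfM mulrA.
pose ins n (q : R * R) := [/\ x1 <= q.1, q.1 + W n <= x2, y1 <= q.2 & q.2 + V n <= y2].
pose r n (q : R * R) := normc (rect g q.1 (q.1 + W n) q.2 (q.2 + V n)).
have step (nq : nat * (R * R)) : exists q' : R * R, ins nq.1 nq.2 ->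
    [/\ ins nq.1.+1 q', `|q'.1 - nq.2.1| <= W nq.1, `|q'.2 - nq.2.2| <= V nq.1 & r nq.1 nq.2 <= 4 * r nq.1.+1 q'].
  case: nq => n [a b] /=; have [i|ni] := pselect (ins n (a, b)); last by exists (0, 0).
  have [i1 i2 i3 i4] := i; rewrite /= in i1 i2 i3 i4.
  have wn := W0 n; have vn := V0 n.
  have sub' : contr g a (a + W n) b (b + V n).
    by move=> w ww; apply: H; exact: inrect_sub ww.
  have wn' : a <= a + W n by lra.
  have vn' : b <= b + V n by lra.
  have [x [y [hx hy hr]]] := quadrisect sub' wn' vn'.
  exists (x, y) => _; rewrite /ins /r /= WS VS; rewrite [a + W n]addrC [b + V n]addrC !addrK in hr.
  rewrite [W n + a]addrC [V n + b]addrC in hr.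
  split => //.
  - by case: hx => ->; case: hy => ->; split; lra.
  - by case: hx => ->; rewrite ler_norml; lra.
  - by case: hy => ->; rewrite ler_norml; lra.
have [nx Hnx] := choice step.
pose q := fix q n := if n is n'.+1 then nx (n', q n') else (x1, y1).
have I0 : ins 0%N (x1, y1) by rewrite /ins /W /V /= expr0 !divr1; split; lra.
have I n : ins n (q n).
  by elim: n => [//|n IH]; have [] := Hnx (n, q n) IH.
have dx n : `|(q n.+1).1 - (q n).1| <= (x2 - x1) * (1 / 2) ^+ n.
  by have [_ + _ _] := Hnx (n, q n) (I n); rewrite /W -exprVn div1r.
have dy n : `|(q n.+1).2 - (q n).2| <= (y2 - y1) * (1 / 2) ^+ n.
  by have [_ _ + _] := Hnx (n, q n) (I n); rewrite /V -exprVn div1r.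
have rS n : r n (q n) <= 4 * r n.+1 (q n.+1).
  by have [] := Hnx (n, q n) (I n).
have rn n : r 0%N (q 0%N) <= 4 ^+ n * r n (q n).
  elim: n => [|n IH]; first by rewrite mul1r.
  by rewrite (le_trans IH)// exprSr -mulrA ler_wpM2l// exprn_ge0.
have h01 : 0 <= (1 / 2 : R) < 1 by lra.
have w0 : 0 <= x2 - x1 by rewrite subr_ge0.
have v0 : 0 <= y2 - y1 by rewrite subr_ge0.
have [X HX] := geometric_cauchy_real w0 h01 dx.
have [Y HY] := geometric_cauchy_real v0 h01 dy.
pose c := ((x2 - x1) + (y2 - y1)).
have c0 : 0 <= c by rewrite addr_ge0 ?subr_ge0.
have hX n : `|(q n).1 - X| <= 2 * (x2 - x1) * (1 / 2) ^+ n.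
  by rewrite (le_trans (HX n))// (_ : _ / (1 - 1 / 2) = 2 * (x2 - x1))//; field.
have hY n : `|(q n).2 - Y| <= 2 * (y2 - y1) * (1 / 2) ^+ n.
  by rewrite (le_trans (HY n))// (_ : _ / (1 - 1 / 2) = 2 * (y2 - y1))//; field.
have zin : inrect (Complex X Y) x1 x2 y1 y2.
  split; apply/andP; split => /=; rewrite -subr_le0.
  - apply: (@geom_le0 _ _ (2 * (x2 - x1)) _ h01) => n; have [i _ _ _] := I n.
    by have := hX n; rewrite ler_norml => /andP[]; lra.
  - apply: (@geom_le0 _ _ (2 * (x2 - x1)) _ h01) => n; have [_ i _ _] := I n; have := W0 n.
    by have := hX n; rewrite ler_norml => /andP[]; lra.
  - apply: (@geom_le0 _ _ (2 * (y2 - y1)) _ h01) => n; have [_ _ i _] := I n.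
    by have := hY n; rewrite ler_norml => /andP[]; lra.
  - apply: (@geom_le0 _ _ (2 * (y2 - y1)) _ h01) => n; have [_ _ _ i] := I n; have := V0 n.
    by have := hY n; rewrite ler_norml => /andP[]; lra.
have [l Dl] := D _ zin.
set z := Complex X Y in zin Dl.
apply: normc_eq0; apply/eqP; rewrite eq_le normc_ge0 andbT.
have rE : r 0%N (q 0%N) = normc (rect g x1 x2 y1 y2).
  by rewrite /r /W /V /= expr0 !divr1 [x1 + _]addrC [y1 + _]addrC !subrK.
rewrite -rE; apply/ler_addgt0Pr => e e0; rewrite add0r.
(* 12 c^2 is the product of the constants 4, 3 c and c in the bound for the n-th rectangle; the 1
   avoids a division by zero for a degenerate rectangle. *)
pose e' := e / (12 * c ^+ 2 + 1).
have cc0 : 0 < 12 * c ^+ 2 + 1 by rewrite ltr_wpDl// mulr_ge0// exprn_ge0.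
have e'0 : 0 < e' by rewrite divr_gt0.
have [d d0 hd] := Dl e' e'0.
have [n hn] : exists n, 3 * c * (1 / 2) ^+ n < d.
  have : ((3 * c) * (1 / 2) ^+ n) @[n --> \oo] --> (3 * c * 0 : R).
    by apply: cvgMl_tmp; apply: cvg_expr; rewrite ger0_norm; lra.
  rewrite mulr0 => /cvgrPdist_lt /(_ d d0)[n _ Hn]; exists n.
  by have := Hn n (leqnn n); rewrite /= sub0r normrN; exact/le_lt_trans/ler_norm.
have p0 : 0 <= (1 / 2 : R) ^+ n by rewrite exprn_ge0//; lra.
have WE : W n = (x2 - x1) * (1 / 2) ^+ n by rewrite /W -exprVn div1r.
have VE : V n = (y2 - y1) * (1 / 2) ^+ n by rewrite /V -exprVn div1r.
have near w : inrect w (q n).1 ((q n).1 + W n) (q n).2 ((q n).2 + V n) -> normc (w - z) <= 3 * c * (1 / 2) ^+ n.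
  move=> [/andP[a1 a2] /andP[a3 a4]]; rewrite (le_trans (normc_leReIm _))//.
  rewrite ReB ImB /= /c.
  have := hX n; have := hY n; rewrite !ler_norml => /andP[b1 b2] /andP[b3 b4].
  have u1 : `|cRe w - X| <= 3 * (x2 - x1) * (1 / 2) ^+ n by rewrite ler_norml; lra.
  have u2 : `|cIm w - Y| <= 3 * (y2 - y1) * (1 / 2) ^+ n by rewrite ler_norml; lra.
  lra.
have [i1 i2 i3 i4] := I n; have wn := W0 n; have vn := V0 n.
have Hs : contr g (q n).1 ((q n).1 + W n) (q n).2 ((q n).2 + V n).
  by move=> w ww; apply: H; exact: inrect_sub ww.
have xn : (q n).1 <= (q n).1 + W n by rewrite lerDl.
have yn : (q n).2 <= (q n).2 + V n by rewrite lerDl.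
pose rem w := g w + ((l * z - g z) + (- l) * w).
have remE w : rem w = g w - g z - l * (w - z) by rewrite /rem; ring.
have Ha : contr (fun w => (l * z - g z) + (- l) * w) (q n).1 ((q n).1 + W n) (q n).2 ((q n).2 + V n).
  by move=> w _; apply: contzD; [exact: contz_cst|apply: contzZ; exact: contz_id].
have rrem : rect g (q n).1 ((q n).1 + W n) (q n).2 ((q n).2 + V n) =
    rect rem (q n).1 ((q n).1 + W n) (q n).2 ((q n).2 + V n).
  by rewrite /rem (rectD xn yn (contr_b Hs) (contr_b Ha)) (rect_affine xn yn) addr0.
have Hr : contr rem (q n).1 ((q n).1 + W n) (q n).2 ((q n).2 + V n).
  by move=> w ww; apply: contzD; [exact: Hs|exact: Ha].
have bnd : r n (q n) <= 4 * (e' * (3 * c * (1 / 2) ^+ n)) * (c * (1 / 2) ^+ n).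
  rewrite /r rrem (le_trans (@rect_bound _ _ _ _ xn yn _ (e' * (3 * c * (1 / 2) ^+ n)) (contr_b Hr) _))//.
    move=> w [ww _]; have wz := near w ww; rewrite remE (le_trans (hd w _))//; first exact: le_lt_trans hn.
    by rewrite ler_wpM2l// ltW.
  rewrite [X in _ <= _ * X](_ : _ = (q n).1 + W n - (q n).1 + ((q n).2 + V n - (q n).2))//.
  by rewrite WE VE /c; ring.
rewrite (le_trans (rn n))// (le_trans (ler_wpM2l _ bnd))//.
rewrite (_ : _ * _ = (4 ^+ n * ((1 / 2) ^+ n * (1 / 2) ^+ n)) * (e' * (12 * c ^+ 2))); last by ring.
rewrite -!exprMn (_ : 4 * (1 / 2 * (1 / 2)) = 1 :> R); last by field.
by rewrite expr1n mul1r /e' mulrAC ler_pdivrMr// ler_wpM2l ?(ltW e0)// lerDl ler01.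
Qed.

End rectangles.

(** The arithmetic that gives |J| >= 1 for small a in [holomorphic_expansion], isolated from its
    large context. *)
Lemma norm_ge1_pert (R : realType) (j J d1 d2 t m k c : R) : j <= J + d1 + d2 -> d2 <= t * m ->
  k * c <= t * k -> t * (m + k + 1) <= 1 -> d1 <= k * c -> 4 <= j -> 0 <= t -> 1 <= J.
Proof. lra. Qed.

(** * Second-order expansion of a holomorphic function *)

Section cauchy.
Context {R : realType}.
Implicit Types (f g : R[i] -> R[i]) (x y : R) (z w a : R[i]).

Lemma cdiff_near f g z l (d0 : R) : 0 < d0 -> (forall w, normc (w - z) < d0 -> f w = g w) ->
  cdiff g z l -> cdiff f z l.
Proof.
move=> d00 fg H e e0; have [d dp hd] := H e e0.
exists (Num.min d d0); first by rewrite lt_min dp.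
move=> w; rewrite lt_min => /andP[wd wd0].
by rewrite !fg ?subrr ?normc0// hd.
Qed.

Lemma cdiffD f g z l m : cdiff f z l -> cdiff g z m -> cdiff (fun w => f w + g w) z (l + m).
Proof.
move=> H1 H2 e e0; have e2 : 0 < e / 2 by lra.
have [d1 d10 h1] := H1 _ e2; have [d2 d20 h2] := H2 _ e2.
exists (Num.min d1 d2); first by rewrite lt_min d10.
move=> w; rewrite lt_min => /andP[w1 w2].
rewrite (_ : _ - _ - _ = (f w - f z - l * (w - z)) + (g w - g z - m * (w - z))); last by ring.
rewrite (le_trans (normcD _ _))//; have := h1 w w1; have := h2 w w2; lra.
Qed.

Lemma cdiff_cst (k : R[i]) z : cdiff (fun=> k) z 0.
Proof.
move=> e e0; exists 1 => // w _.
by rewrite subrr mul0r subrr normc0 mulr_ge0 ?normc_ge0// ltW.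
Qed.

Lemma cdiffM f g z l m : cdiff f z l -> cdiff g z m ->
  cdiff (fun w => f w * g w) z (l * g z + f z * m).
Proof.
move=> H1 H2 e e0.
pose c := normc (f z) + normc (g z) + normc l + 2.
have fz := normc_ge0 (f z); have gz := normc_ge0 (g z); have lz := normc_ge0 l.
have c0 : 0 < c by rewrite /c; lra.
pose e' := Num.min 1 (e / (2 * c)).
have e'0 : 0 < e' by rewrite lt_min ltr01 divr_gt0// mulr_gt0.
have e'1 : e' <= 1 by rewrite ge_min lexx.
have e'e : e' * (2 * c) <= e by rewrite -ler_pdivlMr ?mulr_gt0// ge_min lexx orbT.
have [d1 d10 h1] := H1 _ e'0; have [d2 d20 h2] := H2 _ e'0.
have [d3 d30 h3] := contz_cdiff H2 e'0.
exists (Num.min d1 (Num.min d2 d3)); first by rewrite !lt_min d10 d20.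
move=> w; rewrite !lt_min => /andP[w1 /andP[w2 w3]].
have a1 := h1 w w1; have a2 := h2 w w2; have a3 := h3 w w3.
have gw : normc (g w) <= normc (g z) + 1.
  have := normc_ler_sub (g w) (g z); lra.
rewrite (_ : f w * g w - f z * g z - (l * g z + f z * m) * (w - z) =
  (f w - f z - l * (w - z)) * g w + (l * (w - z) * (g w - g z) + f z * (g w - g z - m * (w - z)))); last by ring.
have wz := normc_ge0 (w - z).
rewrite (le_trans (normcD _ _))//.
have b1 : normc ((f w - f z - l * (w - z)) * g w) <= e' * normc (w - z) * (normc (g z) + 1).
  by rewrite normcM ler_pM ?normc_ge0.
have b2 : normc (l * (w - z) * (g w - g z)) <= normc l * normc (w - z) * e'.
  by rewrite !normcM ler_wpM2l// mulr_ge0.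
have b3 : normc (f z * (g w - g z - m * (w - z))) <= normc (f z) * (e' * normc (w - z)).
  by rewrite normcM ler_wpM2l.
rewrite (le_trans (lerD b1 (le_trans (normcD _ _) (lerD b2 b3))))//.
have := ler_wpM2r wz e'e; rewrite /c.
have := mulr_ge0 (mulr_ge0 (ltW e'0) wz) gz; have := mulr_ge0 (mulr_ge0 (ltW e'0) wz) fz.
have := mulr_ge0 (mulr_ge0 (ltW e'0) wz) lz; have := mulr_ge0 (ltW e'0) wz.
lra.
Qed.

Lemma normc_gt0 z : z != 0 -> 0 < normc z.
Proof. by move=> z0; rewrite lt_neqAle normc_ge0 andbT eq_sym; apply: contraNneq z0 => /normc_eq0 ->. Qed.

Lemma cdiff_inv a z : z != a -> cdiff (fun w => (w - a)^-1) z (- (z - a) ^- 2).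
Proof.
move=> za e e0; have za0 : z - a != 0 by rewrite subr_eq0.
have n0 := normc_gt0 za0; set n := normc (z - a) in n0.
exists (Num.min (n / 2) (e * n ^+ 3 / 2)); first by rewrite lt_min !divr_gt0// mulr_gt0// exprn_gt0.
move=> w; rewrite lt_min => /andP[w1 w2].
have wa : n / 2 <= normc (w - a).
  have := normc_ler_sub (z - a) (w - a); rewrite (_ : z - a - (w - a) = - (w - z)) ?normcN -/n; last by ring.
  lra.
have wa0 : 0 < normc (w - a) by apply: lt_le_trans wa; rewrite divr_gt0.
have wna : w - a != 0 by apply: contraTneq wa0 => ->; rewrite normc0 ltxx.
rewrite (_ : _ - _ - _ = (w - z) * ((w - z) * ((w - a)^-1 * (z - a) ^- 2))); last first.
  by field; rewrite wna za0.
rewrite normcM mulrC; apply: ler_wpM2r; first exact: normc_ge0.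
rewrite !normcM !normcV normcX -/n -invfM ler_pdivrMr ?mulr_gt0 ?exprn_gt0//.
rewrite (le_trans (ltW w2))// exprS -!mulrA ler_wpM2l ?(ltW e0)//.
rewrite (_ : n * (n * (n / 2)) = n / 2 * n ^+ 2); last by ring.
by rewrite ler_wpM2r// exprn_ge0// ltW.
Qed.

Definition dquot g a l z := if z == a then l else (g z - g a) / (z - a).

Lemma cdiff_dquot g a l z m : z != a -> cdiff g z m -> exists k, cdiff (dquot g a l) z k.
Proof.
move=> za gz; have za0 : z - a != 0 by rewrite subr_eq0.
have H := cdiffM (cdiffD gz (cdiff_cst (- g a) z)) (cdiff_inv za).
eexists; apply: (cdiff_near (normc_gt0 za0) _ H) => w wz.
rewrite /dquot; case: eqVneq => // wa; move: wz.
by rewrite wa normc_subC ltxx.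
Qed.

Lemma contz_dquot g a l : cdiff g a l -> contz (dquot g a l) a.
Proof.
move=> H e e0; have [d d0 hd] := H e e0; exists d => // w wa.
rewrite /dquot eqxx; case: eqVneq => [_|wna]; first by rewrite subrr normc0 ltW.
have wa0 : w - a != 0 by rewrite subr_eq0.
rewrite (_ : _ - l = (g w - g a - l * (w - a)) / (w - a)); last by field.
by rewrite normcM normcV ler_pdivrMr ?normc_gt0// hd.
Qed.

(** The difference quotient is bounded near a and holomorphic elsewhere. Cutting out a small square
    around a, the surrounding rectangles integrate to 0 by Goursat's theorem and the small square
    has an arbitrarily small integral. *)
Lemma cauchy_dquot g (rho : R) a : 0 < rho ->
  (forall z, inrect z (- rho) rho (- rho) rho -> exists l, cdiff g z l) ->
  `|cRe a| <= rho / 2 -> `|cIm a| <= rho / 2 ->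
  exists l, rect (dquot g a l) (- rho) rho (- rho) rho = 0.
Proof.
move=> r0 D; case: a => a1 a2; rewrite !ler_norml /= => /andP[h1 h2] /andP[h3 h4].
set a := Complex a1 a2.
have [l Dl] : exists l, cdiff g a l by apply: D; split => /=; apply/andP; split; lra.
exists l; set phi := dquot g a l.
have Cphi : contr phi (- rho) rho (- rho) rho.
  move=> z zin; have [->|za] := eqVneq z a; first exact: contz_dquot.
  have [m gm] := D z zin; have [k kk] := cdiff_dquot l za gm.
  exact: contz_cdiff kk.
have Dphi z : inrect z (- rho) rho (- rho) rho -> z != a -> exists k, cdiff phi z k.
  by move=> /D[m gm] za; exact: cdiff_dquot gm.
have [d d0 hd] := contz_dquot Dl ltr01.
apply: normc_eq0; apply/eqP; rewrite eq_le normc_ge0 andbT.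
apply/ler_addgt0Pr => e e0; rewrite add0r.
pose M := normc l + 1; have M0 : 0 < M by rewrite /M ltr_wpDl// normc_ge0.
(* Half the side of the small square: inside the large one, within distance d of a, and with 16 M t
   <= e for the bound on its integral. *)
pose t := Num.min (rho / 2) (Num.min (d / 3) (e / (16 * M))).
have t0 : 0 < t by rewrite !lt_min !divr_gt0// mulr_gt0.
have t1 : t <= rho / 2 by rewrite ge_min lexx.
have t2 : t <= d / 3 by rewrite !ge_min lexx orbT.
have t3 : t * (16 * M) <= e by rewrite -ler_pdivlMr ?mulr_gt0// !ge_min lexx !orbT.
have sub u1 u2 v1 v2 : - rho <= u1 -> u2 <= rho -> - rho <= v1 -> v2 <= rho -> contr phi u1 u2 v1 v2.
  by move=> i1 i2 i3 i4 z [/andP[k1 k2] /andP[k3 k4]]; apply: Cphi; split; apply/andP; split; lra.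
have G u1 u2 v1 v2 : - rho <= u1 <= u2 -> u2 <= rho -> - rho <= v1 <= v2 -> v2 <= rho ->
    (forall z, inrect z u1 u2 v1 v2 -> z != a) -> rect phi u1 u2 v1 v2 = 0.
  move=> /andP[i1 i1'] i2 /andP[i3 i3'] i4 na; apply: goursat => // z zin; apply: Dphi; last exact: na.
  by have [/andP[k1 k2] /andP[k3 k4]] := zin; split; apply/andP; split; lra.
rewrite (@rect_splitx _ phi _ _ _ _ (a1 - t)) //; [|lra|lra].
rewrite G ?add0r; [|lra|lra|lra|lra|]; last first.
  by move=> z [/andP[k1 k2] _]; apply: contraTneq k2 => -> /=; rewrite -ltNge; lra.
rewrite (@rect_splitx _ phi _ _ _ _ (a1 + t)) //; [|by apply: sub; lra|lra|lra].
rewrite [X in _ + X]G ?addr0; [|lra|lra|lra|lra|]; last first.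
  by move=> z [/andP[k1 k2] _]; apply: contraTneq k1 => -> /=; rewrite -ltNge; lra.
rewrite (@rect_splity _ phi _ _ _ _ (a2 - t)) //; [|by apply: sub; lra|lra|lra].
rewrite G ?add0r; [|lra|lra|lra|lra|]; last first.
  by move=> z [_ /andP[k1 k2]]; apply: contraTneq k2 => -> /=; rewrite -ltNge; lra.
rewrite (@rect_splity _ phi _ _ _ _ (a2 + t)) //; [|by apply: sub; lra|lra|lra].
rewrite [X in _ + X]G ?addr0; [|lra|lra|lra|lra|]; last first.
  by move=> z [_ /andP[k1 k2]]; apply: contraTneq k1 => -> /=; rewrite -ltNge; lra.
have xn : a1 - t <= a1 + t by lra.
have yn : a2 - t <= a2 + t by lra.
have Hb : contb phi (a1 - t) (a1 + t) (a2 - t) (a2 + t) by apply: contr_b; apply: sub; lra.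
rewrite (le_trans (rect_bound xn yn (M := M) Hb _))//; last by rewrite (le_trans _ t3)//; lra.
move=> z [[/andP[k1 k2] /andP[k3 k4]] _].
have za : normc (z - a) < d.
  rewrite (le_lt_trans (normc_leReIm _))// ReB ImB /=.
  have u1 : `|cRe z - a1| <= t by rewrite ler_norml; lra.
  have u2 : `|cIm z - a2| <= t by rewrite ler_norml; lra.
  lra.
have phia : phi a = l by rewrite /phi /dquot eqxx.
have b1 := hd z za; have b2 := normc_ler_sub (phi z) (phi a).
by rewrite /M -phia; move: b1 b2; clear; lra.
Qed.

Lemma bdry_norm (rho : R) z : 0 < rho -> bdry z (- rho) rho (- rho) rho -> rho <= normc z.
Proof.
move=> r0 [_ H].
have h1 := normc_Re z; have h2 := normc_Im z.
by move: h1 h2; case: H => ->; rewrite ?normrN (gtr0_norm r0).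
Qed.

Lemma ccont_bounded (f : R -> R[i]) (x1 x2 : R) : x1 <= x2 -> ccont f x1 x2 ->
  exists M, forall x, x1 <= x <= x2 -> normc (f x) <= M.
Proof.
move=> xx H; have cn : {within `[x1, x2], continuous (fun x => normc (f x))}.
  apply: continuous_in_subspaceT => x; rewrite inE/= in_itv/= => xab.
  apply/cvgrPdist_le => e e0; have [d d0 hd] := H x xab e e0.
  near=> y; have yx : `|y - x| < d by rewrite distrC; near: y; apply/nbhs_ballP; exists d.
  have := hd y yx; have := normc_ler_sub (f y) (f x); have := normc_ler_sub (f x) (f y).
  rewrite (normc_subC (f x)) ler_norml => k1 k2 k3; lra.
have [c _ Hc] := EVT_max xx cn; exists (normc (f c)) => x xab.
by apply: Hc; rewrite in_itv.
Unshelve. all: end_near. Qed.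

Definition kern (G : R[i] -> R[i]) a z := G z / (z - a).

Section square.
Variable rho : R.
Hypothesis r0 : 0 < rho.
Let rr : - rho <= rho. Proof. by rewrite (le_trans _ (ltW r0))// oppr_le0 ltW. Qed.
Local Notation bd z := (bdry z (- rho) rho (- rho) rho).
Local Notation ct g := (contb g (- rho) rho (- rho) rho).
Local Notation I g := (rect g (- rho) rho (- rho) rho).

Lemma contb_bounded g : ct g -> exists2 M, 0 <= M & forall z, bd z -> normc (g z) <= M.
Proof.
move=> cg.
have [M1 H1] := ccont_bounded rr (hline1 rr cg); have [M2 H2] := ccont_bounded rr (hline2 rr cg).
have [M3 H3] := ccont_bounded rr (vline1 rr cg); have [M4 H4] := ccont_bounded rr (vline2 rr cg).
exists (`|M1| + `|M2| + `|M3| + `|M4|); first by rewrite !addr_ge0.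
have n1 := normr_ge0 M1; have n2 := normr_ge0 M2; have n3 := normr_ge0 M3; have n4 := normr_ge0 M4.
have m1 := ler_norm M1; have m2 := ler_norm M2; have m3 := ler_norm M3; have m4 := ler_norm M4.
case=> x y [[/= xx yy] H]; case: H => /= E; subst.
- by have := H3 y yy; move: n1 n2 n3 n4 m1 m2 m3 m4; clear; lra.
- by have := H4 y yy; move: n1 n2 n3 n4 m1 m2 m3 m4; clear; lra.
- by have := H1 x xx; move: n1 n2 n3 n4 m1 m2 m3 m4; clear; lra.
- by have := H2 x xx; move: n1 n2 n3 n4 m1 m2 m3 m4; clear; lra.
Qed.

Lemma contb_kern G a : normc a <= rho / 2 -> ct G -> ct (kern G a).
Proof.
move=> ar cG z bz; apply: contzM; first exact: cG.
have zn := bdry_norm r0 bz.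
apply: contzV; first by apply: contzD; [exact: contz_id|exact: contz_cst].
have ha : normc a < rho by move: ar r0; clear; lra.
by rewrite subr_eq0; apply: contraTneq zn => ->; rewrite -ltNge.
Qed.

Lemma contb_X G k : ct G -> ct (fun z => G z * z ^- k).
Proof.
move=> cG z bz; apply: contzM; first exact: cG.
have z0 : z != 0.
  by apply: contraTneq (bdry_norm r0 bz) => ->; rewrite normc0 -ltNge.
apply: contzV; last by rewrite expf_neq0.
elim: k => [|k IH]; first exact: contz_cst.
have -> : (fun w => w ^+ k.+1) = (fun w : R[i] => w * w ^+ k) by apply/funext => w; rewrite exprS.
by apply: contzM; first exact: contz_id.
Qed.

(** From 1/(z - a) = 1/z + a/z^2 + a^2/z^3 + a^3/(z^3 (z - a)), the last term being bounded because
    |z - a| >= rho / 2 on the boundary. *)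
Lemma kern_expansion G : ct G -> exists2 K, 0 <= K & forall a, normc a <= rho / 2 ->
  normc (I (kern G a) - (I (fun z => G z * z ^- 1) + a * I (fun z => G z * z ^- 2) + a ^+ 2 * I (fun z => G z * z ^- 3)))
    <= K * normc a ^+ 3.
Proof.
move=> cG; have [M M0 HM] := contb_bounded cG.
exists (4 * (M * (rho ^- 3 * (rho / 2)^-1)) * (rho - - rho + (rho - - rho))).
  have k3 : 0 <= rho ^- 3 by rewrite invr_ge0 exprn_ge0// ltW.
  have k2 : 0 <= (rho / 2)^-1 by rewrite invr_ge0 divr_ge0// ltW.
  have k4 : 0 <= rho - - rho + (rho - - rho) by rewrite addr_ge0 ?subr_ge0 ?rr.
  exact: mulr_ge0 (mulr_ge0 (ler0n R 4) (mulr_ge0 M0 (mulr_ge0 k3 k2))) k4.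
move=> a ar; pose E z := a ^+ 3 * ((G z * z ^- 3) * (z - a)^-1).
have c1 := contb_X 1 cG; have c2 := contb_X 2 cG; have c3 := contb_X 3 cG.
have cE : ct (fun z => (G z * z ^- 3) * (z - a)^-1) by exact: contb_kern c3.
have cZ (k : R[i]) g : ct g -> ct (fun z => k * g z) by move=> cg z bz; apply: contzZ; exact: cg.
have cD f g : ct f -> ct g -> ct (fun z => f z + g z) by move=> cf cg z bz; apply: contzD; [exact: cf|exact: cg].
have -> : I (kern G a) = I (fun z => (G z * z ^- 1 + a * (G z * z ^- 2) + a ^+ 2 * (G z * z ^- 3)) + E z).
  apply: (eq_rect rr rr) => z bz; have zn := bdry_norm r0 bz.
  have z0 : z != 0 by apply: contraTneq zn => ->; rewrite normc0 -ltNge.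
  have za : z - a != 0.
    have ha : normc a < rho by move: ar r0; clear; lra.
    by rewrite subr_eq0; apply: contraTneq zn => ->; rewrite -ltNge.
  by rewrite /kern /E; field; rewrite za z0.
have d2 := cZ a _ c2; have d3 := cZ (a ^+ 2) _ c3; have dE := cZ (a ^+ 3) _ cE.
have d12 := cD _ _ c1 d2.
rewrite (rectD rr rr (cD _ _ d12 d3) dE) (rectD rr rr d12 d3) (rectD rr rr c1 d2).
rewrite (rectZ rr rr a c2) (rectZ rr rr _ c3) addrC addKr (rectZ rr rr _ cE) normcM normcX [leRHS]mulrC.
apply: ler_wpM2l; first by rewrite exprn_ge0// normc_ge0.
apply: (rect_bound rr rr cE) => z bz; have zn := bdry_norm r0 bz.
have za : rho / 2 <= normc (z - a).
  have := normc_ler_sub z a; move: zn ar; clear; lra.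
rewrite !normcM -mulrA; apply: ler_pM; [exact: normc_ge0| |exact: HM|].
  by rewrite mulr_ge0 ?normc_ge0.
rewrite !normcV normcX; apply: ler_pM; rewrite ?invr_ge0 ?exprn_ge0 ?normc_ge0//.
  rewrite lef_pV2 ?posrE ?exprn_gt0//; last exact: lt_le_trans zn.
  by rewrite lerXn2r// nnegrE ?(ltW r0)// normc_ge0.
rewrite lef_pV2 ?posrE ?divr_gt0//.
by apply: lt_le_trans za; rewrite divr_gt0.
Qed.

(** Each of the four sides contributes at least 1 to the imaginary part of the integral of dz / z;
    being away from 0, this integral can be divided by. *)
Lemma Im_J0 : 4 <= cIm (I (fun z : R[i] => 1 * z ^- 1)).
Proof.
have cc : ct (fun z : R[i] => 1 * z ^- 1) by apply: contb_X => z _; exact: contz_cst.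
have c1 := ccont_Im (hline1 rr cc); have c2 := ccont_Im (hline2 rr cc).
have c3 := ccont_Re (vline1 rr cc); have c4 := ccont_Re (vline2 rr cc).
have E x y : 1 * (Complex x y : R[i]) ^- 1 = Complex (x / (x ^+ 2 + y ^+ 2)) (- (y / (x ^+ 2 + y ^+ 2))).
  by rewrite mul1r expr1.
have q0 x y : rho ^+ 2 <= x ^+ 2 + y ^+ 2 -> x ^+ 2 + y ^+ 2 <= 2 * rho ^+ 2 ->
   (2 * rho)^-1 <= rho / (x ^+ 2 + y ^+ 2).
  move=> h1 h2; have s0 : 0 < x ^+ 2 + y ^+ 2 by apply: lt_le_trans h1; rewrite exprn_gt0.
  rewrite ler_pdivlMr// ler_pdivrMl ?mulr_gt0//; lra.
have sq t : - rho <= t <= rho -> 0 <= t ^+ 2 <= rho ^+ 2.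
  by move=> /andP[k1 k2]; rewrite sqr_ge0 /= -ler_sqrt ?exprn_ge0 ?(ltW r0)// !sqrtr_sqr (gtr0_norm r0) ler_norml k1.
have b1 := ri_ge rr c1; have b4 := ri_ge rr c4.
have b2 : (2 * rho)^-1 * (rho - - rho) <= ri (fun x => -1 * cIm (1 * (Complex x rho : R[i]) ^- 1)) (- rho) rho.
  apply: ri_ge => //; first exact: rcontZ.
  move=> x /sq /andP[s1 s2]; rewrite E /= mulN1r opprK; apply: q0; lra.
have b3 : (2 * rho)^-1 * (rho - - rho) <= ri (fun y => -1 * cRe (1 * (Complex (- rho) y : R[i]) ^- 1)) (- rho) rho.
  apply: ri_ge => //; first exact: rcontZ.
  move=> x /sq /andP[s1 s2]; rewrite E /= mulN1r mulNr opprK sqrrN; apply: q0; lra.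
rewrite riZ// in b2; rewrite riZ// in b3.
have {}b1 := b1 (2 * rho)^-1; have {}b4 := b4 (2 * rho)^-1.
have hh : (2 * rho)^-1 * (rho - - rho) = 1 by field; rewrite gt_eqF.
rewrite hh in b1 b2 b3 b4.
have {}b1 := b1 _; have {}b4 := b4 _.
have k1 : forall x, - rho <= x <= rho -> (2 * rho)^-1 <= cIm (1 * (Complex x (- rho) : R[i]) ^- 1).
  by move=> x /sq /andP[s1 s2]; rewrite E /= mulNr opprK sqrrN; apply: q0; lra.
have k4 : forall y, - rho <= y <= rho -> (2 * rho)^-1 <= cRe (1 * (Complex rho y : R[i]) ^- 1).
  by move=> x /sq /andP[s1 s2]; rewrite E /=; apply: q0; lra.
have := b1 k1; have := b4 k4.
rewrite /rect /ci /= !mul0r !mul1r ?add0r ?addr0 ?subr0.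
move: b2 b3; lra.
Qed.

End square.

(** Cauchy's formula in the form g a = N / J, where N and J are the integrals of g / (z - a) and of
    1 / (z - a). Both are expanded to second order in a and the expansions are divided. *)
Theorem holomorphic_expansion g (r : R) : 0 < r -> (forall z, normc z < r -> exists l, cdiff g z l) ->
  exists (c1 c2 : R[i]) (K d : R), [/\ 0 < d, 0 <= K &
    forall a, normc a <= d -> normc (g a - g 0 - c1 * a - c2 * a ^+ 2) <= K * normc a ^+ 3].
Proof.
move=> r0 D; pose rho := r / 4.
have p0 : 0 < rho by rewrite divr_gt0.
have rr : - rho <= rho by move: p0; clear; lra.
have Dq z : inrect z (- rho) rho (- rho) rho -> exists l, cdiff g z l.
  move=> [h1 h2]; apply: D; rewrite (le_lt_trans (normc_leReIm _))//.
  have {}h1 : `|cRe z| <= rho by rewrite ler_norml.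
  have {}h2 : `|cIm z| <= rho by rewrite ler_norml.
  move: h1 h2 r0; rewrite /rho; clear; lra.
have cg : contb g (- rho) rho (- rho) rho.
  by move=> z [/Dq[l]]; move=> /contz_cdiff.
have c1 : contb (fun=> 1 : R[i]) (- rho) rho (- rho) rho by move=> z _; exact: contz_cst.
have [K1 K10 H1] := kern_expansion p0 cg; have [K2 K20 H2] := kern_expansion p0 c1.
have J0 := Im_J0 p0.
pose I (h : R[i] -> R[i]) := rect h (- rho) rho (- rho) rho.
rewrite -/(I _) in J0.
move: H1 H2 J0; rewrite -!/(I _).
set N0 := I (fun z => g z * z ^- 1); set N1 := I (fun z => g z * z ^- 2); set N2 := I (fun z => g z * z ^- 3).
set j0 := I (fun z => 1 * z ^- 1); set j1 := I (fun z => 1 * z ^- 2); set j2 := I (fun z => 1 * z ^- 3).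
move=> H1 H2 J0.
have nj0 : 4 <= normc j0 by rewrite (le_trans J0)// (le_trans (ler_norm _))// normc_Im.
have j00 : j0 != 0 by apply: contraTneq nj0 => ->; rewrite normc0 -ltNge.
(* The coefficients of the formal quotient of N0 + N1 a + N2 a^2 by j0 + j1 a + j2 a^2. *)
pose b0 := N0 / j0; pose b1 := (N1 - b0 * j1) / j0; pose b2 := (N2 - b1 * j1 - b0 * j2) / j0.
pose K := K1 + K2 * (normc b0 + normc b1 + normc b2) + (normc b1 * normc j2 + normc b2 * normc j1 + normc b2 * normc j2).
have n0 := @normc_ge0 R.
have K0 : 0 <= K.
  by rewrite /K !addr_ge0 ?mulr_ge0 ?addr_ge0.
pose s := normc j1 + normc j2 + K2 + 1.
have s0 : 0 < s by rewrite ltr_wpDl// !addr_ge0.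
pose d := Num.min (rho / 2) (Num.min 1 s^-1).
have d0 : 0 < d by rewrite !lt_min divr_gt0//= ltr01 invr_gt0.
have d1 : d <= 1 by rewrite !ge_min lexx orbT.
have dr : d <= rho / 2 by rewrite ge_min lexx.
have ds : d * s <= 1 by rewrite -ler_pdivlMr// mul1r !ge_min lexx !orbT.
have main a : normc a <= d -> normc (g a - (b0 + b1 * a + b2 * a ^+ 2)) <= K * normc a ^+ 3.
  move=> ad; have ar : normc a <= rho / 2 by exact: le_trans dr.
  have a1 : normc a <= 1 by exact: le_trans d1.
  have na := n0 a.
  have h1 := H1 a ar; have h2 := H2 a ar.
  have [l Hl] : exists l, rect (dquot g a l) (- rho) rho (- rho) rho = 0.
    by apply: cauchy_dquot => //; [exact: le_trans (normc_Re _) ar|exact: le_trans (normc_Im _) ar].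
  have NJ : I (kern g a) = g a * I (kern (fun=> 1) a).
    have ck := contb_kern p0 ar cg; have c1k := contb_kern p0 ar c1.
    have ck1 : contb (fun z => (- g a) * kern (fun=> 1) a z) (- rho) rho (- rho) rho.
      by move=> z bz; apply: contzZ; exact: c1k.
    have : rect (fun z => kern g a z + (- g a) * kern (fun=> 1) a z) (- rho) rho (- rho) rho = 0.
      rewrite -Hl; apply: (eq_rect rr rr) => z bz; rewrite /dquot /kern.
      case: eqVneq => [za|_]; last by rewrite mul1r mulrBl mulNr.
      have ha : normc a < rho by move: ar p0; clear; lra.
      by have := bdry_norm p0 bz; rewrite za leNgt ha.
    rewrite (rectD rr rr ck ck1) (rectZ rr rr _ c1k) mulNr => /eqP.
    by rewrite subr_eq0 => /eqP.
  move: h1 h2 NJ; set N := I (kern g a); set J := I (kern (fun=> 1) a) => h1 h2 NJ.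
  set P := b0 + b1 * a + b2 * a ^+ 2.
  have nP : normc P <= normc b0 + normc b1 + normc b2.
    rewrite (le_trans (normcD _ _))// lerD//.
      rewrite (le_trans (normcD _ _))// lerD// normcM ler_piMr//.
    by rewrite normcM normcX ler_piMr// exprn_ile1.
  have nJ : 1 <= normc J.
    have q1 : normc j0 <= normc J + normc (J - (j0 + a * j1 + a ^+ 2 * j2)) + normc (a * j1 + a ^+ 2 * j2).
      rewrite {1}(_ : j0 = J + - (J - (j0 + a * j1 + a ^+ 2 * j2)) + - (a * j1 + a ^+ 2 * j2)); last by ring.
      by rewrite (le_trans (normcD _ _))// normcN lerD// (le_trans (normcD _ _))// normcN.
    have q2 : normc (a * j1 + a ^+ 2 * j2) <= normc a * (normc j1 + normc j2).
      rewrite (le_trans (normcD _ _))// [leRHS]mulrDr; apply: lerD; rewrite normcM//.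
      by apply: ler_wpM2r => //; rewrite normcX expr2 ler_piMr.
    have q3 : K2 * normc a ^+ 3 <= normc a * K2.
      by rewrite mulrC ler_wpM2r// exprS ler_piMr// exprn_ile1.
    have q4 : normc a * s <= 1 by rewrite (le_trans _ ds)// ler_wpM2r// ltW.
    exact: (norm_ge1_pert q1 q2 q3 q4 h2 nj0 na).
  have key : J * (g a - P) = (N - (N0 + a * N1 + a ^+ 2 * N2)) - (J - (j0 + a * j1 + a ^+ 2 * j2)) * P
      - a ^+ 3 * (b1 * j2 + b2 * j1 + a * (b2 * j2)).
    rewrite NJ /P /b2 /b1 /b0; field; exact: j00.
  have a3 : 0 <= normc a ^+ 3 by rewrite exprn_ge0.
  have bnd : normc (J * (g a - P)) <= K * normc a ^+ 3.
    rewrite key (le_trans (normcB _ _))// /K [leRHS]mulrDl; apply: lerD.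
      rewrite (le_trans (normcB _ _))// [leRHS]mulrDl; apply: lerD => //.
      rewrite normcM [leRHS]mulrAC; apply: ler_pM; [exact: n0|exact: n0|exact: h2|exact: nP].
    rewrite normcM normcX mulrC; apply: ler_wpM2r => //.
    rewrite (le_trans (normcD _ _))// lerD//.
      by rewrite (le_trans (normcD _ _))// !normcM.
    rewrite normcM [normc (b2 * j2)]normcM -[leRHS]mul1r.
    exact: (ler_wpM2r (mulr_ge0 (n0 b2) (n0 j2)) a1).
  rewrite (le_trans _ bnd)// normcM ler_peMl//.
have g0 : g 0 = b0.
  have := main 0; rewrite normc0 !expr0n /= !mulr0 !addr0 => /(_ (ltW d0)) H.
  apply/eqP; rewrite -subr_eq0; apply/eqP/normc_eq0/eqP; rewrite eq_le H; exact: n0.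
exists b1, b2, K, d; split => // a ad.
by rewrite g0 -addrA -opprD -!addrA -opprD !addrA main.
Qed.

End cauchy.

(** * The real perturbed eigenvalue is the exponential of the pressure *)

Section perturbed_pressure.
Context {R : realType} {A : aperiodic_matrix} {theta : R}.
Local Notation S := (shift_space A theta).
Local Notation sg := (@Defs.shift R A theta).
Implicit Types (x y z : S).
Hypothesis th01 : 0 < theta < 1.

Variables (F : S -> R) (K : R).
Hypothesis K0 : 0 <= K.
Hypothesis FK : forall x y, `|F x - F y| <= K * dtheta x y.
Variables (f : S -> R) (B : R).
Hypothesis B1 : 1 <= B.
Hypothesis f_lip : lip (cplx f) B.
Variables (C : R) (h0 : S -> R) (p : @nweight R A theta).
Hypothesis C1 : 1 <= C.
Hypothesis hC : forall x, C^-1 <= h0 x <= C.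
Hypothesis pE : forall x, p x = expR (F x - 0) * h0 x / h0 (sg x).
Let C0 : 0 < C. Proof. exact: lt_le_trans C1. Qed.
Let hp x : 0 < h0 x.
Proof. by have /andP[+ _] := hC x; apply: lt_le_trans; rewrite invr_gt0. Qed.

Variable t : R.
Let G x := F x + t * f x.
Let q x := p x * expR (t * f x).
Let q0 x : 0 <= q x.
Proof. by rewrite mulr_ge0 ?expR_ge0// (le_trans (ltW (nw_c0 p)) (nw_lb p x)). Qed.

Lemma G_lip : forall x y, `|G x - G y| <= (K + `|t| * B) * dtheta x y.
Proof.
move=> x y; rewrite /G (_ : _ - _ = (F x - F y) + t * (f x - f y)); last by ring.
rewrite (le_trans (ler_normD _ _))// mulrDl lerD// normrM -mulrA ler_wpM2l//.
by have := f_lip x y; rewrite /cplx -rmorphB normc_real.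
Qed.

Lemma bprod_q n x : bprod q n x = expR (birkhoff G n x) * (h0 x / h0 (iter n sg x)).
Proof.
have -> : bprod q n x = bprod p n x * expR (t * birkhoff f n x).
  rewrite /bprod /birkhoff mulr_sumr expR_sum -big_split /=.
  by apply: eq_bigr.
rewrite (bprod_normalized hp pE) mulr0 subr0.
have -> : birkhoff G n x = birkhoff F n x + t * birkhoff f n x.
  by rewrite /birkhoff mulr_sumr -big_split.
by rewrite expRD; ring.
Qed.

Lemma ratio_bound x y : C ^- 2 <= h0 x / h0 y <= C ^+ 2.
Proof.
have /andP[x1 x2] := hC x; have /andP[y1 y2] := hC y.
have i1 : C^-1 <= (h0 y)^-1 by rewrite lef_pV2 ?posrE.
have i2 : (h0 y)^-1 <= C by rewrite -[leRHS]invrK lef_pV2 ?posrE ?invr_gt0.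
rewrite !expr2 invfM; apply/andP; split; apply: ler_pM => //; rewrite ?invr_ge0 ?(ltW C0) ?(ltW (hp _))//.
Qed.

Lemma iter_q_bounds n x (v : S -> R) : (forall y, 0 <= v y) ->
  C ^- 2 * iter n (tr (fun y => expR (G y))) v x <= iter n (tr q) v x <=
  C ^+ 2 * iter n (tr (fun y => expR (G y))) v x.
Proof.
move=> v0; rewrite !iter_trE !mulr_sumr; apply/andP; split; apply: ler_sum => w _.
  rewrite mulrA; apply: ler_wpM2r; first exact: v0.
  rewrite bprod_q bprod_exp mulrC; apply: ler_wpM2l; first exact: expR_ge0.
  by have /andP[] := ratio_bound (wcat w x) (iter n sg (wcat w x)).
rewrite [leRHS]mulrA; apply: ler_wpM2r; first exact: v0.
rewrite bprod_q bprod_exp [leRHS]mulrC; apply: ler_wpM2l; first exact: expR_ge0.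
by have /andP[] := ratio_bound (wcat w x) (iter n sg (wcat w x)).
Qed.

(** An eigenfunction within 1/2 of 1 is positive and bounded, so the iterates of the normalized
    operator grow like l^n; those of the original one differ by bounded ratios of h0. The growth
    rate ln l is then the pressure by the variational principle. *)
Theorem eigen_pressure (h : S -> R[i]) (l : R[i]) :
  (forall x, tr (pw p f t%:C) h x = l * h x) -> (forall x, normc (h x - 1) <= 1 / 2) ->
  cIm l = 0 -> (forall x, cIm (h x) = 0) ->
  0 < cRe l /\ pressure G = (ln (cRe l))%:E.
Proof.
move=> hE h1 Il Ih; pose hr x := cRe (h x).
have hr1 x : 1 / 2 <= hr x <= 3 / 2.
  have := le_trans (normc_Re _) (h1 x); rewrite ReB /= ler_norml /hr => /andP[]; lra.
have hr0 x : 0 <= hr x by have /andP[] := hr1 x; lra.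
have qE x : pw p f t%:C x = (q x)%:C.
  by rewrite /pw -rmorphM cexp_real -rmorphM.
have rE x : tr q hr x = cRe l * hr x.
  have := congr1 (@cRe R) (hE x); rewrite /tr Re_sum => H.
  transitivity (cRe (l * h x)); last by rewrite /hr; case: (l) Il (h x) (Ih x) => a b /= -> [c d] /= ->; rewrite mul0r subr0.
  by rewrite -H; apply: eq_bigr => i _; rewrite qE ReM_real.
have lE n : iter n (tr q) hr = fun x => cRe l ^+ n * hr x.
  elim: n => [|n IH]; first by apply/funext => x; rewrite mul1r.
  by rewrite iterS IH trZ; apply/funext => x; rewrite rE exprSr mulrA.
have KB : 0 <= K + `|t| * B by rewrite addr_ge0// mulr_ge0// (le_trans _ B1).
have [Lam [C' [h' [p' [C'1 LC hC' h'l p'E]]]]] := normalization th01 KB G_lip.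
have C'0 : 0 < C' by exact: lt_le_trans C'1.
have press := variational_principle th01 KB G_lip C'1 (fun n x => proj2 (andP (LC n x))) hC' p'E.
pose x0 : S := point.
have up n : cRe l ^+ n * hr x0 <= C ^+ 2 * (3 / 2 * (C' * expR (n%:R * Lam))).
  have := congr1 (fun g => g x0) (lE n) => <-.
  have /andP[_ H] := iter_q_bounds n x0 hr0; rewrite (le_trans H)// ler_wpM2l ?exprn_ge0 ?(ltW C0)//.
  have /andP[_ H2] := LC n x0; rewrite (le_trans _ (ler_wpM2l _ H2))//.
  have := iter_trZ (fun y => expR (G y)) n (3 / 2) (fun=> 1) => /(congr1 (fun g => g x0)) <-.
  by apply: iter_tr_le => y; [exact: expR_ge0|rewrite mulr1; have /andP[] := hr1 y].
have low n : C ^- 2 * (1 / 2 * (C'^-1 * expR (n%:R * Lam))) <= cRe l ^+ n * hr x0.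
  have := congr1 (fun g => g x0) (lE n) => <-.
  have /andP[H _] := iter_q_bounds n x0 hr0; rewrite (le_trans _ H)// ler_wpM2l ?invr_ge0 ?exprn_ge0 ?(ltW C0)//.
  have /andP[H2 _] := LC n x0; rewrite (le_trans (ler_wpM2l _ H2))//.
  have := iter_trZ (fun y => expR (G y)) n (1 / 2) (fun=> 1) => /(congr1 (fun g => g x0)) <-.
  by apply: iter_tr_le => y; [exact: expR_ge0|rewrite mulr1; have /andP[] := hr1 y].
have hx0 : 0 < hr x0 by have /andP[] := hr1 x0; lra.
have l0 : 0 < cRe l.
  have := low 1%N; rewrite expr1 => H; rewrite -(pmulr_lgt0 _ hx0) (lt_le_trans _ H)//.
  by rewrite !mulr_gt0 ?expR_gt0 ?invr_gt0 ?exprn_gt0// divr_gt0.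
split => //; rewrite press; congr (_%:E).
have lnX n : cRe l ^+ n = expR (n%:R * ln (cRe l)).
  by rewrite -[in LHS](lnK l0) expRM_natl.
apply/eqP; rewrite eq_le; apply/andP; split.
  apply: (@le_of_linear _ _ _ (ln (hr x0) - ln (C ^- 2 * (1 / 2 * C'^-1)))) => n.
  have k0 : 0 < C ^- 2 * (1 / 2 * C'^-1) by rewrite !mulr_gt0 ?invr_gt0 ?exprn_gt0// divr_gt0.
  have := low n; rewrite lnX [1 / 2 * _]mulrA [C ^- 2 * _]mulrA -[X in X * expR _ <= _]lnK ?posrE//.
  rewrite -{1}[hr x0](lnK (hx0 : hr x0 \is Num.pos)) -!expRD ler_expR; lra.
apply: (@le_of_linear _ _ _ (ln (C ^+ 2 * (3 / 2 * C')) - ln (hr x0))) => n.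
have k0 : 0 < C ^+ 2 * (3 / 2 * C') by rewrite !mulr_gt0 ?exprn_gt0// divr_gt0.
have := up n; rewrite lnX [3 / 2 * _]mulrA [C ^+ 2 * _]mulrA -[X in _ <= X * expR _]lnK ?posrE//.
rewrite -{1}[hr x0](lnK (hx0 : hr x0 \is Num.pos)) -!expRD ler_expR; lra.
Qed.

End perturbed_pressure.

(** * Coefficients of germs and first and second derivatives *)

Section germs.
Context {R : realType}.

Lemma small_le (a c d : R) : 0 < d -> 0 <= c -> (forall t, 0 < t <= d -> a <= c * t) -> a <= 0.
Proof.
move=> d0 c0 H; apply/ler_addgt0Pr => e e0; rewrite add0r.
have c1 : 0 < c + 1 by lra.
pose t := Num.min d (e / (c + 1)).
have t0 : 0 < t by rewrite lt_min d0 divr_gt0.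
have tc : t * (c + 1) <= e by rewrite -ler_pdivlMr// ge_min lexx orbT.
have := H t; rewrite t0 ge_min lexx => /(_ isT); lra.
Qed.

Lemma poly_germ (b1 b2 K d : R) : 0 < d -> 0 <= K ->
  (forall t, `|t| <= d -> `|b1 * t + b2 * t ^+ 2| <= K * `|t| ^+ 3) -> b1 = 0 /\ b2 = 0.
Proof.
move=> d0 K0 H.
have e0 : b1 = 0.
  apply/eqP; rewrite -normr_eq0 eq_le normr_ge0 andbT.
  apply: (@small_le _ (K + `|b2|) (Num.min d 1)); [by rewrite lt_min d0 ltr01|by rewrite addr_ge0|].
  move=> t /andP[t0]; rewrite le_min => /andP[td t1].
  have := H t; rewrite (gtr0_norm t0) => /(_ td) h.
  rewrite -(ler_pM2r t0).
  have h1 : `|b1| * t <= K * t ^+ 3 + `|b2| * t ^+ 2.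
    have -> : `|b1| * t = `|(b1 * t + b2 * t ^+ 2) - b2 * t ^+ 2| by rewrite addrK normrM (gtr0_norm t0).
    by rewrite (le_trans (ler_normB _ _))// lerD// normrM [X in _ * X]ger0_norm// sqr_ge0.
  have h2 : K * t ^+ 3 <= K * t ^+ 2.
    by rewrite ler_wpM2l// ler_wiXn2l// ltW.
  rewrite (le_trans h1)// mulrDl mulrDl -!mulrA -!expr2; lra.
split => //; apply/eqP; rewrite -normr_eq0 eq_le normr_ge0 andbT.
apply: (@small_le _ K d) => // t /andP[t0 td].
have := H t; rewrite (gtr0_norm t0) e0 mul0r add0r normrM [X in _ * X]ger0_norm ?sqr_ge0// => /(_ td).
have t2 : 0 < t ^+ 2 by rewrite exprn_gt0.
by rewrite (_ : K * t ^+ 3 = K * t * t ^+ 2) ?(ler_pM2r t2)//; ring.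
Qed.

Lemma complex_poly_germ (b1 b2 : R[i]) (K d : R) : 0 < d -> 0 <= K ->
  (forall t : R, `|t| <= d -> normc (b1 * t%:C + b2 * t%:C ^+ 2) <= K * `|t| ^+ 3) -> b1 = 0 /\ b2 = 0.
Proof.
move=> d0 K0 H.
have E t : cRe (b1 * t%:C + b2 * t%:C ^+ 2) = cRe b1 * t + cRe b2 * t ^+ 2.
  by case: (b1) => x y; case: (b2) => z w /=; ring.
have E' t : cIm (b1 * t%:C + b2 * t%:C ^+ 2) = cIm b1 * t + cIm b2 * t ^+ 2.
  by case: (b1) => x y; case: (b2) => z w /=; ring.
have [r1 r2] : cRe b1 = 0 /\ cRe b2 = 0.
  by apply: (poly_germ d0 K0) => t td; rewrite -E (le_trans (normc_Re _))// H.
have [i1 i2] : cIm b1 = 0 /\ cIm b2 = 0.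
  by apply: (poly_germ d0 K0) => t td; rewrite -E' (le_trans (normc_Im _))// H.
by split; apply/eqP; rewrite eq_complex ?r1 ?r2 ?i1 ?i2 /= eqxx.
Qed.

Definition rdiff (g : R -> R) (x l : R) := forall e : R, 0 < e -> exists2 d : R, 0 < d &
  forall w, `|w - x| < d -> `|g w - g x - l * (w - x)| <= e * `|w - x|.

Lemma rdiff_cvg (g : R -> R) (x l : R) : rdiff g x l <-> h^-1 *: (g (h + x) - g x) @[h --> 0^'] --> l.
Proof.
split=> [H|/cvgrPdist_le H e /H].
  apply/cvgrPdist_le => e e0; have [d d0 hd] := H e e0.
  near=> h; have h0 : h != 0 by near: h; exact: nbhs_dnbhs_neq.
  have hd' : `|h| < d by near: h; apply: dnbhs0_lt.
  have := hd (h + x); rewrite addrK => /(_ hd').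
  have -> : l - h^-1 *: (g (h + x) - g x) = - (h^-1 * (g (h + x) - g x - l * h)).
    by rewrite /GRing.scale /=; field.
  by rewrite normrN normrM normfV ler_pdivrMl ?normr_gt0// [_ * e]mulrC.
case=> d /= d0 hd; exists d => // w wx.
have [->|wnx] := eqVneq w x; first by rewrite !subrr mulr0 subrr !normr0 mulr0.
have w0 : w - x != 0 by rewrite subr_eq0.
have := hd (w - x); rewrite /ball_ /= sub0r normrN => /(_ wx w0); rewrite subrK.
have -> : l - (w - x)^-1 *: (g w - g x) = - ((w - x)^-1 * (g w - g x - l * (w - x))).
  by rewrite /GRing.scale /=; field.
by rewrite normrN normrM normfV ler_pdivrMl ?normr_gt0// [_ * e]mulrC.
Unshelve. all: end_near. Qed.

Lemma is_derive_rdiff (g : R -> R) (x l : R) : rdiff g x l -> is_derive x 1 g l.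
Proof.
move=> /rdiff_cvg H.
have E : (fun h : R => h^-1 *: ((g \o shift x) (h *: 1) - g x)) = (fun h => h^-1 *: (g (h + x) - g x)).
  by apply/funext => h; rewrite /= /GRing.scale /= mulr1.
have dg : derivable g x 1 by rewrite /derivable E; apply/cvg_ex; exists l.
by apply: DeriveDef => //; rewrite /derive E; apply/cvg_lim.
Qed.

Lemma derive1_rdiff (g : R -> R) (x l : R) : rdiff g x l -> derive1 g x = l.
Proof. by move=> /is_derive_rdiff H; rewrite derive1E derive_val. Qed.

(** A limit that does not exist has the default value 0, so a nonzero derivative certifies
    differentiability. It is applied to the second derivative, whose value is - sigma0^2. *)
Lemma derive1_neq0_rdiff (g : R -> R) (x : R) : derive1 g x != 0 -> rdiff g x (derive1 g x).
Proof.
move=> g0; apply/rdiff_cvg.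
have [c|nc] := pselect (cvg (h^-1 *: (g (h + x) - g x) @[h --> 0^'])); first exact: c.
by move: g0; rewrite /derive1 dvgP// eqxx.
Qed.

Lemma rdiff_quadratic (g : R -> R) (u l s : R) : rdiff g u l -> rdiff (fun v => g v + s / 2 * v ^+ 2) u (l + s * u).
Proof.
move=> H e e0; have e2 : 0 < e / 2 by lra.
have s1 : 0 < `|s| + 1 by rewrite ltr_wpDl.
have [d d0 hd] := H _ e2; exists (Num.min d (e / (`|s| + 1))); first by rewrite lt_min d0 divr_gt0.
move=> w; rewrite lt_min => /andP[w1 w2].
have -> : g w + s / 2 * w ^+ 2 - (g u + s / 2 * u ^+ 2) - (l + s * u) * (w - u) =
   (g w - g u - l * (w - u)) + s / 2 * (w - u) * (w - u) by field.
rewrite (le_trans (ler_normD _ _))//.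
have h1 := hd w w1; have n0 := normr_ge0 (w - u).
have h2 : `|s / 2 * (w - u) * (w - u)| <= e / 2 * `|w - u|.
  rewrite normrM; apply: ler_wpM2r => //; rewrite !normrM [X in _ * X * _]ger0_norm//.
  move: w2; rewrite ltr_pdivlMr// => w2; have := ltW w2; have := normr_ge0 s; lra.
lra.
Qed.

(** By the mean value theorem for g + s u^2 / 2, whose derivative is o(u) at 0, one has g u - g 0 =
    - s u^2 / 2 + o(u^2); comparison with the cubic remainder fixes c. *)
Lemma second_derivative_germ (g : R -> R) (c s K d : R) : 0 < d -> 0 <= K ->
  (forall u, `|u| <= d -> exists l, rdiff g u l) ->
  (forall u, `|u| <= d -> `|g u - g 0 + c * u ^+ 2| <= K * `|u| ^+ 3) ->
  derive1n 2 g 0 = - s -> s != 0 -> c = s / 2.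
Proof.
move=> d0 K0 D H g2 s0.
have D' u : `|u| <= d -> rdiff g u (derive1 g u).
  by move=> /D[l gl]; rewrite (derive1_rdiff gl).
have g20 : rdiff (derive1 g) 0 (- s).
  have := g2; rewrite /derive1n /= => E; rewrite -E; apply: derive1_neq0_rdiff.
  by rewrite E oppr_eq0.
have g10 : derive1 g 0 = 0.
  apply: derive1_rdiff => e e0.
  have m0 : 0 < `|c| + K + 1 by rewrite ltr_wpDl// addr_ge0.
  exists (Num.min d (Num.min 1 (e / (`|c| + K + 1)))); first by rewrite !lt_min d0 ltr01 divr_gt0.
  move=> w; rewrite !lt_min subr0 => /andP[w1 /andP[w2 w3]].
  rewrite mul0r subr0; have h := H w (ltW w1).
  have n0 := normr_ge0 w.
  have h1 : `|g w - g 0| <= K * `|w| ^+ 3 + `|c| * `|w| ^+ 2.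
    have -> : g w - g 0 = (g w - g 0 + c * w ^+ 2) - c * w ^+ 2 by rewrite addrK.
    by rewrite (le_trans (ler_normB _ _))// normrM normrX lerD.
  have h2 : K * `|w| ^+ 3 <= K * `|w| ^+ 2 by rewrite ler_wpM2l// ler_wiXn2l// ltW.
  have h3 : `|w| * (`|c| + K + 1) <= e by rewrite -ler_pdivlMr// ltW.
  have h4 := ler_wpM2r n0 h3.
  rewrite (le_trans h1)// (le_trans _ h4)//.
  have := mulr_ge0 n0 n0; rewrite expr2 in h2 *; lra.
have key e : 0 < e -> exists2 dl, 0 < dl & forall t, 0 < t <= dl -> `|g t - g 0 + s / 2 * t ^+ 2| <= e * t ^+ 2.
  move=> e0; have [dl dl0 hdl] := g20 e e0.
  exists (Num.min d (dl / 2)); first by rewrite lt_min d0 divr_gt0.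
  move=> t /andP[t0]; rewrite le_min => /andP[td tdl].
  pose k (u : R) := g u + s / 2 * u ^+ 2.
  have dk (u : R) : `|u| <= d -> is_derive u 1 k (derive1 g u + s * u).
    by move=> /D'/(rdiff_quadratic s)/is_derive_rdiff.
  have ind (u : R) : 0 <= u <= t -> `|u| <= d by move=> /andP[u0 ut]; rewrite ger0_norm// (le_trans ut).
  have ck : {within `[0, t], continuous k}.
    apply: derivable_within_continuous => u; rewrite in_itv/= => /ind ud.
    by have [] := dk u ud.
  have dk' (u : R) : u \in `]0, t[ -> is_derive u 1 k (derive1 g u + s * u).
    by rewrite in_itv/= => /andP[u0 ut]; apply: dk; apply: ind; rewrite !ltW.
  have [c' c'in] := MVT_segment (ltW t0) dk' ck.
  move: c'in; rewrite in_itv/= => /andP[c0 ct].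
  rewrite /k expr0n /= mulr0 addr0 subr0 addrAC => ->.
  have c'd : `|c' - 0| < dl by rewrite subr0 ger0_norm// (le_lt_trans ct)//; lra.
  have := hdl c' c'd; rewrite g10 !subr0 mulNr opprK => h.
  rewrite normrM (gtr0_norm t0) expr2 mulrA; apply: ler_wpM2r; first exact: ltW.
  by rewrite (le_trans h)// ler_wpM2l ?(ltW e0)// ger0_norm.
apply/eqP; rewrite -subr_eq0 -normr_eq0 eq_le normr_ge0 andbT.
apply/ler_addgt0Pr => e e0; rewrite add0r -subr_le0.
have [dl dl0 hk] := key e e0.
apply: (@small_le _ K (Num.min d dl)) => //; first by rewrite lt_min d0.
move=> t /andP[t0]; rewrite le_min => /andP[td tdl].
have := hk t; rewrite t0 => /(_ tdl) h1; have := H t; rewrite (gtr0_norm t0) => /(_ td) h2.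
have t2 : 0 < t ^+ 2 by rewrite exprn_gt0.
rewrite -(ler_pM2r t2) mulrBl -[X in X - _](_ : `|(c - s / 2) * t ^+ 2| = _); last by rewrite normrM [X in _ * X]gtr0_norm.
have -> : (c - s / 2) * t ^+ 2 = (g t - g 0 + c * t ^+ 2) - (g t - g 0 + s / 2 * t ^+ 2) by ring.
rewrite lerBlDr (le_trans (ler_normB _ _))// lerD// (le_trans h2)// exprS mulrA//.
Qed.

End germs.

(** * Taylor coefficients of the eigenvalue from the pressure *)

Section pressure_germ.
Context {R : realType} {A : aperiodic_matrix} {theta : R}.
Local Notation S := (shift_space A theta).
Implicit Types (x y : S).

Lemma cdiff_derivable (Q : R[i] -> R[i]) z : derivable (Q : R[i]^o -> R[i]^o) z 1 -> exists l, cdiff Q z l.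
Proof.
move=> /cvg_ex[l /cvgrPdist_le H]; exists l => e e0.
have eC : 0 < e%:C :> R[i] by rewrite ltcE /= eqxx.
have [d' /= d'0 hd] := H _ eC.
have [d d0 dE] : exists2 d : R, 0 < d & d' = d%:C.
  move: d'0; case: d' {hd} => a b; rewrite ltcE /= => /andP[/eqP -> a0]; by exists a.
exists d => // w wz.
have [->|wnz] := eqVneq w z; first by rewrite !subrr mulr0 subrr normc0 mulr0.
have w0 : w - z != 0 by rewrite subr_eq0.
have := hd (w - z); rewrite /ball_ /= sub0r normrN dE => h.
have {}h := h _ w0.
have {}h : `|l - (w - z)^-1 *: (Q ((w - z) *: (1 : R[i]^o) + z) - Q z)| <= e%:C.
  by apply: h; rewrite ltcE /= eqxx.
move: h; rewrite /GRing.scale /= mulr1 subrK => h.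
have : normc (l - (w - z)^-1 * (Q w - Q z)) <= e by move: h; rewrite lecE /= eqxx.
have -> : l - (w - z)^-1 * (Q w - Q z) = - ((w - z)^-1 * (Q w - Q z - l * (w - z))) by field.
by rewrite normcN normcM normcV ler_pdivrMl ?normc_gt0// [_ * e]mulrC.
Qed.

Lemma tangent_slope (a b k d : R) : 0 < d -> 0 <= k ->
  (forall t, `|t| <= d -> t * a <= b * t + k * `|t| ^+ 2) -> b = a.
Proof.
move=> d0 k0 H; apply/eqP; rewrite eq_le -[b <= a]subr_le0 -[a <= b]subr_le0; apply/andP; split.
  apply: (small_le d0 k0) => t /andP[t0 td].
  have := H (- t); rewrite normrN (gtr0_norm t0) => /(_ td) h'.
  rewrite -(ler_pM2r t0) mulrBl -mulrA -expr2; move: h'; clear; lra.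
apply: (small_le d0 k0) => t /andP[t0 td].
have := H t; rewrite (gtr0_norm t0) => /(_ td) h'.
rewrite -(ler_pM2r t0) mulrBl -mulrA -expr2; move: h'; clear; lra.
Qed.

Variables (th01 : 0 < theta < 1) (f : S -> R) (P : R).
Let F x := - P * f x.
Variables (B : R) (B1 : 1 <= B) (f_lip : lip (cplx f) B) (f_bdd : bdd (cplx f) B).
Hypothesis hP : pressure F = 0%E.
Variable m0 : probability (borel_shift A theta) R.
Hypothesis hm0 : equilibrium_state F m0.
Local Notation alpha := (\int[m0]_x f x)%R.
Variable sigma0 : R.
Hypothesis sigma0_gt0 : 0 < sigma0.
Hypothesis hsigma0 : derive1n 2 (fun u : R => cRe (pressureC F f (0 +i* u))) 0 = - sigma0 ^+ 2.

Let B0 : 0 <= B. Proof. exact: le_trans B1. Qed.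

Lemma f_real_lip x y : `|f x - f y| <= B * dtheta x y.
Proof. by have := f_lip x y; rewrite /cplx -rmorphB normc_real. Qed.

(** The equilibrium state is a competitor in the supremum for every t. The resulting line touches
    the pressure at t = 0, so alpha is the derivative of the pressure there. *)
Lemma pressure_tangent t : ((t * alpha)%:E <= pressure (fun x => (F x + t * f x)%R))%E.
Proof.
have [inv eq] := hm0.
have bf : bm (f : borel_shift A theta -> R) by exact: bm_lip f_real_lip.
have bF : bm (F : borel_shift A theta -> R) by apply: bmZ.
have btf : bm (fun x : borel_shift A theta => t * f x) by exact: bmZ.
apply: le_ereal_sup_tmp; exists (entropy m0 + \int[m0]_x (F x + t * f x)%:E)%E; first by exists m0.
have bFt : bm (fun x : borel_shift A theta => F x + t * f x) by exact: bmD.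
rewrite (expect_EFin m0 bFt) (expectD m0 bF btf) (expectZ m0 t bf) EFinD addeA.
have <- : (\int[m0]_x (F x)%:E)%E = (\int[m0]_x F x)%R%:E by exact: expect_EFin.
by rewrite eq hP add0e.
Qed.

(** Were there no continuation, [pressureC] would be its default 0, whose second derivative is not -
    sigma0^2. *)
Lemma continuation_exists : exists Q, pressure_continuation F f Q /\ Q = pressureC F f.
Proof.
have [[Q HQ]|nQ] := pselect (exists Q, pressure_continuation F f Q).
  exists (pressureC F f); split; last by [].
  by apply: xgetPex; exists Q.
have E : pressureC F f = fun=> 0.
  by rewrite /pressureC; case: xgetP => // Q _ HQ; case: nQ; exists Q.
move: hsigma0; rewrite E /=.
have D0 : derive1 (fun=> 0 : R) = fun=> 0.
  by apply/funext => u; rewrite derive1_cst.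
rewrite /derive1n /= !D0 => /eqP; rewrite eq_sym oppr_eq0 expf_eq0 /=.
by rewrite gt_eqF.
Qed.

Variables (C : R) (h0 : S -> R) (p : @nweight R A theta).
Hypothesis C1 : 1 <= C.
Hypothesis hC : forall x, C^-1 <= h0 x <= C.
Hypothesis pE : forall x, p x = expR (F x - 0) * h0 x / h0 (sg x).

Variables (z0 K : R) (be : R[i]) (h : R[i] -> S -> R[i]) (l : R[i] -> R[i]).
Hypothesis z00 : 0 < z0.
Hypothesis K0 : 0 <= K.
Hypothesis hE : forall z, normc z <= z0 -> forall x, tr (pw p f z) (h z) x = l z * h z x.
Hypothesis h1 : forall z, normc z <= z0 -> forall x, normc (h z x - 1) <= 1 / 2.
Hypothesis lE : forall z, normc z <= z0 ->
  normc (l z - 1 - z * mu p (cplx f) - z ^+ 2 * be) <= K * normc z ^+ 3.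
Hypothesis lr : forall z, normc z <= z0 -> cIm z = 0 -> cIm (l z) = 0 /\ forall x, cIm (h z x) = 0.

Lemma cexp_germ (c1 c2 E : R[i]) (t K' M : R) : 0 <= K' -> `|t| <= 1 -> normc E <= K' * `|t| ^+ 3 ->
  M = normc c1 + normc c2 + K' ->
  normc (cexp (c1 * t%:C + c2 * t%:C ^+ 2 + E) - 1 - c1 * t%:C - (c2 + c1 ^+ 2 / 2) * t%:C ^+ 2)
    <= (K' + M ^+ 3 * expR M + M ^+ 2) * `|t| ^+ 3.
Proof.
move=> K'0 t1 HE ME; set z := c1 * t%:C + c2 * t%:C ^+ 2 + E.
have n1 := normc_ge0 c1; have n2 := normc_ge0 c2; have nt := normr_ge0 t.
have M0 : 0 <= M by rewrite ME !addr_ge0.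
have t2 : `|t| ^+ 2 <= `|t| by rewrite expr2 ler_piMr.
have t3 : `|t| ^+ 3 <= `|t| ^+ 2 by rewrite exprS ler_piMl// exprn_ge0.
have q2 : 0 <= `|t| ^+ 2 by rewrite exprn_ge0.
have zc : normc (z - c1 * t%:C) <= M * `|t| ^+ 2.
  have -> : z - c1 * t%:C = c2 * t%:C ^+ 2 + E by rewrite /z; ring.
  rewrite (le_trans (normcD _ _))// normcM normcX normc_real ME !mulrDl.
  have := ler_wpM2l K'0 t3; have := mulr_ge0 n1 q2; move: HE; lra.
have zM : normc z <= M * `|t|.
  have -> : z = (c2 * t%:C ^+ 2 + E) + c1 * t%:C by rewrite /z; ring.
  rewrite (le_trans (normcD _ _))// (le_trans (lerD (normcD _ _) (lexx _)))//.
  rewrite [normc (c2 * _)]normcM [normc (c1 * _)]normcM normcX normc_real ME !mulrDl.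
  have := ler_wpM2l K'0 (le_trans t3 t2); have := ler_wpM2l n2 t2; move: HE; lra.
have zM1 : normc z <= M by rewrite (le_trans zM)// ler_piMr.
have -> : cexp z - 1 - c1 * t%:C - (c2 + c1 ^+ 2 / 2) * t%:C ^+ 2 =
   (cexp z - 1 - z - z ^+ 2 / 2) + (E + (z - c1 * t%:C) * (z + c1 * t%:C) / 2).
  rewrite (_ : E = z - c1 * t%:C - c2 * t%:C ^+ 2); last by rewrite /z; ring.
  by field.
rewrite (le_trans (normcD _ _))// [leRHS](_ : _ = M ^+ 3 * expR M * `|t| ^+ 3 + (K' * `|t| ^+ 3 + M ^+ 2 * `|t| ^+ 3)); last by ring.
apply: lerD.
  rewrite (le_trans (cexp_taylor3 _))// [leRHS]mulrAC -exprMn.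
  by apply: ler_pM; rewrite ?exprn_ge0 ?normc_ge0 ?expR_ge0 ?ler_expR// lerXn2r// nnegrE ?normc_ge0// mulr_ge0.
rewrite (le_trans (normcD _ _))// lerD// -mulrA normcM.
rewrite (_ : M ^+ 2 * `|t| ^+ 3 = (M * `|t| ^+ 2) * (M * `|t|)); last by ring.
apply: ler_pM; rewrite ?normc_ge0// normcM.
have -> : normc (2^-1 : R[i]) = 2^-1.
  have -> : (2^-1 : R[i]) = (2^-1)%:C by rewrite (rmorphV (real_complex R)) ?unitfE// rmorph_nat.
  by rewrite normc_real ger0_norm.
have : normc (z + c1 * t%:C) <= M * `|t| + M * `|t|.
  rewrite (le_trans (normcD _ _))// lerD// normcM normc_real ler_wpM2r// ME; move: n2 K'0; lra.
lra.
Qed.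

(** For small real t the eigenvalue is e^(Q t), so its expansion is the exponential of that of Q.
    The first coefficient of Q is alpha by the tangent line, and the second is read off on the
    imaginary axis, where the same holomorphic expansion holds. *)
Theorem eigenvalue_germ : mu p (cplx f) = alpha%:C /\ be = ((alpha ^+ 2 + sigma0 ^+ 2) / 2)%:C.
Proof.
have [Q [[r r0 [Qr Qd]] QE]] := continuation_exists.
have Qc z : normc z < r -> exists c, cdiff Q z c.
  by move=> zr; apply: cdiff_derivable; apply: Qd; rewrite ltcE /= eqxx.
have [c1 [c2 [K' [d [d0 K'0 HQ]]]]] := holomorphic_expansion r0 Qc.
have FKB : 0 <= `|P| * B by rewrite mulr_ge0.
have FK x y : `|F x - F y| <= `|P| * B * dtheta x y.
  by rewrite /F -mulrBr normrM normrN -mulrA ler_wpM2l// f_real_lip.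
have Q0 : Q 0 = 0.
  have [] := Qr 0; first by rewrite normr0.
  have -> : pressure (fun x => F x + 0 * f x) = 0%E.
    by rewrite -hP; congr pressure; apply/funext => x; rewrite mul0r addr0.
  by rewrite rmorph0; case: (Q 0) => a b /= [<-] ->.
pose d1 := Num.min (Num.min d 1) (Num.min z0 (r / 2)).
have d10 : 0 < d1 by rewrite !lt_min d0 ltr01 z00 divr_gt0.
have dd : d1 <= d by rewrite !ge_min lexx.
have d11 : d1 <= 1 by rewrite !ge_min lexx !orbT.
have dz : d1 <= z0 by rewrite !ge_min lexx !orbT.
have dr : d1 < r by rewrite (@le_lt_trans _ _ (r / 2))//; [rewrite !ge_min lexx !orbT|lra].
have Qt t : `|t| <= d1 -> normc (Q t%:C - c1 * t%:C - c2 * t%:C ^+ 2) <= K' * `|t| ^+ 3.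
  by move=> td; have := HQ t%:C; rewrite normc_real Q0 subr0 => -> //; exact: le_trans dd.
have Qln t : `|t| <= d1 -> cexp (Q t%:C) = l t%:C.
  move=> td; have tz : normc (t%:C : R[i]) <= z0 by rewrite normc_real (le_trans td).
  have [Il Ih] := lr tz erefl.
  have [l0 pl] := eigen_pressure th01 FKB FK B1 f_lip C1 hC pE (hE tz) (h1 tz) Il Ih.
  have [] := Qr t (le_lt_trans td dr); rewrite pl => -[E] I.
  have -> : Q t%:C = (ln (cRe (l t%:C)))%:C by move: E I; case: (Q t%:C) => a b /= <- ->.
  by rewrite cexp_real lnK//; move: Il; case: (l t%:C) => a b /= ->.
pose M := normc c1 + normc c2 + K'.
pose K2 := (K' + M ^+ 3 * expR M + M ^+ 2) + K.
have M0 : 0 <= M by rewrite /M !addr_ge0 ?normc_ge0.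
have K20 : 0 <= K2 by rewrite /K2 !addr_ge0// ?mulr_ge0 ?expR_ge0 ?exprn_ge0.
(* Two expansions of the eigenvalue with cubic remainder, one from perturbation theory and one from
   the pressure, must have equal coefficients. *)
have [e1 e2] : mu p (cplx f) - c1 = 0 /\ be - (c2 + c1 ^+ 2 / 2) = 0.
  apply: (complex_poly_germ d10 K20) => t td.
  have tz : normc (t%:C : R[i]) <= z0 by rewrite normc_real (le_trans td).
  have g1 := cexp_germ K'0 (le_trans td d11) (Qt t td) (erefl (normc c1 + normc c2 + K')).
  have E : c1 * t%:C + c2 * t%:C ^+ 2 + (Q t%:C - c1 * t%:C - c2 * t%:C ^+ 2) = Q t%:C by ring.
  rewrite E Qln// -/M in g1.
  have g2 := lE tz; rewrite normc_real in g2.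
  have -> : (mu p (cplx f) - c1) * t%:C + (be - (c2 + c1 ^+ 2 / 2)) * t%:C ^+ 2 =
     (l t%:C - 1 - c1 * t%:C - (c2 + c1 ^+ 2 / 2) * t%:C ^+ 2) - (l t%:C - 1 - t%:C * mu p (cplx f) - t%:C ^+ 2 * be) by ring.
  by rewrite (le_trans (normcB _ _))// /K2 [leRHS]mulrDl lerD.
have c1E : c1 = mu p (cplx f) by apply/esym/eqP; rewrite -subr_eq0; apply/eqP.
have bE : be = c2 + c1 ^+ 2 / 2 by apply/eqP; rewrite -subr_eq0; apply/eqP.
have Ic1 : cIm c1 = 0 by rewrite c1E; apply: (mu_real p B0 f_lip).
have Re2 t : cRe (Q t%:C - c1 * t%:C - c2 * t%:C ^+ 2) = cRe (Q t%:C) - cRe c1 * t - cRe c2 * t ^+ 2.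
  by case: (Q t%:C) => a b; case: (c1) => a1 b1; case: (c2) => a2 b2 /=; ring.
have Im2 t : cIm (Q t%:C - c1 * t%:C - c2 * t%:C ^+ 2) = cIm (Q t%:C) - cIm c1 * t - cIm c2 * t ^+ 2.
  by case: (Q t%:C) => a b; case: (c1) => a1 b1; case: (c2) => a2 b2 /=; ring.
have Ic2 : cIm c2 = 0.
  have H t : `|t| <= d1 -> `|0 * t + - cIm c2 * t ^+ 2| <= K' * `|t| ^+ 3.
    move=> td; have := le_trans (normc_Im _) (Qt t td).
    by rewrite Im2 (Qr t (le_lt_trans td dr)).2 Ic1 !mul0r subr0 sub0r add0r mulNr.
  by have [_ /eqP] := poly_germ d10 K'0 H; rewrite oppr_eq0 => /eqP.
have tan t : `|t| <= d1 -> t * alpha <= cRe (Q t%:C).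
  move=> td; have [E _] := Qr t (le_lt_trans td dr).
  by have := pressure_tangent t; rewrite E lee_fin.
have cal : cRe c1 = alpha.
  have k0 : 0 <= `|cRe c2| + K' by rewrite addr_ge0.
  have low t : `|t| <= d1 -> t * alpha <= cRe c1 * t + (`|cRe c2| + K') * `|t| ^+ 2.
    move=> td; have nt := normr_ge0 t.
    have := le_trans (normc_Re _) (Qt t td); rewrite Re2 ler_norml => /andP[_ H].
    have T := tan t td.
    have t3 : `|t| ^+ 3 <= `|t| ^+ 2 by rewrite exprS ler_piMl ?exprn_ge0// (le_trans td).
    have a1 := ler_wpM2l K'0 t3.
    have a2 : cRe c2 * t ^+ 2 <= `|cRe c2| * `|t| ^+ 2.
      by rewrite (le_trans (ler_norm _))// normrM normrX.
    rewrite mulrDl; lra.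
  exact: tangent_slope d10 k0 low.
(* With c1 real, the real part of Q (i u) is - c2 u^2 + O(u^3), so the hypothesis on its second
   derivative gives c2. *)
have c2E : cRe c2 = sigma0 ^+ 2 / 2.
  pose g (u : R) := cRe (Q (0 +i* u)).
  have Dg u : `|u| <= d1 -> exists c, rdiff g u c.
    move=> ud; have ur : normc (0 +i* u) < r.
      by rewrite /normc /= expr0n add0r sqrtr_sqr (le_lt_trans ud).
    have [c cQ] := Qc _ ur; exists (- cIm c) => e e0; have [dl dl0 hd] := cQ e e0.
    exists dl; first exact: dl0.
    move=> w wu.
    have nw : normc ((0 +i* w) - (0 +i* u)) = `|w - u|.
      by rewrite /normc /= subrr expr0n add0r sqrtr_sqr.
    have := hd (0 +i* w); rewrite nw => /(_ wu) /(le_trans (normc_Re _)).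
    have -> : cRe (Q (0 +i* w) - Q (0 +i* u) - c * ((0 +i* w) - (0 +i* u))) =
        g w - g u - - cIm c * (w - u).
      rewrite /g; case: (Q (0 +i* w)) => a b; case: (Q (0 +i* u)) => a' b'.
      by case: (c) => c3 c4 /=; ring.
    exact.
  have Hg u : `|u| <= d1 -> `|g u - g 0 + cRe c2 * u ^+ 2| <= K' * `|u| ^+ 3.
    move=> ud; have nu : normc (0 +i* u) = `|u| by rewrite /normc /= expr0n add0r sqrtr_sqr.
    have := HQ (0 +i* u); rewrite nu Q0 subr0 => /(_ (le_trans ud dd)) /(le_trans (normc_Re _)).
    have -> : cRe (Q (0 +i* u) - c1 * (0 +i* u) - c2 * (0 +i* u) ^+ 2) =
        g u - g 0 + cRe c2 * u ^+ 2.
      rewrite /g (_ : (0 +i* 0) = 0)// Q0 /=.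
      by move: Ic1; case: (Q (0 +i* u)) => a b; case: (c1) => a1 b1; case: (c2) => a2 b2 /= ->; ring.
    exact.
  have s0 : sigma0 ^+ 2 != 0 by rewrite expf_neq0// gt_eqF.
  have g2 : derive1n 2 g 0 = - sigma0 ^+ 2 by rewrite -hsigma0 /g QE.
  exact: (second_derivative_germ d10 K'0 Dg Hg g2 s0).
have c1a : c1 = alpha%:C by move: Ic1 cal; case: (c1) => a b /= -> ->.
split; first by rewrite -c1E.
rewrite bE c1a; move: Ic2 c2E; case: (c2) => a b /= -> ->.
apply/eqP; rewrite -rmorphXn.
have -> : 2%:R = (2%:R : R)%:C by rewrite rmorph_nat.
rewrite -fmorphV -rmorphM eq_complex /= addr0 eqxx andbT; apply/eqP; ring.
Qed.

End pressure_germ.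

(** * Real integrals, substitutions and trigonometric inequalities *)

Section calculus.
Context {R : realType}.
Implicit Types (u v g G : R -> R) (a b : R).

Lemma rcont_for u a b : (forall x, a <= x <= b -> {for x, continuous u}) -> rcont u a b.
Proof.
move=> uc x xab e e0; have /cvgrPdist_le/(_ _ e0) := uc x xab.
move=> /nbhs_ballP[d /= d0 hd]; exists d => // y yx.
by rewrite distrC; apply: hd; rewrite /ball/= distrC.
Qed.

Lemma rcontC u a b : continuous u -> rcont u a b.
Proof. by move=> uc; apply: rcont_for => x _; exact: uc. Qed.

Lemma continuous_is_derive G g : (forall x : R, is_derive x 1 G (g x)) -> continuous G.
Proof.
by move=> H x; apply: differentiable_continuous; apply/derivable1_diffP; case: (H x).
Qed.

Lemma ri_point u a : rcont u a a -> ri u a a = 0.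
Proof.
move=> uc; apply/eqP; rewrite -normr_le0 -[leRHS](mulr0 `|u a|) -(subrr a).
by apply: ri_bound => // x /le_anti <-.
Qed.

Lemma rcont_within u a b : rcont u a b -> {within `[a, b], continuous u}.
Proof.
move=> H; apply: continuous_in_subspaceT => x; rewrite inE/= in_itv/= => xab.
apply/cvgrPdist_le => e e0; have [d d0 hd] := H x xab e e0.
near=> y; rewrite distrC; apply: hd; rewrite distrC.
by near: y; apply/nbhs_ballP; exists d.
Unshelve. all: end_near. Qed.

Lemma ri_ftc G g a b : a <= b -> rcont g a b ->
  (forall x : R, a <= x <= b -> is_derive x 1 G (g x)) -> ri g a b = G b - G a.
Proof.
move=> ab gc GD; move: ab; rewrite le_eqVlt => /predU1P[ab|ab].
  by move: gc; rewrite -ab => /ri_point ->; rewrite subrr.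
have Gc x : a <= x <= b -> {for x, continuous G}.
  by move=> /GD H; apply: differentiable_continuous; apply/derivable1_diffP; case: H.
rewrite /ri /Rintegral (@continuous_FTC2 _ _ G)//; first exact: rcont_within.
  split.
  - by move=> x; rewrite in_itv/= => /andP[/ltW ax /ltW xb]; have [] := GD x; rewrite ?ax.
  - by apply: cvg_at_right_filter; apply: Gc; rewrite lexx ltW.
  - by apply: cvg_at_left_filter; apply: Gc; rewrite lexx ltW.
move=> x; rewrite in_itv/= => /andP[/ltW ax /ltW xb].
have H : is_derive x 1 G (g x) by apply: GD; rewrite ax.
by rewrite derive1E; apply: derive_val.
Qed.

Lemma ri_le u v a b : rcont u a b -> rcont v a b ->
  (forall x, a <= x <= b -> u x <= v x) -> ri u a b <= ri v a b.
Proof.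
move=> /rcont_int ui /rcont_int vi uv; apply: le_Rintegral => //.
Qed.

Lemma cts_bigsum (I : Type) (r : seq I) (F : I -> R -> R) :
  (forall i, continuous (F i)) -> continuous (fun x => \sum_(i <- r) F i x).
Proof.
move=> Fc; elim: r => [|i r IH] x.
  by under eq_fun do rewrite big_nil; exact: cvg_cst.
by under eq_fun do rewrite big_cons; apply: cvgD; [exact: Fc|exact: IH].
Qed.

Lemma ri_sum (I : Type) (r : seq I) (F : I -> R -> R) a b : a <= b ->
  (forall i, continuous (F i)) ->
  ri (fun x => \sum_(i <- r) F i x) a b = \sum_(i <- r) ri (F i) a b.
Proof.
move=> ab Fc; elim: r => [|i r IH].
  by under eq_ri do rewrite big_nil; rewrite ri_cst// mul0r big_nil.
rewrite big_cons -IH -riD; last 2 first.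
- exact: rcontC.
- by apply: rcontC; exact: cts_bigsum.
by apply: eq_ri => x _; rewrite big_cons.
Qed.

Lemma primitive g (L : R) : continuous g -> exists G, forall x, L < x -> is_derive x 1 G (g x).
Proof.
move=> gc; exists (fun x => (\int[lebesgue_measure]_(t in `[L, x]) g t)%R) => x Lx.
have x1 : x < x + 1 by rewrite ltrDl.
have gi : lebesgue_measure.-integrable `[L, x + 1] (EFin \o g).
  by apply: rcont_int; exact: rcontC.
have [D1 D2] := continuous_FTC1_closed x1 gi Lx (gc x).
by apply: DeriveDef; [exact: D1|rewrite -derive1E; exact: D2].
Qed.

(** Produces the Taylor bounds of sine and cosine in turn, each from the preceding one as its
    derivative. *)
Lemma nonneg_of_derive G g : (forall x : R, is_derive x 1 G (g x)) -> G 0 = 0 ->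
  (forall x : R, 0 <= x -> 0 <= g x) -> forall x : R, 0 <= x -> 0 <= G x.
Proof.
move=> GD G0 g0 x; rewrite le_eqVlt => /predU1P[<-|x0]; first by rewrite G0.
have Gc : {within `[0, x], continuous G}.
  by apply: continuous_subspaceT; exact: continuous_is_derive GD.
have [c] := MVT x0 (fun y _ => GD y) Gc.
rewrite in_itv/= => /andP[c0 _]; rewrite G0 !subr0 => ->.
by rewrite mulr_ge0 ?g0// ltW.
Qed.

Lemma sin_le_id (x : R) : 0 <= x -> sin x <= x.
Proof.
move=> x0; rewrite -subr_ge0; move: x x0.
apply: (@nonneg_of_derive (fun x => x - sin x) (fun x => 1 - cos x)); last by move=> x _; rewrite subr_ge0 cos_le1.
by rewrite sin0 subrr.
Qed.

Lemma cos_ge_quad (x : R) : 0 <= x -> 1 - x ^+ 2 / 2 <= cos x.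
Proof.
move=> x0; rewrite -subr_ge0; move: x x0.
apply: (@nonneg_of_derive (fun x => cos x - (1 - x ^+ 2 / 2)) (fun x => x - sin x)).
- move=> x; apply: is_derive_eq; rewrite /GRing.scale/=; lra.
- by rewrite cos0 expr0n /= mul0r subr0 subrr.
- by move=> x x0; rewrite subr_ge0 sin_le_id.
Qed.

Lemma sin_ge_cubic (x : R) : 0 <= x -> x - x ^+ 3 / 6 <= sin x.
Proof.
move=> x0; rewrite -subr_ge0; move: x x0.
apply: (@nonneg_of_derive (fun x => sin x - (x - x ^+ 3 / 6)) (fun x => cos x - (1 - x ^+ 2 / 2))).
- move=> x; apply: is_derive_eq; rewrite /GRing.scale/=; lra.
- by rewrite sin0 expr0n /= mul0r !subr0.
- by move=> x x0; rewrite subr_ge0 cos_ge_quad.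
Qed.

Lemma cos_le_quartic (x : R) : 0 <= x -> cos x <= 1 - x ^+ 2 / 2 + x ^+ 4 / 24.
Proof.
move=> x0; rewrite -subr_ge0; move: x x0.
apply: (@nonneg_of_derive (fun x => 1 - x ^+ 2 / 2 + x ^+ 4 / 24 - cos x) (fun x => sin x - (x - x ^+ 3 / 6))).
- move=> x; apply: is_derive_eq; rewrite /GRing.scale/=; lra.
- by rewrite cos0 !expr0n /= !mul0r subr0 addr0 subrr.
- by move=> x x0; rewrite subr_ge0 sin_ge_cubic.
Qed.

(** By the half-angle formula and sin y >= y / 3 for y = x / 2 <= 2, a consequence of the cubic
    bound. *)
Lemma cos_le_quad_pi (x : R) : 0 <= x <= pi -> x ^+ 2 / 18 <= 1 - cos x.
Proof.
move=> /andP[x0 xp]; have p2 := @pihalf_lt2 R.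
have y0 : 0 <= x / 2 by rewrite divr_ge0.
have s1 := sin_ge_cubic y0.
have s2 : x / 2 / 3 <= sin (x / 2).
  have : (x / 2) * (x / 2) ^+ 2 <= (x / 2) * 4.
    apply: ler_wpM2l => //; have -> : 4 = 2 ^+ 2 :> R by rewrite expr2; lra.
    by rewrite lerXn2r// ?nnegrE//; lra.
  by rewrite -exprS => h; lra.
have c0 : 0 <= x / 2 / 3 by rewrite divr_ge0.
have -> : 1 - cos x = 2 * sin (x / 2) ^+ 2.
  have -> : x = x / 2 + x / 2 by lra.
  have := sin2cos2 (x / 2); rewrite cosD -!expr2 (_ : (x / 2 + x / 2) / 2 = x / 2); last lra.
  by move=> ->; rewrite cos2sin2; ring.
have : (x / 2 / 3) ^+ 2 <= sin (x / 2) ^+ 2 by rewrite lerXn2r// ?nnegrE// (le_trans c0).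
have -> : (x / 2 / 3) ^+ 2 = x ^+ 2 / 36 by field.
lra.
Qed.

Lemma is_derive_affine G g (c d x : R) : is_derive (c * x + d) 1 G (g (c * x + d)) ->
  is_derive x 1 (fun y => G (c * y + d)) (c * g (c * x + d)).
Proof.
move=> H; have D : is_derive x 1 (fun y : R => c * y + d) c.
  by apply: is_derive_eq; rewrite /GRing.scale/= mulr1 addr0.
by rewrite mulrC; exact: (is_derive1_comp (f := G) (g := fun y : R => c * y + d) H D).
Qed.

Lemma ri_affine g (c d a b : R) : 0 < c -> a <= b -> continuous g ->
  ri (fun x => g (c * x + d)) a b = c^-1 * ri g (c * a + d) (c * b + d).
Proof.
move=> c0 ab gc; have [G GD] := primitive (c * a + d - 1) gc.
have h x : a <= x -> c * a + d - 1 < c * x + d.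
  by move=> ax; have := ler_wpM2l (ltW c0) ax; lra.
have -> : ri g (c * a + d) (c * b + d) = G (c * b + d) - G (c * a + d).
  apply: ri_ftc; first by rewrite lerD2r ler_pM2l.
    exact: rcontC.
  by move=> x /andP[ax _]; apply: GD; lra.
rewrite mulrBr; apply: (@ri_ftc (fun x => c^-1 * G (c * x + d))) => //.
- apply: rcontC => x; apply: continuous_comp; last exact: gc.
  by apply: cvgD; [apply: cvgM; [exact: cvg_cst|exact: cvg_id]|exact: cvg_cst].
- move=> x /andP[ax _]; have D := is_derive_affine (GD _ (h x ax)).
  by apply: is_derive_eq; rewrite /GRing.scale/= mulKf// gt_eqF.
Qed.

Lemma ri_opp g (a b : R) : a <= b -> continuous g ->
  ri (fun x => g (- x)) a b = ri g (- b) (- a).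
Proof.
move=> ab gc; have [G GD] := primitive (- b - 1) gc.
have h x : x <= b -> - b - 1 < -1 * x + 0 by move=> xb; lra.
have -> : ri g (- b) (- a) = - G (-1 * b + 0) - - G (-1 * a + 0).
  rewrite !mulN1r !addr0 opprK addrC; apply: ri_ftc; first by rewrite lerN2.
    exact: rcontC.
  by move=> x /andP[ax _]; apply: GD; lra.
apply: (@ri_ftc (fun x => - G (-1 * x + 0))) => //.
- by apply: rcontC => x; apply: continuous_comp; [exact: opp_continuous|exact: gc].
- move=> x /andP[_ xb]; have D := is_derive_affine (GD _ (h x xb)).
  by apply: is_derive_eq; rewrite mulN1r opprK mulN1r addr0.
Qed.

Lemma ri_subset g (a b c d : R) : c <= a -> a <= b -> b <= d -> continuous g ->
  (forall x, 0 <= g x) -> ri g a b <= ri g c d.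
Proof.
move=> ca ab bd gc g0; have rc x y : rcont g x y by exact: rcontC.
have p0 x y : x <= y -> 0 <= ri g x y.
  by move=> xy; rewrite -(mul0r (y - x)); apply: ri_ge => // z _; exact: g0.
rewrite (ri_split ca (le_trans ab bd))// (ri_split ab bd)//.
by rewrite addrCA lerDl addr_ge0// p0.
Qed.

Lemma cos_lip (s t : R) : `|cos s - cos t| <= `|s - t|.
Proof.
wlog st : s t / s < t.
  move=> H; have [st|st|->] := ltgtP s t; first exact: H.
    by rewrite distrC [leRHS]distrC; exact: H.
  by rewrite !subrr.
have cc : {within `[s, t], continuous (@cos R)}.
  by apply: continuous_subspaceT; exact: continuous_cos.
have [c _ E] := MVT st (fun y _ => is_derive_cos y) cc.
rewrite distrC E normrM normrN [in leRHS]distrC ler_piMl//.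
by rewrite ler_norml sin_geN1 sin_le1.
Qed.

End calculus.

(** * The Fejer kernel and the Gaussian integral *)

Section fejer.
Context {R : realType}.
Implicit Types (t x A T : R).

(** The kernel 2 (1 - cos t) / t^2, given as the Fourier transform of a triangle; this form exhibits
    the compact support in frequency and is defined at 0. Its total mass is 2 pi. *)
Definition fejer t : R := ri (fun x => 2 * (1 - x) * cos (x * t)) 0 1.

Lemma is_derive_sinM t (x : R) : is_derive x 1 (fun y : R => sin (y * t)) (t * cos (x * t)).
Proof.
have -> : (fun y : R => sin (y * t)) = (fun y : R => sin (t * y + 0)).
  by apply/funext => y; rewrite addr0 mulrC.
have -> : x * t = t * x + 0 by rewrite addr0 mulrC.
exact: (is_derive_affine (G := sin) (g := cos) (is_derive_sin _)).
Qed.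

Lemma is_derive_cosM t (x : R) : is_derive x 1 (fun y : R => cos (y * t)) (t * - sin (x * t)).
Proof.
have -> : (fun y : R => cos (y * t)) = (fun y : R => cos (t * y + 0)).
  by apply/funext => y; rewrite addr0 mulrC.
have -> : x * t = t * x + 0 by rewrite addr0 mulrC.
exact: (is_derive_affine (G := cos) (g := fun y => - sin y) (is_derive_cos _)).
Qed.

Lemma continuous_cosM t : continuous (fun y : R => cos (y * t)).
Proof. exact: (continuous_is_derive (is_derive_cosM t)). Qed.

Lemma cts_fejer_kernel t : continuous (fun x : R => 2 * (1 - x) * cos (x * t)).
Proof.
move=> x; apply: (cvgM (f := fun y => 2 * (1 - y))); last exact: continuous_cosM.
by apply: cvgM; [exact: cvg_cst|apply: cvgB; [exact: cvg_cst|exact: cvg_id]].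
Qed.

Lemma fejer_eq t : t ^+ 2 * fejer t = 2 * (1 - cos t).
Proof.
have [->|t0] := eqVneq t 0; first by rewrite expr0n /= mul0r cos0 subrr mulr0.
rewrite /fejer (_ : ri _ _ _ = 2 * t^-1 * ((1 - 1) * sin (1 * t)) - 2 * t^-1 ^+ 2 * cos (1 * t) -
  (2 * t^-1 * ((1 - 0) * sin (0 * t)) - 2 * t^-1 ^+ 2 * cos (0 * t))); last first.
  apply: (@ri_ftc _ (fun x => 2 * t^-1 * ((1 - x) * sin (x * t)) - 2 * t^-1 ^+ 2 * cos (x * t))) => //.
    exact/rcontC/cts_fejer_kernel.
  move=> x _; have D1 := is_derive_sinM t x; have D2 := is_derive_cosM t x.
  by apply: is_derive_eq; rewrite /GRing.scale/=; field.
by rewrite subrr !mul0r sin0 cos0 mul1r; field.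
Qed.

Lemma fejer0 : fejer 0 = 1.
Proof.
rewrite /fejer (_ : ri _ _ _ = 2 * 1 - 1 ^+ 2 - (2 * 0 - 0 ^+ 2)); last first.
  apply: (@ri_ftc _ (fun x => 2 * x - x ^+ 2)) => //.
    exact/rcontC/cts_fejer_kernel.
  move=> x _; apply: is_derive_eq; rewrite /GRing.scale/= mulr0 cos0; ring.
by rewrite expr0n expr1n /=; ring.
Qed.

Lemma fejer_ge0 t : 0 <= fejer t.
Proof.
have [->|t0] := eqVneq t 0; first by rewrite fejer0.
have t2 : 0 < t ^+ 2 by rewrite exprn_even_gt0.
by rewrite -(pmulr_rge0 _ t2) fejer_eq mulr_ge0// subr_ge0 cos_le1.
Qed.

Lemma fejerN t : fejer (- t) = fejer t.
Proof. by apply: eq_ri => x _; rewrite mulrN cosN. Qed.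

Lemma fejer_decay t : t ^+ 2 * fejer t <= 4.
Proof. by rewrite fejer_eq; have := cos_geN1 t; lra. Qed.

Lemma fejer_lip s t : `|fejer s - fejer t| <= 2 * `|s - t|.
Proof.
have c1 u : rcont (fun x => 2 * (1 - x) * cos (x * u)) 0 1.
  exact/rcontC/cts_fejer_kernel.
have -> : fejer s - fejer t = ri (fun x => 2 * (1 - x) * cos (x * s) + (-1) * (2 * (1 - x) * cos (x * t))) 0 1.
  by rewrite riD ?riZ//; [rewrite mulN1r|exact: rcontZ].
rewrite -[leRHS]mulr1 -[X in _ * X](subr0 1).
apply: ri_bound => //.
  by apply: rcontC => x; apply: cvgD; [|apply: cvgM; first exact: cvg_cst]; exact: cts_fejer_kernel.
move=> x /andP[x0 x1]; rewrite mulN1r -mulrBr normrM.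
have h1 : `|2 * (1 - x)| <= 2 by rewrite ger0_norm; lra.
have h2 : `|cos (x * s) - cos (x * t)| <= `|s - t|.
  rewrite (le_trans (cos_lip _ _))// -mulrBr normrM ger0_norm// ler_piMl//.
exact: ler_pM.
Qed.

Lemma continuous_fejer : continuous fejer.
Proof.
move=> x; apply/cvgrPdist_le => e e0; near=> y.
rewrite (le_trans (fejer_lip _ _))// mulrC -ler_pdivlMr//; apply: ltW.
by near: y; apply/nbhs_ballP; exists (e / 2) => //=; rewrite divr_gt0.
Unshelve. all: end_near. Qed.

Definition dirichlet (j : nat) x : R := 1 + \sum_(k < j) 2 * cos (x * k.+1%:R).

Lemma dirichlet_eq j x : (1 - cos x) * dirichlet j x = cos (x * j%:R) - cos (x * j.+1%:R).
Proof.
elim: j => [|j IH]; first by rewrite /dirichlet big_ord0 addr0 !mulr1 mulr0 cos0.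
rewrite {1}/dirichlet big_ord_recr /= addrA mulrDr -/(dirichlet j x) IH.
have -> : x * j.+2%:R = x * j.+1%:R + x by rewrite -[j.+2%:R]natr1; ring.
have -> : x * j%:R = x * j.+1%:R - x by rewrite -[j.+1%:R]natr1; ring.
rewrite [cos (_ - x)]cosB cosD; ring.
Qed.

Lemma sum_dirichlet N x : (1 - cos x) * \sum_(j < N) dirichlet j x = 1 - cos (x * N%:R).
Proof.
elim: N => [|N IH]; first by rewrite big_ord0 !mulr0 cos0 subrr.
by rewrite big_ord_recr /= mulrDr IH dirichlet_eq; ring.
Qed.

Lemma sum_dirichlet0 N : \sum_(j < N) dirichlet j 0 = N%:R ^+ 2.
Proof.
have d0 j : dirichlet j 0 = 1 + 2 * j%:R.
  rewrite /dirichlet; congr (_ + _); elim: j => [|j IH]; first by rewrite big_ord0 mulr0.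
  by rewrite big_ord_recr /= IH mul0r cos0 mulr1 -natr1; ring.
elim: N => [|N IH]; first by rewrite big_ord0 expr0n.
by rewrite big_ord_recr /= IH d0 -natr1; ring.
Qed.

Lemma sin_pi_nat k : sin (pi * k%:R) = 0 :> R.
Proof.
elim: k => [|k IH]; first by rewrite mulr0 sin0.
by rewrite -natr1 mulrDr mulr1 sinDpi IH oppr0.
Qed.

Lemma continuous_dirichlet j : continuous (dirichlet j).
Proof.
move=> x; apply: cvgD; first exact: cvg_cst.
apply: (cts_bigsum (F := fun (k : 'I_j) y => 2 * cos (y * k.+1%:R))) => k y.
by apply: cvgM; [exact: cvg_cst|exact: continuous_cosM].
Qed.

Lemma ri_dirichlet j : ri (dirichlet j) 0 pi = pi.
Proof.
have p0 := @pi_ge0 R.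
elim: j => [|j IH].
  by rewrite /dirichlet; under eq_ri do rewrite big_ord0 addr0; rewrite ri_cst// subr0 mul1r.
have -> : ri (dirichlet j.+1) 0 pi = ri (fun x => dirichlet j x + 2 * cos (x * j.+1%:R)) 0 pi.
  by apply: eq_ri => x _; rewrite /dirichlet big_ord_recr /= addrA.
have c2 : continuous (fun x : R => 2 * cos (x * j.+1%:R)).
  by move=> x; apply: cvgM; [exact: cvg_cst|exact: continuous_cosM].
rewrite riD; [|exact/rcontC/continuous_dirichlet|exact/rcontC].
rewrite IH (_ : ri _ _ _ = 2 / j.+1%:R * sin (pi * j.+1%:R) - 2 / j.+1%:R * sin (0 * j.+1%:R)).
  by rewrite sin_pi_nat mul0r sin0 !mulr0 subrr addr0.
apply: (@ri_ftc _ (fun x => 2 / j.+1%:R * sin (x * j.+1%:R))) => //; first exact/rcontC.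
move=> x _; have D := is_derive_sinM j.+1%:R x.
have n0 : j.+1%:R != 0 :> R by rewrite pnatr_eq0.
apply: is_derive_eq; rewrite /GRing.scale/= mulrA divfK//.
Qed.

(** The sum of the Dirichlet kernels is (1 - cos N x) / (1 - cos x), against 2 (1 - cos N x) / x^2
    for the rescaled kernel; 1 / (1 - cos x) - 2 / x^2 is bounded on (0, pi]. *)
Lemma fejer_dirichlet N x : 0 <= x <= pi ->
  `|N%:R ^+ 2 * fejer (N%:R * x + 0) - \sum_(j < N) dirichlet j x| <= 3.
Proof.
move=> /andP[x0 xp]; rewrite addr0.
have [->|xn0] := eqVneq x 0.
  by rewrite mulr0 fejer0 sum_dirichlet0 mulr1 subrr normr0.
have x2 : 0 < x ^+ 2 by rewrite exprn_even_gt0.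
have c1 : x ^+ 2 / 18 <= 1 - cos x by apply: cos_le_quad_pi; rewrite x0.
have c0 : 0 < 1 - cos x by rewrite (lt_le_trans _ c1)// divr_gt0.
have E1 : N%:R ^+ 2 * fejer (N%:R * x) = 2 * (1 - cos (x * N%:R)) / x ^+ 2.
  have -> : 2 * (1 - cos (x * N%:R)) = (N%:R * x) ^+ 2 * fejer (N%:R * x).
    by rewrite fejer_eq [x * _]mulrC.
  by field.
have E2 : \sum_(j < N) dirichlet j x = (1 - cos (x * N%:R)) / (1 - cos x).
  by rewrite -sum_dirichlet mulrAC divff ?mul1r// gt_eqF.
have E3 : N%:R ^+ 2 * fejer (N%:R * x) - \sum_(j < N) dirichlet j x =
   - ((1 - cos (x * N%:R)) * ((x ^+ 2 - 2 * (1 - cos x)) / ((1 - cos x) * x ^+ 2))).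
  rewrite E1 E2; have c0' := lt0r_neq0 c0; move: (1 - cos x) c0' (1 - cos (x * _)) => c c0' k.
  by field; rewrite xn0 c0'.
have l1 := cos_ge_quad x0; have l2 := cos_le_quartic x0.
have q0 : 0 <= 1 - cos (x * N%:R) <= 2.
  by rewrite subr_ge0 cos_le1 /=; have := cos_geN1 (x * N%:R); lra.
have w0 : 0 <= (x ^+ 2 - 2 * (1 - cos x)) / ((1 - cos x) * x ^+ 2) <= 3 / 2.
  have d0 : 0 < (1 - cos x) * x ^+ 2 by exact: mulr_gt0.
  apply/andP; split; first by apply: divr_ge0; [lra|exact: ltW].
  rewrite ler_pdivrMr//; have := ler_wpM2r (ltW x2) c1.
  rewrite (_ : x ^+ 2 / 18 * x ^+ 2 = x ^+ 4 / 18); last by field.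
  lra.
move: q0 w0 => /andP[q1 q2] /andP[w1 w2].
rewrite E3 normrN ger0_norm; last by apply: mulr_ge0.
by apply: (le_trans (ler_pM q1 w1 q2 w2)); lra.
Qed.

(** Each Dirichlet kernel has integral exactly pi over [0, pi], so comparison with the periodic
    kernel evaluates the mass, with an error O(1 / N) after rescaling. *)
Lemma fejer_mass_nat N : (0 < N)%N -> `|ri fejer 0 (N%:R * pi) - pi| <= 3 * pi / N%:R.
Proof.
move=> N0; have n0 : 0 < N%:R :> R by rewrite ltr0n.
have p0 := @pi_ge0 R.
have c1 : continuous (fun x : R => N%:R ^+ 2 * fejer (N%:R * x + 0)).
  move=> x; apply: cvgM; first exact: cvg_cst.
  apply: (@continuous_comp _ _ _ (fun x => N%:R * x + 0) fejer); last exact: continuous_fejer.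
  by apply: cvgD; [apply: cvgM; [exact: cvg_cst|exact: cvg_id]|exact: cvg_cst].
have c2 : continuous (fun x : R => \sum_(j < N) dirichlet j x).
  by apply: cts_bigsum => j; exact: continuous_dirichlet.
have c3 : continuous (fun x : R => N%:R ^+ 2 * fejer (N%:R * x + 0) + (-1) * \sum_(j < N) dirichlet j x).
  by move=> x; apply: cvgD; [exact: c1|apply: cvgM; [exact: cvg_cst|exact: c2]].
have B : `|ri (fun x => N%:R ^+ 2 * fejer (N%:R * x + 0) + (-1) * \sum_(j < N) dirichlet j x) 0 pi| <= 3 * (pi - 0).
  apply: ri_bound => //; first exact/rcontC.
  by move=> x xp; rewrite mulN1r; exact: fejer_dirichlet.
rewrite riD in B; [|exact/rcontC|apply/rcontZ/rcontC; exact: c2].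
rewrite riZ in B; last first.
  apply/rcontC => x; apply: (@continuous_comp _ _ _ (fun x => N%:R * x + 0) fejer); last exact: continuous_fejer.
  by apply: cvgD; [apply: cvgM; [exact: cvg_cst|exact: cvg_id]|exact: cvg_cst].
rewrite riZ in B; last exact/rcontC.
rewrite ri_affine// in B; last exact: continuous_fejer.
rewrite ri_sum// in B; last exact: continuous_dirichlet.
rewrite (eq_bigr (fun=> pi)) in B; last by move=> j _; exact: ri_dirichlet.
rewrite sumr_const card_ord mulr0 !addr0 subr0 in B.
rewrite ler_pdivlMr// -(ger0_norm (ltW n0)) -normrM.
move: B; congr (_ <= _); congr (`|_|).
by rewrite ger0_norm// -[pi *+ N]mulr_natr; field; rewrite gt_eqF.
Qed.

Lemma fejer_sym A : 0 <= A -> ri fejer (- A) 0 = ri fejer 0 A.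
Proof.
move=> A0; have := ri_opp A0 continuous_fejer; rewrite oppr0 => <-.
by apply: eq_ri => x _; exact: fejerN.
Qed.

Lemma fejer_tail (a b : R) : 0 < a -> a <= b -> ri fejer a b <= 4 / a.
Proof.
move=> a0 ab; have b0 : 0 < b by exact: lt_le_trans ab.
have cf x : a <= x <= b -> {for x, continuous (fun x : R => 4 * x^-1 ^+ 2)}.
  move=> /andP[ax _]; have x0 : x != 0 by rewrite gt_eqF// (lt_le_trans a0).
  by apply: cvgM; [exact: cvg_cst|apply: cvgM; apply: (cvgV x0); exact: cvg_id].
have E : ri (fun x => 4 * x^-1 ^+ 2) a b = - (4 * b^-1) - - (4 * a^-1).
  apply: (@ri_ftc _ (fun x => - (4 * x^-1)) _ _ _ ab (rcont_for cf)).
  move=> x /andP[ax _]; have x0 : x != 0 by rewrite gt_eqF// (lt_le_trans a0).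
  have D := is_deriveV x0 (is_derive_id x 1).
  by apply: is_derive_eq; rewrite /GRing.scale/=; field.
have : ri fejer a b <= ri (fun x => 4 * x^-1 ^+ 2) a b.
  apply: ri_le => //; [exact/rcontC/continuous_fejer|exact: rcont_for|].
  move=> x /andP[ax _]; have x0 : 0 < x by exact: lt_le_trans ax.
  by rewrite exprVn ler_pdivlMr ?exprn_gt0// mulrC fejer_decay.
move=> /le_trans; apply; rewrite E; have : 0 <= 4 * b^-1 by rewrite mulr_ge0// invr_ge0 ltW.
lra.
Qed.

Lemma fejer_half A : 0 < A -> pi - 4 / A <= ri fejer 0 A <= pi.
Proof.
move=> A0; have p0 := @pi_gt0 R; have cf := continuous_fejer.
have key e : 0 < e -> exists B, [/\ A <= B & `|ri fejer 0 B - pi| <= e].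
  move=> e0; pose N := (Num.truncn (A / pi + 3 * pi / e)).+1.
  have N0 : 0 < N%:R :> R by rewrite ltr0n.
  have h1 : 0 <= A / pi by rewrite divr_ge0 ?ltW.
  have h2 : 0 <= 3 * pi / e by rewrite divr_ge0 ?mulr_ge0 ?ltW.
  have NE : A / pi + 3 * pi / e < N%:R by exact: truncnS_gt.
  exists (N%:R * pi); split; first by rewrite -ler_pdivrMr// ltW// (le_lt_trans _ NE)// lerDl.
  apply: (le_trans (fejer_mass_nat _)) => //.
  have h3 : 3 * pi / e <= N%:R by rewrite ltW// (le_lt_trans _ NE)// lerDr.
  by move: h3; rewrite !ler_pdivrMr// [e * _]mulrC.
apply/andP; split.
  apply/ler_addgt0Pr => e e0; have [B [AB H]] := key e e0.
  have T := fejer_tail A0 AB.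
  move: H; rewrite (ri_split (ltW A0) AB (rcontC cf)) ler_norml => /andP[H _].
  move: T H; lra.
apply/ler_addgt0Pr => e e0; have [B [AB H]] := key e e0.
have := ri_subset (lexx 0) (ltW A0) AB cf fejer_ge0; move: H.
rewrite ler_norml => /andP[_]; lra.
Qed.

Lemma fejer_mass (a b : R) : a <= b -> 0 <= ri fejer a b <= 2 * pi.
Proof.
move=> ab; have cf := continuous_fejer.
rewrite -(mul0r (b - a)) ri_ge//=; [|exact: rcontC|by move=> x _; exact: fejer_ge0].
pose A := `|a| + `|b| + 1.
have na := normr_ge0 a; have nb := normr_ge0 b.
have A0 : 0 < A by rewrite /A; lra.
have aA : - A <= a by have := ler_norm (- a); rewrite normrN /A; lra.
have bA : b <= A by have := ler_norm b; rewrite /A; lra.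
apply: (le_trans (ri_subset aA ab bA cf fejer_ge0)).
have NA : - A <= 0 by rewrite oppr_le0 ltW.
rewrite (ri_split NA (ltW A0) (rcontC cf)).
rewrite (fejer_sym (ltW A0)).
have /andP[_] := fejer_half A0; lra.
Qed.

Lemma fejer_mass_ge (a b : R) : 0 < a -> 0 < b -> 2 * pi - 4 / a - 4 / b <= ri fejer (- a) b.
Proof.
move=> a0 b0; have cf := continuous_fejer.
have na : - a <= 0 by rewrite oppr_le0 ltW.
rewrite (ri_split na (ltW b0) (rcontC cf)).
rewrite (fejer_sym (ltW a0)).
have /andP[h1 _] := fejer_half a0; have /andP[h2 _] := fejer_half b0; move: h1 h2; lra.
Qed.

Lemma ri_fejer_window T t (p q : R) : 0 < T -> p <= q ->
  ri (fun a => fejer (T * (t - a))) p q = T^-1 * ri fejer (T * (t - q)) (T * (t - p)).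
Proof.
move=> T0 pq; have cf := continuous_fejer.
have -> : ri (fun a => fejer (T * (t - a))) p q = ri (fun a => fejer (T * a + - (T * t))) p q.
  by apply: eq_ri => a _; rewrite -fejerN; congr fejer; ring.
rewrite ri_affine//; congr (_ * _).
have -> : T * p + - (T * t) = - (T * (t - p)) by ring.
have -> : T * q + - (T * t) = - (T * (t - q)) by ring.
have pq' : T * (t - q) <= T * (t - p) by rewrite ler_pM2l// lerD2l lerN2.
rewrite -(ri_opp pq' cf); apply: eq_ri => x _; exact: fejerN.
Qed.

(** The kernel vanishes at nonzero multiples of 2 pi, so it cannot bound a tail of order t^(-2) by
    itself; adding its translate by pi removes the zeros. *)
Lemma fejer_double_ge t : 4 <= (t ^+ 2 + (t + pi) ^+ 2) * (fejer t + fejer (t + pi)).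
Proof.
have e1 := fejer_eq t; have e2 := fejer_eq (t + pi); rewrite cosDpi in e2.
have := mulr_ge0 (sqr_ge0 t) (fejer_ge0 (t + pi)).
have := mulr_ge0 (sqr_ge0 (t + pi)) (fejer_ge0 t).
rewrite mulrDl !mulrDr e1 e2; lra.
Qed.

Lemma gauss_integral_affine (a : R) : 0 < a ->
  ri (fun x => expR (- (a * x ^+ 2))) 0 1 = (Num.sqrt a)^-1 * ri gauss_fun 0 (Num.sqrt a).
Proof.
move=> a0; have s0 : 0 < Num.sqrt a by rewrite sqrtr_gt0.
have := ri_affine 0 s0 (@ler01 R) (@continuous_gauss_fun R).
rewrite !addr0 mulr0 mulr1 => <-.
by apply: eq_ri => x _; rewrite /gauss_fun addr0 exprMn sqr_sqrtr// ltW.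
Qed.

Lemma gauss_limit (e : R) : 0 < e -> exists2 A0, 0 < A0 & forall A, A0 <= A ->
  `|ri gauss_fun 0 A - Num.sqrt pi / 2| <= e.
Proof.
move=> e0; have := @gauss_integral_proof.cvg_integral0_gauss_sqr R.
have p0 := @pi_gt0 R; have sp : 0 < Num.sqrt pi / 2 :> R by rewrite divr_gt0// sqrtr_gt0.
move=> /cvgrPdist_le /(_ _ (mulr_gt0 e0 sp)) [A0 [_ H]].
exists (`|A0| + 1); first by rewrite ltr_wpDl.
move=> A A0A; have := ler_norm A0.
have A0A' : A0 < A by have := ler_norm A0; lra.
move=> _; have := H A A0A'; rewrite distrC.
have -> : pi / 4 = (Num.sqrt pi / 2) ^+ 2 :> R.
  by rewrite exprMn sqr_sqrtr ?ltW// exprVn; congr (_ / _); rewrite -natrX.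
rewrite subr_sqr normrM -/(ri gauss_fun 0 A).
have g0 : 0 <= ri (@gauss_fun R) 0 A by apply: Rintegral_ge0 => x _; exact: gauss_fun_ge0.
rewrite [X in _ * X]ger0_norm ?addr_ge0 ?(ltW sp)// => h.
rewrite -(ler_pM2r sp) (le_trans _ h)// ler_wpM2l//; rewrite lerDr; exact: g0.
Qed.

Lemma gauss_le1 A : 0 <= A -> ri gauss_fun 0 A <= 2 :> R.
Proof.
move=> A0; have [B B0 H] := gauss_limit (@ltr01 R).
have cg : continuous (@gauss_fun R) by exact: continuous_gauss_fun.
have := ri_subset (lexx 0) A0 (_ : A <= A + B) cg (@gauss_fun_ge0 R).
rewrite lerDl => /(_ (ltW B0)) /le_trans; apply.
have := H (A + B); rewrite lerDr A0 => /(_ isT); rewrite ler_norml => /andP[_].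
have : Num.sqrt pi <= 2 :> R.
  rewrite -[leRHS]ger0_norm// -sqrtr_sqr ler_wsqrtr//; have := @pihalf_lt2 R; lra.
lra.
Qed.

End fejer.

(** * Comparison of a window sum with Fejer averages *)

Section sandwich.
Context {R : realType} {I : Type}.
Variables (s : seq I) (a t : I -> R).
Hypothesis a0 : forall y, 0 <= a y.
Implicit Types (p q T eta : R).

Lemma continuous_fejer_window T c : continuous (fun b : R => fejer (T * (c - b))).
Proof.
move=> x; apply: (@continuous_comp _ _ _ (fun b : R => T * (c - b)) fejer); last exact: continuous_fejer.
by apply: cvgM; [exact: cvg_cst|apply: cvgB; [exact: cvg_cst|exact: cvg_id]].
Qed.

Lemma continuous_weighted_fejer T : continuous (fun b : R => \sum_(y <- s) a y * fejer (T * (t y - b))).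
Proof.
apply: cts_bigsum => y x.
by apply: cvgM; [exact: cvg_cst|exact: continuous_fejer_window].
Qed.

Lemma ri_weighted_fejer T p q : p <= q ->
  ri (fun b => \sum_(y <- s) a y * fejer (T * (t y - b))) p q =
  \sum_(y <- s) a y * ri (fun b => fejer (T * (t y - b))) p q.
Proof.
move=> pq; rewrite ri_sum//; last first.
  by move=> y x; apply: cvgM; [exact: cvg_cst|exact: continuous_fejer_window].
apply: eq_bigr => y _; apply: riZ; exact/rcontC/continuous_fejer_window.
Qed.

(** The kernel sums are integrated over the window enlarged by eta; a point of the window sees
    almost the full mass 2 pi of the kernel, and the other terms are nonnegative. *)
Lemma window_upper T eta p q M : 0 < T -> 0 < eta -> p <= q ->
  (forall b, p - eta <= b <= q + eta -> \sum_(y <- s) a y * fejer (T * (t y - b)) <= M) ->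
  (\sum_(y <- s | p <= t y <= q) a y) * (2 * pi - 8 / (T * eta)) <= T * ((q - p + 2 * eta) * M).
Proof.
move=> T0 e0 pq H; have pq' : p - eta <= q + eta by lra.
have Te : 0 < T * eta by exact: mulr_gt0.
have U : ri (fun b => \sum_(y <- s) a y * fejer (T * (t y - b))) (p - eta) (q + eta) <= M * (q + eta - (p - eta)).
  rewrite -(ri_cst M pq'); apply: ri_le => //; first exact/rcontC/continuous_weighted_fejer.
  by apply: rcontC => x; exact: cvg_cst.
rewrite ri_weighted_fejer// in U.
rewrite (_ : (q - p + 2 * eta) * M = M * (q + eta - (p - eta))); last by ring.
apply: le_trans (ler_wpM2l (ltW T0) U); rewrite mulr_sumr mulr_suml big_mkcond /=.
apply: ler_sum => y _; rewrite ri_fejer_window//.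
rewrite (_ : T * (a y * (T^-1 * _)) = a y * ri fejer (T * (t y - (q + eta))) (T * (t y - (p - eta)))); last first.
  by rewrite mulrCA mulVKf// gt_eqF.
case: ifP => [/andP[pt tq]|_]; last first.
  apply: mulr_ge0 => //; have h : T * (t y - (q + eta)) <= T * (t y - (p - eta)) by rewrite ler_pM2l//; lra.
  by have /andP[] := fejer_mass h.
apply: ler_wpM2l => //.
have h1 : 0 < T * (q + eta - t y) by apply: mulr_gt0 => //; lra.
have h2 : 0 < T * (t y - (p - eta)) by apply: mulr_gt0 => //; lra.
have -> : T * (t y - (q + eta)) = - (T * (q + eta - t y)) by ring.
apply: le_trans (fejer_mass_ge h1 h2).
have i1 : 4 / (T * (q + eta - t y)) <= 4 / (T * eta).
  by rewrite ler_pM2l// lef_pV2 ?posrE// ler_pM2l//; lra.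
have i2 : 4 / (T * (t y - (p - eta))) <= 4 / (T * eta).
  by rewrite ler_pM2l// lef_pV2 ?posrE// ler_pM2l//; lra.
lra.
Qed.

(** D with c^2 + (c + pi)^2 <= D (c - b)^2 whenever b is in [p, q] and |c - b| >= eta; the 4 stands
    for an upper bound of pi. *)
Definition tail_const p q eta : R :=
  (2 * (`|p| + `|q|) ^+ 2 + 2 * (`|p| + `|q| + 4) ^+ 2) / eta ^+ 2 + 4.

Lemma tail_const_ge0 p q eta : 0 <= tail_const p q eta.
Proof. rewrite /tail_const addr_ge0//; apply: divr_ge0; last exact: sqr_ge0.
by apply: addr_ge0; apply: mulr_ge0 => //; exact: sqr_ge0. Qed.

(** The tail of the narrow kernel is dominated by two kernels of scale 1, with the gain T^(-2).
    Their sums obey the same local limit theorem, which controls the points far from the window. *)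
Lemma fejer_far T eta p q c b : 0 < T -> 0 < eta -> p <= b <= q -> eta <= `|c - b| ->
  fejer (T * (c - b)) <= tail_const p q eta / T ^+ 2 * (fejer c + fejer (c + pi)).
Proof.
move=> T0 e0 /andP[pb bq] cb; set m := `|p| + `|q|.
have m0 : 0 <= m by rewrite addr_ge0.
have bm : `|b| <= m.
  rewrite ler_norml; have := ler_norm q; have := ler_norm (- p); rewrite normrN.
  have := normr_ge0 p; have := normr_ge0 q; rewrite /m; move: pb bq => pb bq h1 h2 h3 h4; apply/andP; split; lra.
set D := tail_const p q eta; have D0 : 0 <= D by exact: tail_const_ge0.
have s0 : 0 < (c - b) ^+ 2 by rewrite exprn_even_gt0//= -normr_gt0 (lt_le_trans e0).
have es : eta ^+ 2 <= (c - b) ^+ 2.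
  by rewrite -(real_normK (num_real (c - b))) lerXn2r// nnegrE ltW.
have W : c ^+ 2 + (c + pi) ^+ 2 <= D * (c - b) ^+ 2.
  have p4 : pi <= 4 :> R by have := @pihalf_lt2 R; lra.
  have b2 : b ^+ 2 <= m ^+ 2 by rewrite -(real_normK (num_real b)) lerXn2r// nnegrE.
  have b3 : (b + pi) ^+ 2 <= (m + 4) ^+ 2.
    rewrite -(real_normK (num_real (b + pi))) lerXn2r// ?nnegrE ?addr_ge0//.
    by rewrite (le_trans (ler_normD _ _))// lerD// ger0_norm ?pi_ge0.
  have k0 : 0 <= (2 * m ^+ 2 + 2 * (m + 4) ^+ 2) / eta ^+ 2.
    apply: divr_ge0; last exact: sqr_ge0.
    by apply: addr_ge0; apply: mulr_ge0 => //; exact: sqr_ge0.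
  have := ler_wpM2l k0 es; rewrite divfK ?expf_neq0 ?gt_eqF//.
  rewrite /D /tail_const -/m [in X in _ -> X]mulrDl.
  have := sqr_ge0 (c - b - b); have := sqr_ge0 (c - b - (b + pi)).
  move: b2 b3; set k := (_ / _) * _; lra.
have J := fejer_double_ge c.
have Jn : 0 <= fejer c + fejer (c + pi) by rewrite addr_ge0 ?fejer_ge0.
have T2 : 0 < T ^+ 2 by rewrite exprn_gt0.
have K := fejer_decay (T * (c - b)); rewrite exprMn in K.
rewrite -(ler_pM2l T2) [leRHS](_ : _ = D * (fejer c + fejer (c + pi))); last first.
  by field; rewrite gt_eqF.
rewrite -(ler_pM2l s0) mulrA [(c - b) ^+ 2 * T ^+ 2]mulrC (le_trans K)// (le_trans J)//.
by rewrite mulrA [(c - b) ^+ 2 * D]mulrC; apply: ler_wpM2r.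
Qed.

(** Integration over the shrunken window: a point of the window contributes at most 2 pi, a point
    outside is at distance at least eta and is handled by [fejer_far]. *)
Lemma window_lower T eta p q m J : 0 < T -> 0 < eta -> p + eta <= q - eta ->
  (forall b, p + eta <= b <= q - eta -> m <= \sum_(y <- s) a y * fejer (T * (t y - b))) ->
  \sum_(y <- s) a y * (fejer (t y) + fejer (t y + pi)) <= J ->
  T * ((q - p - 2 * eta) * m) <=
  2 * pi * (\sum_(y <- s | p <= t y <= q) a y) + (q - p - 2 * eta) * (tail_const p q eta / T * J).
Proof.
move=> T0 e0 pq H HJ; set D := tail_const p q eta; have D0 : 0 <= D by exact: tail_const_ge0.
set w := q - p - 2 * eta; have w0 : 0 <= w by rewrite /w; lra.
have L : m * w <= ri (fun b => \sum_(y <- s) a y * fejer (T * (t y - b))) (p + eta) (q - eta).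
  have -> : w = q - eta - (p + eta) by rewrite /w; ring.
  by apply: ri_ge => //; exact/rcontC/continuous_weighted_fejer.
rewrite ri_weighted_fejer// in L.
have -> : T * (w * m) = T * (m * w) by ring.
apply: (le_trans (ler_wpM2l (ltW T0) L)).
apply: (@le_trans _ _ (2 * pi * (\sum_(y <- s | p <= t y <= q) a y) +
   w * (D / T * \sum_(y <- s) a y * (fejer (t y) + fejer (t y + pi))))); last first.
  by rewrite lerD2l ler_wpM2l// ler_wpM2l// divr_ge0// ltW.
rewrite !mulr_sumr [X in _ <= X + _]big_mkcond -big_split /=; apply: ler_sum => y _.
have Jn : 0 <= fejer (t y) + fejer (t y + pi) by rewrite addr_ge0 ?fejer_ge0.
have rhs0 : 0 <= w * (D / T * (a y * (fejer (t y) + fejer (t y + pi)))).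
  by rewrite !mulr_ge0// invr_ge0 ltW.
case: ifPn => [_|out].
  rewrite -[leLHS]addr0 lerD// ri_fejer_window//.
  have h : T * (t y - (q - eta)) <= T * (t y - (p + eta)) by rewrite ler_pM2l//; lra.
  have /andP[_ h2] := fejer_mass h.
  by rewrite mulrCA mulVKf ?gt_eqF// mulrC; apply: ler_wpM2r.
rewrite add0r; have B : ri (fun b => fejer (T * (t y - b))) (p + eta) (q - eta) <=
    D / T ^+ 2 * (fejer (t y) + fejer (t y + pi)) * (q - eta - (p + eta)).
  rewrite -(ri_cst _ pq); apply: ri_le.
  - exact/rcontC/continuous_fejer_window.
  - by apply: rcontC => x; exact: cvg_cst.
  - move=> b /andP[pb bq]; apply: fejer_far => //; first by apply/andP; split; lra.
    move: out; rewrite negb_and -!ltNge => /orP[tp|qt].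
      by rewrite distrC (le_trans _ (ler_norm _))//; lra.
    by rewrite (le_trans _ (ler_norm _))//; lra.
have := ler_wpM2l (ltW T0) (ler_wpM2l (a0 y) B); move=> /le_trans; apply.
apply: le_of_eq; rewrite /w; field; rewrite gt_eqF//.
Qed.

End sandwich.

Lemma le_window (R : realType) (c f n z : R) : (c <= f - n - z) = (z + n + c <= f).
Proof. by apply/idP/idP; lra. Qed.

Lemma window_le (R : realType) (c f n z : R) : (f - n - z <= c) = (f <= z + n + c).
Proof. by apply/idP/idP; lra. Qed.

Lemma window_widen (R : realType) (p q e c : R) : 0 < e -> p + e <= c <= q - e -> p - e <= c <= q + e.
Proof. by move=> e0 /andP[h1 h2]; apply/andP; split; lra. Qed.

Lemma norm_in_window (R : realType) (p q e c : R) : p - e <= c <= q + e -> `|c| <= `|p| + `|q| + e.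
Proof.
move=> /andP[h1 h2]; have := ler_norm q; have := ler_norm (- p); rewrite normrN ler_norml.
by have := normr_ge0 p; have := normr_ge0 q => *; apply/andP; split; lra.
Qed.

Lemma ratio_close (R : realType) (V Q e : R) : 0 < Q -> V <= Q * (1 + e) -> Q * (1 - e) <= V -> `|V / Q - 1| <= e.
Proof.
move=> Q0 h1 h2; rewrite ler_norml lerBlDl lerBrDr ler_pdivlMr// ler_pdivrMr// [_ * Q]mulrC [(1 + e) * Q]mulrC.
by rewrite h1 andbT addrC.
Qed.

(** * From kernel asymptotics to windows *)

Section window_limit.
Context {R : realType} {I : Type}.
Variables (s : nat -> seq I) (a F : nat -> I -> R) (al c0 : R) (eps : nat -> R).
Hypothesis a0 : forall n y, 0 <= a n y.
Hypothesis eps01 : forall n, 0 < eps n <= 1.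
Hypothesis c00 : 0 < c0.

Definition kernel_sum n (T x : R) : R :=
  \sum_(y <- s n) a n y * fejer (T / eps n * (F n y - n%:R * al - x)).

Hypothesis kernel_sum_cvg : forall T X e : R, 0 < T -> 0 < e -> \forall n \near \oo,
  forall x, `|x| <= X -> `|kernel_sum n T x * (T / eps n * Num.sqrt n%:R) - c0| <= e.

Definition window_sum n (p q z : R) : R :=
  \sum_(y <- s n | z + n%:R * al + p * eps n <= F n y <= z + n%:R * al + q * eps n) a n y.

Let kernel_bounds n T x k : 0 < T -> (0 < n)%N -> 0 < k ->
  `|kernel_sum n T x * (T / eps n * Num.sqrt n%:R) - c0| <= c0 * k ->
  c0 * (1 - k) * (eps n / Num.sqrt n%:R) / T <= kernel_sum n T x <=
  c0 * (1 + k) * (eps n / Num.sqrt n%:R) / T.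
Proof.
move=> T0 n0 k0; have /andP[e0 _] := eps01 n.
have sn : 0 < Num.sqrt n%:R :> R by rewrite sqrtr_gt0 ltr0n.
have m0 : 0 < T / eps n * Num.sqrt n%:R by rewrite mulr_gt0// divr_gt0.
have E c : c * (eps n / Num.sqrt n%:R) / T = c / (T / eps n * Num.sqrt n%:R).
  by field; rewrite !gt_eqF.
rewrite !E ler_pdivrMr// ler_pdivlMr// ler_norml => /andP[h1 h2].
by apply/andP; split; [move: h1|move: h2]; set X := kernel_sum _ _ _ * _; rewrite ?mulrBr ?mulrDr mulr1; lra.
Qed.

Let final_upper (V Q k e : R) : 0 < Q -> 0 < k -> k <= 1 / 20 -> 20 * k <= e ->
  V * (1 - k) <= Q * ((1 + 2 * k) * (1 + k)) -> V <= Q * (1 + e).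
Proof.
move=> Q0 k0 k1 ke H.
have h : Q * ((1 + 2 * k) * (1 + k)) <= Q * (1 + e) * (1 - k).
  rewrite -mulrA ler_wpM2l ?ltW//.
  have : (1 + 20 * k) * (1 - k) <= (1 + e) * (1 - k) by apply: ler_wpM2r; lra.
  have : 0 <= k * (1 / 20 - k) by apply: mulr_ge0; lra.
  lra.
have k10 : 0 < 1 - k by lra.
by rewrite -(ler_pM2r k10) (le_trans H).
Qed.

Let final_lower (V Q k e : R) : 0 < Q -> 0 < k -> k <= 1 / 20 -> 20 * k <= e ->
  Q * ((1 - 2 * k) * ((1 - k) - k * (1 + k))) <= V -> Q * (1 - e) <= V.
Proof.
move=> Q0 k0 k1 ke; apply: le_trans; apply: (ler_wpM2l (ltW Q0)).
have h0 : 0 <= k * (1 / 20 - k) by apply: mulr_ge0; lra.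
have h1 : 0 <= k ^+ 3 by rewrite exprn_ge0// ltW.
have h2 := sqr_ge0 k; lra.
Qed.

Let aux1 (u v : R) : 0 <= v -> u <= 1 + u + v. Proof. lra. Qed.

Let aux2 (u v : R) : 0 <= u -> v <= 1 + u + v. Proof. lra. Qed.

Let idU (T w k b P : R) : T != 0 -> P != 0 ->
  T * ((w + 2 * (k * w)) * (c0 * (1 + k) * b / T)) = 2 * P * (w * c0 / (2 * P) * b * ((1 + 2 * k) * (1 + k))).
Proof. by move=> T0 P0; field; rewrite T0 P0. Qed.

Let idL (w k b P : R) : P != 0 ->
  2 * P * (w * c0 / (2 * P) * b * ((1 - 2 * k) * (1 - k - k * (1 + k)))) =
  (w - 2 * (k * w)) * (c0 * (1 - k) * b) - (w - 2 * (k * w)) * (k * (c0 * (1 + k) * b)).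
Proof. by move=> P0; field. Qed.

Theorem window_limit (p q X e : R) : p < q -> 0 < e -> \forall n \near \oo, forall z, `|z| <= X ->
  `|window_sum n p q z / ((q - p) * c0 / (2 * pi) * (eps n / Num.sqrt n%:R)) - 1| <= e.
Proof.
move=> pq e0; have p0 := @pi_gt0 R; have p2 := @pi_ge2 R.
set w := q - p; have w0 : 0 < w by rewrite /w subr_gt0.
(* The relative errors add up to a few multiples of k, and 20 absorbs them together with the
   quadratic terms. *)
pose k := Num.min 1 e / 20; have k0 : 0 < k by rewrite divr_gt0// lt_min ltr01.
have k1 : k <= 1 / 20 by rewrite /k ler_pM2r// ge_min lexx.
have ke : 20 * k <= e by rewrite /k mulrC divfK// ge_min lexx orbT.
pose eta := k * w; have eta0 : 0 < eta by rewrite mulr_gt0.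
set D := tail_const p q eta; have D0 : 0 <= D by exact: tail_const_ge0.
(* The second term makes the mass of the kernel missing from the window at most 2 pi k, the third
   makes the tail constant 2 D / T at most k. *)
pose T := 1 + 4 / (k * eta) + 2 * D / k.
have t1 : 0 <= 4 / (k * eta) by apply: divr_ge0 => //; apply: ltW; exact: mulr_gt0.
have t2 : 0 <= 2 * D / k by apply: divr_ge0; [exact: mulr_ge0|exact: ltW].
have T0 : 0 < T by rewrite /T; lra.
have T1 : 8 / (T * eta) <= 2 * pi * k.
  have h : 4 <= T * (k * eta).
    have kn : 0 < k * eta by exact: mulr_gt0.
    by rewrite -ler_pdivrMr//; exact: (aux1 _ t2).
  have Te : 0 < T * eta by exact: mulr_gt0.
  rewrite ler_pdivrMr//.
  have -> : 2 * pi * k * (T * eta) = 2 * pi * (T * (k * eta)) by ring.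
  have := ler_wpM2l (ltW p0) h; lra.
have T2 : 2 * D / T <= k.
  by rewrite ler_pdivrMr// [k * T]mulrC -ler_pdivrMr//; exact: (aux2 _ t1).
(* Room for the centre z, for the enlarged window and for the translate by pi used in the tail. *)
pose X' := X + (`|p| + `|q| + eta) + pi.
have c0k : 0 < c0 * k by rewrite mulr_gt0.
have := kernel_sum_cvg X' T0 c0k; have := kernel_sum_cvg X' ltr01 c0k.
move=> N1 N2; near=> n => z zX.
have n0 : (0 < n)%N by near: n; exact: nbhs_infty_gt.
have K1 : forall x, `|x| <= X' -> `|kernel_sum n 1 x * (1 / eps n * Num.sqrt n%:R) - c0| <= c0 * k.
  by near: n.
have K2 : forall x, `|x| <= X' -> `|kernel_sum n T x * (T / eps n * Num.sqrt n%:R) - c0| <= c0 * k.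
  by near: n.
have /andP[en0 en1] := eps01 n.
have sn : 0 < Num.sqrt n%:R :> R by rewrite sqrtr_gt0 ltr0n.
pose t y := (F n y - n%:R * al - z) / eps n.
set b := eps n / Num.sqrt n%:R; have b0 : 0 < b by rewrite divr_gt0.
have tE T' c y : T' * (t y - c) = T' / eps n * (F n y - n%:R * al - (z + c * eps n)).
  by rewrite /t; field; rewrite gt_eqF.
have xX c : `|c| <= `|p| + `|q| + eta -> `|z + c * eps n| <= X'.
  move=> cb; rewrite (le_trans (ler_normD _ _))// /X' -addrA lerD// normrM (gtr0_norm en0).
  by apply: (le_trans (ler_piMr (normr_ge0 c) en1)); rewrite (le_trans cb)// lerDl ltW.
have VE : window_sum n p q z = \sum_(y <- s n | p <= t y <= q) a n y.
  rewrite /window_sum; apply: eq_bigl => y; rewrite /t ler_pdivlMr// ler_pdivrMr//.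
  by rewrite le_window window_le.
set V := window_sum n p q z in VE *.
have cb c : p - eta <= c <= q + eta -> `|c| <= `|p| + `|q| + eta.
  exact: norm_in_window.
set Q := w * c0 / (2 * pi) * b.
have Q0 : 0 < Q by rewrite /Q; apply: mulr_gt0 => //; apply: divr_gt0; apply: mulr_gt0.
have Up : V <= Q * (1 + e).
  apply: (final_upper Q0 k0 k1 ke).
  have U := @window_upper R I (s n) (a n) t (a0 n) T eta p q (c0 * (1 + k) * b / T) T0 eta0 (ltW pq).
  have {}U := U _; rewrite -VE in U.
  have {U} : V * (2 * pi - 8 / (T * eta)) <= T * ((w + 2 * eta) * (c0 * (1 + k) * b / T)).
    apply: U => c /cb cB; have /andP[_] := kernel_bounds T0 n0 k0 (K2 _ (xX c cB)).
    by rewrite /kernel_sum; under eq_bigr do rewrite -tE.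
  have V0 : 0 <= V by apply: sumr_ge0.
  have -> : T * ((w + 2 * eta) * (c0 * (1 + k) * b / T)) = 2 * pi * (Q * ((1 + 2 * k) * (1 + k))).
    by apply: idU; rewrite gt_eqF.
  have : V * (2 * pi * (1 - k)) <= V * (2 * pi - 8 / (T * eta)).
    by apply: ler_wpM2l => //; rewrite mulrBr mulr1 lerD2l lerN2.
  move=> h1 h2; have := le_trans h1 h2; have pp : 0 < 2 * pi :> R by exact: mulr_gt0.
  by rewrite mulrCA ler_pM2l.
have Lo : Q * (1 - e) <= V.
  apply: (final_lower Q0 k0 k1 ke).
  have pq' : p + eta <= q - eta.
    have : eta <= 1 / 20 * w by rewrite /eta ler_wpM2r// ltW.
    by rewrite /w; move: w0; rewrite /w; lra.
  pose J := 2 * (c0 * (1 + k) * b).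
  have HJ : \sum_(y <- s n) a n y * (fejer (t y) + fejer (t y + pi)) <= J.
    have h1 : `|0 : R| <= `|p| + `|q| + eta by rewrite normr0 !addr_ge0// ltW.
    have z1 : `|z + 0 * eps n| <= X' by exact: xX.
    have z2 : `|z + - pi * eps n| <= X'.
      rewrite (le_trans (ler_normD _ _))// /X' lerD//.
        by rewrite (le_trans zX)// lerDl; move: h1; rewrite normr0.
      by rewrite normrM normrN !gtr0_norm// ler_piMr// ltW.
    have /andP[_ J1] := kernel_bounds (@ltr01 R) n0 k0 (K1 _ z1).
    have /andP[_ J2] := kernel_bounds (@ltr01 R) n0 k0 (K1 _ z2).
    rewrite divr1 in J1; rewrite divr1 in J2.
    under eq_bigr do rewrite mulrDr; rewrite big_split /J /= mulr2n mulrDl mul1r; apply: lerD.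
      apply: le_trans J1; apply: le_of_eq; apply: eq_bigr => y _.
      by rewrite -tE mul1r subr0.
    apply: le_trans J2; apply: le_of_eq; apply: eq_bigr => y _.
    by rewrite -tE mul1r opprK.
  have L := @window_lower R I (s n) (a n) t (a0 n) T eta p q (c0 * (1 - k) * b / T) J T0 eta0 pq'.
  have {}L := fun H => L H HJ; rewrite -VE -/w -/D in L.
  have {L} : T * ((w - 2 * eta) * (c0 * (1 - k) * b / T)) <= 2 * pi * V + (w - 2 * eta) * (D / T * J).
    apply: L => c /(window_widen eta0)/cb cB.
    have /andP[+ _] := kernel_bounds T0 n0 k0 (K2 _ (xX c cB)).
    by rewrite /kernel_sum; under eq_bigr do rewrite -tE.
  have w'0 : 0 <= w - 2 * eta by move: pq'; rewrite /w; lra.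
  have h3 : (w - 2 * eta) * (D / T * J) <= (w - 2 * eta) * (k * (c0 * (1 + k) * b)).
    apply: ler_wpM2l => //; rewrite /J mulrA [D / T * 2](_ : _ = 2 * D / T); last by ring.
    apply: ler_wpM2r => //; apply: ltW; apply: mulr_gt0 => //; apply: mulr_gt0 => //.
    by rewrite addr_gt0.
  have -> : T * ((w - 2 * eta) * (c0 * (1 - k) * b / T)) = (w - 2 * eta) * (c0 * (1 - k) * b).
    by field; rewrite gt_eqF.
  move=> h4; have pp : 0 < 2 * pi :> R by exact: mulr_gt0.
  rewrite -(ler_pM2l pp).
  have -> : 2 * pi * (Q * ((1 - 2 * k) * (1 - k - k * (1 + k)))) =
     (w - 2 * eta) * (c0 * (1 - k) * b) - (w - 2 * eta) * (k * (c0 * (1 + k) * b)).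
    by apply: idL; rewrite gt_eqF.
  by rewrite lerBlDr (le_trans h4)// lerD2l.
exact: ratio_close.
Unshelve. all: end_near. Qed.

End window_limit.

(** * Gaussian approximation of powers *)

Section local_limit.
Context {R : realType}.
Implicit Types (c v w u r sig : R).

Lemma normc_expr_sub (x y : R[i]) (m : R) n : normc x <= m -> normc y <= m ->
  normc (x ^+ n.+1 - y ^+ n.+1) <= n.+1%:R * normc (x - y) * m ^+ n.
Proof.
move=> xm ym; rewrite subrXX normcM [n.+1%:R * _]mulrC -mulrA ler_wpM2l ?normc_ge0//.
have m0 : 0 <= m by rewrite (le_trans (normc_ge0 _) xm).
apply: (le_trans (normc_sum _ _ _)).
apply: (@le_trans _ _ (\sum_(i < n.+1) m ^+ n)); last by rewrite sumr_const card_ord mulr_natl.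
apply: ler_sum => i _; rewrite normcM !normcX.
have -> : m ^+ n = m ^+ (n.+1.-1 - i) * m ^+ i by rewrite -exprD subnK// -ltnS.
by apply: ler_pM; rewrite ?exprn_ge0 ?normc_ge0// lerXn2r// nnegrE normc_ge0.
Qed.

Lemma expR_ge_sqr c : 0 <= c -> c ^+ 2 / 4 <= expR c.
Proof.
move=> c0; have -> : expR c = expR (c / 2) ^+ 2 by rewrite expr2 -expRD; congr expR; lra.
have h : c / 2 <= expR (c / 2) by have := expR_ge1Dx (c / 2); lra.
have -> : c ^+ 2 / 4 = (c / 2) ^+ 2 by field.
by rewrite lerXn2r// nnegrE ?divr_ge0// (le_trans _ h)// divr_ge0.
Qed.

(** Half of the exponent absorbs the polynomial factor, by e^y >= y^2 / 4. *)
Lemma poly_gauss c v w : 0 < c -> 0 <= w -> w <= 1 + v ^+ 4 ->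
  w * expR (- (c * v ^+ 2)) <= (1 + 16 / c ^+ 2) * expR (- (c / 2 * v ^+ 2)).
Proof.
move=> c0 w0 wv; have q0 : 0 <= c / 2 * v ^+ 2 by rewrite mulr_ge0 ?sqr_ge0// divr_ge0// ltW.
have e1 := expR_ge_sqr q0.
have e2 : 1 <= expR (c / 2 * v ^+ 2) by rewrite -[leLHS]expR0 ler_expR.
have -> : expR (- (c * v ^+ 2)) = expR (- (c / 2 * v ^+ 2)) * expR (- (c / 2 * v ^+ 2)).
  by rewrite -expRD; congr expR; field.
rewrite mulrA ler_wpM2r ?expR_ge0// expRN ler_pdivrMr ?expR_gt0//.
apply: (le_trans wv); rewrite mulrDl mul1r lerD//.
have k0 : 0 <= 16 / c ^+ 2 by rewrite divr_ge0// sqr_ge0.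
apply: le_trans (ler_wpM2l k0 e1); apply: le_of_eq; field.
by rewrite gt_eqF.
Qed.

(** With q the square root of r, the factor n is absorbed by q^(-n) through Bernoulli's
    inequality. *)
Lemma nat_pow_decay r : 0 < r < 1 -> exists C q : R, [/\ 0 < C, 0 < q < 1 & forall n, n%:R * r ^+ n <= C * q ^+ n].
Proof.
move=> /andP[r0 r1]; pose q := Num.sqrt r.
have q0 : 0 < q by rewrite sqrtr_gt0.
have q1 : q < 1 by rewrite -sqrtr1 ltr_sqrt.
have qq : r = q * q by rewrite -expr2 sqr_sqrtr// ltW.
have iq : 0 < q^-1 - 1 by rewrite subr_gt0 invf_gt1.
exists (q^-1 - 1)^-1, q; split; rewrite ?invr_gt0 ?q0// => n.
have h : n%:R * (q^-1 - 1) <= q^-1 ^+ n.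
  have qE : q^-1 = 1 + (q^-1 - 1) by rewrite addrC subrK.
  rewrite [in leRHS]qE; move: iq; set d := _ - 1 => iq.
  elim: n => [|n IH]; first by rewrite mul0r expr0.
  have : d <= d * (1 + d) ^+ n by apply: ler_peMr; [exact: ltW|apply: exprn_ege1; rewrite lerDl ltW].
  rewrite -natr1 [(n%:R + 1) * d]mulrDl mul1r exprS [(1 + d) * _]mulrDl mul1r => h; exact: lerD.
have qn : 0 < q ^+ n by rewrite exprn_gt0.
rewrite qq exprMn mulrA; apply: ler_wpM2r; first exact: ltW.
rewrite -[leRHS]mul1r ler_pdivlMr//.
move: (ler_wpM2r (ltW qn) h); rewrite -exprMn mulVf ?expr1n; last by rewrite gt_eqF.
by rewrite mulrAC.
Qed.

(** A difference of n-th powers is at most n times the difference of the bases times the (n-1)-th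
    power of their bound. With v = sqrt n |u|, n |u|^3 is v^3 / sqrt n, and the cube is absorbed by
    the Gaussian. *)
Lemma gauss_pow_sub sig C (L : R -> R[i]) (u0 : R) : 0 < sig -> 0 < u0 -> 0 <= C ->
  (forall u, `|u| <= u0 -> normc (L u - (1 - sig ^+ 2 * u ^+ 2 / 2)%:C) <= C * `|u| ^+ 3) ->
  exists u1 K c, [/\ 0 < u1 <= u0, 0 <= K, 0 < c <= sig ^+ 2 / 4 & forall u n, `|u| <= u1 -> (2 <= n)%N ->
    normc (L u ^+ n - (expR (- (n%:R * (sig ^+ 2 * u ^+ 2 / 2))))%:C) <=
    K / Num.sqrt n%:R * expR (- (c * n%:R * u ^+ 2))].
Proof.
move=> sig0 u00 C0 HL; have s2 : 0 < sig ^+ 2 by rewrite exprn_gt0.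
pose C3 := C + (sig ^+ 2 / 2) ^+ 2 * expR (sig ^+ 2 / 2).
have C30 : 0 <= C3 by rewrite /C3 addr_ge0// mulr_ge0 ?expR_ge0// sqr_ge0.
(* Small enough that the cubic error is at most half of the quadratic term and that the latter is at
   most 1/2. *)
pose u1 := Num.min (Num.min u0 1) (Num.min (sig ^+ 2 / (4 * (C + 1))) (sig ^+ 2 + 1)^-1).
have C1 : 0 < C + 1 by rewrite ltr_wpDl.
have s21 : 0 < sig ^+ 2 + 1 by rewrite addr_gt0.
have u10 : 0 < u1.
  rewrite /u1 !lt_min u00 ltr01 /= invr_gt0 s21 andbT.
  by apply: divr_gt0 => //; exact: mulr_gt0.
pose c := sig ^+ 2 / 8; have c0 : 0 < c by rewrite divr_gt0.
exists u1, (C3 * (1 + 16 / c ^+ 2)), (c / 2); split.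
- by rewrite u10 /= !ge_min lexx.
- by rewrite mulr_ge0// addr_ge0// divr_ge0// sqr_ge0.
- by rewrite divr_gt0//=; rewrite /c; move: s2; clear; lra.
move=> u [//|n] uu n2.
have uu0 : `|u| <= u0 by rewrite (le_trans uu)// !ge_min lexx.
have ub : `|u| <= 1 by rewrite (le_trans uu)// !ge_min lexx !orbT.
have uc : C * `|u| <= sig ^+ 2 / 4.
  have : `|u| <= sig ^+ 2 / (4 * (C + 1)) by rewrite (le_trans uu)// !ge_min lexx !orbT.
  rewrite ler_pdivlMr ?mulr_gt0// => h; have := normr_ge0 u; move: h; clear; lra.
set A := sig ^+ 2 * u ^+ 2 / 2.
have u2 : `|u| ^+ 2 = u ^+ 2 by rewrite real_normK// num_real.
have A0 : 0 <= A by rewrite /A divr_ge0// mulr_ge0 ?sqr_ge0.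
have As : A <= sig ^+ 2 / 2.
  rewrite /A ler_pM2r//; apply: ler_piMr; first exact: ltW.
  by rewrite -u2 exprn_ile1.
have A1 : A <= 1 / 2.
  have h : `|u| <= (sig ^+ 2 + 1)^-1 by rewrite (le_trans uu)// !ge_min lexx !orbT.
  rewrite -[(_ + 1)^-1]mul1r ler_pdivlMr// in h.
  rewrite /A ler_pM2r// -u2 (_ : sig ^+ 2 * `|u| ^+ 2 = sig ^+ 2 * `|u| * `|u|); last by ring.
  have := ler_wpM2r (normr_ge0 u) h; have := normr_ge0 u; have := mulr_ge0 (normr_ge0 u) (normr_ge0 u).
  move: ub; set x := `|u|; set y := sig ^+ 2; clear; lra.
have t3 : 0 <= `|u| ^+ 3 by rewrite exprn_ge0.
have Lg : normc (L u - (expR (- A))%:C) <= C3 * `|u| ^+ 3.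
  have -> : L u - (expR (- A))%:C = (L u - (1 - A)%:C) - (cexp (- A)%:C - 1 - (- A)%:C).
    by rewrite cexp_real rmorphB !rmorphN rmorph1; ring.
  rewrite (le_trans (normcB _ _))// /C3 mulrDl lerD ?HL//.
  rewrite (le_trans (cexp_taylor2 _))// normc_real normrN ger0_norm//.
  rewrite [leRHS]mulrAC; apply: ler_pM; [exact: sqr_ge0|exact: expR_ge0| |by rewrite ler_expR].
  rewrite [leLHS](_ : _ = (sig ^+ 2 / 2) ^+ 2 * u ^+ 4); last by rewrite /A; field.
  apply: ler_wpM2l; first exact: sqr_ge0.
  rewrite (_ : u ^+ 4 = `|u| ^+ 4); last first.
    by rewrite (exprM u 2 2) (exprM `|u| 2 2) u2.
  by rewrite [leLHS]exprS; apply: ler_piMl.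
have Lm : normc (L u) <= expR (- (A / 2)).
  apply: (@le_trans _ _ (1 - A / 2)); last by have := expR_ge1Dx (- (A / 2)); rewrite -[X in X <= _]/(1 - A / 2).
  have -> : L u = (L u - (1 - A)%:C) + (1 - A)%:C by rewrite subrK.
  apply: (le_trans (normcD _ _)); rewrite normc_real [X in _ + X]ger0_norm; last by move: A1; clear; lra.
  have h : C * `|u| ^+ 3 <= sig ^+ 2 / 4 * u ^+ 2.
    rewrite (_ : `|u| ^+ 3 = `|u| * u ^+ 2); last by rewrite -u2 -exprS.
    by rewrite mulrA; apply: ler_wpM2r => //; exact: sqr_ge0.
  have := HL u uu0; rewrite -/A => hL; have := le_trans hL h.
  rewrite (_ : sig ^+ 2 / 4 * u ^+ 2 = A / 2); last by rewrite /A; field.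
  clear; lra.
have gm : normc (expR (- A))%:C <= expR (- (A / 2)).
  by rewrite normc_real ger0_norm ?expR_ge0// ler_expR lerN2; move: A0; clear; lra.
have := normc_expr_sub n Lm gm.
have -> : (expR (- A))%:C ^+ n.+1 = (expR (- (n.+1%:R * A)))%:C :> R[i].
  by rewrite -rmorphXn -expRM_natl mulrN.
move=> /le_trans; apply.
have n1 : (0 : R) < n.+1%:R by rewrite ltr0n.
pose v := Num.sqrt n.+1%:R * `|u|.
have s0 : 0 < Num.sqrt n.+1%:R :> R by rewrite sqrtr_gt0.
have ss : Num.sqrt n.+1%:R ^+ 2 = n.+1%:R :> R by apply: sqr_sqrtr; exact: ltW.
have v0 : 0 <= v by apply: mulr_ge0 => //; exact: ltW.
have vw : v ^+ 3 <= 1 + v ^+ 4.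
  have [v1|v1] := leP v 1.
    by rewrite (le_trans (exprn_ile1 _ v0 v1))// lerDl exprn_ge0.
  by rewrite [v ^+ 4]exprS (le_trans (ler_peMl _ (ltW v1)))// ?exprn_ge0// lerDr.
have P := poly_gauss c0 (exprn_ge0 3 v0) vw.
have E1 : n.+1%:R * (C3 * `|u| ^+ 3) = C3 / Num.sqrt n.+1%:R * v ^+ 3.
  by rewrite /v -{1}ss; field; rewrite gt_eqF.
have v2 : v ^+ 2 = n.+1%:R * u ^+ 2 by rewrite /v exprMn ss u2.
have E2 : expR (- (A / 2)) ^+ n <= expR (- (c * v ^+ 2)).
  rewrite -expRM_natl ler_expR mulrN lerN2 v2 /A /c.
  have h : n.+1%:R <= 2 * n%:R :> R by rewrite -natrM ler_nat; move: n2; case: (n) => // k _; rewrite mul2n -addnn addSn addnS !ltnS leq_addr.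
  have := ler_wpM2r (mulr_ge0 (ltW s2) (sqr_ge0 u)) h; move: (sig ^+ 2) (u ^+ 2) => a b; clear; lra.
apply: (@le_trans _ _ (n.+1%:R * (C3 * `|u| ^+ 3) * expR (- (c * v ^+ 2)))).
  apply: ler_pM => //; rewrite ?exprn_ge0 ?expR_ge0 ?mulr_ge0 ?normc_ge0 ?ler0n//.
  by rewrite ler_wpM2l.
rewrite E1 -[leLHS]mulrA.
have k0 : 0 <= C3 / Num.sqrt n.+1%:R by apply: divr_ge0 => //; exact: ltW.
apply: (le_trans (ler_wpM2l k0 P)); rewrite v2; apply: le_of_eq.
by rewrite -[c / 2 * n.+1%:R * _]mulrA; ring.
Qed.

Lemma gauss_xi_bound c (t : R) : 0 < c -> 0 < t -> ri (fun x => expR (- (c * (t * x) ^+ 2))) 0 1 <= 2 / (Num.sqrt c * t).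
Proof.
move=> c0 t0; have ct : 0 < c * t ^+ 2 by rewrite mulr_gt0// exprn_gt0.
have -> : ri (fun x => expR (- (c * (t * x) ^+ 2))) 0 1 = ri (fun x => expR (- (c * t ^+ 2 * x ^+ 2))) 0 1.
  by apply: eq_ri => x _; rewrite exprMn mulrA.
have st : Num.sqrt (c * t ^+ 2) = Num.sqrt c * t by rewrite sqrtrM ?ltW// sqrtr_sqr gtr0_norm.
rewrite gauss_integral_affine// st mulrC ler_wpM2r//; last by apply: gauss_le1; rewrite mulr_ge0// ?sqrtr_ge0 ltW.
by rewrite invr_ge0 mulr_ge0 ?sqrtr_ge0// ltW.
Qed.

Lemma continuous_gauss_xi c (t : R) : continuous (fun x : R => expR (- (c * (t * x) ^+ 2))).
Proof.
move=> x; apply: continuous_comp; last exact: continuous_expR.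
apply: (@continuous_comp _ _ _ (fun x : R => c * (t * x) ^+ 2) (fun x => - x)); last exact: opp_continuous.
apply: cvgM; first exact: cvg_cst.
apply: (@continuous_comp _ _ _ (fun x : R => t * x) (fun x => x ^+ 2)); last exact: exprn_continuous.
by apply: cvgM; [exact: cvg_cst|exact: cvg_id].
Qed.

End local_limit.

(** * Eventual bounds and the three ranges of frequencies *)

Section near_lemmas.
Context {R : realType}.
Implicit Types (K e r : R).

Lemma near_sqrt_ge K : \forall n \near \oo, K <= Num.sqrt n%:R :> R.
Proof.
near=> n; have h : K ^+ 2 <= n%:R by near: n; exact: nbhs_infty_ger.
by rewrite (le_trans (ler_norm K))// -sqrtr_sqr ler_wsqrtr.
Unshelve. all: end_near. Qed.

Lemma near_div_sqrt K e : 0 <= K -> 0 < e -> \forall n \near \oo, K / Num.sqrt n%:R <= e.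
Proof.
move=> K0 e0; near=> n; have n0 : (0 < n)%N by near: n; exact: nbhs_infty_gt.
have s0 : 0 < Num.sqrt n%:R :> R by rewrite sqrtr_gt0 ltr0n.
by rewrite ler_pdivrMr// mulrC -ler_pdivrMr//; near: n; exact: near_sqrt_ge.
Unshelve. all: end_near. Qed.

Lemma near_nat_pow K r e : 0 <= K -> 0 < r < 1 -> 0 < e -> \forall n \near \oo, K * (n%:R * r ^+ n) <= e.
Proof.
move=> K0 r01 e0; have [C [q [C0 /andP[q0 q1] H]]] := nat_pow_decay r01.
have KC : 0 < K * C + 1 by rewrite ltr_wpDl// mulr_ge0// ltW.
have : (fun n => q ^+ n) @ \oo --> (0 : R) by apply: cvg_expr; rewrite gtr0_norm.
move=> /cvgr0_norm_le /(_ (e / (K * C + 1)) (divr_gt0 e0 KC)) N; near=> n.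
have : `|q ^+ n| <= e / (K * C + 1) by near: n.
have qn : 0 <= q ^+ n by rewrite exprn_ge0// ltW.
rewrite (ger0_norm qn) ler_pdivlMr// => h.
have := ler_wpM2l K0 (H n); move=> /le_trans; apply; apply: le_trans h.
by rewrite mulrA [leRHS]mulrC; apply: ler_wpM2r => //; rewrite lerDl.
Unshelve. all: end_near. Qed.

Lemma gauss_exponent (A B D N : R) : N * A * D <= N * A * B -> 2 * (A * B) <= N * (A * B) -> 0 <= A * B ->
  - (N * (A * B / 2)) <= N * - (A * D / 4) - A / 4 * B.
Proof. lra. Qed.

Lemma error_sum (D z g x y m k : R) : D <= z + g -> 0 <= y -> z <= k * x + m -> g <= x ->
  D <= y + (k + 1) * x + m.
Proof. lra. Qed.

Lemma triple_bound (f g k1 k2 k3 e1 e2 : R) : `|f - 2 * g| <= 2 * (k1 * e1 + k2 * e2 + k3) ->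
  2 * g + (- (2 * k1) * e1 + (- (2 * k2) * e2 + - (2 * k3))) <= f <= 2 * g + (2 * k1 * e1 + (2 * k2 * e2 + 2 * k3)).
Proof. by rewrite ler_norml => /andP[h1 h2]; apply/andP; split; [move: h1|move: h2]; lra. Qed.

Lemma combine_errors (z1 z2 z3 z4 z5 z6 e : R) : z1 <= z2 + z3 -> z2 - z3 <= z1 -> z3 <= z4 + z5 ->
  z4 <= e / 4 -> z5 <= e / 4 -> `|z2 - z6| <= e / 4 -> 0 < e -> `|z1 - z6| <= e.
Proof.
move=> h1 h2 h3 h4 h5; rewrite !ler_norml => /andP[h6 h7] h8; apply/andP; split; lra.
Qed.

Definition near_expansion (Z : nat -> R -> R[i]) (al sig : R) :=
  exists (u0 C r : R) (l : R -> R[i]), [/\ 0 < u0, 0 <= C, 0 < r < 1 &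
  forall u, `|u| <= u0 -> (forall n, (2 <= n)%N -> normc (Z n u - l u ^+ n) <= C * r ^+ n) /\
    normc (l u * cexp (Complex 0 (- u * al)) - (1 - sig ^+ 2 * u ^+ 2 / 2)%:C) <= C * `|u| ^+ 3].

Definition medium_bound (Z : nat -> R -> R[i]) :=
  forall u1 a1, 0 < u1 -> u1 <= a1 -> exists C r : R, [/\ 0 <= C, 0 < r < 1 &
  forall u, u1 <= `|u| <= a1 -> forall n, (2 <= n)%N -> normc (Z n u) <= C * r ^+ n].

(** The extra factor [eps n] pays for the length T / eps n of the range of frequencies. *)
Definition large_bound (Z : nat -> R -> R[i]) (eps : nat -> R) :=
  forall T, 0 < T -> exists a1 C r : R, [/\ 0 < a1, 0 <= C, 0 < r < 1 &
  forall u n, (2 <= n)%N -> a1 <= `|u| -> `|u| * eps n <= T -> normc (Z n u) <= C * r ^+ n * eps n].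

End near_lemmas.

(** * Local limit theorem for the kernel sums *)

Section kernel_asymptotics.
Context {R : realType} {I : Type}.
Variables (s : nat -> seq I) (a F : nat -> I -> R) (al sig : R) (eps : nat -> R).
Hypothesis eps01 : forall n, 0 < eps n <= 1.
Hypothesis sig0 : 0 < sig.

Definition charsum n (u : R) : R[i] :=
  \sum_(y <- s n) (a n y)%:C * cexp (Complex 0 u * (F n y)%:C).

Hypothesis HN : near_expansion charsum al sig.
Hypothesis HM : medium_bound charsum.
Hypothesis HL : large_bound charsum eps.

Definition phase n (u x : R) : R[i] := cexp (Complex 0 (- u * (n%:R * al + x))).

Lemma Re_fourier_sum n u x :
  cRe (charsum n u * phase n u x) = \sum_(y <- s n) a n y * cos (u * (F n y - n%:R * al - x)).
Proof.
rewrite /charsum mulr_suml Re_sum; apply: eq_bigr => y _.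
rewrite -mulrA -cexpD ReM_real; congr (_ * _).
have -> : Complex 0 u * (F n y)%:C + Complex 0 (- u * (n%:R * al + x)) =
    Complex 0 (u * (F n y - n%:R * al - x)).
  by apply: complex_ext => /=; ring.
by rewrite /= expR0 mul1r.
Qed.

Lemma fourier_kernelE n (T x xi : R) :
  2 * ((1 - xi) * cRe (charsum n (T / eps n * xi) * phase n (T / eps n * xi) x)) =
  \sum_(y <- s n) a n y * (2 * (1 - xi) * cos (xi * (T / eps n * (F n y - n%:R * al - x)))).
Proof.
rewrite Re_fourier_sum !mulr_sumr; apply: eq_bigr => y _.
by rewrite (_ : xi * _ = T / eps n * xi * (F n y - n%:R * al - x)); ring.
Qed.

Lemma kernel_sum_fourier n T x : kernel_sum s a F al eps n T x =
  ri (fun xi => 2 * ((1 - xi) * cRe (charsum n (T / eps n * xi) * phase n (T / eps n * xi) x))) 0 1.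
Proof.
under [RHS]eq_ri do rewrite fourier_kernelE; rewrite ri_sum//; last first.
  by move=> y xi; apply: cvgM; [exact: cvg_cst|exact: cts_fejer_kernel].
by apply: eq_bigr => y _; rewrite riZ//; exact/rcontC/cts_fejer_kernel.
Qed.

Lemma continuous_fourier_kernel n (T x : R) : continuous (fun xi : R =>
  2 * ((1 - xi) * cRe (charsum n (T / eps n * xi) * phase n (T / eps n * xi) x))).
Proof.
rewrite (funext (fourier_kernelE n T x)); apply: cts_bigsum => y xi.
by apply: cvgM; [exact: cvg_cst|exact: cts_fejer_kernel].
Qed.

Lemma normc_phase n u x : normc (phase n u x) = 1.
Proof. by rewrite normc_cexp /= expR0. Qed.

(** The three error terms come from small, intermediate and large frequencies. For small u, both the
    phase in x and the factor 1 - xi differ from 1 by O(u), and u against the Gaussian costs 1 /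
    sqrt n. *)
Lemma fourier_pointwise T X : 0 < T -> exists K1 K2 K3 c c2 r : R,
  [/\ [/\ 0 <= K1, 0 <= K2 & 0 <= K3], 0 < c, 0 < c2, 0 < r < 1 &
  forall n u xi x, (2 <= n)%N -> 0 <= u -> u * eps n <= T -> 0 <= xi <= 1 -> xi <= T^-1 * u -> `|x| <= X ->
  `|(1 - xi) * cRe (charsum n u * phase n u x) - expR (- (n%:R * (sig ^+ 2 * u ^+ 2 / 2)))| <=
  K1 / Num.sqrt n%:R * expR (- (c * n%:R * u ^+ 2)) + K2 * r ^+ n * expR (- (c2 * u ^+ 2)) + K3 * r ^+ n * eps n].
Proof.
move=> T0; have [u0 [C [r1 [l [u00 C0 /andP[r10 r11] H]]]]] := HN.
have s2 : 0 < sig ^+ 2 by rewrite exprn_gt0.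
have [u1 [K [c [/andP[u10 u1u0] K0 /andP[c0 cs] HG]]]] :=
  gauss_pow_sub sig0 u00 C0 (fun u ub => (H u ub).2).
have [a1 [CL [rL [a10 CL0 /andP[rL0 rL1] HLa]]]] := HL T0.
pose b1 := Num.max a1 u1; have b1u : u1 <= b1 by rewrite le_max lexx orbT.
have b1a : a1 <= b1 by rewrite le_max lexx.
have [CM [rM [CM0 /andP[rM0 rM1] HMa]]] := HM u10 b1u.
pose c2 := sig ^+ 2 / 4; have c20 : 0 < c2 by rewrite divr_gt0.
pose rG := expR (- (sig ^+ 2 * u1 ^+ 2 / 4)).
have rG0 : 0 < rG by exact: expR_gt0.
have rG1 : rG < 1 by rewrite /rG -[ltRHS]expR0 ltr_expR oppr_lt0 divr_gt0// mulr_gt0// exprn_gt0.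
pose r := Num.max (Num.max r1 rL) (Num.max rM rG).
have r01 : 0 < r < 1 by rewrite !gt_max r11 rL1 rM1 rG1 !lt_max r10.
have rle t n : 0 < t -> t <= r -> t ^+ n <= r ^+ n.
  by move=> t0 tr; rewrite lerXn2r// nnegrE ltW//; case/andP: r01.
have R1 n : r1 ^+ n <= r ^+ n by apply: rle => //; rewrite !le_max lexx.
have RL n : rL ^+ n <= r ^+ n by apply: rle => //; rewrite !le_max lexx !orbT.
have RM n : rM ^+ n <= r ^+ n by apply: rle => //; rewrite !le_max lexx !orbT.
have RG n : rG ^+ n <= r ^+ n by apply: rle => //; rewrite !le_max lexx !orbT.
have rn0 n : 0 <= r ^+ n by rewrite exprn_ge0// ltW//; case/andP: r01.
(* A Gaussian factor is inserted into the errors up to the frequency b1, where it is at least 1 / E;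
   the integral over the rescaled variable is then of order eps n instead of 1. *)
pose E := expR (c2 * b1 ^+ 2).
pose M := `|X| * expR (u1 * `|X|) + T^-1.
have M0 : 0 <= M by rewrite /M addr_ge0 ?invr_ge0 ?(ltW T0)// mulr_ge0// expR_ge0.
have sc : 0 < sig ^+ 2 / 2 by rewrite divr_gt0.
pose Q := 1 + 16 / (sig ^+ 2 / 2) ^+ 2.
have Q0 : 0 <= Q by rewrite /Q addr_ge0// divr_ge0// sqr_ge0.
exists (K + M * Q), (C * E + CM * E + 1), CL, c, c2, r; split => //.
  split => //; first by rewrite addr_ge0// mulr_ge0.
  by rewrite !addr_ge0// mulr_ge0// expR_ge0.
move=> n u xi x n2 u_ge0 uT /andP[xi0 xi1] xiu xX.
set w := charsum n u * phase n u x; set g := expR (- (n%:R * (sig ^+ 2 * u ^+ 2 / 2))).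
have nw : normc w = normc (charsum n u) by rewrite normcM normc_phase mulr1.
have g0 : 0 <= g by exact: expR_ge0.
have n0 : (0 : R) < n%:R by rewrite ltr0n (leq_trans _ n2).
have sn : 0 < Num.sqrt n%:R :> R by rewrite sqrtr_gt0.
have /andP[en0 en1] := eps01 n.
have e1 := expR_ge0 (- (c * n%:R * u ^+ 2)); have e2 := expR_ge0 (- (c2 * u ^+ 2)).
have t1 : 0 <= (K + M * Q) / Num.sqrt n%:R * expR (- (c * n%:R * u ^+ 2)).
  by apply: mulr_ge0 => //; apply: divr_ge0; [rewrite addr_ge0// mulr_ge0|exact: ltW].
have t3 : 0 <= CL * r ^+ n * eps n by rewrite !mulr_ge0// ltW.
have re2 : 0 <= r ^+ n * expR (- (c2 * u ^+ 2)) by exact: mulr_ge0.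
have un : `|u| = u by rewrite ger0_norm.
have Eu : u <= b1 -> 1 <= E * expR (- (c2 * u ^+ 2)).
  move=> ub; rewrite -expRD -[leLHS]expR0 ler_expR subr_ge0; apply: ler_wpM2l; first exact: ltW.
  by rewrite lerXn2r// nnegrE (le_trans u_ge0).
have dec k : 0 <= k -> u <= b1 -> k * r ^+ n <= k * E * (r ^+ n * expR (- (c2 * u ^+ 2))).
  move=> k0 ub; rewrite -mulrA ler_wpM2l//.
  by rewrite [E * _]mulrCA; apply: ler_peMr => //; exact: Eu.
have [uu|uu] := leP u u1.
  have uu0 : `|u| <= u0 by rewrite un (le_trans uu).
  have [Hn _] := H u uu0.
  pose A := cexp (Complex 0 (- u * al)); pose px := cexp (Complex 0 (- u * x)).
  have phE : phase n u x = A ^+ n * px.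
    rewrite /phase /A /px -cexpX -cexpD; congr cexp; rewrite -(rmorph_nat (real_complex R)).
    by apply: complex_ext => /=; ring.
  have npx : normc px = 1 by rewrite normc_cexp /= expR0.
  have pd : normc (px - 1) <= u * (`|X| * expR (u1 * `|X|)).
    have uX : u * `|x| <= u * `|X| by rewrite ler_wpM2l// (le_trans xX)// ler_norm.
    have nI : normc (Complex 0 (- u * x)) = u * `|x|.
      by rewrite /normc /= expr0n add0r sqrtr_sqr normrM normrN un.
    rewrite (le_trans (cexp_taylor1 _))// nI mulrA; apply: ler_pM; rewrite ?mulr_ge0 ?expR_ge0//.
    by rewrite ler_expR (le_trans uX)// ler_wpM2r.
  have wE : w - g%:C = (charsum n u - l u ^+ n) * phase n u x +
      (((l u * A) ^+ n - g%:C) * px + g%:C * (px - 1)).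
    by rewrite /w phE exprMn; ring.
  have hw : normc (w - g%:C) <= C * r1 ^+ n + (K / Num.sqrt n%:R * expR (- (c * n%:R * u ^+ 2)) +
      g * (u * (`|X| * expR (u1 * `|X|)))).
    rewrite wE (le_trans (normcD _ _))// lerD//.
      by rewrite normcM normc_phase mulr1; exact: Hn.
    rewrite (le_trans (normcD _ _))// lerD//.
      by rewrite normcM npx mulr1; apply: HG => //; rewrite un.
    by rewrite normcM normc_real ger0_norm// ler_wpM2l.
  have hR : `|cRe w - g| <= normc (w - g%:C).
    by apply: le_trans (normc_Re _); rewrite ReB.
  have gu : g * u <= Q / Num.sqrt n%:R * expR (- (c * n%:R * u ^+ 2)).
    pose v := Num.sqrt n%:R * u; have v0 : 0 <= v by rewrite mulr_ge0// ltW.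
    have vw : v <= 1 + v ^+ 4.
      have [v1|v1] := leP v 1; first by rewrite (le_trans v1)// lerDl exprn_ge0.
      rewrite (@le_trans _ _ (v ^+ 4))// ?lerDr// exprS; apply: ler_peMr => //.
      by apply: exprn_ege1; exact: ltW.
    have v2 : v ^+ 2 = n%:R * u ^+ 2 by rewrite /v exprMn sqr_sqrtr// ltW.
    have gv : expR (- (sig ^+ 2 / 2 * v ^+ 2)) = g by rewrite /g v2; congr (expR (- _)); field.
    have gc : expR (- (sig ^+ 2 / 2 / 2 * v ^+ 2)) <= expR (- (c * n%:R * u ^+ 2)).
      rewrite ler_expR lerN2 v2 -mulrA; apply: ler_wpM2r.
        by apply: mulr_ge0; [exact: ltW|exact: sqr_ge0].
      by rewrite (le_trans cs)//; apply: le_of_eq; field.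
    have P := le_trans (poly_gauss sc v0 vw) (ler_wpM2l Q0 gc).
    rewrite gv in P.
    rewrite -(ler_pM2l sn) (_ : Num.sqrt n%:R * (g * u) = v * g); last by rewrite /v; ring.
    have -> : Num.sqrt n%:R * (Q / Num.sqrt n%:R * expR (- (c * n%:R * u ^+ 2))) = Q * expR (- (c * n%:R * u ^+ 2)).
      by field; rewrite gt_eqF.
    exact: P.
  have hD : `|(1 - xi) * cRe w - g| <= normc (w - g%:C) + T^-1 * (g * u).
    have -> : (1 - xi) * cRe w - g = (1 - xi) * (cRe w - g) - xi * g by ring.
    rewrite (le_trans (ler_normB _ _))// lerD//.
      rewrite normrM -[leRHS]mul1r; apply: ler_pM => //.
      by rewrite ger0_norm ?subr_ge0// gerBl.
    by rewrite normrM (ger0_norm g0) ger0_norm// mulrC mulrCA ler_wpM2l.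
  have ub : u <= b1 by exact: le_trans b1u.
  have h1 := dec C C0 ub; have h2 : 0 <= CM * E * (r ^+ n * expR (- (c2 * u ^+ 2))).
    by rewrite mulr_ge0// mulr_ge0// expR_ge0.
  have h3 := ler_wpM2l C0 (R1 n).
  have h4 := ler_wpM2l M0 gu.
  rewrite -[(_ + 1) * r ^+ n * _]mulrA.
  have -> : (K + M * Q) / Num.sqrt n%:R * expR (- (c * n%:R * u ^+ 2)) =
    K / Num.sqrt n%:R * expR (- (c * n%:R * u ^+ 2)) + M * (Q / Num.sqrt n%:R * expR (- (c * n%:R * u ^+ 2))).
    by ring.
  have gM : M * (g * u) = g * (u * (`|X| * expR (u1 * `|X|))) + T^-1 * (g * u) by rewrite /M; ring.
  move: hD hw t3 re2 h1 h2 h3 h4; rewrite gM; set x1 := r ^+ n * expR _.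
  set x2 := K / _ * _; set x3 := M * (Q / _ * _); set x4 := g * (u * _); rewrite [(C * E + _ + 1) * x1]mulrDl [(C * E + _) * x1]mulrDl [1 * x1]mul1r.
  move: (normc (w - _)) (CL * _ * _) (C * r1 ^+ n) (C * r ^+ n) (C * E * x1) (CM * E * x1) (T^-1 * (g * u)).
  by move=> *; lra.
have gB : g <= r ^+ n * expR (- (c2 * u ^+ 2)).
  apply: (@le_trans _ _ (rG ^+ n * expR (- (c2 * u ^+ 2)))); last by rewrite ler_wpM2r.
  rewrite /g /rG -expRM_natl -expRD ler_expR.
  have h1 : u1 ^+ 2 <= u ^+ 2 by rewrite lerXn2r// ?nnegrE// ltW.
  have h2 : (2 : R) <= n%:R by rewrite ler_nat.
  have h3 := ler_wpM2l (mulr_ge0 (ltW n0) (ltW s2)) h1.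
  have h4 := ler_wpM2r (mulr_ge0 (ltW s2) (sqr_ge0 u)) h2.
  have h5 := mulr_ge0 (ltW s2) (sqr_ge0 u).
  exact: gauss_exponent.
have big : `|(1 - xi) * cRe w - g| <= normc (charsum n u) + g.
  rewrite (le_trans (ler_normB _ _))// [X in _ + X <= _]ger0_norm// lerD2r normrM.
  rewrite -nw -[leRHS]mul1r; apply: ler_pM => //; last exact: normc_Re.
  by rewrite ger0_norm ?subr_ge0// gerBl.
have [ub|ub] := leP u b1.
  have := HMa u _ n n2; rewrite un (ltW uu) ub => /(_ isT) hZ.
  have h1 := dec CM CM0 ub; have h2 : 0 <= C * E * (r ^+ n * expR (- (c2 * u ^+ 2))).
    by rewrite mulr_ge0// mulr_ge0// expR_ge0.
  have h3 := ler_wpM2l CM0 (RM n).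
  rewrite -[(_ + 1) * r ^+ n * _]mulrA; apply: (error_sum big t1 _ gB).
  by rewrite (le_trans (le_trans hZ (le_trans h3 h1)))// mulrDl -addrA addrCA lerDl addr_ge0.
have := HLa u n n2; rewrite un => /(_ (le_trans b1a (ltW ub)) uT) hZ.
have h1 : 0 <= (C * E + CM * E) * (r ^+ n * expR (- (c2 * u ^+ 2))).
  by rewrite mulr_ge0// addr_ge0// mulr_ge0// expR_ge0.
have h3 := ler_wpM2r (ltW en0) (ler_wpM2l CL0 (RL n)).
rewrite -[(_ + 1) * r ^+ n * _]mulrA; apply: (error_sum big t1 _ gB).
by rewrite (le_trans (le_trans hZ h3))// lerDr.
Qed.

Lemma ri_gauss_main n T : 0 < T -> (0 < n)%N ->
  ri (fun xi => expR (- (n%:R * (sig ^+ 2 * (T / eps n * xi) ^+ 2 / 2)))) 0 1 * (T / eps n * Num.sqrt n%:R) =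
  Num.sqrt 2 / sig * ri gauss_fun 0 (sig / Num.sqrt 2 * (T / eps n * Num.sqrt n%:R)).
Proof.
move=> T0 n0; have /andP[e0 _] := eps01 n; have t0 : 0 < T / eps n by exact: divr_gt0.
have s2 : 0 < Num.sqrt 2 :> R by rewrite sqrtr_gt0.
have sn : 0 < Num.sqrt n%:R :> R by rewrite sqrtr_gt0 ltr0n.
set t := T / eps n in t0 *; set b := sig / Num.sqrt 2 * (t * Num.sqrt n%:R).
have b0 : 0 < b by apply: mulr_gt0; [exact: divr_gt0|exact: mulr_gt0].
have bb : b ^+ 2 = n%:R * (sig ^+ 2 / 2) * t ^+ 2.
  by rewrite /b !exprMn exprVn !sqr_sqrtr//; ring.
have -> : ri (fun xi => expR (- (n%:R * (sig ^+ 2 * (t * xi) ^+ 2 / 2)))) 0 1 =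
   ri (fun x => expR (- (b ^+ 2 * x ^+ 2))) 0 1.
  by apply: eq_ri => x _; congr (expR (- _)); rewrite bb; field.
rewrite gauss_integral_affine ?exprn_gt0// sqrtr_sqr gtr0_norm//.
rewrite /b; field; rewrite !gt_eqF//.
Qed.

(** After rescaling, the main term is a Gaussian integral over a range tending to infinity, and the
    errors are O(1 / sqrt n) and O(n r^n), uniformly for |x| <= X. *)
Theorem kernel_asymptotic (T X e : R) : 0 < T -> 0 < e -> \forall n \near \oo, forall x, `|x| <= X ->
  `|kernel_sum s a F al eps n T x * (T / eps n * Num.sqrt n%:R) - Num.sqrt (2 * pi) / sig| <= e.
Proof.
move=> T0 e0; have [K1 [K2 [K3 [c [c2 [r [[K10 K20 K30] c0 c20 r01 H]]]]]]] := fourier_pointwise X T0.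
have s2 : 0 < Num.sqrt 2 :> R by rewrite sqrtr_gt0.
have sc : 0 < Num.sqrt c by rewrite sqrtr_gt0.
have sc2 : 0 < Num.sqrt c2 by rewrite sqrtr_gt0.
have kg : 0 < 2 * (Num.sqrt 2 / sig) by rewrite mulr_gt0// divr_gt0.
have e4 : 0 < e / 4 by rewrite divr_gt0.
have [A0 A00 HA] := gauss_limit (divr_gt0 e4 kg).
have L1 : 0 <= 4 * K1 / Num.sqrt c by apply: divr_ge0; [rewrite mulr_ge0|exact: ltW].
have L2 : 0 <= 4 * K2 / Num.sqrt c2 + 2 * K3 * T.
  by apply: addr_ge0; [apply: divr_ge0; [rewrite mulr_ge0|exact: ltW]|rewrite !mulr_ge0// ltW].
near=> n => x xX.
have n2 : (2 <= n)%N by near: n; exact: nbhs_infty_ge.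
have n0 : (0 < n)%N by exact: ltn_trans n2.
have nR : (0 : R) < n%:R by rewrite ltr0n.
have sn : 0 < Num.sqrt n%:R :> R by rewrite sqrtr_gt0.
have /andP[en0 en1] := eps01 n.
set t := T / eps n; have t0 : 0 < t by exact: divr_gt0.
have tT : T <= t by rewrite /t ler_pdivlMr// ler_piMr// ltW.
pose G xi := expR (- (n%:R * (sig ^+ 2 * (t * xi) ^+ 2 / 2))).
pose E1 xi := expR (- (c * n%:R * (t * xi) ^+ 2)).
pose E2 xi := expR (- (c2 * (t * xi) ^+ 2)).
have cG : continuous G.
  have -> : G = fun xi => expR (- (n%:R * sig ^+ 2 / 2 * (t * xi) ^+ 2)).
    by apply/funext => xi; rewrite /G; congr (expR (- _)); ring.
  exact: continuous_gauss_xi.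
have cE1 : continuous E1 by exact: continuous_gauss_xi.
have cE2 : continuous E2 by exact: continuous_gauss_xi.
have cZ (g : R -> R) k : continuous g -> continuous (fun xi => k * g xi).
  by move=> cg xi; apply: cvgM; [exact: cvg_cst|exact: cg].
have lin k0 k1 k2 k3 : rcont (fun xi => k0 * G xi + (k1 * E1 xi + (k2 * E2 xi + k3))) 0 1 /\
   ri (fun xi => k0 * G xi + (k1 * E1 xi + (k2 * E2 xi + k3))) 0 1 =
   k0 * ri G 0 1 + (k1 * ri E1 0 1 + (k2 * ri E2 0 1 + k3)).
  have cc : continuous (fun xi : R => k2 * E2 xi + k3) by move=> xi; apply: cvgD; [exact: cZ|exact: cvg_cst].
  have cd : continuous (fun xi : R => k1 * E1 xi + (k2 * E2 xi + k3)).
    by move=> xi; apply: cvgD; [exact: cZ|exact: cc].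
  have r1 (g : R -> R) : continuous g -> rcont g 0 1 by exact: rcontC.
  split; first by apply: r1 => xi; apply: cvgD; [exact: cZ|exact: cd].
  rewrite (riD (r1 _ (cZ _ k0 cG)) (r1 _ cd)) (riD (r1 _ (cZ _ k1 cE1)) (r1 _ cc)).
  rewrite (riD (r1 _ (cZ _ k2 cE2)) (r1 _ (fun xi => cvg_cst k3))) ri_cst// subr0 mulr1.
  by rewrite (riZ _ (r1 _ cG)) (riZ _ (r1 _ cE1)) (riZ _ (r1 _ cE2)).
pose k1 := K1 / Num.sqrt n%:R; pose k2 := K2 * r ^+ n; pose k3 := K3 * r ^+ n * eps n.
have P xi : 0 <= xi <= 1 ->
    `|2 * ((1 - xi) * cRe (charsum n (t * xi) * phase n (t * xi) x)) - 2 * G xi| <=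
    2 * (k1 * E1 xi + k2 * E2 xi + k3).
  move=> /andP[xi0 xi1]; rewrite -mulrBr normrM ger0_norm// ler_wpM2l//.
  apply: H => //; [exact: mulr_ge0 (ltW t0) xi0| |by rewrite xi0|].
    by rewrite mulrAC /t divfK ?gt_eqF// ler_piMr// ltW.
  by rewrite mulrA ler_peMl// mulrC ler_pdivlMr// mul1r.
have cf : rcont (fun xi => 2 * ((1 - xi) * cRe (charsum n (t * xi) * phase n (t * xi) x))) 0 1.
  by apply: rcontC; exact: continuous_fourier_kernel.
have [rcu riu] := lin 2 (2 * k1) (2 * k2) (2 * k3).
have [rcl ril] := lin 2 (- (2 * k1)) (- (2 * k2)) (- (2 * k3)).
have Up : kernel_sum s a F al eps n T x <= 2 * ri G 0 1 + (2 * k1 * ri E1 0 1 + (2 * k2 * ri E2 0 1 + 2 * k3)).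
  rewrite kernel_sum_fourier -/t -riu; apply: (ri_le cf rcu) => xi xi01.
  by have /andP[] := triple_bound (P xi xi01).
have Lo : 2 * ri G 0 1 - (2 * k1 * ri E1 0 1 + (2 * k2 * ri E2 0 1 + 2 * k3)) <= kernel_sum s a F al eps n T x.
  rewrite kernel_sum_fourier -/t; apply: le_trans (_ : _ <= ri (fun xi => 2 * G xi + (- (2 * k1) * E1 xi + (- (2 * k2) * E2 xi + - (2 * k3)))) 0 1) _.
    by rewrite ril !mulNr -!opprD.
  by apply: (ri_le rcl cf) => xi xi01; have /andP[] := triple_bound (P xi xi01).
have m0 : 0 < t * Num.sqrt n%:R by exact: mulr_gt0.
have B1 : ri E1 0 1 <= 2 / (Num.sqrt c * Num.sqrt n%:R * t).
  have -> : Num.sqrt c * Num.sqrt n%:R = Num.sqrt (c * n%:R) by rewrite sqrtrM// ltW.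
  by apply: gauss_xi_bound => //; exact: mulr_gt0.
have B2 : ri E2 0 1 <= 2 / (Num.sqrt c2 * t) by exact: gauss_xi_bound.
have /andP[rr0 _] := r01.
have rn0 : 0 <= r ^+ n by rewrite exprn_ge0// ltW.
have k10 : 0 <= k1 by rewrite /k1 divr_ge0// ltW.
have k20 : 0 <= k2 by rewrite /k2 mulr_ge0.
have sqn : Num.sqrt n%:R <= n%:R :> R.
  have s1 : 1 <= Num.sqrt n%:R :> R by rewrite -[leLHS]sqrtr1 ler_wsqrtr// ler1n.
  by rewrite -[leRHS](sqr_sqrtr (ltW nR)) expr2; apply: ler_peMl => //; exact: ltW.
have err : (2 * k1 * ri E1 0 1 + (2 * k2 * ri E2 0 1 + 2 * k3)) * (t * Num.sqrt n%:R) <=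
    4 * K1 / Num.sqrt c / Num.sqrt n%:R + (4 * K2 / Num.sqrt c2 + 2 * K3 * T) * (n%:R * r ^+ n).
  have h1 : 2 * k1 * ri E1 0 1 + (2 * k2 * ri E2 0 1 + 2 * k3) <=
     2 * k1 * (2 / (Num.sqrt c * Num.sqrt n%:R * t)) + (2 * k2 * (2 / (Num.sqrt c2 * t)) + 2 * k3).
    apply: lerD; first by apply: ler_wpM2l => //; exact: mulr_ge0.
    by rewrite lerD2r; apply: ler_wpM2l => //; exact: mulr_ge0.
  apply: (le_trans (ler_wpM2r (ltW m0) h1)).
  have -> : (2 * k1 * (2 / (Num.sqrt c * Num.sqrt n%:R * t)) + (2 * k2 * (2 / (Num.sqrt c2 * t)) + 2 * k3)) * (t * Num.sqrt n%:R) =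
    4 * K1 / Num.sqrt c / Num.sqrt n%:R + (4 * K2 / Num.sqrt c2 + 2 * K3 * T) * (Num.sqrt n%:R * r ^+ n).
    rewrite /k1 /k2 /k3 /t; move: (gt_eqF sn) (gt_eqF sc) (gt_eqF sc2) (gt_eqF T0) (gt_eqF en0).
    move: (Num.sqrt n%:R) (Num.sqrt c) (Num.sqrt c2) (eps n) => z1 z2 z3 z4 h1' h2' h3' h4' h5'.
    by field; rewrite h1' h2' h3' h4' h5'.
  by rewrite lerD2l ler_wpM2l// ler_wpM2r.
have near1 : 4 * K1 / Num.sqrt c / Num.sqrt n%:R <= e / 4 by near: n; exact: near_div_sqrt.
have near2 : (4 * K2 / Num.sqrt c2 + 2 * K3 * T) * (n%:R * r ^+ n) <= e / 4 by near: n; exact: (near_nat_pow L2 r01 e4).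
have sg2 : 0 < sig / Num.sqrt 2 by exact: divr_gt0.
have near3 : A0 <= sig / Num.sqrt 2 * (t * Num.sqrt n%:R).
  apply: (@le_trans _ _ (sig / Num.sqrt 2 * (T * Num.sqrt n%:R))); last first.
    by rewrite ler_wpM2l ?(ltW sg2)// ler_wpM2r// ltW.
  rewrite mulrA -ler_pdivrMl ?mulr_gt0// mulrC; near: n; exact: near_sqrt_ge.
have main := ri_gauss_main T0 n0; rewrite -/t -/(G) in main.
have mainE : `|2 * (ri G 0 1 * (t * Num.sqrt n%:R)) - Num.sqrt (2 * pi) / sig| <= e / 4.
  rewrite main; have -> : Num.sqrt (2 * pi) / sig = 2 * (Num.sqrt 2 / sig) * (Num.sqrt pi / 2).
    by rewrite sqrtrM//; field; rewrite gt_eqF.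
  rewrite [2 * (_ * ri _ _ _)]mulrA -mulrBr normrM (gtr0_norm kg) mulrC -ler_pdivlMr//; exact: HA.
have U' := ler_wpM2r (ltW m0) Up; have L' := ler_wpM2r (ltW m0) Lo.
rewrite mulrDl -(mulrA 2 (ri G 0 1)) in U'; rewrite mulrBl -(mulrA 2 (ri G 0 1)) in L'.
exact: (combine_errors U' L' err near1 near2 mainE e0).
Unshelve. all: end_near. Qed.

End kernel_asymptotics.

(** * Large frequencies by weak contraction and Ruelle's Lemma *)

Section large_frequencies.
Context {R : realType} {A : aperiodic_matrix} {theta : R}.
Local Notation S := (shift_space A theta).
Implicit Types (g v : S -> R[i]) (u : R).
Hypothesis th01 : 0 < theta < 1.

Lemma sup_norm_ge g x : ((normc (g x))%:E <= sup_norm g)%E.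
Proof. by apply: ereal_sup_ubound; exists x. Qed.

Lemma sup_norm_ge0 g : (0 <= sup_norm g)%E.
Proof. by apply: le_trans (sup_norm_ge g point); rewrite lee_fin normc_ge0. Qed.

Lemma lip_const_ge0 g : (0 <= lip_const g)%E.
Proof. by apply: le_ereal_inf_tmp => _ [C [C0 _] <-]; rewrite lee_fin. Qed.

Lemma theta_u_norm_le u g : 1 <= `|u| -> (theta_u_norm u g <= theta_norm g)%E.
Proof.
move=> u1; apply: leeD => //; rewrite -[leRHS]mul1e; apply: lee_wpmul2r; first exact: lip_const_ge0.
by rewrite lee_fin invf_le1// (lt_le_trans _ u1).
Qed.

Lemma theta_norm_le u g : 1 <= `|u| -> (theta_norm g <= `|u|%:E * theta_u_norm u g)%E.
Proof.
move=> u1; have u0 : 0 < `|u| by exact: lt_le_trans u1.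
rewrite ge0_muleDr ?sup_norm_ge0//; last first.
  by rewrite mule_ge0 ?lip_const_ge0// lee_fin invr_ge0.
rewrite muleA -EFinM divff ?gt_eqF// mul1e leeD//.
by rewrite -[leLHS]mul1e lee_wpmul2r ?sup_norm_ge0// lee_fin.
Qed.

(** Passing from the u-dependent norm to the Lipschitz norm costs one factor |u|. *)
Lemma op_norm_le u (T : (S -> R[i]) -> (S -> R[i])) (c : R) : 1 <= `|u| ->
  (op_norm (theta_u_norm u) T <= c%:E)%E -> (op_norm theta_norm T <= (`|u| * c)%:E)%E.
Proof.
move=> u1 H; apply: ge_ereal_sup => _ [g [Fg g1] <-].
apply: (le_trans (theta_norm_le _ u1)); rewrite EFinM lee_pmul2l//; last first.
  by rewrite lte_fin (lt_le_trans _ u1).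
apply: le_trans H; apply: ereal_sup_ubound; exists g => //; split => //.
exact: le_trans (theta_u_norm_le _ u1) g1.
Qed.

Lemma ruelle_powZ f (s c : R[i]) n v : ruelle_pow f s n (fun x => c * v x) = fun x => c * ruelle_pow f s n v x.
Proof.
rewrite /ruelle_pow; elim: n => // n IH; rewrite !iterS IH; apply/funext => x.
by rewrite /ruelle_op mulr_fsumr; apply: eq_fsbigr => y _; rewrite mulrCA.
Qed.

Lemma cyl_char_lip i : lipschitz_by (@cyl_char R A theta i) 1.
Proof.
split => // x y; rewrite mul1r /cyl_char.
have d0 := d_ge0 th01 x y.
case: (dthetaP x y) => [[xy _]|[[|m] [xy _ dE]]]; first by rewrite {1}xy subrr normc0.
  rewrite dE expr0.
  by case: (_ == i); case: (_ == i); rewrite ?subrr ?subr0 ?sub0r ?normcN ?normc0 ?normc1.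
by rewrite (xy 0%N)// subrr normc0.
Qed.

(** The characteristic function of a cylinder has Lipschitz norm at most 2, so half of it lies in
    the unit ball of the operator norm. *)
Lemma ruelle_pow_cyl f (s : R[i]) n i (x : S) (c : R) :
  (op_norm theta_norm (ruelle_pow f s n) <= c%:E)%E -> normc (ruelle_pow f s n (cyl_char i) x) <= 2 * c.
Proof.
move=> H; pose k : R[i] := (2^-1)%:C.
have nk : normc k = 2^-1 by rewrite normc_real ger0_norm.
have kl : lipschitz_by (fun x => k * @cyl_char R A theta i x) 2^-1.
  split => // y z; rewrite -mulrBr normcM nk ler_wpM2l//.
  by have [_ h] := cyl_char_lip i; rewrite (le_trans (h y z)) ?mul1r.
have kn : (theta_norm (fun x => k * @cyl_char R A theta i x)%R <= 1)%E.
  rewrite (_ : 1%E = (2^-1 : R)%:E + (2^-1 : R)%:E)%E; last by rewrite -EFinD; congr EFin; lra.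
  apply: leeD.
    apply: ge_ereal_sup => _ [y _ <-]; rewrite lee_fin normcM nk /cyl_char.
    by rewrite ler_piMr//; case: (_ == i); rewrite ?normc1 ?normc0.
  by apply: ereal_inf_lbound; exists 2^-1.
have := le_trans (sup_norm_ge (ruelle_pow f s n (fun x => k * @cyl_char R A theta i x)) x) _.
move=> /(_ c%:E); rewrite lee_fin ruelle_powZ normcM nk => h.
rewrite -ler_pdivrMl// mulrC -[_ / 2]mulrC; apply: h.
apply: le_trans H; apply: le_trans (_ : (theta_norm (ruelle_pow f s n (fun x => k * @cyl_char R A theta i x))%R <= _)%E).
  by rewrite ruelle_powZ; apply: leeDl; exact: lip_const_ge0.
by apply: ereal_sup_ubound; exists (fun x => k * @cyl_char R A theta i x) => //; split => //; exists 2^-1.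
Qed.

(** One factor |u| comes from Ruelle's Lemma and one from the change of norm. Each of the terms in
    the sum over m is of order rho^n, whence the factor n. *)
Theorem periodic_sum_large f (P : R) (x : 'I_(kappa A) -> S) (rho1 rho ep : R) :
  pressure (fun x => - P * f x) = 0%E -> ruelle_estimate f x rho1 -> 0 < rho1 -> rho1 < rho ->
  weakly_contracting_with f P rho -> 0 < ep ->
  exists a1 K : R, [/\ 1 <= a1, 0 <= K & forall u n, a1 <= `|u| -> (2 <= n)%N ->
    normc (\sum_(y \in @periodic_points R A theta n) cexp (((- P) +i* u) * (birkhoff f n y)%:C)) <=
    K * (n%:R * rho ^+ n) * (`|u| ^+ 2 * `|u| `^ ep)].
Proof.
move=> hP hr r10 r1r hw ep0.
have r0 : 0 < rho by exact: lt_trans r1r.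
have [a0 [Ae [a00 Ae0 HC]]] := hw ep ep0.
(* The pressure at - P f is 0, so rho1^m e^(m e') = rho^m, which completes rho^(n - m) to rho^n for
   every m. *)
pose e' := ln (rho / rho1).
have e'0 : 0 < e' by rewrite ln_gt0// ltr_pdivlMr// mul1r.
have re : rho1 * expR e' = rho by rewrite /e' lnK ?posrE ?divr_gt0// mulrC divfK// gt_eqF.
have aP : 0 < `|P| + 1 by rewrite ltr_wpDl.
have [C C0 HR] := hr (`|P| + 1) 1 e' aP ltr01 e'0.
pose ka : R := (kappa A)%:R.
exists (Num.max 1 a0), (C * Ae + ka * (2 * Ae)); split.
- by rewrite le_max lexx.
- by rewrite addr_ge0 ?mulr_ge0 ?ler0n ?(ltW C0) ?(ltW Ae0).
move=> u n; rewrite ge_max => /andP[u1 ua] n2.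
have u0 : 0 < `|u| by exact: lt_le_trans u1.
pose q := `|u| `^ ep; have q0 : 0 <= q by exact: powR_ge0.
have ON k : (op_norm theta_norm (ruelle_pow f ((- P)%R +i* u)%C k) <= (`|u| * (Ae * rho ^+ k * q))%:E)%E.
  by apply: op_norm_le => //; exact: HC.
have nP : `|- P| <= `|P| + 1 by rewrite normrN lerDl.
have := HR n (- P) u n2 nP u1.
rewrite (_ : fine (pressure (fun y => - P * f y)) = 0); last by rewrite hP.
set Z := \sum_(y \in _) _; set Y := \sum_(i < _) _ => HZ.
have HZ' : normc (Z - Y) <= C * `|u| * (n%:R * (`|u| * (Ae * rho ^+ n * q))).
  rewrite -lee_fin; apply: (le_trans HZ); rewrite [leRHS]EFinM; apply: lee_wpmul2l.
    by rewrite lee_fin mulr_ge0// ltW.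
  apply: (@le_trans _ _ (\sum_(2 <= m < n.+1) (`|u| * (Ae * rho ^+ n * q))%:E)%E).
    rewrite big_nat [leRHS]big_nat; apply: lee_sum => m /andP[m2 mn].
    rewrite addr0; have e1 : 0 <= rho1 ^+ m * expR (m%:R * e') by rewrite mulr_ge0 ?expR_ge0// exprn_ge0// ltW.
    apply: (@le_trans _ _ ((`|u| * (Ae * rho ^+ (n - m) * q))%:E * (rho1 ^+ m * expR (m%:R * e'))%:E)%E).
      by apply: lee_wpmul2r; rewrite ?lee_fin//; exact: ON.
    rewrite -EFinM lee_fin expRM_natl -exprMn re.
    rewrite -[in leRHS](subnK (_ : (m <= n)%N)) // exprD; apply: le_of_eq; ring.
  rewrite sumEFin lee_fin sumr_const_nat -[_ *+ (n.+1 - 2)]mulr_natl; apply: ler_wpM2r.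
    by rewrite !mulr_ge0 ?exprn_ge0 ?(ltW r0) ?(ltW Ae0).
  by rewrite ler_nat leq_subLR; case: (n).
have HY : normc Y <= ka * (2 * (`|u| * (Ae * rho ^+ n * q))).
  rewrite (le_trans (normc_sum _ _ _))//.
  apply: (@le_trans _ _ (\sum_(i < kappa A) 2 * (`|u| * (Ae * rho ^+ n * q)))); last first.
    by rewrite sumr_const card_ord /ka -[leLHS]mulr_natl.
  by apply: ler_sum => i _; apply: ruelle_pow_cyl; exact: ON.
have -> : Z = (Z - Y) + Y by rewrite subrK.
rewrite (le_trans (normcD _ _))// !mulrDl lerD//.
  by apply: (le_trans HZ'); apply: le_of_eq; rewrite -/q; ring.
apply: (le_trans HY); rewrite -/q.
rewrite (_ : ka * (2 * (`|u| * (Ae * rho ^+ n * q))) = (ka * (2 * Ae) * rho ^+ n * q) * (1 * `|u|)); last by ring.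
rewrite [leRHS](_ : _ = (ka * (2 * Ae) * rho ^+ n * q) * (n%:R * `|u| ^+ 2)); last by ring.
apply: ler_wpM2l; first by rewrite !mulr_ge0 ?ler0n ?exprn_ge0 ?(ltW r0) ?(ltW Ae0).
apply: ler_pM => //; first by rewrite ler1n (leq_trans _ n2).
by rewrite expr2 ler_peMl.
Qed.

End large_frequencies.

(** * Weighted sums over periodic points *)

Section periodic_fourier.
Context {R : realType} {A : aperiodic_matrix} {theta : R}.
Local Notation S := (shift_space A theta).

Definition periodic_seq n : seq S := fset_set (@periodic_points R A theta n).

Lemma mem_periodic_seq n y : (0 < n)%N -> (y \in periodic_seq n) = (y \in @periodic_points R A theta n).
Proof. by move=> n0; rewrite /periodic_seq in_fset_set//; exact: finite_periodic. Qed.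

Lemma sum_periodic_seq (K : comNzRingType) n (g : S -> K) : (0 < n)%N ->
  \sum_(y \in @periodic_points R A theta n) g y = \sum_(y <- periodic_seq n) g y.
Proof. by move=> n0; rewrite fsbig_finite//; exact: finite_periodic. Qed.

Lemma count_periodic_seq (f : S -> R) n (a b : R) : (0 < n)%N ->
  count_periodic f n a b = \sum_(y <- periodic_seq n | a <= birkhoff f n y <= b) 1%N.
Proof.
move=> n0; rewrite sum1_count -size_filter /count_periodic.
have fP := @finite_periodic R A theta n n0.
have fW : finite_set [set x | @periodic_points R A theta n x /\ a <= birkhoff f n x <= b].
  by apply: sub_finite_set fP => x [].
apply: perm_size; apply: uniq_perm; rewrite ?fset_uniq ?filter_uniq ?fset_uniq//.
move=> x; rewrite mem_filter mem_periodic_seq// in_fset_set//.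
apply/idP/idP; first by rewrite inE => -[Px ->] /=; rewrite inE.
by move=> /andP[hx /set_mem Px]; apply/mem_set; split.
Qed.

Variables (f : S -> R) (P : R) (h : S -> R) (p : @nweight R A theta).
Hypothesis h0 : forall x, 0 < h x.
Hypothesis pE : forall x, p x = expR (- P * f x - 0) * h x / h (sg x).

Lemma birkhoffZ (c : R) n x : birkhoff (fun x => c * f x) n x = c * birkhoff f n x.
Proof. by rewrite /birkhoff mulr_sumr. Qed.

(** The coboundary factor h / (h o shift^n) equals 1 on a closed orbit. *)
Lemma bprod_periodic n y : @periodic_points R A theta n y -> bprod p n y = expR (- P * birkhoff f n y).
Proof.
move=> py; rewrite (bprod_normalized h0 pE) birkhoffZ mulr0 subr0 (py : iter n sg y = y).
by rewrite mulfK// gt_eqF.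
Qed.

Lemma fourier_Zsum n u : (0 < n)%N ->
  charsum periodic_seq (bprod p) (birkhoff f) n u = Zsum (pw p f (Complex 0 u)) n.
Proof.
move=> n0; rewrite /Zsum sum_periodic_seq// /charsum; apply: eq_bigr => y _.
by rewrite bprod_pw.
Qed.

Lemma fourier_periodic n u : (0 < n)%N ->
  charsum periodic_seq (bprod p) (birkhoff f) n u =
  \sum_(y \in @periodic_points R A theta n) cexp ((- P +i* u) * (birkhoff f n y)%:C).
Proof.
move=> n0; rewrite sum_periodic_seq// /charsum; apply: eq_big_seq => y.
rewrite mem_periodic_seq// inE => py; rewrite bprod_periodic// -cexp_real -cexpD; congr cexp.
by apply: complex_ext => /=; ring.
Qed.

(** For |u| <= T / eps_n the power |u|^(2 + ep) is at most of order e^((2 + ep) delta n); one more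
    e^(delta n) is needed to extract the factor eps_n, whence 3 + ep. *)
Lemma fourier_large (K a1 ep rho delta : R) : 0 < rho -> 0 < ep -> 0 < delta -> 1 <= a1 -> 0 <= K ->
  rho * expR ((3 + ep) * delta) < 1 ->
  (forall u n, a1 <= `|u| -> (2 <= n)%N ->
    normc (\sum_(y \in @periodic_points R A theta n) cexp (((- P) +i* u) * (birkhoff f n y)%:C)) <=
    K * (n%:R * rho ^+ n) * (`|u| ^+ 2 * `|u| `^ ep)) ->
  large_bound (charsum periodic_seq (bprod p) (birkhoff f)) (fun n => expR (- delta * n%:R)).
Proof.
move=> r0 ep0 d0 a11 K0 rr H T T0; set r := rho * _ in rr.
have rp : 0 < r by rewrite mulr_gt0// expR_gt0.
have r01 : 0 < r < 1 by rewrite rp.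
have [C [q [C0 q01 HC]]] := nat_pow_decay r01.
exists a1, (K * (T ^+ 2 * T `^ ep) * C), q; split => //; first by rewrite (lt_le_trans _ a11).
  by rewrite !mulr_ge0 ?powR_ge0 ?exprn_ge0 ?(ltW T0) ?(ltW C0).
move=> u n n2 ua uT; rewrite fourier_periodic; last exact: ltn_trans n2.
apply: (le_trans (H u n ua n2)).
have en := expR_gt0 (- delta * n%:R).
have uT' : `|u| <= T * expR (delta * n%:R).
  have -> : expR (delta * n%:R) = (expR (- delta * n%:R))^-1 by rewrite mulNr expRN invrK.
  by rewrite ler_pdivlMr.
have u0 := normr_ge0 u; have E0 := expR_ge0 (delta * n%:R).
have h1 : `|u| ^+ 2 <= T ^+ 2 * expR (delta * n%:R) ^+ 2.
  by rewrite -exprMn lerXn2r// nnegrE// mulr_ge0// ltW.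
have h2 : `|u| `^ ep <= T `^ ep * expR (ep * (delta * n%:R)).
  apply: (@le_trans _ _ ((T * expR (delta * n%:R)) `^ ep)).
    by apply: ge0_ler_powR; rewrite ?nnegrE ?(ltW ep0)// mulr_ge0// ltW.
  rewrite powRM ?(ltW T0)//; apply: ler_wpM2l; first exact: powR_ge0.
  by rewrite /powR gt_eqF ?expR_gt0// expRK.
have h3 := ler_pM (exprn_ge0 2 u0) (powR_ge0 `|u| ep) h1 h2.
have k0 : 0 <= K * (n%:R * rho ^+ n) by rewrite !mulr_ge0 ?ler0n ?exprn_ge0 ?(ltW r0).
apply: (le_trans (ler_wpM2l k0 h3)).
have rE : r ^+ n * expR (- delta * n%:R) = rho ^+ n * (expR (delta * n%:R) ^+ 2 * expR (ep * (delta * n%:R))).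
  rewrite /r exprMn -mulrA -!expRM_natl -!expRD; congr (_ * expR _); ring.
rewrite [leLHS](_ : _ = K * (T ^+ 2 * T `^ ep) * (n%:R * (rho ^+ n * (expR (delta * n%:R) ^+ 2 * expR (ep * (delta * n%:R)))))); last by ring.
rewrite -rE [leRHS](_ : _ = K * (T ^+ 2 * T `^ ep) * (C * q ^+ n * expR (- delta * n%:R))); last by ring.
apply: ler_wpM2l; first by rewrite !mulr_ge0 ?powR_ge0 ?exprn_ge0 ?(ltW T0).
by rewrite mulrA; apply: ler_wpM2r; [exact: ltW|exact: HC].
Qed.

(** Multiplication by e^(- i u al) centres the eigenvalue: it removes the mean and the al^2 part of
    the quadratic term, leaving the variance. *)
Lemma eigenvalue_local (l : R[i]) (u al sig K : R) : 0 <= K -> `|u| <= 1 ->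
  normc (l - 1 - Complex 0 u * al%:C - Complex 0 u ^+ 2 * ((al ^+ 2 + sig ^+ 2) / 2)%:C) <= K * `|u| ^+ 3 ->
  normc (l * cexp (Complex 0 (- u * al)) - (1 - sig ^+ 2 * u ^+ 2 / 2)%:C) <=
  (K + `|al| ^+ 3 * expR `|al| + sig ^+ 2 / 2 * (`|al| * expR `|al|)) * `|u| ^+ 3.
Proof.
move=> K0 u1 H; pose w := Complex 0 (u * al).
have nw : normc w = `|u| * `|al| by rewrite /normc /= expr0n add0r sqrtr_sqr normrM.
have nwa : normc w <= `|al| by rewrite nw ler_piMl.
have -> : Complex 0 (- u * al) = - w by apply/eqP; rewrite eq_complex /= oppr0 mulNr !eqxx.
have E1 : normc (cexp w) = 1 by rewrite normc_cexp /= expR0.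
have -> : l * cexp (- w) - (1 - sig ^+ 2 * u ^+ 2 / 2)%:C =
   (l - (1 - sig ^+ 2 * u ^+ 2 / 2)%:C * cexp w) * cexp (- w).
  by rewrite mulrBl -[_ * cexp w * _]mulrA -cexpD subrr cexp0 mulr1.
rewrite normcM cexpN normcV E1 invr1 mulr1.
set g := l - 1 - _ - _ in H.
have -> : l - (1 - sig ^+ 2 * u ^+ 2 / 2)%:C * cexp w =
   g - (cexp w - 1 - w - w ^+ 2 / 2) + (sig ^+ 2 * u ^+ 2 / 2)%:C * (cexp w - 1).
  have e2 : Complex 0 u ^+ 2 * ((al ^+ 2 + sig ^+ 2) / 2)%:C = w ^+ 2 / 2 - (sig ^+ 2 * u ^+ 2 / 2)%:C.
    have -> : (2 : R[i])^-1 = (2^-1)%:C by rewrite fmorphV rmorph_nat.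
    by apply: complex_ext; rewrite !expr2 /=; ring.
  have e1 : Complex 0 u * al%:C = w.
    by apply: complex_ext => /=; ring.
  by rewrite /g e1 e2 rmorphB rmorph1; ring.
have t3 : 0 <= `|u| ^+ 3 by rewrite exprn_ge0.
rewrite (le_trans (normcD _ _))// [leRHS]mulrDl lerD//.
  rewrite (le_trans (normcB _ _))// [leRHS]mulrDl lerD//.
  rewrite (le_trans (cexp_taylor3 _))// nw exprMn [leRHS]mulrC -[leLHS]mulrA.
  by rewrite !ler_wpM2l ?exprn_ge0// ler_expR -nw.
rewrite normcM normc_real ger0_norm; last by rewrite divr_ge0// mulr_ge0 ?sqr_ge0.
rewrite [leRHS](_ : _ = (sig ^+ 2 * u ^+ 2 / 2) * (`|u| * `|al| * expR `|al|)); last first.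
  by rewrite -(real_normK (num_real u)); field.
apply: ler_wpM2l; first by rewrite divr_ge0// mulr_ge0 ?sqr_ge0.
rewrite (le_trans (cexp_taylor1 _))// -nw ler_wpM2l ?normc_ge0// ler_expR//.
Qed.

(** On the window f^n differs from z + n alpha by at most (|q1| + |q2|) eps, so the weights are
    constant up to the factor e^(|P| (|q1| + |q2|) eps), and dividing by them turns the weighted sum
    into the count. *)
Lemma window_count (al z eps q1 q2 Q k : R) n : (0 < n)%N -> 0 < eps -> 0 < Q -> 0 < k <= 1 ->
  expR (`|P| * (`|q1| + `|q2|) * eps) <= 1 + k / 4 ->
  let X0 := z + n%:R * al in
  `|(\sum_(y <- periodic_seq n | X0 + q1 * eps <= birkhoff f n y <= X0 + q2 * eps) bprod p n y) / Q - 1| <= k / 4 ->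
  `|(count_periodic f n (X0 + q1 * eps) (X0 + q2 * eps))%:R / (expR (P * X0) * Q) - 1| < k.
Proof.
move=> n0 e0 Q0 /andP[k0 k1] Hk X0; set W := \sum_(y <- _ | _) _ => HW.
rewrite count_periodic_seq//; set N := (\sum_(y <- _ | _) 1%N)%:R.
have NE : N = \sum_(y <- periodic_seq n | X0 + q1 * eps <= birkhoff f n y <= X0 + q2 * eps) (1 : R).
  by rewrite /N natr_sum.
set m := `|P| * (`|q1| + `|q2|) * eps in Hk.
have WE : expR (P * X0) * W = \sum_(y <- periodic_seq n | X0 + q1 * eps <= birkhoff f n y <= X0 + q2 * eps)
    expR (- P * (birkhoff f n y - X0)).
  rewrite /W mulr_sumr big_seq_cond [RHS]big_seq_cond; apply: eq_bigr => y /andP[+ _].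
  rewrite mem_periodic_seq// inE => /bprod_periodic ->.
  by rewrite -expRD; congr expR; ring.
have bnd y : X0 + q1 * eps <= birkhoff f n y <= X0 + q2 * eps ->
    expR (- m) <= expR (- P * (birkhoff f n y - X0)) <= expR m.
  move=> /andP[b1 b2]; rewrite !ler_expR -ler_norml normrM normrN /m -mulrA ler_wpM2l//.
  have a1 := ler_wpM2r (ltW e0) (ler_norm q2); have a2 := ler_wpM2r (ltW e0) (ler_norm (- q1)).
  have a3 := mulr_ge0 (normr_ge0 q1) (ltW e0); have a4 := mulr_ge0 (normr_ge0 q2) (ltW e0).
  rewrite normrN in a2; rewrite mulrDl ler_norml; apply/andP; split; lra.
have up : expR (P * X0) * W <= expR m * N.
  by rewrite WE NE mulr_sumr; apply: ler_sum => y /bnd /andP[_]; rewrite mulr1.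
have lo : expR (- m) * N <= expR (P * X0) * W.
  by rewrite WE NE mulr_sumr; apply: ler_sum => y /bnd /andP[+ _]; rewrite mulr1.
have eX := expR_gt0 (P * X0); have em := expR_gt0 m.
set V := N / (expR (P * X0) * Q).
have V0 : 0 <= V by rewrite /V divr_ge0 ?ler0n// ltW// mulr_gt0.
have den : 0 < expR (P * X0) * Q by exact: mulr_gt0.
have WV : W / Q <= expR m * V.
  rewrite /V mulrA ler_pdivlMr// mulrCA mulrC -mulrA mulrCA; move: up; congr (_ <= _).
  by field; rewrite gt_eqF.
have VW : V <= expR m * (W / Q).
  rewrite /V ler_pdivrMr//; move: lo; rewrite expRN ler_pdivrMl// => /le_trans; apply.
  by apply: le_of_eq; field; rewrite gt_eqF.
move: HW; rewrite ler_norml => /andP[w1 w2].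
have m1 : 1 <= expR m.
  by rewrite -[leLHS]expR0 ler_expR /m !mulr_ge0 ?addr_ge0// ltW.
have v1 : V <= (1 + k / 4) * (1 + k / 4).
  have wq : W / Q <= 1 + k / 4 by lra.
  apply: (le_trans VW); apply: (le_trans (ler_wpM2l (ltW em) wq)).
  by apply: ler_wpM2r => //; lra.
have v2 : 1 - k / 4 <= (1 + k / 4) * V.
  have wq : 1 - k / 4 <= W / Q by lra.
  by apply: (le_trans wq); apply: (le_trans WV); apply: ler_wpM2r.
have kk : k * k <= k by rewrite ler_piMl// ltW.
rewrite ltr_norml; apply/andP; split; last lra.
have k2 := mulr_ge0 (ltW k0) (ltW k0).
have v3 : (1 + k / 4) * (1 - k) < (1 + k / 4) * V by apply: lt_le_trans v2; lra.
have k4 : 0 < 1 + k / 4 by lra.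
by move: v3; rewrite ltr_pM2l//; lra.
Qed.

End periodic_fourier.

(** * Assembly of the estimates and conclusion *)

Theorem spectral_data (R : realType) (A : aperiodic_matrix) (theta : R) (f : shift_space A theta -> R)
    (P : R) (m0 : probability (borel_shift A theta) R) (sigma0 : R) :
  0 < theta < 1 -> Ftheta (cplx f) -> ~ lattice f -> pressure (fun x => - P * f x) = 0%E ->
  equilibrium_state (fun x => - P * f x) m0 -> 0 < sigma0 ->
  derive1n 2 (fun u : R => complex.Re (pressureC (fun x => - P * f x) f (0 +i* u))) 0 = - sigma0 ^+ 2 ->
  exists (h0 : shift_space A theta -> R) (p : @nweight R A theta),
  [/\ forall x, 0 < h0 x,
      forall x, p x = expR (- P * f x - 0) * h0 x / h0 (Defs.shift x),
      near_expansion (charsum (@periodic_seq R A theta) (bprod p) (birkhoff f)) (\int[m0]_x f x)%R sigma0 &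
      medium_bound (charsum (@periodic_seq R A theta) (bprod p) (birkhoff f))].
Proof.
move=> th01 Ff nl hP hm0 s0 hs; have [B [B1 f_lip f_bdd]] := Ftheta_bounds th01 Ff.
have B0 : 0 <= B by exact: le_trans B1.
have FKB : 0 <= `|P| * B by rewrite mulr_ge0.
have FK x y : `|- P * f x - - P * f y| <= `|P| * B * dtheta x y.
  by rewrite -mulrBr normrM normrN -mulrA ler_wpM2l// (f_real_lip f_lip).
have [Lam [C0 [h0 [p [C01 HL hC hlip pE]]]]] := normalization th01 FKB FK.
have LC n x : iter n (tr (fun x => expR (- P * f x))) (fun=> 1) x <= C0 * expR (n%:R * Lam).
  by have /andP[] := HL n x.
(* The growth rate is the pressure, which vanishes, so the weight is normalized with exponent 0. *)
have := variational_principle th01 FKB FK C01 LC hC pE; rewrite hP => -[L0].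
rewrite -L0 in pE.
have C00 : 0 < C0 by exact: lt_le_trans C01.
have h00 x : 0 < h0 x by have /andP[+ _] := hC x; apply: lt_le_trans; rewrite invr_gt0.
exists h0, p; split => //; last first.
  move=> u1 a1 u10 ua; have [C [r [C_gt0 r01 H]]] := trace_medium p B1 f_lip f_bdd u10 ua nl.
  exists C, r; split => //; first exact: ltW.
  by move=> u uu n n2; rewrite fourier_Zsum; [exact: H|exact: ltn_trans n2].
have [z0 [K [s [be [/andP[z00 z01] K0 s01 H]]]]] := perturbation p B1 f_lip f_bdd.
(* Eigenpairs are chosen for all z at once, with junk values outside the disc of radius z0. *)
have ex z : exists hl : (shift_space A theta -> R[i]) * R[i], normc z <= z0 ->
    spectral_pair p f K s be z hl.1 hl.2.
  have [zz|zz] := pselect (normc z <= z0); last by exists (fun=> 0, 0) => /zz.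
  by have [h [l Hl]] := H z zz; exists (h, l) => _; exact: Hl.
have [hl HH] := choice ex.
have [muE beE] := eigenvalue_germ (h := fun z => (hl z).1) (l := fun z => (hl z).2) th01 B1 f_lip hP hm0 s0 hs
  C01 hC pE z00 K0 (fun z zz => let: And4 (And3 a _ _) _ _ _ := HH z zz in a)
  (fun z zz => let: And4 (And3 _ _ a) _ _ _ := HH z zz in a)
  (fun z zz => let: And4 _ _ a _ := HH z zz in a)
  (fun z zz => let: And4 _ _ _ a := HH z zz in a).
have [Ct Ct0 HT] := trace_near p B1 f_lip (@ler01 R).
have [C1 [r [C10 r01 HR]]] := combine_rates p B1 th01 s01 Ct0 (mulr_ge0 Ct0 K0).
set al := (\int[m0]_x f x)%R in muE beE *.
pose C2 := K + `|al| ^+ 3 * expR `|al| + sigma0 ^+ 2 / 2 * (`|al| * expR `|al|).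
have C20 : 0 <= C2.
  by rewrite /C2 !addr_ge0// !mulr_ge0 ?expR_ge0 ?exprn_ge0// ?invr_ge0// ltW.
exists z0, (C1 + C2), r, (fun u => (hl (Complex 0 u)).2); split => //; first by rewrite addr_ge0// ltW.
move=> u uz; have nu : normc (Complex 0 u) = `|u| by rewrite /normc /= expr0n add0r sqrtr_sqr.
have nz : normc (Complex 0 u) <= z0 by rewrite nu.
have [[Hh Hb H1] Hg Hl _] := HH _ nz.
have u1 : `|u| <= 1 by exact: le_trans uz z01.
split.
  move=> n n2; have m0' : (0 < n./2)%N by rewrite half_gt0.
  have nE : n = (n./2 + (n - n./2))%N by rewrite subnKC// -divn2 leq_div.
  rewrite fourier_Zsum; last exact: ltn_trans n2.
  have := HT u K s _ _ u1 K0 (ltW (andP s01).1) Hh Hb H1 Hg n./2 (n - n./2)%N m0'.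
  rewrite -nE => /le_trans; apply; apply: (le_trans (HR n)).
  by rewrite ler_wpM2r ?lerDl// exprn_ge0// ltW//; case/andP: r01.
rewrite nu muE beE in Hl.
apply: (le_trans (eigenvalue_local K0 u1 Hl)); rewrite ler_wpM2r ?exprn_ge0//.
by rewrite -/C2 lerDr ltW.
Qed.

Theorem theorem1 (R : realType) (A : aperiodic_matrix) (theta : R)
    (htheta : 0 < theta < 1)
    (f : shift_space A theta -> R)
    (f_lip : Ftheta (cplx f))
    (f_pos : forall x, 0 < f x)
    (f_nonlattice : ~ lattice f)
    (P : R) (hP : pressure (fun x => - P * f x) = 0%E)
    (m0 : probability (borel_shift A theta) R)
    (hm0 : equilibrium_state (fun x => - P * f x) m0)
    (alpha : R) (halpha : alpha = (\int[m0]_x f x)%R)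
    (sigma0 : R) (sigma0_gt0 : 0 < sigma0)
    (hsigma0_re :
      derive1n 2 (fun u : R =>
        complex.Re (pressureC (fun x => - P * f x) f (0 +i* u))) 0 = - sigma0 ^+ 2)
    (hsigma0_im :
      derive1n 2 (fun u : R =>
        complex.Im (pressureC (fun x => - P * f x) f (0 +i* u))) 0 = 0)
    (f_contracting : weakly_contracting f P)
    (x : 'I_(kappa A) -> shift_space A theta)
    (hx : forall i, val (x i) 0%N = i)
    (rho1 rho : R) (hrho1 : ruelle_estimate f x rho1)
    (rho_bounds : [/\ 0 < rho1, rho1 < rho & rho < 1])
    (hrho : weakly_contracting_with f P rho)
    (delta : R) (hdelta : 0 < delta < - ln rho / 3)
    (p q : R) (hpq : p < q) :
  let eps_ (n : nat) := expR (- delta * n%:R) in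
  forall e : R, 0 < e ->
    \forall n \near \oo, forall z : R, 0 <= z <= alpha ->
      `| (count_periodic f n (z + n%:R * alpha + p * eps_ n)
                             (z + n%:R * alpha + q * eps_ n))%:R
         / (expR (P * (z + n%:R * alpha)) * ((q - p) * eps_ n)
            / (Num.sqrt (2 * pi) * sigma0 * Num.sqrt n%:R))
         - 1 | < e.

Proof.
move=> eps_ e e0.
have [rho10 rho1r rho_lt1] := rho_bounds; have rho0 : 0 < rho by exact: lt_trans rho1r.
have /andP[d0 dr] := hdelta.
have [h0 [p_ [h00 pE HN HM]]] := spectral_data htheta f_lip f_nonlattice hP hm0 sigma0_gt0 hsigma0_re.
rewrite -halpha in HN.
(* Half of the slack in delta < - ln rho / 3: with this ep, ln rho + (3 + ep) delta equals minus
   half of - ln rho - 3 delta. *)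
pose ep := (- ln rho - 3 * delta) / (2 * delta).
have num0 : 0 < - ln rho - 3 * delta by rewrite subr_gt0; move: dr; rewrite ltr_pdivlMr// mulrC.
have ep0 : 0 < ep by rewrite divr_gt0// mulr_gt0.
have rr : rho * expR ((3 + ep) * delta) < 1.
  rewrite -[X in X * _]lnK ?posrE// -expRD -[ltRHS]expR0 ltr_expR.
  have -> : ln rho + (3 + ep) * delta = - ((- ln rho - 3 * delta) / 2) by rewrite /ep; field; rewrite gt_eqF.
  by rewrite oppr_lt0 divr_gt0.
have [a1 [K [a11 K0 HP]]] := periodic_sum_large htheta hP hrho1 rho10 rho1r hrho ep0.
have eps01 n : 0 < eps_ n <= 1.
  by rewrite /eps_ expR_gt0 /= -[leRHS]expR0 ler_expR mulNr oppr_le0 mulr_ge0// ltW.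
have HL := fourier_large h00 pE rho0 ep0 d0 a11 K0 rr HP.
have KS T X k (T0 : 0 < T) := kernel_asymptotic eps01 sigma0_gt0 HN HM HL X T0 (e := k).
have w2 : 0 < Num.sqrt (2 * pi) :> R by rewrite sqrtr_gt0 mulr_gt0// pi_gt0.
have c00 : 0 < Num.sqrt (2 * pi) / sigma0 by exact: divr_gt0.
pose k := Num.min 1 e; have k0 : 0 < k by rewrite lt_min ltr01.
have k1 : k <= 1 by rewrite /k ge_min lexx.
have ke : k <= e by rewrite /k ge_min lexx orbT.
have k4 : 0 < k / 4 by rewrite divr_gt0.
have a0 n y : 0 <= bprod p_ n y by exact: bprod_ge0.
(* The range |z| <= alpha contains all admissible z, so the limit is uniform in z. *)
have WL := window_limit a0 eps01 c00 KS alpha hpq k4.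
pose m := `|P| * (`|p| + `|q|).
have mge : 0 <= m by rewrite /m mulr_ge0// addr_ge0.
have lk : 0 < ln (1 + k / 4) by rewrite ln_gt0// ltrDl.
have e_small : \forall n \near \oo, expR (m * eps_ n) <= 1 + k / 4.
  have q01 : `|expR (- delta)| < 1 by rewrite gtr0_norm ?expR_gt0// -[ltRHS]expR0 ltr_expR oppr_lt0.
  have m1 : 0 < m + 1 by rewrite ltr_wpDl.
  have := cvg_expr q01; move=> /cvgr0_norm_le /(_ _ (divr_gt0 lk m1)) N; near=> n.
  have : `|expR (- delta) ^+ n| <= ln (1 + k / 4) / (m + 1) by near: n.
  rewrite ger0_norm; last by rewrite exprn_ge0// expR_ge0.
  rewrite -expRM_natl mulrC ler_pdivlMr// => h.
  rewrite -[leRHS]lnK ?posrE ?addr_gt0// ler_expR; apply: le_trans h.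
  by rewrite [leLHS]mulrC /eps_; apply: ler_wpM2l; [exact: expR_ge0|rewrite lerDl].
near=> n => z /andP[z0 za].
have n0 : (0 < n)%N by near: n; exact: nbhs_infty_gt.
have W : forall z, `|z| <= alpha -> `|window_sum (@periodic_seq R A theta) (bprod p_) (birkhoff f) alpha eps_ n p q z /
    ((q - p) * (Num.sqrt (2 * pi) / sigma0) / (2 * pi) * (eps_ n / Num.sqrt n%:R)) - 1| <= k / 4.
  by near: n; exact: WL.
have /andP[en0 en1] := eps01 n.
have sn : 0 < Num.sqrt n%:R :> R by rewrite sqrtr_gt0 ltr0n.
set Q := (q - p) * (Num.sqrt (2 * pi) / sigma0) / (2 * pi) * (eps_ n / Num.sqrt n%:R).
(* The constant sqrt (2 pi) / sigma0 of the local limit theorem, divided by the mass 2 pi of the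
   kernel, is 1 / (sqrt (2 pi) sigma0). *)
have QE : (q - p) * eps_ n / (Num.sqrt (2 * pi) * sigma0 * Num.sqrt n%:R) = Q.
  have pp : 0 < 2 * pi :> R by rewrite mulr_gt0// pi_gt0.
  rewrite /Q; move: (sqr_sqrtr (ltW pp)) (gt_eqF w2) (gt_eqF sn) (gt_eqF sigma0_gt0).
  move: (Num.sqrt (2 * pi)) (Num.sqrt n%:R) => w v <- w0 v0 s0'.
  by field; rewrite w0 v0 s0'.
have Q0 : 0 < Q.
  by rewrite -QE divr_gt0 ?mulr_gt0 ?subr_gt0.
rewrite -[expR _ * _ / _]mulrA QE; apply: (@lt_le_trans _ _ k) => //.
apply: (window_count h00 pE n0 en0 Q0); first by rewrite k0.
  by near: n.
have zX : `|z| <= alpha by rewrite ger0_norm.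
exact: W z zX.
Unshelve. all: end_near. Qed.
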